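(* Let $M$ be an even positive integer, let $f:\mathbb{Z}\to\mathbb{C}$ be an $M$-periodic function that is even or odd, and let $\gamma=\begin{pmatrix}a&b\\c&d\end{pmatrix}\in\mathrm{SL}(2,\mathbb{Z})$ with $c>0$. With $\Lambda_N(n):=e^{i\pi n^2/N}$, the formula $$h(n):=(cM)^{-1/2}\,\Lambda_M^{bd}(n)\sum_{r\bmod M}f(r+dn)\,g(r)\,e^{2\pi i bnr/M},\qquad g(r):=\sum_{\substack{\ell\bmod cM\\ \ell\equiv r\bmod M}}\Lambda_{cM}^a(\ell)$$ defines an $M$-periodic function $h$ of the same parity as $f$, and for all $\tau\in\mathbb{H}$, with $\gamma(\tau)=\frac{a\tau+b}{c\tau+d}$: (1) if $f$ is even, $$\theta\big(\gamma(\tau);f\big)=\Big(\frac{c\tau+d}{i}\Big)^{\frac12}\theta(\tau;h);$$ (2) if $f$ is odd, $$\Theta\big(\gamma(\tau);1,f,M\big)=i\Big(\frac{c\tau+d}{i}\Big)^{\frac32}\Theta(\tau;1,h,M);$$ (3) if $f$ is even, $$\Theta(\tau;1,h,M)\pm i\Big(\frac{c\tau+d}{i}\Big)^{-\frac32}\Theta\big(\gamma(\tau);1,f,M\big)=\frac{(cM)^{1/2}}{2\pi}\,f(0)\,\frac{i}{c\tau+d}+\mathscr{S}^{\frac\pi2\mp\varepsilon}\,\tilde\Theta\big(c\tau+d;1,\Lambda_{cM}^{-d}h,cM\big);$$ (4) if $f$ is odd, $$\Theta(\tau;0,h,M)\mp\Big(\frac{c\tau+d}{i}\Big)^{-\frac12}\Theta\big(\gamma(\tau);0,f,M\big)=\mathscr{S}^{\frac\pi2\mp\varepsilon}\,\tilde\Theta\big(c\tau+d;0,\Lambda_{cM}^{-d}h,cM\big).$$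 In (3) and (4) the upper signs go together and the lower signs go together.
   Context: $\mathbb{H}=\{\operatorname{Im}\tau>0\}$; powers of $\frac{c\tau+d}i$ use the argument in $(-\frac\pi2,\frac\pi2)$. For $N\in\mathbb{Z}_{>0}$, an $N$-periodic function $g$ and $\nu\in\mathbb{Z}_{\ge0}$, $$\Theta(\tau;\nu,g,N)=\sum_{n\ge1}n^\nu g(n)e^{i\pi n^2\tau/N},\qquad \tilde\Theta(\tau;\nu,g,N)=\sum_{p\ge0}\frac1{p!}L(-2p-\nu,g)\Big(\frac{\pi i}{N}\Big)^p\tau^p,$$ with $L(s,g)$ the analytic continuation of $\sum_{n\ge1}g(n)n^{-s}$. For an even $M$-periodic $g$, $\theta(\tau;g):=g(0)+2\,\Theta(\tau;0,g,M)$. The function $\Lambda_{cM}^{-d}h$ is the pointwise product $n\mapsto\Lambda_{cM}(n)^{-d}h(n)$, which is $cM$-periodic (as $M$ is even); similarly $\Lambda_M^{bd}(n)=\Lambda_M(n)^{bd}$. For a formal series $\tilde\psi(\tau)=\sum_{p\ge0}c_p\tau^p$ let $\hat\psi(\xi)=\sum_{p\ge1}c_p\frac{\xi^{p-1}}{(p-1)!}$ and let $\mathscr{S}^\theta\tilde\psi(\tau)=c_0+\int_0^{e^{i\theta}\infty}e^{-\xi/\tau}\hat\psi(\xi)\,d\xi$ for $\arg\tau\in(\theta-\frac\pi2,\theta+\frac\pi2)$ (Borel–Laplace sum in the direction $\theta$). For $\tilde\psi=\tilde\Theta(\cdot;\nu,g,N)$ the only singular direction of $\hat\psi$ is $\frac\pi2$;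 $\mathscr{S}^{\frac\pi2\mp\varepsilon}\tilde\Theta(c\tau+d;\dots)$ means the function $\mathscr{S}^{\frac\pi2\mp\varepsilon}\tilde\Theta(\cdot\,;\dots)$ evaluated at the point $c\tau+d\in\mathbb{H}$, where $\varepsilon\in(0,\frac\pi2)$ is any number such that $\varepsilon<\arg(c\tau+d)<\pi-\varepsilon$ (the value does not depend on it). *)

(* Defs.v *)
From Stdlib Require Import Reals ZArith ClassicalEpsilon.
From Coquelicot Require Export Coquelicot.
Open Scope C_scope.

Definition Cexp (z : C) : C := exp (Re z) * (cos (Im z), sin (Im z)).

(* The principal argument, in (-PI, PI]; on the half-plane Re z > 0 it takes
   its values in (-PI/2, PI/2). *)
Definition Carg (z : C) : R :=
  if Rle_dec 0 (Im z) then acos (Re z / Cmod z) else (- acos (Re z / Cmod z))%R.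

Definition Cpower (z : C) (alpha : R) : C :=
  Rpower (Cmod z) alpha * Cexp (Ci * (alpha * Carg z)%R).

Definition Cpowz (z : C) (k : Z) : C :=
  match k with
  | Z0 => 1
  | Zpos p => z ^ Pos.to_nat p
  | Zneg p => / z ^ Pos.to_nat p
  end.

(* Sum of a complex series; meaningful when both real series converge. *)
Definition CSeries (u : nat -> C) : C :=
  (Series (fun n => Re (u n)), Series (fun n => Im (u n))).

(* [F] is the sum of a convergent power series on a disc around [z0]. *)
Definition analytic_at (F : C -> C) (z0 : C) : Prop :=
  exists (a : nat -> C) (rho : R), (0 < rho)%R /\
    forall z : C, (Cmod (z - z0) < rho)%R ->
      is_pseries (K := C_AbsRing) (V := C_NormedModule) a (z - z0) (F z).

Definition periodic (N : Z) (g : Z -> C) : Prop := forall n : Z, g (n + N)%Z = g n.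
Definition even_fun (g : Z -> C) : Prop := forall n : Z, g (- n)%Z = g n.
Definition odd_fun (g : Z -> C) : Prop := forall n : Z, g (- n)%Z = - g n.

(* Sum over the representatives 0, ..., N - 1 of the residues mod N > 0. *)
Definition sum_mod (N : Z) (F : Z -> C) : C :=
  sum_n (fun k : nat => F (Z.of_nat k)) (Nat.pred (Z.to_nat N)).

(* The term of index n of the series is the one attached to the integer n + 1. *)
Definition Theta (tau : C) (nu : nat) (g : Z -> C) (N : Z) : C :=
  CSeries (fun n : nat =>
    INR (S n) ^ nu * g (Z.of_nat (S n))
    * Cexp (Ci * PI * INR (S n) ^ 2 * tau / IZR N)).

Definition theta (tau : C) (g : Z -> C) (M : Z) : C :=
  g 0%Z + 2 * Theta tau 0 g M.

(* [F] continues the Dirichlet series of [g] analytically to C \ {1}; for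
   periodic [g] the value at any s <> 1 is thereby uniquely determined.  The
   value at s = 1, a possible pole, is left arbitrary. *)
Definition is_L_continuation (g : Z -> C) (F : C -> C) : Prop :=
  (forall s : C, s <> 1 -> analytic_at F s) /\
  (forall s : C, (1 < Re s)%R ->
     is_series (K := C_AbsRing) (V := C_NormedModule)
       (fun n : nat => g (Z.of_nat (S n)) * Cexp (- s * ln (INR (S n)))) (F s)).

Definition Lfun (g : Z -> C) : C -> C :=
  epsilon (inhabits (fun _ : C => RtoC 0)) (is_L_continuation g).

(* The formal series is represented by its sequence of coefficients. *)
Definition Theta_tilde (nu : nat) (g : Z -> C) (N : Z) (p : nat) : C :=
  / INR (fact p) * Lfun g (- (2 * INR p) - INR nu)%R * (PI * Ci / IZR N) ^ p.

Definition ray (vartheta r : R) : C := r * Cexp (Ci * vartheta).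

(* [v] is the value at [tau] of the Borel-Laplace sum, in the direction
   [vartheta], of the formal series sum_p c_p tau^p: the Borel transform
   converges near 0 and continues analytically to [Phi] along the ray, [tau]
   has a determination of its argument within PI/2 of [vartheta], and the
   Laplace integral of [Phi] converges.  The integral over the ray is
   parametrized by xi = r e^(i vartheta).  By uniqueness of analytic
   continuation at most one [v] qualifies. *)
Definition is_Borel_Laplace (vartheta : R) (c : nat -> C) (tau v : C) : Prop :=
  tau <> 0 /\
  (exists k : Z, vartheta - PI / 2 < Carg tau + 2 * IZR k * PI < vartheta + PI / 2)%R /\
  exists (Phi : C -> C) (rho : R) (I : C),
    (0 < rho)%R /\
    (forall xi : C, (Cmod xi < rho)%R ->
       is_pseries (K := C_AbsRing) (V := C_NormedModule)
         (fun k : nat => c (S k) / INR (fact k)) xi (Phi xi)) /\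
    (forall r : R, (0 <= r)%R -> analytic_at Phi (ray vartheta r)) /\
    is_RInt_gen (V := C_R_NormedModule)
      (fun r : R => Cexp (- ray vartheta r / tau) * Phi (ray vartheta r)
                    * Cexp (Ci * vartheta))
      (at_point 0%R) (Rbar_locally p_infty) I /\
    v = c 0%nat + I.

Definition Lambda (N n : Z) : C := Cexp (Ci * PI * IZR n ^ 2 / IZR N).

Definition gsum (M a c r : Z) : C :=
  sum_mod (c * M) (fun l : Z =>
    if Z.eqb (l mod M) (r mod M) then Cpowz (Lambda (c * M) l) a else 0).

Definition htrans (M : Z) (f : Z -> C) (a b c d : Z) (n : Z) : C :=
  / sqrt (IZR (c * M)) * Cpowz (Lambda M n) (b * d)
  * sum_mod M (fun r : Z =>
      f (r + d * n)%Z * gsum M a c r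
      * Cexp (2 * PI * Ci * IZR b * IZR n * IZR r / IZR M)).

(* Main.v *)
Require Import Defs.
From Stdlib Require Import Reals ZArith Lra Lia ClassicalEpsilon FunctionalExtensionality.
From Coquelicot Require Import Coquelicot.
Open Scope C_scope.

(** Put [N = c M], [G = Lambda_N^a f], [j = c tau + d], and let [q] be the principal square root
    of [j / i].  Since [a d - b c = 1], the function [Lambda_N^(-d) h] is the discrete Fourier
    transform of [G] modulo [N], so both theta series are sums of Gaussians, with widths exchanged
    by [tau -> gamma tau].

    Euler-Maclaurin summation against the periodic primitives of the weighted comb
    [n |-> dft N G n], given by Fourier series over [m >= 1], expresses [Theta(tau)] as a mean
    term, a boundary term at 0, and a sum over [m] of half-line Fourier integrals of the
    Gaussian, i.e. values of the error function.  The same primitives at 0 are the values of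
    [L(s, dft N G)] at the non-positive integers, so the Borel transform of [Theta_tilde] is a sum
    over [m] of functions [(1 - w_m xi)^(-nu - 3/2)], whose Laplace integrals are again error
    functions.  Term by term in [m], the error functions agree up to the contribution of their
    limit at infinity, whose sign depends on the side of the direction [PI / 2] and which
    produces exactly the Gaussians of [Theta(gamma tau)].  When [f] has the parity of [n^nu],
    the error functions at [m] and [-m] add up to a Gaussian, which gives the modular
    transformation laws. *)

(** Order 2 is the base of the summation formula because the Fourier series of the primitives
    converge absolutely only from there; the first-order boundary value, which jumps at the
    integers, is a separate finite sum. One set of primitives serves all test functions: Gaussians
    give the theta series, [x^(-s)] the continuation of [L], [x^k] its values. The comparison is
    thus between two expansions over the same frequencies.

    The exponent [nu + 3/2] comes from [(2p + nu)! / (p! (p - 1)!)], which is [4^p (nu + 1/2)] times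
    a binomial coefficient. The singular points of the Borel transform are [i PI m^2 / N]; there
    [exp (- xi / j)] is, up to the factor [Lambda_N^a], the [m]-th exponential of the theta series
    at [gamma tau]. For the parity opposite to [n^nu] the frequencies [m] and [-m] reinforce each
    other in the values at 0 of the primitives.

    The error function is carried by an entire function of the square of its argument. No branch is
    chosen before the limit at infinity, where the two square roots give opposite values: this is
    the only place where the side of the direction [PI / 2] matters. *)

Notation is_Cseries := (is_series (K := C_AbsRing) (V := C_NormedModule)).
Notation is_CRInt := (is_RInt (V := C_R_NormedModule)).
Notation is_Cder := (is_derive (K := R_AbsRing) (V := C_R_NormedModule)).
Notation Clim f F l := (filterlim f F (locally (T := C_UniformSpace) l)).
Notation Ccont f x := (continuous (T := R_UniformSpace) (U := C_UniformSpace) f x).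

(** * Limits of complex-valued functions along a filter *)

Lemma C_ext (x y : C) : Re x = Re y -> Im x = Im y -> x = y.
Proof. destruct x, y; simpl; intros -> ->; reflexivity. Qed.

(** Balls of the product uniform structure on [C] and discs of the modulus contain each other up to
    the factor [sqrt 2]; from here on only the modulus is used. *)
Lemma Clim_eps {T} (F : (T -> Prop) -> Prop) {FF : Filter F} (f : T -> C) (l : C) :
  (forall eps : R, (0 < eps)%R -> F (fun x => (Cmod (f x - l) < eps)%R)) <-> Clim f F l.
Proof.
  split.
  - intros H.
    apply (proj2 (filterlim_locally f l)). intros eps.
    apply filter_imp with (2 := H eps (cond_pos eps)).
    intros x Hx. apply (C_NormedModule_mixin_compat1 l (f x) eps), Hx.
  - intros H eps He.
    assert (Hs : (0 < sqrt 2)%R) by (apply sqrt_lt_R0; lra).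
    assert (He2 : (0 < eps / sqrt 2)%R) by (apply Rdiv_lt_0_compat; lra).
    apply filter_imp with (2 := proj1 (filterlim_locally f l) H (mkposreal _ He2)).
    intros x Hx.
    generalize (C_NormedModule_mixin_compat2 l (f x) (mkposreal _ He2) Hx).
    simpl. replace (sqrt 2 * (eps / sqrt 2))%R with eps by (field; lra). auto.
Qed.

Lemma Cmod_Re_le (z : C) : (Rabs (Re z) <= Cmod z)%R.
Proof. apply re_le_Cmod. Qed.

Lemma Cmod_Im_le (z : C) : (Rabs (Im z) <= Cmod z)%R.
Proof.
  apply Rle_trans with (2 := Rmax_Cmod z). apply Rmax_r.
Qed.

Lemma Cmod_le_Re_Im (z : C) : (Cmod z <= Rabs (Re z) + Rabs (Im z))%R.
Proof.
  pose proof (Rabs_pos (Re z)); pose proof (Rabs_pos (Im z)).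
  unfold Cmod. apply Rsqr_incr_0_var; [|lra].
  rewrite Rsqr_sqrt by nra. unfold Rsqr.
  pose proof (pow2_abs (fst z)); pose proof (pow2_abs (snd z)).
  unfold Re, Im in *. nra.
Qed.

Lemma Cmod_triangle_minus (x y : C) : (Cmod x - Cmod y <= Cmod (x - y))%R.
Proof.
  pose proof (Cmod_triangle (x - y) y) as H.
  replace (x - y + y) with x in H by ring. lra.
Qed.

Lemma Cmod_sub_sym (x y : C) : Cmod (x - y) = Cmod (y - x).
Proof. rewrite <- Cmod_opp. f_equal. ring. Qed.

Lemma Clim_components {T} (F : (T -> Prop) -> Prop) {FF : Filter F} (f : T -> C) (l : C) :
  filterlim (fun x => Re (f x)) F (locally (Re l)) ->
  filterlim (fun x => Im (f x)) F (locally (Im l)) -> Clim f F l.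
Proof.
  intros H1 H2. apply (proj1 (Clim_eps F f l)). intros eps He.
  assert (He2 : (0 < eps / 2)%R) by lra.
  apply filter_imp with (2 := filter_and _ _
    (proj1 (filterlim_locally _ _) H1 (mkposreal _ He2))
    (proj1 (filterlim_locally _ _) H2 (mkposreal _ He2))).
  intros x [Ha Hb]. apply Rle_lt_trans with (1 := Cmod_le_Re_Im _).
  change (Rabs (Re (f x) - Re l) < eps / 2)%R in Ha.
  change (Rabs (Im (f x) - Im l) < eps / 2)%R in Hb.
  replace (Re (f x - l)) with (Re (f x) - Re l)%R by reflexivity.
  replace (Im (f x - l)) with (Im (f x) - Im l)%R by reflexivity. lra.
Qed.

Lemma Clim_Re {T} (F : (T -> Prop) -> Prop) {FF : Filter F} (f : T -> C) (l : C) :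
  Clim f F l -> filterlim (fun x => Re (f x)) F (locally (Re l)).
Proof.
  intros H. apply (proj2 (filterlim_locally _ _)). intros eps.
  apply filter_imp with (2 := proj2 (Clim_eps F f l) H eps (cond_pos eps)).
  intros x Hx. change (Rabs (Re (f x) - Re l) < eps)%R.
  apply Rle_lt_trans with (2 := Hx).
  apply (Cmod_Re_le (f x - l)).
Qed.

Lemma Clim_Im {T} (F : (T -> Prop) -> Prop) {FF : Filter F} (f : T -> C) (l : C) :
  Clim f F l -> filterlim (fun x => Im (f x)) F (locally (Im l)).
Proof.
  intros H. apply (proj2 (filterlim_locally _ _)). intros eps.
  apply filter_imp with (2 := proj2 (Clim_eps F f l) H eps (cond_pos eps)).
  intros x Hx. change (Rabs (Im (f x) - Im l) < eps)%R.
  apply Rle_lt_trans with (2 := Hx).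
  apply (Cmod_Im_le (f x - l)).
Qed.

Lemma Clim_unique {T} (F : (T -> Prop) -> Prop) {FF : ProperFilter F} (f : T -> C) (l1 l2 : C) :
  Clim f F l1 -> Clim f F l2 -> l1 = l2.
Proof.
  intros H1 H2.
  destruct (Ceq_dec l1 l2) as [E|E]; [exact E|exfalso].
  assert (Hp : (0 < Cmod (l1 - l2))%R) by (apply Cmod_gt_0, Cminus_eq_contra, E).
  assert (Hp2 : (0 < Cmod (l1 - l2) / 2)%R) by lra.
  destruct (filter_ex _ (filter_and _ _ (proj2 (Clim_eps F f l1) H1 _ Hp2)
     (proj2 (Clim_eps F f l2) H2 _ Hp2))) as [x [Ha Hb]].
  pose proof (Cmod_triangle (l1 - f x) (f x - l2)) as H.
  replace (l1 - f x + (f x - l2)) with (l1 - l2) in H by ring.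
  rewrite (Cmod_sub_sym l1 (f x)) in H. lra.
Qed.

Lemma Clim_plus {T} (F : (T -> Prop) -> Prop) {FF : Filter F} (f g : T -> C) (a b : C) :
  Clim f F a -> Clim g F b -> Clim (fun x => f x + g x) F (a + b).
Proof.
  intros H1 H2. apply (proj1 (Clim_eps F _ _)). intros eps He.
  assert (He2 : (0 < eps / 2)%R) by lra.
  apply filter_imp with (2 := filter_and _ _ (proj2 (Clim_eps F f a) H1 _ He2)
     (proj2 (Clim_eps F g b) H2 _ He2)).
  intros x [Ha Hb].
  replace (f x + g x - (a + b)) with ((f x - a) + (g x - b)) by ring.
  apply Rle_lt_trans with (1 := Cmod_triangle _ _). lra.
Qed.

Lemma Clim_const {T} (F : (T -> Prop) -> Prop) {FF : Filter F} (a : C) :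
  Clim (fun _ : T => a) F a.
Proof. apply filterlim_const. Qed.

Lemma Clim_mult {T} (F : (T -> Prop) -> Prop) {FF : Filter F} (f g : T -> C) (a b : C) :
  Clim f F a -> Clim g F b -> Clim (fun x => f x * g x) F (a * b).
Proof.
  intros H1 H2.
  pose proof (Clim_Re _ _ _ H1) as R1; pose proof (Clim_Im _ _ _ H1) as I1.
  pose proof (Clim_Re _ _ _ H2) as R2; pose proof (Clim_Im _ _ _ H2) as I2.
  assert (Hm : forall (u v : T -> R) lu lv, filterlim u F (locally lu) ->
     filterlim v F (locally lv) -> filterlim (fun x => u x * v x)%R F (locally (lu * lv)%R)).
  { intros u v lu lv Hu Hv.
    eapply filterlim_comp_2; [exact Hu|exact Hv|apply (filterlim_mult (K := R_AbsRing) lu lv)]. }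
  assert (Hp : forall (u v : T -> R) lu lv, filterlim u F (locally lu) ->
     filterlim v F (locally lv) -> filterlim (fun x => u x + v x)%R F (locally (lu + lv)%R)).
  { intros u v lu lv Hu Hv.
    eapply filterlim_comp_2; [exact Hu|exact Hv|apply (filterlim_plus (V := R_NormedModule) lu lv)]. }
  assert (Ho : forall (u : T -> R) lu, filterlim u F (locally lu) ->
     filterlim (fun x => - u x)%R F (locally (- lu)%R)).
  { intros u lu Hu. apply (filterlim_comp _ _ _ u Ropp _ _ _ Hu (filterlim_opp (V := R_NormedModule) lu)). }
  apply Clim_components; [ exact _ | |].
  - apply (Hp _ _ _ _ (Hm _ _ _ _ R1 R2) (Ho _ _ (Hm _ _ _ _ I1 I2))).
  - apply (Hp _ _ _ _ (Hm _ _ _ _ R1 I2) (Hm _ _ _ _ I1 R2)).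
Qed.

Lemma Clim_opp {T} (F : (T -> Prop) -> Prop) {FF : Filter F} (f : T -> C) (a : C) :
  Clim f F a -> Clim (fun x => - f x) F (- a).
Proof.
  intros H.
  apply (filterlim_ext (fun x => (-1)%R * f x)).
  { intros x. ring. }
  replace (- a) with ((-1)%R * a) by ring.
  apply Clim_mult; [exact _|apply filterlim_const|exact H].
Qed.

Lemma Clim_minus {T} (F : (T -> Prop) -> Prop) {FF : Filter F} (f g : T -> C) (a b : C) :
  Clim f F a -> Clim g F b -> Clim (fun x => f x - g x) F (a - b).
Proof. intros H1 H2. apply Clim_plus; [exact _|exact H1|apply Clim_opp; [exact _|exact H2]]. Qed.

Lemma Clim_squeeze0 {T} (F : (T -> Prop) -> Prop) {FF : Filter F} (f : T -> C) (g : T -> R) :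
  F (fun x => (Cmod (f x) <= g x)%R) -> filterlim g F (locally 0%R) -> Clim f F (RtoC 0).
Proof.
  intros H1 H2. apply (proj1 (Clim_eps F _ _)). intros eps He.
  apply filter_imp with (2 := filter_and _ _ H1 (proj1 (filterlim_locally _ _) H2 (mkposreal _ He))).
  intros x [Ha Hb]. change (Rabs (g x - 0) < eps)%R in Hb.
  replace (f x - 0) with (f x) by ring.
  pose proof (Rle_abs (g x - 0)). lra.
Qed.

Lemma Clim_bound {T} (F : (T -> Prop) -> Prop) {FF : ProperFilter F} (f : T -> C) (a : C) (B : R) :
  F (fun x => (Cmod (f x) <= B)%R) -> Clim f F a -> (Cmod a <= B)%R.
Proof.
  intros H1 H2. apply Rnot_lt_le. intros H.
  assert (Hp : (0 < Cmod a - B)%R) by lra.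
  destruct (filter_ex _ (filter_and _ _ H1 (proj2 (Clim_eps F f a) H2 _ Hp))) as [x [Ha Hb]].
  pose proof (Cmod_triangle_minus a (f x)). rewrite Cmod_sub_sym in H0. lra.
Qed.

(** * Complex series *)

Lemma Csum_Sn (a : nat -> C) (n : nat) : sum_n a (S n) = sum_n a n + a (S n).
Proof. exact (@sum_Sn C_AbelianMonoid a n). Qed.

Lemma Csum_O (a : nat -> C) : sum_n a 0 = a 0%nat.
Proof. exact (@sum_O C_AbelianMonoid a). Qed.

Lemma Rsum_Sn (a : nat -> R) (n : nat) : sum_n a (S n) = (sum_n a n + a (S n))%R.
Proof. exact (@sum_Sn R_AbelianMonoid a n). Qed.

Lemma Rsum_O (a : nat -> R) : sum_n a 0 = a 0%nat.
Proof. exact (@sum_O R_AbelianMonoid a). Qed.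

Lemma Re_sum_n (a : nat -> C) n : Re (sum_n a n) = sum_n (fun k => Re (a k)) n.
Proof. induction n; [now rewrite Rsum_O, Csum_O|rewrite Rsum_Sn, Csum_Sn, <- IHn; reflexivity]. Qed.

Lemma Im_sum_n (a : nat -> C) n : Im (sum_n a n) = sum_n (fun k => Im (a k)) n.
Proof. induction n; [now rewrite Rsum_O, Csum_O|rewrite Rsum_Sn, Csum_Sn, <- IHn; reflexivity]. Qed.

Lemma is_Cseries_components (a : nat -> C) (l : C) :
  is_Cseries a l <->
  is_series (fun n => Re (a n)) (Re l) /\ is_series (fun n => Im (a n)) (Im l).
Proof.
  unfold is_series. split.
  - intros H. split.
    + apply filterlim_ext with (2 := Clim_Re _ _ _ H). intros n. apply Re_sum_n.
    + apply filterlim_ext with (2 := Clim_Im _ _ _ H). intros n. apply Im_sum_n.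
  - intros [H1 H2]. apply Clim_components; [exact _| |].
    + apply filterlim_ext with (2 := H1). intros n. symmetry. apply Re_sum_n.
    + apply filterlim_ext with (2 := H2). intros n. symmetry. apply Im_sum_n.
Qed.

Lemma CSeries_unique (a : nat -> C) (l : C) : is_Cseries a l -> CSeries a = l.
Proof.
  intros H. apply is_Cseries_components in H. destruct H as [H1 H2].
  apply C_ext; simpl; now apply is_series_unique.
Qed.

Lemma is_Cseries_unique (a : nat -> C) (l1 l2 : C) : is_Cseries a l1 -> is_Cseries a l2 -> l1 = l2.
Proof. intros H1 H2. now rewrite <- (CSeries_unique _ _ H1), <- (CSeries_unique _ _ H2). Qed.

Lemma is_CSeries_le (a : nat -> C) (b : nat -> R) :
  (forall n, Cmod (a n) <= b n)%R -> ex_series b -> is_Cseries a (CSeries a).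
Proof.
  intros Hab Hb. apply is_Cseries_components. split; apply Series_correct;
    apply (ex_series_le (V := R_CompleteNormedModule) _ b); auto; intros n;
    apply Rle_trans with (2 := Hab n).
  - apply Cmod_Re_le.
  - apply Cmod_Im_le.
Qed.

Lemma CSeries_ext (a b : nat -> C) : (forall n, a n = b n) -> CSeries a = CSeries b.
Proof. intros H. now replace a with b by (apply functional_extensionality; auto). Qed.

Lemma sum_n_Cmod_le (a : nat -> C) (b : nat -> R) n :
  (forall k, (k <= n)%nat -> Cmod (a k) <= b k)%R -> (Cmod (sum_n a n) <= sum_n b n)%R.
Proof.
  induction n; intros H.
  - rewrite Csum_O, Rsum_O. auto.
  - rewrite Rsum_Sn, Csum_Sn. apply Rle_trans with (1 := Cmod_triangle _ _).
    apply Rplus_le_compat; auto.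
Qed.

Lemma sum_n_tail_le (a : nat -> C) (b : nat -> R) M K :
  (forall n, Cmod (a n) <= b n)%R -> (M <= K)%nat ->
  (Cmod (sum_n a K - sum_n a M) <= sum_n b K - sum_n b M)%R.
Proof.
  intros H HK. induction HK as [|K HK IH].
  - replace (sum_n a M - sum_n a M) with (RtoC 0) by ring. rewrite Cmod_0. lra.
  - rewrite Rsum_Sn, Csum_Sn.
    replace (sum_n a K + a (S K) - sum_n a M) with ((sum_n a K - sum_n a M) + a (S K)) by ring.
    apply Rle_trans with (1 := Cmod_triangle _ _).
    pose proof (H (S K)). lra.
Qed.

Lemma sum_n_nonneg_incr (b : nat -> R) M K :
  (forall n, 0 <= b n)%R -> (M <= K)%nat -> (sum_n b M <= sum_n b K)%R.
Proof.
  intros H HK. induction HK as [|K HK IH]; [lra|].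
  rewrite Rsum_Sn. pose proof (H (S K)). lra.
Qed.

Lemma sum_n_le_Series (b : nat -> R) M :
  (forall n, 0 <= b n)%R -> ex_series b -> (sum_n b M <= Series b)%R.
Proof.
  intros H Hb.
  assert (HL : is_lim_seq (sum_n b) (Series b)) by apply (Series_correct _ Hb).
  apply (is_lim_seq_le_loc (fun _ => sum_n b M) (sum_n b) (sum_n b M) (Series b));
    [|apply is_lim_seq_const|exact HL].
  exists M. intros K HK. now apply sum_n_nonneg_incr.
Qed.

Lemma CSeries_tail_le (a : nat -> C) (b : nat -> R) M :
  (forall n, Cmod (a n) <= b n)%R -> ex_series b ->
  (Cmod (CSeries a - sum_n a M) <= Series b - sum_n b M)%R.
Proof.
  intros H Hb.
  assert (Hb0 : forall n, (0 <= b n)%R).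
  { intros n. apply Rle_trans with (2 := H n). apply Cmod_ge_0. }
  apply (Clim_bound eventually (fun K => sum_n a K - sum_n a M)).
  - exists M. intros K HK. apply Rle_trans with (1 := sum_n_tail_le a b M K H HK).
    pose proof (sum_n_le_Series b K Hb0 Hb). lra.
  - apply Clim_minus; [exact _| |apply filterlim_const].
    apply (is_CSeries_le a b H Hb).
Qed.

Lemma CSeries_le (a : nat -> C) (b : nat -> R) :
  (forall n, Cmod (a n) <= b n)%R -> ex_series b -> (Cmod (CSeries a) <= Series b)%R.
Proof.
  intros H Hb.
  apply (Clim_bound eventually (sum_n a)).
  - exists 0%nat. intros K HK.
    apply Rle_trans with (sum_n b K); [apply sum_n_Cmod_le; auto|].
    apply sum_n_le_Series; auto. intros n. apply Rle_trans with (2 := H n). apply Cmod_ge_0.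
  - apply (is_CSeries_le a b H Hb).
Qed.

Lemma Clim_sum_n {T} (F : (T -> Prop) -> Prop) {FF : Filter F} (f : T -> nat -> C) (g : nat -> C) M :
  (forall n, Clim (fun t => f t n) F (g n)) -> Clim (fun t => sum_n (f t) M) F (sum_n g M).
Proof.
  intros H. induction M.
  - apply (filterlim_ext (fun t => f t 0%nat)); [intros t; now rewrite Csum_O|].
    rewrite Csum_O. apply H.
  - apply (filterlim_ext (fun t => sum_n (f t) M + f t (S M))); [intros t; now rewrite Csum_Sn|].
    rewrite Csum_Sn. now apply Clim_plus.
Qed.

Lemma Series_tail_small (b : nat -> R) (eps : R) :
  ex_series b -> (0 < eps)%R -> exists M, (Series b - sum_n b M < eps)%R.
Proof.
  intros Hb He.
  destruct (proj1 (filterlim_locally _ _) (Series_correct _ Hb) (mkposreal _ He)) as [M HM].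
  exists M. pose proof (HM M (le_n M)) as H. change (Rabs (sum_n b M - Series b) < eps)%R in H.
  apply Rabs_def2 in H. lra.
Qed.

(** Dominated convergence for series: the tails are small uniformly in [t], and a finite sum passes
    to the limit. The filter is arbitrary because the limit is taken along integers in some uses and
    along reals in others. *)
Lemma CSeries_tannery {T} (F : (T -> Prop) -> Prop) {FF : ProperFilter F}
  (f : T -> nat -> C) (g : nat -> C) (b : nat -> R) :
  ex_series b ->
  F (fun t => forall n, Cmod (f t n) <= b n)%R ->
  (forall n, Clim (fun t => f t n) F (g n)) ->
  Clim (fun t => CSeries (f t)) F (CSeries g).
Proof.
  intros Hb Hf Hg.
  assert (Hgb : forall n, (Cmod (g n) <= b n)%R).
  { intros n. apply (Clim_bound F (fun t => f t n)); [|apply Hg].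
    apply filter_imp with (2 := Hf). auto. }
  apply (proj1 (Clim_eps F _ _)). intros eps He.
  destruct (Series_tail_small b (eps / 3) Hb) as [M HM]; [lra|].
  assert (He3 : (0 < eps / 3)%R) by lra.
  apply filter_imp with (2 := filter_and _ _ Hf
    (proj2 (Clim_eps F _ _) (Clim_sum_n F f g M Hg) _ He3)).
  intros t [Ha Hc].
  pose proof (CSeries_tail_le (f t) b M Ha Hb) as H1.
  pose proof (CSeries_tail_le g b M Hgb Hb) as H2. rewrite Cmod_sub_sym in H2.
  replace (CSeries (f t) - CSeries g) with
    ((CSeries (f t) - sum_n (f t) M) + ((sum_n (f t) M - sum_n g M) + (sum_n g M - CSeries g))) by ring.
  apply Rle_lt_trans with (1 := Cmod_triangle _ _).
  pose proof (Cmod_triangle (sum_n (f t) M - sum_n g M) (sum_n g M - CSeries g)). lra.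
Qed.

Lemma is_Cseries_plus (a b : nat -> C) (la lb : C) :
  is_Cseries a la -> is_Cseries b lb -> is_Cseries (fun n => a n + b n) (la + lb).
Proof. exact (is_series_plus (V := C_NormedModule) a b la lb). Qed.

Lemma is_Cseries_scal (c : C) (a : nat -> C) (la : C) :
  is_Cseries a la -> is_Cseries (fun n => c * a n) (c * la).
Proof. intros H. apply (is_series_scal (V := C_NormedModule) c a la H). Qed.

Lemma is_Cseries_ext (a b : nat -> C) (l : C) :
  (forall n, a n = b n) -> is_Cseries a l -> is_Cseries b l.
Proof. exact (is_series_ext (V := C_NormedModule) a b l). Qed.

Lemma is_Cseries_sum_n (a : nat -> nat -> C) (l : nat -> C) K :
  (forall k, (k <= K)%nat -> is_Cseries (fun m => a m k) (l k)) ->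
  is_Cseries (fun m => sum_n (a m) K) (sum_n l K).
Proof.
  induction K; intros H.
  - rewrite Csum_O. apply (is_Cseries_ext (fun m => a m 0%nat)); [|auto].
    intros m. now rewrite Csum_O.
  - rewrite Csum_Sn. apply (is_Cseries_ext (fun m => sum_n (a m) K + a m (S K))).
    + intros m. now rewrite Csum_Sn.
    + apply is_Cseries_plus; auto.
Qed.

(** Truncating the inner sums at [K] gives a finite interchange; the row sums of [c] dominate, so
    Tannery's theorem lets [K] go to infinity. *)
Lemma CSeries_fubini (a : nat -> nat -> C) (c : nat -> nat -> R) :
  (forall m k, Cmod (a m k) <= c m k)%R ->
  (forall m, ex_series (c m)) -> ex_series (fun m => Series (c m)) ->
  is_Cseries (fun k => CSeries (fun m => a m k)) (CSeries (fun m => CSeries (a m))).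
Proof.
  intros Ha Hc Hb.
  assert (Hc0 : forall m k, (0 <= c m k)%R).
  { intros m k. apply Rle_trans with (2 := Ha m k). apply Cmod_ge_0. }
  assert (Hck : forall m k, (c m k <= Series (c m))%R).
  { intros m k. apply Rle_trans with (sum_n (c m) k); [|now apply sum_n_le_Series].
    destruct k; [rewrite Rsum_O; lra|]. rewrite Rsum_Sn.
    assert (0 <= sum_n (c m) k)%R.
    { apply Rle_trans with (sum_n (c m) 0%nat); [rewrite Rsum_O; auto|].
      apply sum_n_nonneg_incr; auto with arith. }
    lra. }
  assert (HT : Clim (fun K => CSeries (fun m => sum_n (a m) K)) eventually
                 (CSeries (fun m => CSeries (a m)))).
  { apply (CSeries_tannery eventually (fun K m => sum_n (a m) K) _ (fun m => Series (c m)) Hb).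
    - exists 0%nat. intros K _ m.
      apply Rle_trans with (sum_n (c m) K); [apply sum_n_Cmod_le; auto|].
      now apply sum_n_le_Series.
    - intros m. apply (is_CSeries_le (a m) (c m)); auto. }
  unfold is_series. apply filterlim_ext with (2 := HT).
  intros K. apply CSeries_unique, is_Cseries_sum_n.
  intros k _. apply (is_CSeries_le _ (fun m => Series (c m))); auto.
  intros m. apply Rle_trans with (1 := Ha m k). auto.
Qed.

Lemma is_Cseries_decr_n (a : nat -> C) (n : nat) (l : C) :
  is_Cseries (fun k => a (S n + k)%nat) (l - sum_n a n) -> is_Cseries a l.
Proof.
  intros H. apply (is_series_decr_n (V := C_NormedModule) a (S n)); [lia|exact H].
Qed.

Lemma is_Rseries_decr_n (a : nat -> R) (n : nat) (l : R) :
  is_series (fun k => a (S n + k)%nat) (l - sum_n a n)%R -> is_series a l.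
Proof.
  intros H. apply (is_series_decr_n (V := R_NormedModule) a (S n)); [lia|exact H].
Qed.

Lemma Rsum_n_zero (a : nat -> R) n : (forall k, (k <= n)%nat -> a k = 0%R) -> sum_n a n = 0%R.
Proof.
  induction n; intros H; [rewrite Rsum_O; auto|].
  rewrite Rsum_Sn, IHn by auto. rewrite H by auto. apply Rplus_0_r.
Qed.

Lemma is_Cseries_incr_n (a : nat -> C) (n : nat) (l : C) :
  is_Cseries a l -> is_Cseries (fun k => a (S n + k)%nat) (l - sum_n a n).
Proof.
  intros H. apply (is_series_incr_n (V := C_NormedModule) a (S n)); [lia|].
  simpl. match goal with |- is_series _ ?x => replace x with l; [exact H|] end.
  change (l = l - sum_n a n + sum_n a n). ring.
Qed.

Lemma sum_n_zero (a : nat -> C) n : (forall k, (k <= n)%nat -> a k = 0) -> sum_n a n = RtoC 0.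
Proof.
  induction n; intros H; [rewrite Csum_O; auto|].
  rewrite Csum_Sn, IHn by auto. rewrite H by auto. apply Cplus_0_r.
Qed.

Lemma is_Cseries_0 : is_Cseries (fun _ => RtoC 0) (RtoC 0).
Proof.
  apply (filterlim_ext (fun _ => RtoC 0)); [|apply filterlim_const].
  intros n. symmetry. now apply sum_n_zero.
Qed.

(** The Cauchy product is a double sum over the triangle [i <= k], extended by zero. Row [i] is the
    series [b] shifted by [i] and multiplied by [a i], and Fubini sums the columns instead. *)
Lemma is_Cseries_cauchy (a b : nat -> C) (la lb : C) :
  ex_series (fun n => Cmod (a n)) -> ex_series (fun n => Cmod (b n)) ->
  is_Cseries a la -> is_Cseries b lb ->
  is_Cseries (fun k => sum_n (fun i => a i * b (k - i)%nat) k) (la * lb).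
Proof.
  intros Ea Eb Ha Hb.
  set (f := fun i k => if le_dec i k then a i * b (k - i)%nat else RtoC 0).
  set (c := fun i k => Cmod (f i k)).
  assert (Hsh : forall i, is_series (c i) (Cmod (a i) * Series (fun n => Cmod (b n)))%R).
  { intros i.
    assert (Hs : is_series (fun k => c i (i + k)%nat) (Cmod (a i) * Series (fun n => Cmod (b n)))%R).
    { apply (is_series_ext (fun k => scal (Cmod (a i)) (Cmod (b k)))).
      - intros k. unfold c, f. destruct le_dec; [|lia]. rewrite Cmod_mult.
        replace (i + k - i)%nat with k by lia. reflexivity.
      - apply (is_series_scal (V := R_NormedModule)), Series_correct, Eb. }
    destruct i; [exact Hs|].
    apply (is_Rseries_decr_n (c (S i)) i). rewrite Rsum_n_zero.
    - rewrite Rminus_0_r. exact Hs.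
    - intros k Hk. unfold c, f. destruct le_dec; [lia|apply Cmod_0]. }
  assert (Hf : forall i, CSeries (f i) = a i * lb).
  { intros i. apply CSeries_unique.
    assert (Hs : is_Cseries (fun k => f i (i + k)%nat) (a i * lb)).
    { apply (is_Cseries_ext (fun k => a i * b k)).
      - intros k. unfold f. destruct le_dec; [|lia]. now replace (i + k - i)%nat with k by lia.
      - now apply is_Cseries_scal. }
    destruct i; [exact Hs|].
    apply (is_Cseries_decr_n (f (S i)) i). rewrite sum_n_zero.
    - replace (a (S i) * lb - 0) with (a (S i) * lb) by ring. exact Hs.
    - intros k Hk. unfold f. destruct le_dec; [lia|reflexivity]. }
  assert (HF : is_Cseries (fun k => CSeries (fun m => f m k)) (CSeries (fun m => CSeries (f m)))).
  { apply (CSeries_fubini f c).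
    - intros; apply Rle_refl.
    - intros i. eexists; apply Hsh.
    - apply (ex_series_ext (fun i => Cmod (a i) * Series (fun n => Cmod (b n)))%R).
      + intros i. symmetry. now apply is_series_unique.
      + apply (ex_series_scal_r (Series (fun n => Cmod (b n))) (fun i => Cmod (a i)) Ea). }
  replace (CSeries (fun m => CSeries (f m))) with (la * lb) in HF.
  2:{ symmetry. apply CSeries_unique. apply (is_Cseries_ext (fun i => lb * a i)).
      - intros i. rewrite Hf. ring.
      - rewrite Cmult_comm. now apply is_Cseries_scal. }
  apply is_Cseries_ext with (2 := HF).
  intros k. apply CSeries_unique.
  apply (is_Cseries_decr_n _ k).
  replace (sum_n (fun i : nat => a i * b (k - i)%nat) k) with (sum_n (fun m => f m k) k).
  - unfold Cminus. rewrite Cplus_opp_r. apply (is_Cseries_ext (fun _ => RtoC 0)); [|exact is_Cseries_0].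
    intros n. unfold f. destruct le_dec; [lia|reflexivity].
  - apply (sum_n_ext_loc (G := C_AbelianMonoid)). intros n Hn. unfold f. destruct le_dec; [reflexivity|lia].
Qed.

(** * Derivatives of complex functions of a real variable *)

Lemma norm_CR (z : C) : @norm R_AbsRing C_R_NormedModule z = Cmod z.
Proof.
  unfold norm; simpl. unfold prod_norm, Cmod, norm; simpl. unfold abs; simpl.
  f_equal. pose proof (pow2_abs (fst z)); pose proof (pow2_abs (snd z)). simpl in *. lra.
Qed.

Lemma is_Cder_eps (f : R -> C) (x : R) (l : C) :
  is_Cder f x l <->
  (forall eps : R, (0 < eps)%R -> exists delta : R, (0 < delta)%R /\
     forall h : R, (Rabs h < delta)%R -> (Cmod (f (x + h)%R - f x - h * l) <= eps * Rabs h)%R).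
Proof.
  assert (Hs : forall (h : R) (l : C), scal (V := C_R_NormedModule) h l = h * l).
  { intros h [a b]. unfold scal; simpl. unfold prod_scal, scal; simpl. unfold mult; simpl.
    apply C_ext; simpl; ring. }
  split.
  - intros [_ H] eps He.
    destruct (H x (fun P HP => HP) (mkposreal _ He)) as [d Hd].
    exists d. split; [apply cond_pos|]. intros h Hh.
    assert (Hb : ball x d (x + h)%R).
    { change (Rabs (x + h - x) < d)%R. now replace (x + h - x)%R with h by ring. }
    specialize (Hd (x + h)%R Hb). rewrite norm_CR, Hs in Hd.
    change (norm (minus (x + h)%R x)) with (Rabs (x + h - x)) in Hd.
    change (minus (x + h)%R x) with (x + h - x)%R in Hd.
    replace (x + h - x)%R with h in Hd by ring. exact Hd.
  - intros H. split; [apply is_linear_scal_l|].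
    intros y Hy eps. pose proof (is_filter_lim_locally_unique (V := R_NormedModule) x y Hy) as E. subst y. clear Hy.
    destruct (H eps (cond_pos eps)) as [d [Hd0 Hd]].
    exists (mkposreal d Hd0). intros y Hy.
    change (Rabs (y - x) < d)%R in Hy. specialize (Hd (y - x)%R Hy).
    rewrite norm_CR, Hs. change (norm (minus y x)) with (Rabs (y - x)).
    change (minus y x) with (y - x)%R.
    replace (x + (y - x))%R with y in Hd by (apply eq_sym, Rplus_minus). exact Hd.
Qed.

Lemma is_Cder_ext (f g : R -> C) (x : R) (l : C) :
  (forall t, f t = g t) -> is_Cder f x l -> is_Cder g x l.
Proof. intros H. apply is_derive_ext, H. Qed.

Lemma is_Cder_cont (f : R -> C) (x : R) (l : C) : is_Cder f x l -> Ccont f x.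
Proof. intros H. apply (ex_derive_continuous (V := C_R_NormedModule)). now exists l. Qed.

Lemma is_Cder_cont_eps (f : R -> C) (x : R) : Ccont f x ->
  forall eps : R, (0 < eps)%R -> exists delta : R, (0 < delta)%R /\
     forall h : R, (Rabs h < delta)%R -> (Cmod (f (x + h)%R - f x) < eps)%R.
Proof.
  intros H eps He.
  destruct (proj2 (Clim_eps (locally x) f (f x)) H eps He) as [d Hd].
  exists d. split; [apply cond_pos|]. intros h Hh. apply Hd.
  change (Rabs (x + h - x) < d)%R. now replace (x + h - x)%R with h by ring.
Qed.

Lemma is_Cder_plus (f g : R -> C) (x : R) (a b : C) :
  is_Cder f x a -> is_Cder g x b -> is_Cder (fun t => f t + g t) x (a + b).
Proof. exact (is_derive_plus (V := C_R_NormedModule) f g x a b). Qed.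

Lemma is_Cder_const (c : C) (x : R) : is_Cder (fun _ => c) x (RtoC 0).
Proof. exact (is_derive_const (V := C_R_NormedModule) c x). Qed.

Lemma is_Cder_mult (f g : R -> C) (x : R) (a b : C) :
  is_Cder f x a -> is_Cder g x b -> is_Cder (fun t => f t * g t) x (a * g x + f x * b).
Proof.
  intros Hf Hg. pose proof (is_Cder_cont_eps _ _ (is_Cder_cont _ _ _ Hf)) as Cf.
  apply is_Cder_eps. intros eps He.
  set (K := (1 + Cmod (g x) + Cmod (f x) + Cmod b)%R).
  assert (HK : (1 <= K)%R).
  { unfold K. pose proof (Cmod_ge_0 (g x)); pose proof (Cmod_ge_0 (f x)); pose proof (Cmod_ge_0 b). lra. }
  assert (He' : (0 < Rmin 1 (eps / (3 * K)))%R).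
  { apply Rmin_pos; [lra|]. apply Rdiv_lt_0_compat; lra. }
  set (e := Rmin 1 (eps / (3 * K))) in *.
  assert (HeK : (3 * (e * K) <= eps)%R).
  { apply Rle_trans with (3 * (eps / (3 * K) * K))%R.
    - apply Rmult_le_compat_l; [lra|]. apply Rmult_le_compat_r; [lra|apply Rmin_r].
    - right. field. lra. }
  assert (He1 : (e <= 1)%R) by apply Rmin_l.
  destruct (proj1 (is_Cder_eps _ _ _) Hf e He') as [d1 [Hd1 H1]].
  destruct (proj1 (is_Cder_eps _ _ _) Hg e He') as [d2 [Hd2 H2]].
  destruct (Cf e He') as [d3 [Hd3 H3]].
  exists (Rmin d1 (Rmin d2 d3)). split; [repeat apply Rmin_pos; auto|].
  intros h Hh.
  specialize (H1 h (Rlt_le_trans _ _ _ Hh (Rmin_l _ _))).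
  specialize (H2 h (Rlt_le_trans _ _ _ Hh (Rle_trans _ _ _ (Rmin_r _ _) (Rmin_l _ _)))).
  specialize (H3 h (Rlt_le_trans _ _ _ Hh (Rle_trans _ _ _ (Rmin_r _ _) (Rmin_r _ _)))).
  replace (f (x + h)%R * g (x + h)%R - f x * g x - h * (a * g x + f x * b)) with
    ((f (x + h)%R - f x - h * a) * g x + (f x * (g (x + h)%R - g x - h * b) +
     ((f (x + h)%R - f x) * (g (x + h)%R - g x - h * b) + (f (x + h)%R - f x) * (h * b)))) by ring.
  apply Rle_trans with (1 := Cmod_triangle _ _).
  pose proof (Cmod_triangle (f x * (g (x + h)%R - g x - h * b))
     ((f (x + h)%R - f x) * (g (x + h)%R - g x - h * b) + (f (x + h)%R - f x) * (h * b))) as T1.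
  pose proof (Cmod_triangle ((f (x + h)%R - f x) * (g (x + h)%R - g x - h * b)) ((f (x + h)%R - f x) * (h * b))) as T2.
  rewrite !Cmod_mult in *. rewrite Cmod_R in T2.
  set (u := Cmod (f (x + h)%R - f x - h * a)) in *.
  set (v := Cmod (g (x + h)%R - g x - h * b)) in *.
  set (w := Cmod (f (x + h)%R - f x)) in *.
  assert (0 <= v)%R by apply Cmod_ge_0. assert (0 <= w)%R by apply Cmod_ge_0.
  pose proof (Cmod_ge_0 (g x)). pose proof (Cmod_ge_0 (f x)). pose proof (Cmod_ge_0 b).
  pose proof (Rabs_pos h).
  assert (A1 : (u * Cmod (g x) <= e * Rabs h * Cmod (g x))%R) by (apply Rmult_le_compat_r; auto).
  assert (A2 : (Cmod (f x) * v <= Cmod (f x) * (e * Rabs h))%R) by (apply Rmult_le_compat_l; auto).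
  assert (A3 : (w * v <= 1 * (e * Rabs h))%R) by (apply Rmult_le_compat; lra).
  assert (A4 : (w * (Rabs h * Cmod b) <= e * (Rabs h * Cmod b))%R).
  { apply Rmult_le_compat_r; [|lra]. apply Rmult_le_pos; auto. }
  apply Rle_trans with (e * K * Rabs h)%R; [unfold K; lra|].
  apply Rmult_le_compat_r; auto. assert (0 <= e * K)%R by (apply Rmult_le_pos; lra). lra.
Qed.

Lemma is_Cder_scal (c : C) (f : R -> C) (x : R) (a : C) :
  is_Cder f x a -> is_Cder (fun t => c * f t) x (c * a).
Proof.
  intros H. replace (c * a) with (0 * f x + c * a) by ring.
  apply (is_Cder_mult (fun _ => c) f); [apply is_Cder_const|exact H].
Qed.

Lemma is_Cder_minus (f g : R -> C) (x : R) (a b : C) :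
  is_Cder f x a -> is_Cder g x b -> is_Cder (fun t => f t - g t) x (a - b).
Proof. exact (is_derive_minus (V := C_R_NormedModule) f g x a b). Qed.

Lemma is_Cder_RtoC (f : R -> R) (x a : R) :
  is_derive f x a -> is_Cder (fun t => RtoC (f t)) x (RtoC a).
Proof.
  intros H. apply is_Cder_eps. intros eps He.
  destruct H as [_ H]. destruct (H x (fun P HP => HP) (mkposreal _ He)) as [d Hd].
  exists d. split; [apply cond_pos|]. intros h Hh.
  assert (Hb : ball x d (x + h)%R).
  { change (Rabs (x + h - x) < d)%R. now replace (x + h - x)%R with h by ring. }
  specialize (Hd (x + h)%R Hb).
  change (Rabs (f (x + h) - f x - (x + h - x) * a) <= eps * Rabs (x + h - x))%R in Hd.
  replace (x + h - x)%R with h in Hd by ring.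
  now rewrite <- RtoC_mult, <- !RtoC_minus, Cmod_R.
Qed.

Lemma is_Cder_id (x : R) : is_Cder (fun t => RtoC t) x (RtoC 1).
Proof. apply (is_Cder_RtoC (fun t => t)). exact (is_derive_id (K := R_AbsRing) x). Qed.

(** Complex differentiability with a quadratic remainder. It is stronger than needed for the chain
    rule along real paths, but it follows from one inequality for parametric integrals and square
    roots. *)
Definition qd (g : C -> C) (z l : C) : Prop :=
  exists K delta : R, (0 <= K)%R /\ (0 < delta)%R /\
    forall h : C, (Cmod h < delta)%R -> (Cmod (g (z + h)%C - g z - h * l) <= K * (Cmod h * Cmod h))%R.

Lemma is_Cder_comp (g : C -> C) (u : R -> C) (x : R) (l du : C) :
  qd g (u x) l -> is_Cder u x du -> is_Cder (fun t => g (u t)) x (du * l).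
Proof.
  intros [K [d0 [HK [Hd0 Hg]]]] Hu.
  pose proof (is_Cder_cont_eps _ _ (is_Cder_cont _ _ _ Hu)) as Cu.
  apply is_Cder_eps. intros eps He.
  set (B := (1 + Cmod du + Cmod l)%R).
  assert (HB : (1 <= B)%R).
  { unfold B. pose proof (Cmod_ge_0 du); pose proof (Cmod_ge_0 l). lra. }
  set (e1 := Rmin 1 (eps / (2 * B))).
  assert (He1 : (0 < e1)%R).
  { apply Rmin_pos; [lra|]. apply Rdiv_lt_0_compat; lra. }
  set (e2 := Rmin d0 (eps / (2 * ((K + 1) * B)))).
  assert (HKB : (0 < (K + 1) * B)%R) by (apply Rmult_lt_0_compat; lra).
  assert (He2 : (0 < e2)%R).
  { apply Rmin_pos; [lra|]. apply Rdiv_lt_0_compat; lra. }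
  destruct (proj1 (is_Cder_eps _ _ _) Hu e1 He1) as [d1 [Hd1 H1]].
  destruct (Cu e2 He2) as [d2 [Hd2 H2]].
  exists (Rmin d1 d2). split; [now apply Rmin_pos|]. intros h Hh.
  specialize (H1 h (Rlt_le_trans _ _ _ Hh (Rmin_l _ _))).
  specialize (H2 h (Rlt_le_trans _ _ _ Hh (Rmin_r _ _))).
  set (w := u (x + h)%R - u x) in *.
  specialize (Hg w (Rlt_le_trans _ _ _ H2 (Rmin_l _ _))).
  replace (u x + w) with (u (x + h)%R) in Hg by (unfold w; ring).
  replace (g (u (x + h)%R) - g (u x) - h * (du * l)) with
    ((g (u (x + h)%R) - g (u x) - w * l) + (w - h * du) * l) by ring.
  apply Rle_trans with (1 := Cmod_triangle _ _). rewrite Cmod_mult.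
  pose proof (Rabs_pos h). pose proof (Cmod_ge_0 du). pose proof (Cmod_ge_0 l). pose proof (Cmod_ge_0 w).
  assert (Hw : (Cmod w <= B * Rabs h)%R).
  { pose proof (Cmod_triangle (w - h * du) (h * du)) as T. rewrite Cmod_mult, Cmod_R in T.
    replace (w - h * du + h * du) with w in T by ring.
    assert (e1 <= 1)%R by apply Rmin_l. unfold B. nra. }
  assert (A1 : (K * (Cmod w * Cmod w) <= eps / 2 * Rabs h)%R).
  { apply Rle_trans with ((K + 1) * (e2 * (B * Rabs h)))%R.
    - apply Rmult_le_compat; try lra. + apply Rmult_le_pos; lra.
      + apply Rmult_le_compat; lra.
    - apply Rle_trans with ((K + 1) * B * (eps / (2 * ((K + 1) * B))) * Rabs h)%R.
      + replace ((K + 1) * (e2 * (B * Rabs h)))%R with ((K + 1) * B * e2 * Rabs h)%R by ring.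
        apply Rmult_le_compat_r; auto. apply Rmult_le_compat_l; [lra|apply Rmin_r].
      + right. field. split; lra. }
  assert (A2 : (Cmod (w - h * du) * Cmod l <= eps / 2 * Rabs h)%R).
  { apply Rle_trans with (eps / (2 * B) * Rabs h * B)%R.
    - apply Rmult_le_compat; auto.
      + apply Cmod_ge_0.
      + apply Rle_trans with (1 := H1). apply Rmult_le_compat_r; auto. apply Rmin_r.
      + unfold B. lra.
    - right. field. lra. }
  lra.
Qed.

(** * Integrals of complex functions of a real variable *)

Lemma is_CRInt_derive (f df : R -> C) (a b : R) : (a <= b)%R ->
  (forall x, (a <= x <= b)%R -> is_Cder f x (df x)) ->
  (forall x, (a <= x <= b)%R -> Ccont df x) -> is_CRInt df a b (f b - f a).
Proof.
  intros Hab H1 H2.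
  apply (is_RInt_derive (V := C_R_CompleteNormedModule) f df a b);
    rewrite Rmin_left, Rmax_right by lra; auto.
Qed.

Lemma is_CRInt_ext (f g : R -> C) (a b : R) (l : C) : (a <= b)%R ->
  (forall x, (a < x < b)%R -> f x = g x) -> is_CRInt f a b l -> is_CRInt g a b l.
Proof.
  intros Hab H. apply is_RInt_ext. rewrite Rmin_left, Rmax_right by lra. exact H.
Qed.

Lemma is_CRInt_unique (f : R -> C) (a b : R) (l1 l2 : C) :
  is_CRInt f a b l1 -> is_CRInt f a b l2 -> l1 = l2.
Proof.
  intros H1 H2.
  rewrite <- (is_RInt_unique (V := C_R_CompleteNormedModule) _ _ _ _ H1).
  now rewrite <- (is_RInt_unique (V := C_R_CompleteNormedModule) _ _ _ _ H2).
Qed.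

Lemma is_CRInt_norm (f : R -> C) (g : R -> R) (a b : R) (lf : C) (lg : R) : (a <= b)%R ->
  (forall x, (a <= x <= b)%R -> (Cmod (f x) <= g x)%R) ->
  is_CRInt f a b lf -> is_RInt g a b lg -> (Cmod lf <= lg)%R.
Proof.
  intros Hab H H1 H2. rewrite <- norm_CR.
  apply (norm_RInt_le (V := C_R_NormedModule) f g a b); auto.
  intros x Hx. rewrite norm_CR. auto.
Qed.

Lemma is_CRInt_norm_const (f : R -> C) (B : R) (a b : R) (lf : C) : (a <= b)%R ->
  (forall x, (a <= x <= b)%R -> (Cmod (f x) <= B)%R) ->
  is_CRInt f a b lf -> (Cmod lf <= (b - a) * B)%R.
Proof.
  intros Hab H H1. apply (is_CRInt_norm f (fun _ => B) a b); auto.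
  apply (is_RInt_const (V := R_NormedModule)).
Qed.

Lemma is_CRInt_plus (f g : R -> C) (a b : R) (lf lg : C) :
  is_CRInt f a b lf -> is_CRInt g a b lg -> is_CRInt (fun x => f x + g x) a b (lf + lg).
Proof. exact (is_RInt_plus (V := C_R_NormedModule) f g a b lf lg). Qed.

Lemma is_CRInt_minus (f g : R -> C) (a b : R) (lf lg : C) :
  is_CRInt f a b lf -> is_CRInt g a b lg -> is_CRInt (fun x => f x - g x) a b (lf - lg).
Proof. exact (is_RInt_minus (V := C_R_NormedModule) f g a b lf lg). Qed.

Lemma Ccont_plus (f g : R -> C) (x : R) : Ccont f x -> Ccont g x -> Ccont (fun t => f t + g t) x.
Proof. intros Hf Hg. exact (Clim_plus (locally x) f g _ _ Hf Hg). Qed.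

Lemma Ccont_mult (f g : R -> C) (x : R) : Ccont f x -> Ccont g x -> Ccont (fun t => f t * g t) x.
Proof. intros Hf Hg. exact (Clim_mult (locally x) f g _ _ Hf Hg). Qed.

Lemma Ccont_const (c : C) (x : R) : Ccont (fun _ => c) x.
Proof. apply filterlim_const. Qed.

Lemma ex_CRInt_cont (f : R -> C) (a b : R) : (a <= b)%R ->
  (forall x, (a <= x <= b)%R -> Ccont f x) -> exists l : C, is_CRInt f a b l.
Proof.
  intros Hab H. apply (ex_RInt_continuous (V := C_R_CompleteNormedModule)).
  rewrite Rmin_left, Rmax_right by lra. exact H.
Qed.

Lemma is_CRInt_scal (c : C) (f : R -> C) (a b : R) (l : C) :
  is_CRInt f a b l -> is_CRInt (fun x => c * f x) a b (c * l).
Proof.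
  intros H.
  pose proof (is_RInt_fct_extend_fst f a b l H) as H1.
  pose proof (is_RInt_fct_extend_snd f a b l H) as H2.
  apply (is_RInt_fct_extend_pair (U := R_NormedModule) (V := R_NormedModule)).
  - apply (is_RInt_minus (V := R_NormedModule)
      (fun x => scal (fst c) (fst (f x))) (fun x => scal (snd c) (snd (f x)))).
    + apply (is_RInt_scal (V := R_NormedModule)), H1.
    + apply (is_RInt_scal (V := R_NormedModule)), H2.
  - apply (is_RInt_plus (V := R_NormedModule)
      (fun x => scal (fst c) (snd (f x))) (fun x => scal (snd c) (fst (f x)))).
    + apply (is_RInt_scal (V := R_NormedModule)), H2.
    + apply (is_RInt_scal (V := R_NormedModule)), H1.
Qed.

Lemma is_CRInt_chasles (f : R -> C) (a b c : R) (l1 l2 : C) :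
  is_CRInt f a b l1 -> is_CRInt f b c l2 -> is_CRInt f a c (l1 + l2).
Proof. exact (is_RInt_Chasles (V := C_R_NormedModule) f a b c l1 l2). Qed.

Lemma is_CRInt_point (f : R -> C) (a : R) : is_CRInt f a a (RtoC 0).
Proof. exact (is_RInt_point (V := C_R_NormedModule) f a). Qed.

Lemma is_CRInt_CSeries (f : nat -> R -> C) (F : R -> C) (I : nat -> C) (B : nat -> R) (a b : R) :
  (a <= b)%R -> ex_series B ->
  (forall n x, (a <= x <= b)%R -> (Cmod (f n x) <= B n)%R) ->
  (forall n, is_CRInt (f n) a b (I n)) ->
  (forall x, (a <= x <= b)%R -> F x = CSeries (fun n => f n x)) ->
  is_CRInt F a b (CSeries I) /\ is_Cseries I (CSeries I).
Proof.
  intros Hab HB Hf HI HF.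
  assert (HIb : forall n, (Cmod (I n) <= (b - a) * B n)%R).
  { intros n. apply (is_CRInt_norm_const (f n)); auto. }
  assert (HIs : is_Cseries I (CSeries I)).
  { apply (is_CSeries_le I (fun n => (b - a) * B n)%R); auto.
    apply (ex_series_scal_l (b - a)%R B HB). }
  split; [|exact HIs].
  (* The theorem on uniform limits of integrals asks for uniform convergence on the whole line, so
     the variable is clamped to [[a, b]]. *)
  set (p := fun x => Rmax a (Rmin b x)).
  assert (Hp : forall x, (a <= p x <= b)%R).
  { intros x. unfold p. split; [apply Rmax_l|]. apply Rmax_lub; [lra|apply Rmin_l]. }
  assert (Hp2 : forall x, (a <= x <= b)%R -> p x = x).
  { intros x Hx. unfold p. rewrite Rmin_right by lra. apply Rmax_right; lra. }
  set (S := fun (K : nat) (x : R) => sum_n (fun n => f n (p x)) K).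
  assert (HS : forall K, is_CRInt (S K) a b (sum_n I K)).
  { intros K. unfold S. induction K.
    - apply (is_CRInt_ext (f 0%nat)); auto.
      + intros x Hx. rewrite Csum_O, Hp2; auto; lra.
      + rewrite Csum_O. apply HI.
    - rewrite Csum_Sn.
      apply (is_CRInt_ext (fun x => sum_n (fun n => f n (p x)) K + f (Datatypes.S K) x)); auto.
      + intros x Hx. rewrite Csum_Sn. f_equal. now rewrite Hp2 by lra.
      + now apply is_CRInt_plus. }
  assert (HU : filterlim S eventually (locally (T := fct_UniformSpace R C_UniformSpace) (fun x => CSeries (fun n => f n (p x))))).
  { apply (proj2 (filterlim_locally (U := fct_UniformSpace R C_UniformSpace) S _)). intros eps.
    destruct (Series_tail_small B eps HB (cond_pos eps)) as [M HM].
    exists M. intros K HK x.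
    apply (C_NormedModule_mixin_compat1 _ _ eps).
    change (Cmod (S K x - CSeries (fun n => f n (p x))) < eps)%R. rewrite Cmod_sub_sym.
    apply Rle_lt_trans with (1 := CSeries_tail_le (fun n => f n (p x)) B K (fun n => Hf n _ (Hp x)) HB).
    assert (sum_n B M <= sum_n B K)%R.
    { apply sum_n_nonneg_incr; auto. intros n. apply Rle_trans with (2 := Hf n a ltac:(lra)). apply Cmod_ge_0. }
    lra. }
  destruct (filterlim_RInt (V := C_R_CompleteNormedModule) S a b eventually _
    (fun x => CSeries (fun n => f n (p x))) (sum_n I) HS HU) as [If [H1 H2]].
  replace (CSeries I) with (If : C).
  - apply is_CRInt_ext with (3 := H2); auto.
    intros x Hx. rewrite HF by lra. now rewrite Hp2 by lra.
  - apply (Clim_unique eventually (sum_n I)); [exact H1|exact HIs].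
Qed.

(** * The complex exponential *)

Lemma Cexp_plus (z w : C) : Cexp (z + w) = Cexp z * Cexp w.
Proof.
  unfold Cexp. destruct z as [a b], w as [c d]. simpl.
  rewrite exp_plus, cos_plus, sin_plus. apply C_ext; simpl; ring.
Qed.

Lemma Cexp_0 : Cexp 0 = 1.
Proof. unfold Cexp. simpl. rewrite exp_0, cos_0, sin_0. apply C_ext; simpl; ring. Qed.

Lemma Cmod_Cexp (z : C) : Cmod (Cexp z) = exp (Re z).
Proof.
  unfold Cexp. rewrite Cmod_mult, Cmod_R, (Rabs_pos_eq _ (Rlt_le _ _ (exp_pos _))).
  unfold Cmod; simpl.
  replace (cos (Im z) * (cos (Im z) * 1) + sin (Im z) * (sin (Im z) * 1))%R with 1%R.
  - rewrite sqrt_1. ring.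
  - pose proof (sin2_cos2 (Im z)). unfold Rsqr in *. lra.
Qed.

Lemma Cexp_neq_0 (z : C) : Cexp z <> 0.
Proof.
  intros H. pose proof (Cmod_Cexp z) as E. rewrite H, Cmod_0 in E.
  pose proof (exp_pos (Re z)). lra.
Qed.

Lemma Cexp_opp (z : C) : Cexp (- z) = / Cexp z.
Proof.
  assert (H : Cexp z * Cexp (- z) = 1).
  { rewrite <- Cexp_plus. replace (z + - z) with (RtoC 0) by ring. apply Cexp_0. }
  pose proof (Cexp_neq_0 z).
  apply (f_equal (fun x => / Cexp z * x)) in H. rewrite Cmult_assoc, Cinv_l, Cmult_1_l in H by auto.
  rewrite H. ring.
Qed.

Lemma Cexp_R (x : R) : Cexp (RtoC x) = RtoC (exp x).
Proof. unfold Cexp. simpl. rewrite cos_0, sin_0. apply C_ext; simpl; ring. Qed.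

Lemma Cmod_Cexp_le (z : C) : (Cmod (Cexp z) <= exp (Cmod z))%R.
Proof.
  rewrite Cmod_Cexp. destruct (Req_dec (Re z) (Cmod z)) as [E|E]; [rewrite E; lra|].
  left. apply exp_increasing. pose proof (Cmod_Re_le z). pose proof (Rle_abs (Re z)). lra.
Qed.

Lemma Cexp_2PI_Z (n : Z) : Cexp (2 * PI * Ci * IZR n) = 1.
Proof.
  assert (Hp : forall m : nat, Cexp (2 * PI * Ci * INR m) = 1).
  { induction m.
    - simpl. replace (2 * PI * Ci * 0) with (RtoC 0) by ring. apply Cexp_0.
    - rewrite S_INR, RtoC_plus.
      replace (2 * PI * Ci * (INR m + 1)) with (2 * PI * Ci * INR m + 2 * PI * Ci) by ring.
      rewrite Cexp_plus, IHm. unfold Cexp. simpl.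
      replace ((2 * PI - 0 * 0) * 0 - (2 * 0 + 0 * PI) * 1)%R with 0%R by ring.
      replace ((2 * PI - 0 * 0) * 1 + (2 * 0 + 0 * PI) * 0)%R with (2 * PI)%R by ring.
      rewrite exp_0, cos_2PI, sin_2PI. apply C_ext; simpl; ring. }
  destruct (Z_le_gt_dec 0 n) as [H|H].
  - rewrite <- (Z2Nat.id n H), <- INR_IZR_INZ. apply Hp.
  - replace (2 * PI * Ci * IZR n) with (- (2 * PI * Ci * INR (Z.to_nat (- n)))).
    + rewrite Cexp_opp, Hp. field.
    + rewrite INR_IZR_INZ, Z2Nat.id by lia. rewrite opp_IZR, RtoC_opp. ring.
Qed.

Lemma is_Cder_Cexp_lin (z : C) (t : R) : is_Cder (fun t => Cexp (t * z)) t (z * Cexp (t * z)).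
Proof.
  destruct z as [a b].
  apply (is_Cder_ext (fun t : R => RtoC (exp (t * a)) * (RtoC (cos (t * b)) + Ci * RtoC (sin (t * b))))).
  { intros s. unfold Cexp. simpl.
    replace (s * a - 0 * b)%R with (s * a)%R by ring.
    replace (s * b + 0 * a)%R with (s * b)%R by ring. apply C_ext; simpl; ring. }
  replace ((a, b) * Cexp (t * (a, b))) with
    (RtoC (a * exp (t * a)) * (RtoC (cos (t * b)) + Ci * RtoC (sin (t * b))) +
     RtoC (exp (t * a)) * (RtoC (- (b * sin (t * b))) + Ci * RtoC (b * cos (t * b)))).
  2:{ unfold Cexp. simpl.
    replace (t * a - 0 * b)%R with (t * a)%R by ring.
    replace (t * b + 0 * a)%R with (t * b)%R by ring. apply C_ext; simpl; ring. }
  apply (is_Cder_mult (fun t : R => RtoC (exp (t * a))) (fun t : R => RtoC (cos (t * b)) + Ci * RtoC (sin (t * b)))).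
  - apply (is_Cder_RtoC (fun t => exp (t * a))). auto_derive; [trivial|ring].
  - apply (is_Cder_plus (fun t : R => RtoC (cos (t * b))) (fun t : R => Ci * RtoC (sin (t * b)))).
    + apply (is_Cder_RtoC (fun t => cos (t * b))). auto_derive; [trivial|ring].
    + apply (is_Cder_scal Ci (fun t => RtoC (sin (t * b)))). apply (is_Cder_RtoC (fun t => sin (t * b))). auto_derive; [trivial|ring].
Qed.

(** Indexed by the number of terms, so that differentiating along a ray lowers the index by exactly
    one. *)
Fixpoint exp_poly (n : nat) (z : C) : C :=
  match n with O => 0 | S n' => exp_poly n' z + z ^ n' / INR (fact n') end.

Lemma is_Cder_pow (f : R -> C) (x : R) (a : C) (n : nat) :
  is_Cder f x a -> is_Cder (fun t => f t ^ n) x (INR n * a * f x ^ (pred n)).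
Proof.
  intros H. induction n.
  - simpl. replace (0 * a * 1) with (RtoC 0) by ring. apply is_Cder_const.
  - replace (INR (S n) * a * f x ^ pred (S n)) with (a * f x ^ n + f x * (INR n * a * f x ^ pred n)).
    + apply (is_Cder_mult f (fun t => f t ^ n)); auto.
    + rewrite S_INR, RtoC_plus. destruct n; simpl; ring.
Qed.

Lemma INR_fact_C_neq_0 n : RtoC (INR (fact n)) <> 0.
Proof. intros H. apply (INR_fact_neq_0 n). now apply RtoC_inj. Qed.

Lemma is_Cder_exp_poly (z : C) n (t : R) :
  is_Cder (fun t => exp_poly (S n) (t * z)) t (z * exp_poly n (t * z)).
Proof.
  induction n.
  - apply (is_Cder_ext (fun _ => RtoC 1)).
    + intros s. simpl. field.
    + simpl. rewrite Cmult_0_r. apply is_Cder_const.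
  - change (exp_poly (S n) (t * z)) with (exp_poly n (t * z) + (t * z) ^ n / INR (fact n)).
    rewrite Cmult_plus_distr_l.
    apply (is_Cder_plus (fun t => exp_poly (S n) (t * z)) (fun t => (t * z) ^ S n / INR (fact (S n)))); [exact IHn|].
    apply (is_Cder_ext (fun s => / INR (fact (S n)) * (s * z) ^ S n)).
    { intros s. unfold Cdiv. ring. }
    replace (z * ((t * z) ^ n / INR (fact n))) with
      (/ INR (fact (S n)) * (INR (S n) * (1 * z + t * 0) * (t * z) ^ pred (S n))).
    + apply (is_Cder_scal _ (fun s => (s * z) ^ S n)). apply (is_Cder_pow (fun s => s * z)).
      apply (is_Cder_mult (fun s => RtoC s) (fun _ => z)); [apply is_Cder_id|apply is_Cder_const].
    + rewrite fact_simpl, mult_INR, RtoC_mult. simpl pred. field.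
      split; [apply INR_fact_C_neq_0|]. intros E. apply RtoC_inj in E. now apply (not_0_INR (S n)) in E.
Qed.

Lemma exp_poly_0 n : exp_poly (S n) 0 = 1.
Proof.
  induction n.
  - simpl. field.
  - change (exp_poly (S (S n)) 0) with (exp_poly (S n) 0 + 0 ^ S n / INR (fact (S n))).
    rewrite IHn. simpl Cpow. unfold Cdiv. ring.
Qed.

(** Along the segment [t z] the remainder of order [n + 1] has derivative [z] times the remainder of
    order [n] and vanishes at [t = 0]; integrating the bound of order [n] produces the factor
    [1 / (n + 1)]. *)
Lemma Cexp_taylor n : forall z : C,
  (Cmod (Cexp z - exp_poly n z) <= Cmod z ^ n / INR (fact n) * exp (Cmod z))%R.
Proof.
  induction n; intros z.
  - simpl. replace (Cexp z - 0) with (Cexp z) by ring. rewrite Rdiv_1_r, Rmult_1_l. apply Cmod_Cexp_le.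
  - assert (HD : forall t, is_Cder (fun t => Cexp (t * z) - exp_poly (S n) (t * z)) t
        (z * (Cexp (t * z) - exp_poly n (t * z)))).
    { intros t. replace (z * (Cexp (t * z) - exp_poly n (t * z))) with
        (z * Cexp (t * z) - z * exp_poly n (t * z)) by ring.
      apply (is_Cder_minus (fun t => Cexp (t * z)) (fun t => exp_poly (S n) (t * z)));
        [apply is_Cder_Cexp_lin|apply is_Cder_exp_poly]. }
    assert (HI : is_CRInt (fun t => z * (Cexp (t * z) - exp_poly n (t * z))) 0 1
       (Cexp (1 * z) - exp_poly (S n) (1 * z) - (Cexp (0 * z) - exp_poly (S n) (0 * z)))).
    { apply (is_CRInt_derive (fun t => Cexp (t * z) - exp_poly (S n) (t * z))); [lra|auto|].
      intros t _. apply Ccont_mult; [apply Ccont_const|].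
      apply (Clim_minus (locally t) (fun t => Cexp (t * z)) (fun t => exp_poly n (t * z))).
      - exact (is_Cder_cont _ _ _ (is_Cder_Cexp_lin z t)).
      - destruct n as [|m]; [exact (Ccont_const 0 t)|exact (is_Cder_cont _ _ _ (is_Cder_exp_poly z m t))]. }
    replace (Cexp (0 * z) - exp_poly (S n) (0 * z)) with (RtoC 0) in HI.
    2:{ rewrite Cmult_0_l, Cexp_0, exp_poly_0. ring. }
    rewrite Cmult_1_l in HI. replace (Cexp z - exp_poly (S n) z - 0) with (Cexp z - exp_poly (S n) z) in HI by ring.
    set (c := (Cmod z ^ S n / INR (fact n) * exp (Cmod z))%R).
    assert (HR : is_RInt (fun t => t ^ n * c)%R 0 1 (/ INR (S n) * c)%R).
    { replace (/ INR (S n) * c)%R with (minus (1 ^ S n * (/ INR (S n) * c)) (0 ^ S n * (/ INR (S n) * c)))%R.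
      - apply (is_RInt_derive (V := R_CompleteNormedModule) (fun t => t ^ S n * (/ INR (S n) * c))%R).
        + intros x _. auto_derive; [trivial|]. simpl pred.
          change (match n with O => 1%R | S _ => (INR n + 1)%R end) with (INR (S n)). field. apply not_0_INR. lia.
        + intros x _. apply (ex_derive_continuous (fun t => t ^ n * c)%R). auto_derive. trivial.
      - change (1 ^ S n * (/ INR (S n) * c) - 0 ^ S n * (/ INR (S n) * c) = / INR (S n) * c)%R.
        rewrite pow1, pow_i by lia. ring. }
    apply Rle_trans with (/ INR (S n) * c)%R.
    + apply (is_CRInt_norm (fun t => z * (Cexp (t * z) - exp_poly n (t * z))) (fun t => t ^ n * c)%R 0 1); auto; [lra|].
      intros t Ht. rewrite Cmod_mult.
      apply Rle_trans with (Cmod z * (Cmod (t * z) ^ n / INR (fact n) * exp (Cmod (t * z))))%R.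
      * apply Rmult_le_compat_l; [apply Cmod_ge_0|apply IHn].
      * rewrite Cmod_mult, Cmod_R, (Rabs_pos_eq t) by lra. rewrite Rpow_mult_distr.
        unfold c. simpl pow. pose proof (Cmod_ge_0 z) as Hz.
        pose proof (pow_le t n ltac:(lra)). pose proof (pow_le _ n Hz).
        assert (exp (t * Cmod z) <= exp (Cmod z))%R.
        { destruct (Req_dec (t * Cmod z) (Cmod z)) as [E|E]; [rewrite E; lra|].
          left. apply exp_increasing. nra. }
        pose proof (INR_fact_lt_0 n) as Hfa. pose proof (Rinv_0_lt_compat _ Hfa).
        replace (Cmod z * (t ^ n * Cmod z ^ n / INR (fact n) * exp (t * Cmod z)))%R with
          ((Cmod z * t ^ n * Cmod z ^ n * / INR (fact n)) * exp (t * Cmod z))%R by (unfold Rdiv; ring).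
        replace (t ^ n * (Cmod z * Cmod z ^ n / INR (fact n) * exp (Cmod z)))%R with
          ((Cmod z * t ^ n * Cmod z ^ n * / INR (fact n)) * exp (Cmod z))%R by (unfold Rdiv; ring).
        apply Rmult_le_compat_l; auto. repeat apply Rmult_le_pos; auto; lra.
    + right. unfold c. rewrite fact_simpl, mult_INR. field.
      split; [apply INR_fact_neq_0|apply not_0_INR; lia].
Qed.

Lemma sum_n_exp_poly (z : C) n : sum_n (fun k => z ^ k / INR (fact k)) n = exp_poly (S n) z.
Proof.
  induction n.
  - rewrite Csum_O. simpl. symmetry. apply Cplus_0_l.
  - rewrite Csum_Sn, IHn. reflexivity.
Qed.

Lemma is_series_exp (x : R) : is_series (fun k => x ^ k / INR (fact k))%R (exp x).
Proof.
  apply is_series_ext with (2 := is_exp_Reals x).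
  intros n. rewrite pow_n_pow. unfold scal; simpl. unfold mult; simpl. field. apply INR_fact_neq_0.
Qed.

Lemma is_Cseries_exp (z : C) : is_Cseries (fun k => z ^ k / INR (fact k)) (Cexp z).
Proof.
  apply (proj1 (Clim_eps eventually _ _)). intros eps He.
  pose proof (is_series_exp (Cmod z)) as Hs.
  pose proof (ex_series_lim_0 _ (ex_intro _ _ Hs)) as H0.
  assert (He' : (0 < eps / exp (Cmod z))%R) by (apply Rdiv_lt_0_compat; [lra|apply exp_pos]).
  apply is_lim_seq_spec in H0. destruct (H0 (mkposreal _ He')) as [M HM].
  exists M. intros n Hn.
  match goal with |- (Cmod (?s - _) < _)%R => replace s with (exp_poly (S n) z : C) by (symmetry; apply sum_n_exp_poly) end.
  rewrite Cmod_sub_sym. apply Rle_lt_trans with (1 := Cexp_taylor (S n) z).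
  specialize (HM (S n) ltac:(lia)). simpl pos in HM.
  rewrite Rminus_0_r in HM. apply Rle_lt_trans with (Rabs (Cmod z ^ S n / INR (fact (S n))) * exp (Cmod z))%R.
  - apply Rmult_le_compat_r; [left; apply exp_pos|apply Rle_abs].
  - apply (Rmult_lt_compat_r (exp (Cmod z))) in HM; [|apply exp_pos].
    apply Rlt_le_trans with (1 := HM). right. field. pose proof (exp_pos (Cmod z)). lra.
Qed.

Lemma exp_le (x y : R) : (x <= y)%R -> (exp x <= exp y)%R.
Proof. intros [H|H]; [left; now apply exp_increasing|rewrite H; lra]. Qed.

Lemma Cexp_quad (h : C) : (Cmod (Cexp h - 1 - h) <= Cmod h * Cmod h * exp (Cmod h))%R.
Proof.
  pose proof (Cexp_taylor 2 h) as H. simpl in H.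
  replace (Cexp h - (0 + 1 / 1 + h * 1 / 1)) with (Cexp h - 1 - h) in H
    by field.
  apply Rle_trans with (1 := H). apply Rmult_le_compat_r; [left; apply exp_pos|].
  pose proof (Cmod_ge_0 h). nra.
Qed.

Lemma qd_Cexp (z : C) : qd Cexp z (Cexp z).
Proof.
  exists (Cmod (Cexp z) * exp 1)%R, 1%R. split; [|split; [lra|]].
  - apply Rmult_le_pos; [apply Cmod_ge_0|left; apply exp_pos].
  - intros h Hh. rewrite Cexp_plus.
    replace (Cexp z * Cexp h - Cexp z - h * Cexp z) with (Cexp z * (Cexp h - 1 - h)) by ring.
    rewrite Cmod_mult, Rmult_assoc. apply Rmult_le_compat_l; [apply Cmod_ge_0|].
    apply Rle_trans with (1 := Cexp_quad h). rewrite (Rmult_comm (exp 1)).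
    apply Rmult_le_compat_l; [|apply exp_le; lra].
    apply Rmult_le_pos; apply Cmod_ge_0.
Qed.

Lemma is_Cder_Cexp (p : R -> C) (x : R) (dp : C) :
  is_Cder p x dp -> is_Cder (fun t => Cexp (p t)) x (dp * Cexp (p x)).
Proof. intros H. apply (is_Cder_comp Cexp p); [apply qd_Cexp|exact H]. Qed.

Lemma Ccont_RtoC (f : R -> R) (x : R) : continuous f x -> Ccont (fun t => RtoC (f t)) x.
Proof.
  intros H. apply Clim_components; [exact _|exact H|].
  apply (filterlim_ext (fun _ => 0%R)); [reflexivity|]. exact (filterlim_const (U := R_UniformSpace) 0%R).
Qed.

Lemma Ccont_comp (g : C -> C) (u : R -> C) (x : R) (l : C) :
  qd g (u x) l -> Ccont u x -> Ccont (fun t => g (u t)) x.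
Proof.
  intros [K [d0 [HK [Hd0 Hg]]]] Hu.
  apply (proj1 (Clim_eps (locally x) _ _)). intros eps He.
  set (B := (K * d0 + Cmod l + 1)%R).
  assert (HB : (0 < B)%R).
  { unfold B. pose proof (Cmod_ge_0 l). assert (0 <= K * d0)%R by (apply Rmult_le_pos; lra). lra. }
  assert (He2 : (0 < Rmin d0 (eps / B))%R) by (apply Rmin_pos; [lra|apply Rdiv_lt_0_compat; lra]).
  apply filter_imp with (2 := proj2 (Clim_eps (locally x) _ _) Hu _ He2).
  intros t Ht. set (w := u t - u x) in *.
  assert (Hw1 : (Cmod w < d0)%R) by (apply Rlt_le_trans with (1 := Ht), Rmin_l).
  assert (Hw2 : (Cmod w < eps / B)%R) by (apply Rlt_le_trans with (1 := Ht), Rmin_r).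
  specialize (Hg w Hw1). replace (u x + w) with (u t) in Hg by (unfold w; ring).
  replace (g (u t) - g (u x)) with ((g (u t) - g (u x) - w * l) + w * l) by ring.
  apply Rle_lt_trans with (1 := Cmod_triangle _ _). rewrite Cmod_mult.
  pose proof (Cmod_ge_0 w). pose proof (Cmod_ge_0 l).
  assert (A : (K * (Cmod w * Cmod w) <= K * d0 * Cmod w)%R).
  { rewrite Rmult_assoc. apply Rmult_le_compat_l; auto. apply Rmult_le_compat_r; lra. }
  apply Rle_lt_trans with (Cmod w * B)%R; [unfold B; lra|].
  apply Rlt_le_trans with (eps / B * B)%R; [apply Rmult_lt_compat_r; auto|].
  right. field. lra.
Qed.

(** * Exponential kernels and the error function *)

Lemma qd_exp_kernel (p q : R -> R) (F F' : C -> C) (P Q : R) (w : C) :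
  (forall t, (0 <= t <= 1)%R -> (Rabs (p t) <= P)%R /\ (Rabs (q t) <= Q)%R) ->
  (forall z : C, is_CRInt (fun t => q t * Cexp (- z * p t)) 0 1 (F z)) ->
  (forall z : C, is_CRInt (fun t => - (p t * q t) * Cexp (- z * p t)) 0 1 (F' z)) ->
  qd F w (F' w).
Proof.
  intros HB HF HF'.
  assert (HP : (0 <= P)%R) by (apply Rle_trans with (2 := proj1 (HB 0%R ltac:(lra))), Rabs_pos).
  assert (HQ : (0 <= Q)%R) by (apply Rle_trans with (2 := proj2 (HB 0%R ltac:(lra))), Rabs_pos).
  exists (Q * exp (Cmod w * P) * (P * P * exp P))%R, 1%R.
  assert (HK : (0 <= Q * exp (Cmod w * P))%R) by (apply Rmult_le_pos; [lra|left; apply exp_pos]).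
  assert (HK2 : (0 <= P * P * exp P)%R) by (repeat apply Rmult_le_pos; auto; left; apply exp_pos).
  split; [now apply Rmult_le_pos|split; [lra|]].
  intros h Hh. pose proof (Cmod_ge_0 h) as Hh0.
  pose proof (is_CRInt_minus _ _ _ _ _ _ (is_CRInt_minus _ _ _ _ _ _ (HF (w + h)) (HF w))
    (is_CRInt_scal h _ _ _ _ (HF' w))) as HI.
  replace (Q * exp (Cmod w * P) * (P * P * exp P) * (Cmod h * Cmod h))%R with
    ((1 - 0) * (Q * exp (Cmod w * P) * (P * P * exp P * (Cmod h * Cmod h))))%R by ring.
  apply is_CRInt_norm_const with (3 := HI); [lra|]. intros t Ht.
  destruct (HB t Ht) as [Hp Hq].
  (* The remainder of the integral is the integral of the remainder of [exp] at [- h * p t], which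
     is quadratic in [h] uniformly in [t]. *)
  replace (q t * Cexp (- (w + h) * p t) - q t * Cexp (- w * p t) - h * (- (p t * q t) * Cexp (- w * p t)))
    with (q t * Cexp (- w * p t) * (Cexp (- h * p t) - 1 - (- h * p t))).
  2:{ replace (- (w + h) * p t) with (- w * p t + - h * p t) by ring. rewrite Cexp_plus. ring. }
  rewrite !Cmod_mult, Cmod_R.
  assert (Hpt : forall z : C, (Cmod (- z * p t) <= Cmod z * P)%R).
  { intros z. rewrite Cmod_mult, Cmod_R, Cmod_opp. apply Rmult_le_compat_l; [apply Cmod_ge_0|auto]. }
  apply Rmult_le_compat; try apply Cmod_ge_0.
  - apply Rmult_le_pos; [apply Rabs_pos|apply Cmod_ge_0].
  - apply Rmult_le_compat; auto; [apply Rabs_pos|apply Cmod_ge_0|].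
    apply Rle_trans with (1 := Cmod_Cexp_le _). apply exp_le, Hpt.
  - apply Rle_trans with (1 := Cexp_quad _).
    pose proof (Hpt h) as Hph. pose proof (Cmod_ge_0 (- h * p t)).
    replace (P * P * exp P * (Cmod h * Cmod h))%R with ((Cmod h * P) * (Cmod h * P) * exp P)%R by ring.
    apply Rmult_le_compat.
    + now apply Rmult_le_pos.
    + left; apply exp_pos.
    + now apply Rmult_le_compat.
    + apply exp_le. nra.
Qed.

(** Differentiation in [z] stays in this family, replacing [q] by [- p q]; the error function and
    its companion are two members. *)
Definition kint (p q : R -> R) (z : C) : C :=
  RInt (V := C_R_CompleteNormedModule) (fun t : R => q t * Cexp (- z * p t)) 0 1.

Lemma Ccont_Cexp (u : R -> C) (x : R) : Ccont u x -> Ccont (fun t => Cexp (u t)) x.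
Proof. apply (Ccont_comp Cexp u x _ (qd_Cexp (u x))). Qed.

Lemma kint_correct (p q : R -> R) (z : C) :
  (forall t, continuous p t) -> (forall t, continuous q t) ->
  is_CRInt (fun t : R => q t * Cexp (- z * p t)) 0 1 (kint p q z).
Proof.
  intros Hp Hq.
  apply (RInt_correct (V := C_R_CompleteNormedModule) (fun t : R => q t * Cexp (- z * p t))).
  apply ex_CRInt_cont; [lra|]. intros t _.
  apply Ccont_mult; [apply (Ccont_RtoC q), Hq|].
  apply (Ccont_Cexp (fun t => - z * p t)).
  apply Ccont_mult; [apply Ccont_const|apply (Ccont_RtoC p), Hp].
Qed.

Lemma qd_kint (p q : R -> R) (P Q : R) (w : C) :
  (forall t, continuous p t) -> (forall t, continuous q t) ->
  (forall t, (0 <= t <= 1)%R -> (Rabs (p t) <= P)%R /\ (Rabs (q t) <= Q)%R) ->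
  qd (kint p q) w (kint p (fun t => - (p t * q t))%R w).
Proof.
  intros Hp Hq HB.
  apply (qd_exp_kernel p q (kint p q) (kint p (fun t => - (p t * q t))%R) P Q w HB).
  - intros z. now apply kint_correct.
  - intros z. apply (is_CRInt_ext (fun t => RtoC (- (p t * q t)) * Cexp (- z * p t))); [lra| |].
    + intros t _. now rewrite RtoC_opp, RtoC_mult.
    + apply kint_correct; auto. intros t.
      apply (continuous_opp (V := R_NormedModule) (fun t => p t * q t)%R).
      now apply (continuous_mult (K := R_AbsRing) p q).
Qed.

(** [v * gint (v * v)] is the integral of [exp (- u^2)] along the segment from 0 to [v]. *)
Definition gint : C -> C := kint (fun t => t ^ 2)%R (fun _ => 1%R).
Definition gint' : C -> C := kint (fun t => t ^ 2)%R (fun t => - (t ^ 2 * 1))%R.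
Definition hint : C -> C := kint (fun t => 1 + t ^ 2)%R (fun t => / (1 + t ^ 2))%R.

Lemma cont_sqr (t : R) : continuous (fun t => t ^ 2)%R t.
Proof. apply (ex_derive_continuous (fun t => t ^ 2)%R). auto_derive. trivial. Qed.

Lemma cont_inv1 (t : R) : continuous (fun t => / (1 + t ^ 2))%R t.
Proof. apply (ex_derive_continuous (fun t => / (1 + t ^ 2))%R). auto_derive. nra. Qed.

Lemma cont_1sqr (t : R) : continuous (fun t => 1 + t ^ 2)%R t.
Proof. apply (ex_derive_continuous (fun t => 1 + t ^ 2)%R). auto_derive. trivial. Qed.

Lemma qd_gint (w : C) : qd gint w (gint' w).
Proof.
  apply (qd_kint (fun t => t ^ 2)%R (fun _ => 1%R) 1 1 w).
  - apply cont_sqr.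
  - intros t. apply continuous_const.
  - intros t Ht. rewrite !Rabs_pos_eq by nra. nra.
Qed.

Lemma gint_eq (w : C) : is_CRInt (fun t : R => Cexp (- w * (t ^ 2)%R)) 0 1 (gint w).
Proof.
  apply (is_CRInt_ext (fun t : R => RtoC 1 * Cexp (- w * (t ^ 2)%R))); [lra|intros; ring|].
  apply (kint_correct (fun t => t ^ 2)%R (fun _ => 1%R)); [apply cont_sqr|intros; apply continuous_const].
Qed.

(** Integrate the derivative of [t exp (- w t^2)] over [[0, 1]]. With [w = u^2] the identity says
    that [u gint (u^2)] has derivative [exp (- u^2)]. *)
Lemma gint_ode (w : C) : gint w + 2 * w * gint' w = Cexp (- w).
Proof.
  assert (H1 : is_CRInt (fun t : R => Cexp (- w * (t ^ 2)%R) + 2 * w * (RtoC (- (t ^ 2 * 1)) * Cexp (- w * (t ^ 2)%R))) 0 1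
     (gint w + 2 * w * gint' w)).
  { apply is_CRInt_plus; [apply gint_eq|]. apply is_CRInt_scal.
    apply (kint_correct (fun t => t ^ 2)%R (fun t => - (t ^ 2 * 1))%R); [apply cont_sqr|].
    intros t. apply (ex_derive_continuous (fun t => - (t ^ 2 * 1))%R). auto_derive. trivial. }
  assert (HD : forall t : R, is_Cder (fun t : R => t * Cexp (- w * (t ^ 2)%R)) t
      (Cexp (- w * (t ^ 2)%R) + 2 * w * (RtoC (- (t ^ 2 * 1)) * Cexp (- w * (t ^ 2)%R)))).
  { intros t.
    replace (Cexp (- w * (t ^ 2)%R) + 2 * w * (RtoC (- (t ^ 2 * 1)) * Cexp (- w * (t ^ 2)%R))) with
      (1 * Cexp (- w * (t ^ 2)%R) + t * ((- w * (2 * t)%R) * Cexp (- w * (t ^ 2)%R))).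
    - apply (is_Cder_mult (fun t => RtoC t)); [apply is_Cder_id|].
      apply (is_Cder_Cexp (fun t : R => - w * (t ^ 2)%R)).
      apply (is_Cder_scal (- w) (fun t : R => RtoC (t ^ 2))).
      apply (is_Cder_RtoC (fun t => t ^ 2)%R). auto_derive; [trivial|ring].
    - rewrite RtoC_opp, !RtoC_mult, !RtoC_pow. ring. }
  assert (HC : forall x, (0 <= x <= 1)%R -> Ccont (fun t : R => Cexp (- w * (t ^ 2)%R) +
     2 * w * (RtoC (- (t ^ 2 * 1)) * Cexp (- w * (t ^ 2)%R))) x).
  { intros x _.
    assert (HE : Ccont (fun t : R => Cexp (- w * (t ^ 2)%R)) x).
    { apply (Ccont_Cexp (fun t : R => - w * (t ^ 2)%R)).
      apply Ccont_mult; [apply Ccont_const|apply (Ccont_RtoC (fun t => t ^ 2)%R), cont_sqr]. }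
    apply Ccont_plus; [exact HE|].
    apply Ccont_mult; [apply Ccont_const|]. apply Ccont_mult; [|exact HE].
    apply (Ccont_RtoC (fun t => - (t ^ 2 * 1))%R).
    apply (ex_derive_continuous (fun t => - (t ^ 2 * 1))%R). auto_derive. trivial. }
  rewrite (is_CRInt_unique _ _ _ _ _ H1 (is_CRInt_derive _ _ 0 1 ltac:(lra) (fun t _ => HD t) HC)).
  rewrite pow1, Cmult_1_r. ring.
Qed.

Lemma qd_hint (w : C) : qd hint w (- (Cexp (- w) * gint w)).
Proof.
  replace (- (Cexp (- w) * gint w)) with
    (kint (fun t => 1 + t ^ 2)%R (fun t => - ((1 + t ^ 2) * / (1 + t ^ 2)))%R w).
  - apply (qd_kint (fun t => 1 + t ^ 2)%R (fun t => / (1 + t ^ 2))%R 2 1 w).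
    + apply cont_1sqr.
    + apply cont_inv1.
    + intros t Ht. rewrite Rabs_pos_eq by nra. split; [nra|].
      rewrite Rabs_pos_eq; [|left; apply Rinv_0_lt_compat; nra].
      apply Rle_trans with (/ 1)%R; [apply Rinv_le_contravar; nra|rewrite Rinv_1; lra].
  - assert (H1 := kint_correct (fun t => 1 + t ^ 2)%R (fun t => - ((1 + t ^ 2) * / (1 + t ^ 2)))%R w).
    apply (is_CRInt_unique _ _ _ _ _ (H1 cont_1sqr ltac:(
      intros t; apply (ex_derive_continuous (fun t => - ((1 + t ^ 2) * / (1 + t ^ 2)))%R); auto_derive; nra))).
    replace (- (Cexp (- w) * gint w)) with (- Cexp (- w) * gint w) by ring.
    apply (is_CRInt_ext (fun t : R => - Cexp (- w) * Cexp (- w * (t ^ 2)%R))); [lra| |].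
    + intros t _. replace (- ((1 + t ^ 2) * / (1 + t ^ 2)))%R with (-1)%R by (field; nra).
      rewrite RtoC_plus. replace (- w * (1 + (t ^ 2)%R)) with (- w + - w * (t ^ 2)%R) by ring.
      rewrite Cexp_plus. ring.
    + apply is_CRInt_scal, gint_eq.
Qed.

Lemma is_Cder_0_eq (f : R -> C) : (forall t, (0 <= t <= 1)%R -> is_Cder f t (RtoC 0)) -> f 1%R = f 0%R.
Proof.
  intros H.
  pose proof (is_CRInt_derive f (fun _ => RtoC 0) 0 1 ltac:(lra) H (fun x _ => Ccont_const 0 x)) as H1.
  pose proof (is_CRInt_scal 0 _ _ _ _ H1) as H2.
  assert (H3 : is_CRInt (fun _ => RtoC 0) 0 1 (0 * (f 1%R - f 0%R))).
  { apply (is_CRInt_ext (fun _ => 0 * RtoC 0)); [lra|intros; ring|exact H2]. }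
  pose proof (is_CRInt_unique _ _ _ _ _ H1 H3) as E.
  rewrite Cmult_0_l in E. apply (f_equal (fun z => z + f 0%R)) in E.
  replace (f 1%R - f 0%R + f 0%R) with (f 1%R) in E by ring. rewrite E. ring.
Qed.

Lemma is_RInt_inv1 : is_RInt (fun t => / (1 + t ^ 2))%R 0 1 (PI / 4)%R.
Proof.
  replace (PI / 4)%R with (minus (atan 1) (atan 0)).
  - apply (is_RInt_derive (V := R_CompleteNormedModule) atan).
    + intros x _. apply is_derive_Reals, derivable_pt_lim_atan.
    + intros x _. apply cont_inv1.
  - rewrite atan_1, atan_0. change (PI / 4 - 0 = PI / 4)%R. ring.
Qed.

Lemma is_Cder_lin (w : C) (t : R) : is_Cder (fun t : R => t * w) t w.
Proof.
  enough (H : is_Cder (fun t : R => t * w) t (1 * w + t * 0)).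
  { replace (1 * w + t * 0) with w in H by ring. exact H. }
  apply (is_Cder_mult (fun t => RtoC t) (fun _ => w)); [apply is_Cder_id|apply is_Cder_const].
Qed.

Lemma is_CRInt_RtoC (f : R -> R) (a b l : R) :
  is_RInt f a b l -> is_CRInt (fun t => RtoC (f t)) a b (RtoC l).
Proof.
  intros H. apply (is_RInt_fct_extend_pair (U := R_NormedModule) (V := R_NormedModule)).
  - exact H.
  - assert (H0 : is_RInt (fun _ : R => 0%R) a b ((b - a) * 0)%R)
      by exact (is_RInt_const (V := R_NormedModule) a b 0%R).
    rewrite Rmult_0_r in H0. exact H0.
Qed.

Lemma hint_eq (w : C) :
  is_CRInt (fun t : R => RtoC (/ (1 + t ^ 2)) * Cexp (- w * RtoC (1 + t ^ 2))) 0 1 (hint w).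
Proof. apply (kint_correct (fun t => 1 + t ^ 2)%R (fun t => / (1 + t ^ 2))%R); [apply cont_1sqr|apply cont_inv1]. Qed.

(** The classical evaluation of the Gaussian integral, for complex [w]: by [gint_ode] the left side
    has zero derivative along the segment from 0 to [w], and at 0 it is the integral of
    [1 / (1 + t^2)] over [[0, 1]]. *)
Lemma gint_sqr (w : C) : w * (gint w * gint w) + hint w = RtoC (PI / 4).
Proof.
  set (f := fun t : R => (t * w) * (gint (t * w) * gint (t * w)) + hint (t * w)).
  assert (Hf : f 1%R = f 0%R).
  { apply is_Cder_0_eq. intros t _.
    assert (Hl : is_Cder (fun t : R => t * w) t w).
    { apply is_Cder_lin. }
    pose proof (is_Cder_comp gint (fun t : R => t * w) t _ _ (qd_gint (t * w)) Hl) as Hg.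
    pose proof (is_Cder_comp hint (fun t : R => t * w) t _ _ (qd_hint (t * w)) Hl) as Hh.
    match goal with |- is_Cder _ _ ?z => replace z with
      (w * (gint (t * w) * gint (t * w)) + (t * w) * (w * gint' (t * w) * gint (t * w) + gint (t * w) * (w * gint' (t * w)))
        + w * (- (Cexp (- (t * w)) * gint (t * w)))) end.
    - apply (is_Cder_plus (fun t : R => (t * w) * (gint (t * w) * gint (t * w))) (fun t : R => hint (t * w))); [|exact Hh].
      apply (is_Cder_mult (fun t : R => t * w) (fun t : R => gint (t * w) * gint (t * w))); [exact Hl|].
      apply (is_Cder_mult (fun t : R => gint (t * w)) (fun t : R => gint (t * w))); exact Hg.
    - rewrite <- gint_ode. ring. }
  unfold f in Hf. rewrite Cmult_1_l in Hf. rewrite Hf, Cmult_0_l, Cmult_0_l, Cplus_0_l.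
  apply (is_CRInt_unique _ _ _ _ _ (hint_eq 0)).
  apply (is_CRInt_ext (fun t : R => RtoC (/ (1 + t ^ 2)))); [lra| |].
  - intros t _. replace (- 0 * RtoC (1 + t ^ 2)) with (RtoC 0) by ring. rewrite Cexp_0. ring.
  - apply is_CRInt_RtoC, is_RInt_inv1.
Qed.

Lemma hint_bound (w : C) : (0 <= Re w)%R -> (Cmod (hint w) <= exp (- Re w) * (PI / 4))%R.
Proof.
  intros Hw.
  apply (is_CRInt_norm (fun t : R => RtoC (/ (1 + t ^ 2)) * Cexp (- w * RtoC (1 + t ^ 2)))
    (fun t => scal (exp (- Re w)) (/ (1 + t ^ 2)))%R 0 1); [lra| |apply hint_eq|].
  - intros t Ht. rewrite Cmod_mult, Cmod_R, Cmod_Cexp.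
    assert (0 < / (1 + t ^ 2))%R by (apply Rinv_0_lt_compat; nra).
    rewrite Rabs_pos_eq by lra.
    change (scal (exp (- Re w)) (/ (1 + t ^ 2)))%R with (exp (- Re w) * / (1 + t ^ 2))%R.
    rewrite (Rmult_comm (exp (- Re w))). apply Rmult_le_compat_l; [lra|]. apply exp_le.
    replace (Re (- w * RtoC (1 + t ^ 2))) with (- Re w - Re w * (t * t))%R by (simpl; unfold Re; ring).
    pose proof (Rmult_le_pos _ _ Hw (Rle_0_sqr t)) as H0. unfold Rsqr in H0. lra.
  - apply (is_RInt_scal (V := R_NormedModule)), is_RInt_inv1.
Qed.

(** The square of [v * gint (v * v)] is close to [PI / 4], and its sign is fixed by continuity
    from the positive reals. *)
Lemma Re_pos_of_connected (v : C) : (0 < Re v)%R -> (Rabs (Im v) < Re v)%R -> (0 < Re (v * gint (v * v)))%R.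
Proof.
  intros Hv1 Hv2. set (x := Re v) in *. set (y := Im v) in *.
  set (p := fun t : R => RtoC x + t * (Ci * y)).
  set (V := fun t : R => p t * gint (p t * p t)).
  assert (Hre : forall t, (0 <= t <= 1)%R -> (0 < Re (p t * p t))%R).
  { intros t Ht. unfold p. simpl. apply Rabs_def2 in Hv2.
    match goal with |- (0 < ?e)%R => replace e with ((x - t * y) * (x + t * y))%R by ring end.
    apply Rmult_lt_0_compat; nra. }
  assert (Hcp : forall t, Ccont p t).
  { intros t. apply (is_Cder_cont p t (0 + Ci * y)). unfold p.
    apply (is_Cder_plus (fun _ => RtoC x)); [apply is_Cder_const|apply is_Cder_lin]. }
  assert (HcV : forall t, Ccont V t).
  { intros t. apply Ccont_mult; [apply Hcp|].
    apply (Ccont_comp gint (fun t => p t * p t) t _ (qd_gint _)). apply Ccont_mult; apply Hcp. }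
  (* If [Re (V t)] vanished, [V t] squared would have real part at most 0; but that square is
     [PI / 4 - hint], and [hint] has modulus below [PI / 4] as long as the argument has positive
     real part. *)
  assert (Hnz : forall t, (0 <= t <= 1)%R -> Re (V t) <> 0%R).
  { intros t Ht E. specialize (Hre t Ht).
    pose proof (gint_sqr (p t * p t)) as HG.
    pose proof (hint_bound (p t * p t) ltac:(lra)) as HB.
    assert (HV : V t * V t = RtoC (PI / 4) - hint (p t * p t)).
    { rewrite <- HG. unfold V. ring. }
    apply (f_equal Re) in HV.
    replace (Re (V t * V t)) with (- (Im (V t) * Im (V t)))%R in HV.
    2:{ replace (Re (V t * V t)) with (Re (V t) * Re (V t) - Im (V t) * Im (V t))%R by reflexivity. rewrite E. ring. }
    replace (Re (RtoC (PI / 4) - hint (p t * p t))) with (PI / 4 - Re (hint (p t * p t)))%R in HV by reflexivity.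
    pose proof (Cmod_Re_le (hint (p t * p t))) as HR. pose proof (Rle_abs (Re (hint (p t * p t)))).
    assert (exp (- Re (p t * p t)) < 1)%R by (rewrite <- exp_0; apply exp_increasing; lra).
    pose proof PI_RGT_0. nra. }
  assert (H0 : (0 < Re (V 0%R))%R).
  { unfold V, p. rewrite Cmult_0_l, Cplus_0_r.
    assert (Hg : is_CRInt (fun t : R => RtoC (exp (- (x * x) * t ^ 2))) 0 1 (gint (x * x))).
    { apply (is_CRInt_ext (fun t : R => Cexp (- (RtoC x * RtoC x) * (t ^ 2)%R))); [lra| |apply gint_eq].
      intros t _. rewrite <- Cexp_R. f_equal. now rewrite RtoC_mult, RtoC_opp, RtoC_mult. }
    pose proof (is_RInt_fct_extend_fst _ _ _ _ Hg) as Hr. simpl in Hr.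
    replace (Re (RtoC x * gint (RtoC x * RtoC x))) with (x * fst (gint (RtoC x * RtoC x)))%R
      by (simpl; unfold Re; ring).
    apply Rmult_lt_0_compat; [exact Hv1|].
    apply Rlt_le_trans with (exp (- (x * x))); [apply exp_pos|].
    assert (Hc : is_RInt (fun _ : R => exp (- (x * x))) 0 1 ((1 - 0) * exp (- (x * x)))%R)
      by exact (is_RInt_const (V := R_NormedModule) 0 1 _).
    replace (exp (- (x * x))) with ((1 - 0) * exp (- (x * x)))%R by ring.
    apply (is_RInt_le (fun _ => exp (- (x * x))) (fun t => exp (- (x * x) * (t * (t * 1)))) 0 1); auto; [lra|].
    intros t Ht. apply exp_le.
    assert (0 <= (x * x) * (1 - t * t))%R by (apply Rmult_le_pos; [apply Rle_0_sqr|nra]). lra. }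
  replace (v * gint (v * v)) with (V 1%R).
  2:{ unfold V. replace (p 1%R) with v; [reflexivity|]. unfold p. apply C_ext; simpl; unfold x, y; ring. }
  apply Rnot_le_lt. intros Hle.
  assert (HcR : forall t : R, continuity_pt (fun t => Re (V t)) t).
  { intros t. apply continuity_pt_filterlim. apply (Clim_Re (locally t) V (V t)), HcV. }
  assert (Hneg : (Re (V 1%R) < 0)%R).
  { destruct Hle as [Hlt|Heq]; [exact Hlt|]. exfalso. apply (Hnz 1%R ltac:(lra) Heq). }
  destruct (IVT (fun t => - Re (V t))%R 0 1) as [t [Ht1 Ht2]]; try lra.
  - intros t. apply continuity_pt_opp, HcR.
  - apply (Hnz t Ht1). lra.
Qed.

(** Factor [V^2 - s^2 = - hint] with [s = sqrt PI / 2]. Since [Re V > 0], the factor [V + s] has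
    modulus at least [s] and can be divided out, leaving the decay of [hint]. *)
Lemma gint_limit_bound (v : C) : (0 < Re v)%R -> (Rabs (Im v) < Re v)%R ->
  (Cmod (v * gint (v * v) - RtoC (sqrt PI / 2)) <= sqrt PI / 2 * exp (- Re (v * v)))%R.
Proof.
  intros H1 H2. pose proof (Re_pos_of_connected v H1 H2) as Hp.
  set (V := v * gint (v * v)) in *. set (s := (sqrt PI / 2)%R).
  assert (Hs : (0 < s)%R).
  { unfold s. pose proof (sqrt_lt_R0 PI PI_RGT_0). lra. }
  assert (Hss : (s * s = PI / 4)%R).
  { unfold s. pose proof (sqrt_sqrt PI (Rlt_le _ _ PI_RGT_0)) as E. lra. }
  assert (HV : (V - s) * (V + s) = - hint (v * v)).
  { replace ((V - s) * (V + s)) with (v * v * (gint (v * v) * gint (v * v)) - RtoC (s * s)).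
    - rewrite Hss, <- (gint_sqr (v * v)). ring.
    - rewrite RtoC_mult. unfold V. ring. }
  apply (f_equal Cmod) in HV. rewrite Cmod_mult, Cmod_opp in HV.
  assert (Hr : (0 <= Re (v * v))%R).
  { replace (Re (v * v)) with ((Re v - Im v) * (Re v + Im v))%R by (simpl; unfold Re, Im; ring).
    apply Rabs_def2 in H2. apply Rmult_le_pos; lra. }
  pose proof (hint_bound (v * v) Hr) as HB. rewrite <- HV, <- Hss in HB.
  assert (Hge : (s <= Cmod (V + s))%R).
  { apply Rle_trans with (Re (V + s)).
    - replace (Re (V + s)) with (Re V + s)%R by reflexivity. lra.
    - apply Rle_trans with (2 := Cmod_Re_le _). apply Rle_abs. }
  pose proof (Cmod_ge_0 (V - s)).
  apply Rmult_le_reg_r with s; [exact Hs|].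
  apply Rle_trans with (Cmod (V - s) * Cmod (V + s))%R; [now apply Rmult_le_compat_l|]. lra.
Qed.

Ltac rring := match goal with |- @eq _ ?a ?b => change (@eq R a b) end; ring.
Ltac rfield := match goal with |- @eq _ ?a ?b => change (@eq R a b) end; field.
Ltac cring := match goal with |- @eq _ ?a ?b => change (@eq C a b) end; ring.

(** * Fourier series of the second Bernoulli polynomial *)

Lemma ex_series_inv_sqr : ex_series (fun k : nat => / (INR (S k)) ^ 2)%R.
Proof.
  apply (ex_series_le (V := R_CompleteNormedModule) _ (fun k => 2 * (/ INR (S k) - / INR (S (S k))))%R).
  - intros k. change (Rabs (/ INR (S k) ^ 2) <= 2 * (/ INR (S k) - / INR (S (S k))))%R.
    pose proof (pos_INR k). rewrite !S_INR. set (x := (INR k + 1)%R).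
    assert (Hx : (1 <= x)%R) by (unfold x; lra).
    assert (0 < / x ^ 2)%R by (apply Rinv_0_lt_compat; nra).
    rewrite Rabs_pos_eq by lra.
    replace (2 * (/ x - / (x + 1)))%R with (2 / (x * (x + 1)))%R by (field; lra).
    apply Rmult_le_reg_r with (x ^ 2 * (x + 1))%R; [nra|].
    replace (/ x ^ 2 * (x ^ 2 * (x + 1)))%R with (x + 1)%R by (field; lra).
    replace (2 / (x * (x + 1)) * (x ^ 2 * (x + 1)))%R with (2 * x)%R by (field; lra). lra.
  - apply (ex_series_scal_l 2%R (fun k => (/ INR (S k) - / INR (S (S k)))%R)).
    exists 1%R.
    assert (HS : forall n, sum_n (fun k => / INR (S k) - / INR (S (S k)))%R n = (1 - / INR (S (S n)))%R).
    { induction n.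
      - rewrite Rsum_O. simpl. rfield.
      - rewrite Rsum_Sn, IHn. rring. }
    change (is_lim_seq (sum_n (fun k => / INR (S k) - / INR (S (S k)))%R) 1%R).
    apply (is_lim_seq_ext (fun n => 1 - / INR (S (S n)))%R); [intros n; symmetry; apply HS|].
    replace (Finite 1) with (Finite (1 - 0)) by (f_equal; ring).
    apply (is_lim_seq_minus' (fun _ => 1%R) (fun n => / INR (S (S n)))%R); [apply is_lim_seq_const|].
    assert (H := is_lim_seq_INR).
    apply (proj1 (is_lim_seq_incr_1 _ _)) in H. apply (proj1 (is_lim_seq_incr_1 _ _)) in H.
    apply (is_lim_seq_inv (fun n => INR (S (S n))) p_infty H). discriminate.
Qed.

Lemma dirichlet_kernel (x : R) (n : nat) : sin x <> 0%R ->
  sum_n (fun k => cos (2 * INR (S k) * x)) n = (sin ((2 * INR n + 3) * x) / (2 * sin x) - / 2)%R.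
Proof.
  intros Hx. induction n.
  - rewrite Rsum_O. match goal with |- @eq _ ?a ?b => change (@eq R a b) end. simpl.
    replace ((2 * 0 + 3) * x)%R with (2 * x + x)%R by ring. replace (2 * 1 * x)%R with (2 * x)%R by ring.
    rewrite sin_plus, sin_2a, cos_2a_sin. pose proof (sin2_cos2 x) as E. unfold Rsqr in E.
    replace (2 * sin x * cos x * cos x)%R with (2 * sin x * (1 - sin x * sin x))%R by (rewrite <- E; ring).
    field. auto.
  - rewrite Rsum_Sn, IHn. match goal with |- @eq _ ?a ?b => change (@eq R a b) end. rewrite !S_INR. set (a := INR n).
    replace ((2 * (a + 1) + 3) * x)%R with (2 * (a + 1 + 1) * x + x)%R by ring.
    replace ((2 * a + 3) * x)%R with (2 * (a + 1 + 1) * x - x)%R by ring.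
    rewrite sin_plus, sin_minus. field. auto.
Qed.

Lemma sin_PI_pos (t : R) : (0 < t <= 1 / 2)%R -> (0 < sin (PI * t))%R.
Proof. intros Ht. pose proof PI_RGT_0. apply sin_gt_0; nra. Qed.

Lemma sin_PI_ge (y t : R) : (0 < y)%R -> (y <= t <= 1 / 2)%R -> (sin (PI * y) <= sin (PI * t))%R.
Proof. intros Hy Ht. pose proof PI_RGT_0. apply sin_incr_1; nra. Qed.

(** The weight [t - y] vanishes at [y] and the sine of the integrated cosine vanishes at [1/2], so
    integration by parts leaves only the two cosines over the squared frequency, i.e. terms of the
    Bernoulli series. *)
Lemma is_RInt_weight_cos (y : R) (k : nat) :
  is_RInt (fun t => (t - y) * cos (2 * INR (S k) * (PI * t)))%R y (1 / 2)
    ((cos (2 * INR (S k) * (PI * (1 / 2))) - cos (2 * INR (S k) * (PI * y))) / (4 * PI ^ 2 * INR (S k) ^ 2))%R.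
Proof.
  set (m := (2 * INR (S k) * PI)%R).
  assert (Hm : (m <> 0)%R).
  { unfold m. pose proof PI_RGT_0. pose proof (lt_0_INR (S k) ltac:(lia)). nra. }
  assert (HI : is_RInt (fun t => (t - y) * cos (m * t))%R y (1 / 2)
    (minus (((1 / 2) - y) * sin (m * (1 / 2)) / m + cos (m * (1 / 2)) / m ^ 2)
           ((y - y) * sin (m * y) / m + cos (m * y) / m ^ 2))%R).
  { apply (is_RInt_derive (V := R_CompleteNormedModule) (fun t => (t - y) * sin (m * t) / m + cos (m * t) / m ^ 2)%R).
    - intros t _. auto_derive; [trivial|]. field. exact Hm.
    - intros t _. apply (ex_derive_continuous (fun t => (t - y) * cos (m * t))%R). auto_derive. trivial. }
  change (minus (((1 / 2) - y) * sin (m * (1 / 2)) / m + cos (m * (1 / 2)) / m ^ 2)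
           ((y - y) * sin (m * y) / m + cos (m * y) / m ^ 2))%R with
    ((((1 / 2) - y) * sin (m * (1 / 2)) / m + cos (m * (1 / 2)) / m ^ 2) -
           ((y - y) * sin (m * y) / m + cos (m * y) / m ^ 2))%R in HI.
  replace (sin (m * (1 / 2))) with 0%R in HI.
  2:{ replace (m * (1 / 2))%R with (INR (S k) * PI)%R by (unfold m; field).
      rewrite INR_IZR_INZ. symmetry. apply sin_eq_0_1. now exists (Z.of_nat (S k)). }
  match type of HI with is_RInt _ _ _ ?v => match goal with |- is_RInt _ _ _ ?w => replace w with v end end.
  - apply is_RInt_ext with (2 := HI). intros t _. f_equal. f_equal. unfold m. ring.
  - replace (2 * INR (S k) * (PI * (1 / 2)))%R with (m * (1 / 2))%R by (unfold m; ring).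
    replace (2 * INR (S k) * (PI * y))%R with (m * y)%R by (unfold m; ring).
    replace (4 * PI ^ 2 * INR (S k) ^ 2)%R with (m ^ 2)%R by (unfold m; ring).
    field. exact Hm.
Qed.

Lemma is_RInt_sum_n (f : nat -> R -> R) (l : nat -> R) (a b : R) n :
  (forall k, is_RInt (f k) a b (l k)) -> is_RInt (fun t => sum_n (fun k => f k t) n) a b (sum_n l n).
Proof.
  intros H. induction n.
  - rewrite Rsum_O. apply (is_RInt_ext (f 0%nat)); [|apply H]. intros t _. now rewrite Rsum_O.
  - rewrite Rsum_Sn. apply (is_RInt_ext (fun t => plus (sum_n (fun k => f k t) n) (f (S n) t))).
    + intros t _. now rewrite Rsum_Sn.
    + apply (is_RInt_plus (V := R_NormedModule)); auto.
Qed.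

Lemma Rsum_n_scal (c : R) (f : nat -> R) n : sum_n (fun k => c * f k)%R n = (c * sum_n f n)%R.
Proof. induction n; [now rewrite !Rsum_O|rewrite !Rsum_Sn, IHn; rring]. Qed.

(** A Riemann-Lebesgue estimate with rate [1 / M], by one integration by parts. On [[y, 1/2]] the
    sine stays above [sin (PI y)], so the weight is smooth; it vanishes at [y], which leaves one
    boundary term. *)
Lemma weight_sin_bound (y M l : R) : (0 < y <= 1 / 2)%R -> (0 < M)%R ->
  is_RInt (fun t => (t - y) / sin (PI * t) * sin (M * t))%R y (1 / 2) l ->
  (Rabs l <= (2 / sin (PI * y) + PI / sin (PI * y) ^ 2) / M)%R.
Proof.
  intros Hy HM HI. set (s := sin (PI * y)).
  assert (Hs : (0 < s)%R) by (apply sin_PI_pos; lra).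
  pose proof PI_RGT_0 as Hpi.
  set (w := fun t => ((t - y) / sin (PI * t))%R).
  set (w' := fun t => (/ sin (PI * t) - (t - y) * (PI * cos (PI * t)) / (sin (PI * t) ^ 2))%R).
  assert (Hst : forall t, (y <= t <= 1 / 2)%R -> (s <= sin (PI * t))%R).
  { intros t Ht. apply sin_PI_ge; lra. }
  assert (Hcont : forall t, (y <= t <= 1 / 2)%R -> continuous (fun t => w' t * cos (M * t) / M)%R t).
  { intros t Ht. specialize (Hst t Ht).
    apply (ex_derive_continuous (fun t => w' t * cos (M * t) / M)%R). unfold w'. auto_derive.
    repeat split; nra. }
  assert (Hcont2 : forall t, (y <= t <= 1 / 2)%R -> continuous (fun t => w t * sin (M * t))%R t).
  { intros t Ht. specialize (Hst t Ht).
    apply (ex_derive_continuous (fun t => w t * sin (M * t))%R). unfold w. auto_derive. lra. }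
  destruct (ex_RInt_continuous (V := R_CompleteNormedModule) (fun t => w' t * cos (M * t) / M)%R y (1 / 2)) as [J HJ].
  { rewrite Rmin_left, Rmax_right by lra. exact Hcont. }
  assert (HD : is_RInt (fun t => w' t * cos (M * t) / M - w t * sin (M * t))%R y (1 / 2)
     (w (1 / 2) * cos (M * (1 / 2)) / M - w y * cos (M * y) / M)%R).
  { apply (is_RInt_derive (V := R_CompleteNormedModule) (fun t => w t * cos (M * t) / M)%R);
      rewrite Rmin_left, Rmax_right by lra; intros t Ht.
    - specialize (Hst t Ht). unfold w, w'. auto_derive; [lra|]. field. lra.
    - apply (continuous_minus (V := R_NormedModule)); auto. }
  pose proof (is_RInt_minus (V := R_NormedModule) _ _ _ _ _ _ HJ HD) as HE.
  assert (El : l = (J - (w (1 / 2) * cos (M * (1 / 2)) / M - w y * cos (M * y) / M))%R).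
  { rewrite <- (is_RInt_unique _ _ _ _ HI). apply is_RInt_unique.
    apply is_RInt_ext with (2 := HE). intros t _.
    change (w' t * cos (M * t) / M - (w' t * cos (M * t) / M - w t * sin (M * t)) = w t * sin (M * t))%R. ring. }
  replace (w y) with 0%R in El by (unfold w; field; unfold s in Hs; lra).
  assert (HJb : (Rabs J <= (1 / 2 - y) * ((/ s + PI / s ^ 2) / M))%R).
  { assert (Hc : is_RInt (fun _ : R => (/ s + PI / s ^ 2) / M)%R y (1 / 2) ((1 / 2 - y) * ((/ s + PI / s ^ 2) / M))%R)
      by exact (is_RInt_const (V := R_NormedModule) y (1 / 2) _).
    apply (norm_RInt_le (V := R_NormedModule) _ _ y (1 / 2) J _ ltac:(lra)) with (2 := HJ) (3 := Hc).
    intros t Ht. change (Rabs (w' t * cos (M * t) / M) <= (/ s + PI / s ^ 2) / M)%R.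
    specialize (Hst t Ht). set (st := sin (PI * t)) in *.
    unfold Rdiv at 1. rewrite Rabs_mult, (Rabs_pos_eq (/ M)) by (left; now apply Rinv_0_lt_compat).
    apply Rmult_le_compat_r; [left; now apply Rinv_0_lt_compat|].
    rewrite Rabs_mult. rewrite <- (Rmult_1_r (/ s + PI / s ^ 2)).
    apply Rmult_le_compat; try apply Rabs_pos.
    - unfold w'. apply Rle_trans with (1 := Rabs_triang _ _). rewrite Rabs_Ropp.
      assert (H1 : (0 < / st <= / s)%R).
      { split; [apply Rinv_0_lt_compat; lra|apply Rinv_le_contravar; lra]. }
      fold st. apply Rplus_le_compat.
      + rewrite Rabs_pos_eq; lra.
      + unfold Rdiv. rewrite Rabs_mult, (Rabs_pos_eq (/ st ^ 2)).
        2:{ left. apply Rinv_0_lt_compat. nra. }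
        apply Rmult_le_compat; [apply Rabs_pos|left; apply Rinv_0_lt_compat; nra| |].
        * rewrite !Rabs_mult, (Rabs_pos_eq PI) by lra. rewrite (Rabs_pos_eq (t - y)) by lra.
          pose proof (COS_bound (PI * t)). assert (Rabs (cos (PI * t)) <= 1)%R by (apply Rabs_le; lra).
          pose proof (Rabs_pos (cos (PI * t))). assert (PI * Rabs (cos (PI * t)) <= PI)%R by nra. nra.
        * apply Rinv_le_contravar; [nra|]. apply pow_incr. lra.
    - pose proof (COS_bound (M * t)). apply Rabs_le; lra. }
  assert (Hw : (Rabs (w (1 / 2) * cos (M * (1 / 2)) / M) <= / s / M)%R).
  { unfold Rdiv at 1. rewrite Rabs_mult, (Rabs_pos_eq (/ M)) by (left; now apply Rinv_0_lt_compat).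
    apply Rmult_le_compat_r; [left; now apply Rinv_0_lt_compat|]. rewrite Rabs_mult.
    rewrite <- (Rmult_1_r (/ s)). apply Rmult_le_compat; try apply Rabs_pos.
    - unfold w. specialize (Hst (1 / 2)%R ltac:(lra)).
      unfold Rdiv at 1. rewrite Rabs_mult, (Rabs_pos_eq (/ _)) by (left; apply Rinv_0_lt_compat; lra).
      rewrite <- (Rmult_1_l (/ s)). apply Rmult_le_compat; [apply Rabs_pos|left; apply Rinv_0_lt_compat; lra| |].
      + apply Rabs_le. lra.
      + apply Rinv_le_contravar; lra.
    - pose proof (COS_bound (M * (1 / 2))). apply Rabs_le; lra. }
  rewrite El. apply Rle_trans with (1 := Rabs_triang _ _). rewrite Rabs_Ropp.
  replace (w (1 / 2) * cos (M * (1 / 2)) / M - 0 * cos (M * y) / M)%R with (w (1 / 2) * cos (M * (1 / 2)) / M)%R by (field; lra).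
  assert (0 <= (/ s + PI / s ^ 2) / M)%R.
  { apply Rdiv_le_0_compat; [|lra]. pose proof (Rinv_0_lt_compat s Hs).
    assert (0 <= PI / s ^ 2)%R by (apply Rdiv_le_0_compat; nra). lra. }
  replace ((2 / s + PI / s ^ 2) / M)%R with ((/ s + PI / s ^ 2) / M + / s / M)%R by (field; lra). nra.
Qed.

Definition bcos (y : R) (k : nat) : R := (cos (2 * INR (S k) * (PI * y)) / INR (S k) ^ 2)%R.

Lemma bcos_bound (y : R) (k : nat) : (Cmod (RtoC (bcos y k)) <= / (INR (S k)) ^ 2)%R.
Proof.
  rewrite Cmod_R. unfold bcos, Rdiv. rewrite Rabs_mult.
  pose proof (lt_0_INR (S k) ltac:(lia)).
  assert (0 < / INR (S k) ^ 2)%R by (apply Rinv_0_lt_compat; nra).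
  rewrite (Rabs_pos_eq (/ _)) by lra. rewrite <- (Rmult_1_l (/ INR (S k) ^ 2)) at 2.
  apply Rmult_le_compat_r; [lra|]. apply Rabs_le. apply COS_bound.
Qed.

Definition bser (y : R) : C := CSeries (fun k => RtoC (bcos y k)).

Lemma bser_correct (y : R) : is_Cseries (fun k => RtoC (bcos y k)) (bser y).
Proof. apply (is_CSeries_le _ _ (bcos_bound y) ex_series_inv_sqr). Qed.

(** Sum [is_RInt_weight_cos] over [k <= K]. The Dirichlet kernel turns the sum of cosines into
    [- 1/2] plus an oscillating quotient: the constant integrates to the quadratic polynomial, the
    quotient tends to 0 by [weight_sin_bound]. The base point [1/2] keeps away from the zero of the
    sine. *)
Lemma bser_half (y : R) : (0 < y <= 1 / 2)%R -> bser y = bser (1 / 2) + RtoC (PI ^ 2 * (y - 1 / 2) ^ 2).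
Proof.
  intros Hy. pose proof PI_RGT_0 as Hpi.
  set (s := sin (PI * y)). assert (Hs : (0 < s)%R) by (apply sin_PI_pos; lra).
  set (B := (2 / s + PI / s ^ 2)%R).
  assert (HB : (0 <= B)%R).
  { unfold B. pose proof (Rdiv_lt_0_compat 2 s ltac:(lra) Hs).
    assert (0 <= PI / s ^ 2)%R by (apply Rdiv_le_0_compat; nra). lra. }
  assert (HK : forall K, (Rabs (sum_n (fun k => bcos (1 / 2) k - bcos y k)%R K + PI ^ 2 * (y - 1 / 2) ^ 2)
      <= 2 * PI ^ 2 * (B / ((2 * INR K + 3) * PI)))%R).
  { intros K. set (M := ((2 * INR K + 3) * PI)%R).
    assert (HM : (0 < M)%R) by (unfold M; pose proof (pos_INR K); nra).
    pose proof (is_RInt_sum_n _ _ _ _ K (is_RInt_weight_cos y)) as H1.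
    assert (H2 : is_RInt (fun t => (t - y) / 2)%R y (1 / 2) ((y - 1 / 2) ^ 2 / 4)%R).
    { replace ((y - 1 / 2) ^ 2 / 4)%R with (minus ((1 / 2 - y) ^ 2 / 4) ((y - y) ^ 2 / 4))%R.
      - apply (is_RInt_derive (V := R_CompleteNormedModule) (fun t => (t - y) ^ 2 / 4)%R).
        + intros t _. auto_derive; [trivial|field].
        + intros t _. apply (ex_derive_continuous (fun t => (t - y) / 2)%R). auto_derive. trivial.
      - change ((1 / 2 - y) ^ 2 / 4 - (y - y) ^ 2 / 4 = (y - 1 / 2) ^ 2 / 4)%R. field. }
    pose proof (is_RInt_plus (V := R_NormedModule) _ _ _ _ _ _ H1 H2) as H3.
    pose proof (is_RInt_scal (V := R_NormedModule) _ _ _ 2%R _ H3) as H4.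
    assert (H5 := fun h => weight_sin_bound y M _ Hy HM (is_RInt_ext _ _ _ _ _ h H4)).
    match type of H5 with _ -> (Rabs ?v <= _)%R => set (v0 := v) in H5 end.
    assert (Hv0 : v0 = (2 * (sum_n (fun k => bcos (1 / 2) k - bcos y k)%R K / (4 * PI ^ 2) + (y - 1 / 2) ^ 2 / 4))%R).
    { unfold v0. match goal with |- scal _ (plus ?a ?b) = _ => change (2 * (a + b) = 2 * (sum_n (fun k => bcos (1 / 2) k - bcos y k) K / (4 * PI ^ 2) + (y - 1 / 2) ^ 2 / 4))%R end.
      f_equal. f_equal. transitivity (/ (4 * PI ^ 2) * sum_n (fun k => bcos (1 / 2) k - bcos y k) K)%R;
        [rewrite <- Rsum_n_scal|unfold Rdiv; apply Rmult_comm].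
      apply (sum_n_ext (G := R_AbelianMonoid)). intros k. unfold bcos.
      pose proof (lt_0_INR (S k) ltac:(lia)). rfield. split; nra. }
    assert (HX : (sum_n (fun k => bcos (1 / 2) k - bcos y k) K + PI ^ 2 * (y - 1 / 2) ^ 2 = 2 * PI ^ 2 * v0)%R).
    { rewrite Hv0. field. lra. }
    rewrite HX, Rabs_mult, (Rabs_pos_eq (2 * PI ^ 2)) by nra.
    apply Rmult_le_compat_l; [nra|]. apply H5.
    rewrite Rmin_left, Rmax_right by lra. intros t Ht.
    match goal with |- scal _ (plus ?a ?b) = _ => change (2 * (a + b) = (t - y) / sin (PI * t) * sin (M * t))%R end.
    assert (Hst : (0 < sin (PI * t))%R) by (apply sin_PI_pos; lra).
    rewrite Rsum_n_scal, dirichlet_kernel by lra.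
    replace ((2 * INR K + 3) * (PI * t))%R with (M * t)%R by (unfold M; ring). field. lra. }
  assert (HL : is_lim_seq (fun K => 2 * PI ^ 2 * (B / ((2 * INR K + 3) * PI)))%R 0%R).
  { apply (is_lim_seq_ext (fun K => (2 * PI * B) * / (2 * INR K + 3))%R).
    - intros K. pose proof (pos_INR K). field. lra.
    - replace (Finite 0) with (Rbar_mult (2 * PI * B)%R (Finite 0)) by (simpl; f_equal; ring).
      apply is_lim_seq_scal_l.
      apply (is_lim_seq_inv _ p_infty); [|discriminate].
      apply (is_lim_seq_le_p_loc INR); [|apply is_lim_seq_INR].
      exists 0%nat. intros n _. pose proof (pos_INR n). lra. }
  set (D := fun k => RtoC (bcos (1 / 2) k) + (-1)%R * RtoC (bcos y k)).
  assert (HD : is_Cseries D (bser (1 / 2) + (-1)%R * bser y)).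
  { apply is_Cseries_plus; [apply bser_correct|apply is_Cseries_scal, bser_correct]. }
  assert (HD2 : is_Cseries D (RtoC (- (PI ^ 2 * (y - 1 / 2) ^ 2)))).
  { apply (filterlim_ext (fun K => (sum_n D K - RtoC (- (PI ^ 2 * (y - 1 / 2) ^ 2))) + RtoC (- (PI ^ 2 * (y - 1 / 2) ^ 2)))).
    { intros K. match goal with |- ?a - ?b + ?b = _ => transitivity (a : C); [ring|reflexivity] end. }
    enough (HE : Clim (fun K => sum_n D K - RtoC (- (PI ^ 2 * (y - 1 / 2) ^ 2))) eventually (RtoC 0)).
    { pose proof (Clim_plus eventually _ _ _ _ HE (Clim_const eventually (RtoC (- (PI ^ 2 * (y - 1 / 2) ^ 2))))) as HE2.
      rewrite Cplus_0_l in HE2. exact HE2. }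
    apply (Clim_squeeze0 eventually _ (fun K => 2 * PI ^ 2 * (B / ((2 * INR K + 3) * PI)))%R); [|exact HL].
    exists 0%nat. intros K _.
    assert (E : sum_n D K = RtoC (sum_n (fun k => bcos (1 / 2) k - bcos y k)%R K)).
    { induction K.
      - rewrite Csum_O, Rsum_O. unfold D. rewrite RtoC_minus. cring.
      - rewrite Csum_Sn, Rsum_Sn, IHK. unfold D. rewrite RtoC_plus, RtoC_minus. cring. }
    rewrite E, <- RtoC_minus, Cmod_R.
    match goal with |- (Rabs ?a <= _)%R => match type of (HK K) with (Rabs ?b <= _)%R => replace a with b by ring end end. apply HK. }
  pose proof (is_Cseries_unique _ _ _ HD HD2) as E. rewrite RtoC_opp in E.
  replace (RtoC (PI ^ 2 * (y - 1 / 2) ^ 2)) with (- (- RtoC (PI ^ 2 * (y - 1 / 2) ^ 2))) by ring.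
  rewrite <- E. ring.
Qed.

Lemma sin_INR_PI (k : nat) : sin (INR k * PI) = 0%R.
Proof. rewrite INR_IZR_INZ. apply sin_eq_0_1. now exists (Z.of_nat k). Qed.

(** Each cosine has integral 0 over [[0, 1/2]], hence so has the series; integrating the quadratic
    formula of [bser_half] over the same interval determines its constant. *)
Lemma bser_at_half : bser (1 / 2) = RtoC (- PI ^ 2 / 12).
Proof.
  pose proof PI_RGT_0 as Hpi.
  destruct (is_CRInt_CSeries (fun k y => RtoC (bcos y k)) bser (fun _ => RtoC 0) (fun k => / INR (S k) ^ 2)%R 0 (1 / 2))
    as [H1 _].
  - lra.
  - exact ex_series_inv_sqr.
  - intros n x _. apply bcos_bound.
  - intros k. pose proof (lt_0_INR (S k) ltac:(lia)) as Hk.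
    apply (is_CRInt_RtoC (fun y => bcos y k)).
    set (m := (2 * INR (S k) * PI)%R). assert (Hm : (m <> 0)%R) by (unfold m; nra).
    set (q := (/ m / INR (S k) ^ 2)%R).
    assert (H : is_RInt (fun t => bcos t k) 0 (1 / 2) (sin (m * (1 / 2)) * q - sin (m * 0) * q)%R).
    { apply (is_RInt_derive (V := R_CompleteNormedModule) (fun t => sin (m * t) * q)%R).
      - intros t _. replace (bcos t k) with (m * cos (m * t) * q)%R; [auto_derive; [trivial|ring]|].
        unfold bcos, q. replace (2 * INR (S k) * (PI * t))%R with (m * t)%R by (unfold m; ring). field. split; lra.
      - intros t _. apply (ex_derive_continuous (fun t => bcos t k)). unfold bcos. auto_derive. trivial. }
    replace (m * (1 / 2))%R with (INR (S k) * PI)%R in H by (unfold m; field).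
    rewrite sin_INR_PI, Rmult_0_r, sin_0, Rmult_0_l, Rminus_0_r in H. exact H.
  - intros x _. reflexivity.
  - assert (H0 : CSeries (fun _ => RtoC 0) = RtoC 0) by (apply CSeries_unique, is_Cseries_0).
    rewrite H0 in H1.
    assert (Hp : is_RInt (fun y => PI ^ 2 * (y - 1 / 2) ^ 2)%R 0 (1 / 2) (PI ^ 2 / 24)%R).
    { replace (PI ^ 2 / 24)%R with (minus (PI ^ 2 * (1 / 2 - 1 / 2) ^ 3 / 3) (PI ^ 2 * (0 - 1 / 2) ^ 3 / 3))%R.
      - apply (is_RInt_derive (V := R_CompleteNormedModule) (fun y => PI ^ 2 * (y - 1 / 2) ^ 3 / 3)%R).
        + intros t _. auto_derive; [trivial|field].
        + intros t _. apply (ex_derive_continuous (fun y => PI ^ 2 * (y - 1 / 2) ^ 2)%R). auto_derive. trivial.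
      - change (PI ^ 2 * (1 / 2 - 1 / 2) ^ 3 / 3 - PI ^ 2 * (0 - 1 / 2) ^ 3 / 3 = PI ^ 2 / 24)%R. field. }
    assert (Hc : is_CRInt (fun _ : R => bser (1 / 2) * RtoC 1) 0 (1 / 2) (bser (1 / 2) * RtoC ((1 / 2 - 0) * 1))).
    { apply is_CRInt_scal, (is_CRInt_RtoC (fun _ => 1%R)). exact (is_RInt_const (V := R_NormedModule) 0 (1 / 2) 1%R). }
    pose proof (is_CRInt_plus _ _ _ _ _ _ Hc (is_CRInt_RtoC _ _ _ _ Hp)) as H2.
    assert (H3 : is_CRInt bser 0 (1 / 2) (bser (1 / 2) * RtoC ((1 / 2 - 0) * 1) + RtoC (PI ^ 2 / 24))).
    { apply is_CRInt_ext with (3 := H2); [lra|]. intros y Hy. rewrite (bser_half y) by lra. now rewrite Cmult_1_r. }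
    pose proof (is_CRInt_unique _ _ _ _ _ H1 H3) as E.
    replace (bser (1 / 2)) with (2%R * (bser (1 / 2) * RtoC ((1 / 2 - 0) * 1) + RtoC (PI ^ 2 / 24)) - 2%R * RtoC (PI ^ 2 / 24)).
    + rewrite <- E, <- !RtoC_mult, <- RtoC_minus. f_equal. field.
    + replace ((1 / 2 - 0) * 1)%R with (/ 2)%R by field. rewrite RtoC_inv by lra. field.
Qed.

(** The quadratic formula is established for [y > 0] only; the endpoint follows by dominated
    convergence along [1 / (n + 2)], which stays in [(0, 1/2]]. *)
Lemma bser_at_0 : bser 0 = RtoC (PI ^ 2 / 6).
Proof.
  set (y := fun n : nat => (/ (INR n + 2))%R).
  assert (Hy : forall n, (0 < y n <= 1 / 2)%R).
  { intros n. unfold y. pose proof (pos_INR n). split; [apply Rinv_0_lt_compat; lra|].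
    replace (1 / 2)%R with (/ 2)%R by field. apply Rinv_le_contravar; lra. }
  assert (Hy0 : is_lim_seq y 0%R).
  { apply (is_lim_seq_inv (fun n => INR n + 2)%R p_infty); [|discriminate].
    apply (is_lim_seq_le_p_loc INR); [|apply is_lim_seq_INR]. exists 0%nat. intros n _. lra. }
  assert (Hcont : forall f : R -> R, continuous f 0%R -> Clim (fun n => RtoC (f (y n))) eventually (RtoC (f 0%R))).
  { intros f Hf. apply (filterlim_comp _ _ _ y (fun t => RtoC (f t)) eventually (locally 0%R)); [exact Hy0|].
    apply (Ccont_RtoC f 0%R Hf). }
  apply (Clim_unique eventually (fun n => bser (y n))).
  - apply (CSeries_tannery eventually (fun n k => RtoC (bcos (y n) k)) (fun k => RtoC (bcos 0 k)) (fun k => / INR (S k) ^ 2)%R).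
    + exact ex_series_inv_sqr.
    + exists 0%nat. intros n _ k. apply bcos_bound.
    + intros k. apply (Hcont (fun t => bcos t k)).
      apply (ex_derive_continuous (fun t => bcos t k)). unfold bcos. auto_derive. trivial.
  - apply (filterlim_ext (fun n => RtoC (- PI ^ 2 / 12 + PI ^ 2 * (y n - 1 / 2) ^ 2))).
    { intros n. rewrite (bser_half (y n)), bser_at_half by apply Hy. now rewrite <- RtoC_plus. }
    replace (PI ^ 2 / 6)%R with (- PI ^ 2 / 12 + PI ^ 2 * (0 - 1 / 2) ^ 2)%R by field.
    apply (Hcont (fun t => - PI ^ 2 / 12 + PI ^ 2 * (t - 1 / 2) ^ 2)%R).
    apply (ex_derive_continuous (fun t => - PI ^ 2 / 12 + PI ^ 2 * (t - 1 / 2) ^ 2)%R). auto_derive. trivial.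
Qed.

Lemma bcos_opp (y : R) (k : nat) : bcos (- y) k = bcos y k.
Proof. unfold bcos. rewrite <- (cos_neg (2 * INR (S k) * (PI * y))). f_equal. f_equal. ring. Qed.

Lemma bcos_shift (y : R) (k : nat) : bcos (y + 1) k = bcos y k.
Proof.
  unfold bcos. f_equal.
  replace (2 * INR (S k) * (PI * (y + 1)))%R with (2 * INR (S k) * (PI * y) + 2 * INR (S k) * PI)%R by ring.
  apply cos_period.
Qed.

(** The Fourier series of the second Bernoulli polynomial, on [-1, 0]. *)
Lemma bser_eq (y : R) : (-1 <= y <= 0)%R -> bser y = RtoC (PI ^ 2 * (y ^ 2 + y + 1 / 6)).
Proof.
  intros Hy.
  assert (H : forall z, (0 <= z <= 1 / 2)%R -> bser z = RtoC (PI ^ 2 * (z ^ 2 - z + 1 / 6))).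
  { intros z Hz. destruct (Req_dec z 0) as [->|Hn].
    - rewrite bser_at_0. f_equal. field.
    - rewrite bser_half, bser_at_half, <- RtoC_plus by lra. f_equal. field. }
  destruct (Rle_dec (- (1 / 2)) y) as [H1|H1].
  - replace (bser y) with (bser (- y)).
    + rewrite H by lra. f_equal. ring.
    + apply CSeries_ext. intros k. now rewrite bcos_opp.
  - replace (bser y) with (bser (y + 1)).
    + rewrite H by lra. f_equal. field.
    + apply CSeries_ext. intros k. now rewrite bcos_shift.
Qed.

Lemma IZR_C_neq_0 (n : Z) : n <> 0%Z -> RtoC (IZR n) <> 0.
Proof. intros H E. apply RtoC_inj in E. now apply eq_IZR in E. Qed.

(** * Sums over residues *)

Lemma sum_mod_ext (N : Z) (F G : Z -> C) : (0 < N)%Z ->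
  (forall k, (0 <= k < N)%Z -> F k = G k) -> sum_mod N F = sum_mod N G.
Proof.
  intros HN H. unfold sum_mod. apply (sum_n_ext_loc (G := C_AbelianMonoid)).
  intros n Hn. apply H. lia.
Qed.

Lemma sum_mod_scal (N : Z) (c : C) (F : Z -> C) : sum_mod N (fun k => c * F k) = c * sum_mod N F.
Proof.
  unfold sum_mod. induction (Nat.pred (Z.to_nat N)) as [|n IH].
  - now rewrite !Csum_O.
  - rewrite !Csum_Sn, IH. cring.
Qed.

Lemma sum_n_swap (F : nat -> nat -> C) n m :
  sum_n (fun i => sum_n (F i) m) n = sum_n (fun j => sum_n (fun i => F i j) n) m.
Proof.
  induction n.
  - rewrite Csum_O. apply (sum_n_ext (G := C_AbelianMonoid)). intros j. now rewrite Csum_O.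
  - rewrite Csum_Sn, IHn.
    rewrite <- (sum_n_plus (G := C_AbelianMonoid)). apply (sum_n_ext (G := C_AbelianMonoid)).
    intros j. rewrite Csum_Sn. reflexivity.
Qed.

Lemma sum_mod_swap (N M : Z) (F : Z -> Z -> C) :
  sum_mod N (fun i => sum_mod M (F i)) = sum_mod M (fun j => sum_mod N (fun i => F i j)).
Proof. apply (sum_n_swap (fun i j => F (Z.of_nat i) (Z.of_nat j))). Qed.

Lemma sum_n_shift1 (F : nat -> C) n : sum_n (fun k => F (S k)) n = sum_n F n + F (S n) - F 0%nat.
Proof.
  induction n.
  - rewrite !Csum_O. cring.
  - rewrite (Csum_Sn (fun k => F (S k))), IHn, (Csum_Sn F n). cring.
Qed.

Lemma sum_mod_shift1 (N : Z) (F : Z -> C) (a : Z) : (0 < N)%Z ->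
  sum_mod N (fun k => F (a + 1 + k)%Z) = sum_mod N (fun k => F (a + k)%Z) + F (a + N)%Z - F a.
Proof.
  intros HN. unfold sum_mod.
  pose proof (sum_n_shift1 (fun k => F (a + Z.of_nat k)%Z) (Nat.pred (Z.to_nat N))) as H.
  cbv beta in H. replace (a + Z.of_nat (S (Nat.pred (Z.to_nat N))))%Z with (a + N)%Z in H by lia.
  replace (a + Z.of_nat 0)%Z with a in H by lia.
  etransitivity; [|exact H]. apply (sum_n_ext (G := C_AbelianMonoid)). intros k. f_equal. lia.
Qed.

Lemma sum_mod_shift (N : Z) (F : Z -> C) (a : Z) : (0 < N)%Z -> periodic N F ->
  sum_mod N (fun k => F (a + k)%Z) = sum_mod N F.
Proof.
  intros HN HF.
  assert (H1 : forall b, sum_mod N (fun k => F (b + 1 + k)%Z) = sum_mod N (fun k => F (b + k)%Z)).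
  { intros b. rewrite sum_mod_shift1, HF by auto. ring. }
  revert a. apply Z.bi_induction.
  - intros x y ->. reflexivity.
  - apply sum_mod_ext; auto.
  - intros n. split; intros H; [rewrite <- H|]; rewrite <- Z.add_1_r in *; rewrite ?H1 in *; auto.
Qed.

Lemma sum_mod_first (N : Z) (F : Z -> C) : (0 < N)%Z ->
  (forall k, (0 < k < N)%Z -> F k = 0) -> sum_mod N F = F 0%Z.
Proof.
  intros HN H. unfold sum_mod.
  assert (Hn : forall n, (n < Z.to_nat N)%nat -> sum_n (fun k => F (Z.of_nat k)) n = F 0%Z).
  { induction n; intros Hn; [now rewrite Csum_O|].
    rewrite Csum_Sn, IHn by lia. rewrite (H (Z.of_nat (S n))) by lia. apply Cplus_0_r. }
  apply Hn. lia.
Qed.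

(** * Roots of unity and the discrete Fourier transform *)

Definition ee (N n : Z) : C := Cexp (2 * PI * Ci * IZR n / IZR N).

Lemma ee_plus (N a b : Z) : (0 < N)%Z -> ee N (a + b) = ee N a * ee N b.
Proof.
  intros HN. unfold ee. rewrite <- Cexp_plus. f_equal. rewrite plus_IZR, RtoC_plus. field.
  apply IZR_C_neq_0; lia.
Qed.

Lemma ee_mult_N (N a : Z) : (0 < N)%Z -> ee N (N * a) = 1.
Proof.
  intros HN. unfold ee. rewrite <- (Cexp_2PI_Z a). f_equal. rewrite mult_IZR, RtoC_mult. field.
  apply IZR_C_neq_0; lia.
Qed.

Lemma ee_0 (N : Z) : (0 < N)%Z -> ee N 0 = 1.
Proof. intros HN. rewrite <- (ee_mult_N N 0 HN). f_equal. lia. Qed.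

Lemma ee_neq_1 (N m : Z) : (0 < m < N)%Z -> ee N m <> 1.
Proof.
  intros Hm E. pose proof PI_RGT_0 as Hpi.
  assert (HmR : (0 < IZR m)%R) by (apply IZR_lt; lia).
  assert (HN : (IZR m < IZR N)%R) by (apply IZR_lt; lia).
  assert (Ex : 2 * PI * Ci * IZR m / IZR N = (0%R, (2 * (PI * (IZR m / IZR N)))%R)).
  { unfold Cdiv. rewrite <- RtoC_inv by lra. apply C_ext; simpl; field; lra. }
  unfold ee in E. rewrite Ex in E. unfold Cexp in E. apply (f_equal Re) in E. simpl in E.
  rewrite exp_0, cos_2a_sin in E.
  assert (Hs : (0 < sin (PI * (IZR m / IZR N)))%R).
  { assert (0 < IZR m / IZR N < 1)%R.
    { split; [apply Rdiv_lt_0_compat; lra|]. apply Rmult_lt_reg_r with (IZR N); [lra|].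
      unfold Rdiv. rewrite Rmult_assoc, Rinv_l by lra. lra. }
    apply sin_gt_0; nra. }
  nra.
Qed.

(** Shifting the index by one multiplies the sum by [ee N m], which is not 1, without changing
    it. *)
Lemma sum_ee (N m : Z) : (0 < m < N)%Z -> sum_mod N (fun r => ee N (m * r)) = 0.
Proof.
  intros Hm. set (S := sum_mod N (fun r => ee N (m * r))).
  assert (H : ee N m * S = S).
  { unfold S. rewrite <- sum_mod_scal.
    rewrite <- (sum_mod_shift N (fun r => ee N (m * r)) 1); [|lia|].
    - apply sum_mod_ext; [lia|]. intros k _. rewrite <- ee_plus by lia. f_equal. lia.
    - intros n. replace (m * (n + N))%Z with (m * n + N * m)%Z by lia.
      rewrite ee_plus, ee_mult_N by lia. ring. }
  apply (f_equal (fun x => x - S)) in H. replace (ee N m * S - S) with ((ee N m - 1) * S) in H by ring.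
  replace (S - S) with (RtoC 0) in H by ring.
  destruct (Ceq_dec S 0) as [E|E]; [exact E|].
  exfalso. apply (Cmult_neq_0 (ee N m - 1) S); auto.
  apply Cminus_eq_contra, ee_neq_1, Hm.
Qed.

Definition sqN (N : Z) : C := RtoC (sqrt (IZR N)).

Lemma sqN_neq_0 (N : Z) : (0 < N)%Z -> sqN N <> 0.
Proof.
  intros HN E. apply RtoC_inj in E.
  assert (0 < sqrt (IZR N))%R by (apply sqrt_lt_R0, IZR_lt; lia). lra.
Qed.

Lemma sqN_sqr (N : Z) : (0 < N)%Z -> sqN N * sqN N = RtoC (IZR N).
Proof.
  intros HN. unfold sqN. rewrite <- RtoC_mult, sqrt_sqrt; [reflexivity|]. apply IZR_le. lia.
Qed.

Definition dft (N : Z) (G : Z -> C) (n : Z) : C :=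
  / sqN N * sum_mod N (fun m => G m * ee N (- (m * n))).

Lemma dft_periodic (N : Z) (G : Z -> C) : (0 < N)%Z -> periodic N (dft N G).
Proof.
  intros HN n. unfold dft. f_equal. apply sum_mod_ext; auto. intros k _. f_equal.
  replace (- (k * (n + N)))%Z with (- (k * n) + N * (- k))%Z by lia.
  rewrite ee_plus, ee_mult_N by auto. ring.
Qed.

Lemma dft_inv (N : Z) (G : Z -> C) (k : Z) : (0 < N)%Z -> periodic N G ->
  / sqN N * sum_mod N (fun r => dft N G r * ee N (k * r)) = G k.
Proof.
  intros HN HG.
  assert (E1 : sum_mod N (fun r => dft N G r * ee N (k * r)) =
    / sqN N * sum_mod N (fun r => sum_mod N (fun m => G (k + m)%Z * ee N (- m * r)))).
  { rewrite <- sum_mod_scal. apply sum_mod_ext; auto. intros r _. unfold dft.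
    rewrite <- (sum_mod_shift N (fun m => G m * ee N (- (m * r))) k); auto.
    - rewrite Cmult_comm, Cmult_assoc, (Cmult_comm (ee N (k * r))), <- Cmult_assoc. f_equal.
      rewrite <- sum_mod_scal. apply sum_mod_ext; auto. intros m _.
      rewrite Cmult_assoc, (Cmult_comm (ee N (k * r))), <- Cmult_assoc. f_equal.
      rewrite <- ee_plus by auto. f_equal. lia.
    - intros m. rewrite HG. f_equal. replace (- ((m + N) * r))%Z with (- (m * r) + N * - r)%Z by lia.
      rewrite ee_plus, ee_mult_N by auto. ring. }
  rewrite E1, sum_mod_swap.
  rewrite (sum_mod_first N); auto.
  - rewrite Z.add_0_r, sum_mod_scal.
    replace (sum_mod N (fun i => ee N (- 0 * i))) with (RtoC (IZR N)).
    + rewrite <- sqN_sqr by auto. field. now apply sqN_neq_0.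
    + unfold sum_mod.
      assert (Hn : forall n, sum_n (fun j => ee N (- 0 * Z.of_nat j)) n = RtoC (INR (S n))).
      { induction n; [rewrite Csum_O; now rewrite ee_0|].
        rewrite Csum_Sn, IHn. rewrite (S_INR (S n)), RtoC_plus. now rewrite ee_0. }
      rewrite Hn. rewrite INR_IZR_INZ. f_equal. f_equal. lia.
  - intros m Hm. rewrite sum_mod_scal.
    rewrite (sum_mod_ext N _ (fun r => ee N ((N - m) * r))); auto.
    + rewrite sum_ee by lia. ring.
    + intros r _. replace ((N - m) * r)%Z with (- m * r + N * r)%Z by lia.
      rewrite ee_plus, ee_mult_N by auto. ring.
Qed.

(** * The periodic primitives of the Dirac comb weighted by [dft N G] *)

Definition mu (N : Z) (k : nat) : R := (2 * PI * INR (S k) / IZR N)%R.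
(** The factor that integration puts in front of [exp (- i mu x)]; the conjugate exponential
    receives [- lam]. The index [k] stands for the frequency number [k + 1]. *)
Definition lam (N : Z) (k : nat) : C := Ci / mu N k.

(** [Qs N G i] is the [i]-fold primitive, of mean zero, of the measure with mass [dft N G n] at
    each integer [n] minus its mean, written as a Fourier series with terms [tq N G i]. *)
Definition tq (N : Z) (G : Z -> C) (i k : nat) (x : R) : C :=
  lam N k ^ i * (G (Z.of_nat (S k)) * Cexp (- (Ci * mu N k * x))) +
  (- lam N k) ^ i * (G (- Z.of_nat (S k))%Z * Cexp (Ci * mu N k * x)).

Definition Qs (N : Z) (G : Z -> C) (i : nat) (x : R) : C := / sqN N * CSeries (fun k => tq N G i k x).

Lemma mu_pos (N : Z) (k : nat) : (0 < N)%Z -> (0 < mu N k)%R.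
Proof.
  intros HN. unfold mu. apply Rdiv_lt_0_compat; [|apply IZR_lt; lia].
  pose proof PI_RGT_0. pose proof (lt_0_INR (S k) ltac:(lia)). nra.
Qed.

Lemma mu_neq_0 (N : Z) (k : nat) : (0 < N)%Z -> RtoC (mu N k) <> 0.
Proof. intros HN E. apply RtoC_inj in E. pose proof (mu_pos N k HN). lra. Qed.

Lemma Cmod_Cexp_Ci (x : R) : Cmod (Cexp (Ci * x)) = 1%R.
Proof. rewrite Cmod_Cexp. simpl. replace (0 * x - 1 * 0)%R with 0%R by ring. apply exp_0. Qed.

Lemma Cmod_lam (N : Z) (k : nat) : (0 < N)%Z -> Cmod (lam N k) = (IZR N / (2 * PI) * / INR (S k))%R.
Proof.
  intros HN. unfold lam. rewrite Cmod_div, Cmod_Ci, Cmod_R by now apply mu_neq_0.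
  rewrite Rabs_pos_eq by (left; now apply mu_pos). unfold mu. field.
  pose proof PI_RGT_0. pose proof (lt_0_INR (S k) ltac:(lia)).
  assert (0 < IZR N)%R by (apply IZR_lt; lia). repeat split; lra.
Qed.

Lemma periodic_bound (N : Z) (G : Z -> C) : (0 < N)%Z -> periodic N G ->
  exists B : R, (0 <= B)%R /\ forall n, (Cmod (G n) <= B)%R.
Proof.
  intros HN HG. exists (sum_n (fun k => Cmod (G (Z.of_nat k))) (Nat.pred (Z.to_nat N))).
  assert (H0 : forall n, (0 <= sum_n (fun k => Cmod (G (Z.of_nat k))) n)%R).
  { induction n; [rewrite Rsum_O; apply Cmod_ge_0|]. rewrite Rsum_Sn.
    pose proof (Cmod_ge_0 (G (Z.of_nat (S n)))). lra. }
  split; [apply H0|]. intros n.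
  assert (HP : forall q m : Z, G (m + q * N)%Z = G m).
  { intros q. apply (Z.bi_induction (fun q => forall m, G (m + q * N)%Z = G m)).
    - intros x y ->. reflexivity.
    - intros m. f_equal. lia.
    - intros x. split; intros H m.
      + replace (m + Z.succ x * N)%Z with (m + x * N + N)%Z by lia. now rewrite HG.
      + rewrite <- (H m). replace (m + Z.succ x * N)%Z with (m + x * N + N)%Z by lia. now rewrite HG. }
  replace (G n) with (G (Z.of_nat (Z.to_nat (n mod N)))).
  - assert (Hs : forall n j, (j <= n)%nat -> (Cmod (G (Z.of_nat j)) <= sum_n (fun k => Cmod (G (Z.of_nat k))) n)%R).
    { induction n0; intros j Hj.
      - replace j with 0%nat by lia. rewrite Rsum_O. lra.
      - rewrite Rsum_Sn. destruct (Nat.eq_dec j (S n0)) as [->|Hne].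
        + specialize (H0 n0). lra.
        + specialize (IHn0 j ltac:(lia)). pose proof (Cmod_ge_0 (G (Z.of_nat (S n0)))). lra. }
    apply Hs. pose proof (Z.mod_pos_bound n N HN). lia.
  - pose proof (Z.mod_pos_bound n N HN). rewrite Z2Nat.id by lia.
    rewrite <- (HP (n / N)%Z). f_equal. rewrite (Z.div_mod n N) at 3 by lia. lia.
Qed.

Lemma tq_bound (N : Z) (G : Z -> C) (B : R) (i k : nat) (x : R) : (0 < N)%Z -> (2 <= i)%nat ->
  (0 <= B)%R -> (forall n, (Cmod (G n) <= B)%R) ->
  (Cmod (tq N G i k x) <= 2 * B * (IZR N / (2 * PI)) ^ i * / INR (S k) ^ 2)%R.
Proof.
  intros HN Hi HB HG. unfold tq.
  assert (HNR : (0 < IZR N)%R) by (apply IZR_lt; lia).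
  pose proof PI_RGT_0 as Hpi. pose proof (lt_0_INR (S k) ltac:(lia)) as Hk.
  assert (H1 : (1 <= INR (S k))%R) by (rewrite S_INR; pose proof (pos_INR k); lra).
  assert (Hl : (Cmod (lam N k) ^ i <= (IZR N / (2 * PI)) ^ i * / INR (S k) ^ 2)%R).
  { rewrite Cmod_lam, Rpow_mult_distr by auto.
    apply Rmult_le_compat_l; [apply pow_le; left; apply Rdiv_lt_0_compat; lra|].
    rewrite pow_inv. apply Rinv_le_contravar; [apply pow_lt; lra|]. apply Rle_pow; auto. }
  apply Rle_trans with (1 := Cmod_triangle _ _). rewrite !Cmod_mult, !Cmod_pow, Cmod_opp.
  replace (- (Ci * mu N k * x)) with (Ci * RtoC (- (mu N k * x))) by (rewrite RtoC_opp, RtoC_mult; ring).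
  replace (Ci * mu N k * x) with (Ci * RtoC (mu N k * x)) by (rewrite RtoC_mult; ring).
  rewrite !Cmod_Cexp_Ci, !Rmult_1_r.
  assert (HL0 : (0 <= Cmod (lam N k) ^ i)%R) by apply pow_le, Cmod_ge_0.
  pose proof (HG (Z.of_nat (S k))) as G1. pose proof (HG (- Z.of_nat (S k))%Z) as G2.
  pose proof (Cmod_ge_0 (G (Z.of_nat (S k)))). pose proof (Cmod_ge_0 (G (- Z.of_nat (S k))%Z)).
  replace (2 * B * (IZR N / (2 * PI)) ^ i * / INR (S k) ^ 2)%R with
    ((IZR N / (2 * PI)) ^ i * / INR (S k) ^ 2 * B + (IZR N / (2 * PI)) ^ i * / INR (S k) ^ 2 * B)%R by ring.
  apply Rplus_le_compat; apply Rmult_le_compat; auto.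
Qed.

Lemma ex_series_tq_bound (A : R) : ex_series (fun k => A * / INR (S k) ^ 2)%R.
Proof. apply (ex_series_scal_l A (fun k => (/ INR (S k) ^ 2)%R) ex_series_inv_sqr). Qed.

Lemma tq_series (N : Z) (G : Z -> C) (i : nat) (x : R) : (0 < N)%Z -> periodic N G -> (2 <= i)%nat ->
  is_Cseries (fun k => tq N G i k x) (CSeries (fun k => tq N G i k x)).
Proof.
  intros HN HG Hi. destruct (periodic_bound N G HN HG) as [B [HB0 HB]].
  apply (is_CSeries_le _ (fun k => 2 * B * (IZR N / (2 * PI)) ^ i * / INR (S k) ^ 2)%R).
  - intros k. now apply tq_bound.
  - apply ex_series_tq_bound.
Qed.

Lemma Qs_bound (N : Z) (G : Z -> C) (i : nat) : (0 < N)%Z -> periodic N G -> (2 <= i)%nat ->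
  exists B : R, (0 <= B)%R /\ forall x, (Cmod (Qs N G i x) <= B)%R.
Proof.
  intros HN HG Hi. destruct (periodic_bound N G HN HG) as [B [HB0 HB]].
  exists (Cmod (/ sqN N) * Series (fun k => 2 * B * (IZR N / (2 * PI)) ^ i * / INR (S k) ^ 2))%R.
  assert (H : forall x, (Cmod (Qs N G i x) <= Cmod (/ sqN N) * Series (fun k => 2 * B * (IZR N / (2 * PI)) ^ i * / INR (S k) ^ 2))%R).
  { intros x. unfold Qs. rewrite Cmod_mult. apply Rmult_le_compat_l; [apply Cmod_ge_0|].
    apply CSeries_le; [intros k; now apply tq_bound|apply ex_series_tq_bound]. }
  split; [|exact H]. apply Rle_trans with (2 := H 0%R), Cmod_ge_0.
Qed.

Lemma Cexp_Ci_plus_opp (x : R) : Cexp (- (Ci * x)) + Cexp (Ci * x) = RtoC (2 * cos x).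
Proof.
  unfold Cexp. simpl. replace (0 * x - 1 * 0)%R with 0%R by ring. rewrite Ropp_0, exp_0.
  replace (0 * 0 + 1 * x)%R with x by ring. rewrite cos_neg, sin_neg. apply C_ext; simpl; ring.
Qed.

(** The Bernoulli polynomial [B_2 (1 + y)] at [y = (x - r) / N], where [r = n + 1 + i]. Taking the
    residues in the window [n + 1, ..., n + N] puts [y] in [[-1, 0]] for every [x] of
    [[n, n + 1]]. *)
Definition bpoly (N : Z) (n : Z) (i : Z) (x : R) : R :=
  (((x - IZR (n + 1 + i)) / IZR N) ^ 2 + (x - IZR (n + 1 + i)) / IZR N + 1 / 6)%R.

(** Writing [G] as an inverse Fourier transform, the terms of frequencies [m] and [- m] combine into
    cosines of [2 PI m (x - r) / N], summed over residues [r] with weight [dft N G r]; the sum over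
    [m] is then the Bernoulli series at a point of [[-1, 0]]. *)
Lemma Qs2_eq (N : Z) (G : Z -> C) (n : Z) (x : R) : (0 < N)%Z -> periodic N G ->
  (IZR n <= x <= IZR n + 1)%R ->
  Qs N G 2 x = - (IZR N / 2) * sum_mod N (fun i => dft N G (n + 1 + i)%Z * RtoC (bpoly N n i x)).
Proof.
  intros HN HG Hx.
  assert (HNR : (0 < IZR N)%R) by (apply IZR_lt; lia).
  pose proof PI_RGT_0 as Hpi.
  set (y := fun i : Z => ((x - IZR (n + 1 + i)) / IZR N)%R).
  assert (Hper : forall k : Z, periodic N (fun r => dft N G r * ee N (k * r))).
  { intros k r. rewrite dft_periodic by auto. f_equal.
    replace (k * (r + N))%Z with (k * r + N * k)%Z by lia. rewrite ee_plus, ee_mult_N by auto. ring. }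
  assert (Ht : forall k, tq N G 2 k x = sum_mod N (fun i =>
      (- (IZR N * sqN N / (2 * PI ^ 2)) * dft N G (n + 1 + i)%Z) * RtoC (bcos (y i) k))).
  { intros k. pose proof (lt_0_INR (S k) ltac:(lia)) as Hk.
    unfold tq. rewrite <- (dft_inv N G (Z.of_nat (S k))), <- (dft_inv N G (- Z.of_nat (S k))) by auto.
    rewrite <- (sum_mod_shift N _ (n + 1) HN (Hper (Z.of_nat (S k)))).
    rewrite <- (sum_mod_shift N _ (n + 1) HN (Hper (- Z.of_nat (S k))%Z)).
    match goal with |- ?l2 * (?s * ?A * ?e1) + ?l3 * (?s * ?B * ?e2) = _ =>
      transitivity ((l2 * s * e1) * A + (l3 * s * e2) * B); [ring|] end.
    rewrite <- !sum_mod_scal.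
    unfold sum_mod. rewrite <- (sum_n_plus (G := C_AbelianMonoid)).
    apply (sum_n_ext (G := C_AbelianMonoid)). intros j. set (r := (n + 1 + Z.of_nat j)%Z).
    match goal with |- plus ?a ?b = ?c => change (a + b = c) end.
    unfold ee, bcos, y. fold r.
    set (th := (2 * INR (S k) * (PI * ((x - IZR r) / IZR N)))%R).
    assert (E1 : Cexp (- (Ci * mu N k * x)) * Cexp (2 * PI * Ci * IZR (Z.of_nat (S k) * r) / IZR N) = Cexp (- (Ci * th))).
    { rewrite <- Cexp_plus. f_equal. unfold th, mu. rewrite mult_IZR, <- INR_IZR_INZ.
      apply C_ext; unfold Cdiv; rewrite <- ?RtoC_inv by lra; simpl; field; lra. }
    assert (E2 : Cexp (Ci * mu N k * x) * Cexp (2 * PI * Ci * IZR (- Z.of_nat (S k) * r) / IZR N) = Cexp (Ci * th)).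
    { rewrite <- Cexp_plus. f_equal. unfold th, mu. rewrite mult_IZR, opp_IZR, <- INR_IZR_INZ.
      apply C_ext; unfold Cdiv; rewrite <- ?RtoC_inv by lra; simpl; field; lra. }
    transitivity (lam N k ^ 2 * / sqN N * dft N G r * (Cexp (- (Ci * th)) + Cexp (Ci * th))).
    - rewrite <- E1, <- E2. simpl Cpow. ring.
    - rewrite Cexp_Ci_plus_opp. unfold lam.
      assert (Hmu : RtoC (mu N k) <> 0) by now apply mu_neq_0.
      replace ((Ci / mu N k) ^ 2 * / sqN N * dft N G r * (2 * cos th)%R) with
        (- (2 * / sqN N / (RtoC (mu N k) ^ 2)) * dft N G r * RtoC (cos th)).
      2:{ rewrite RtoC_mult. simpl Cpow. replace (Ci / mu N k * (Ci / mu N k * 1)) with (- / (mu N k * (mu N k * 1))).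
          - field. split; [now apply sqN_neq_0|exact Hmu].
          - replace (Ci / mu N k * (Ci / mu N k * 1)) with ((Ci * Ci) * / (mu N k * (mu N k * 1))) by (field; auto).
            replace (Ci * Ci) with (- (1 : C)) by (apply C_ext; simpl; ring). ring. }
      rewrite RtoC_div by nra. rewrite RtoC_pow. unfold mu. rewrite RtoC_div by lra. rewrite !RtoC_mult.
      rewrite <- (sqN_sqr N) by auto.
      assert (HPI : RtoC PI <> 0) by (intros E; apply RtoC_inj in E; lra).
      assert (HK : RtoC (INR (S k)) <> 0) by (intros E; apply RtoC_inj in E; lra).
      pose proof (sqN_neq_0 N HN).
      field. repeat split; auto. }
  unfold Qs.
  assert (Hser : is_Cseries (fun k => tq N G 2 k x) (sum_mod N (fun i =>
      (- (IZR N * sqN N / (2 * PI ^ 2)) * dft N G (n + 1 + i)%Z) * bser (y i)))).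
  { apply (is_Cseries_ext (fun k => sum_mod N (fun i =>
      (- (IZR N * sqN N / (2 * PI ^ 2)) * dft N G (n + 1 + i)%Z) * RtoC (bcos (y i) k)))); [intros k; symmetry; apply Ht|].
    unfold sum_mod. apply (is_Cseries_sum_n (fun k j => _) (fun j => _)). intros j _.
    apply is_Cseries_scal, bser_correct. }
  rewrite (CSeries_unique _ _ Hser), <- !sum_mod_scal.
  apply sum_mod_ext; auto. intros i Hi. rewrite bser_eq.
  - unfold bpoly. fold (y i). rewrite (RtoC_mult (PI ^ 2)), RtoC_pow.
    assert (HPI : RtoC PI <> 0) by (intros E; apply RtoC_inj in E; lra).
    pose proof (sqN_neq_0 N HN). field. auto.
  - assert (Hi2 : (IZR n <= IZR (n + 1 + i) - 1 <= IZR n + IZR N - 1)%R).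
    { rewrite !plus_IZR. assert (0 <= IZR i <= IZR (N - 1))%R by (split; apply IZR_le; lia). rewrite minus_IZR in H. lra. }
    unfold y. split.
    + apply Rmult_le_reg_r with (IZR N); auto. unfold Rdiv. rewrite Rmult_assoc, Rinv_l by lra. lra.
    + apply Rmult_le_reg_r with (IZR N); auto. unfold Rdiv. rewrite Rmult_assoc, Rinv_l by lra. lra.
Qed.

(** * Euler-Maclaurin summation *)

(** Unlike [sum_n] it has an empty case, from which the inductions on the length of the interval
    start. *)
Fixpoint psum (F : nat -> C) (T : nat) : C :=
  match T with O => 0 | S T' => psum F T' + F T' end.

Lemma psum_sum_n (F : nat -> C) n : psum F (S n) = sum_n F n.
Proof.
  induction n.
  - rewrite Csum_O. simpl. ring.
  - rewrite Csum_Sn, <- IHn. reflexivity.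
Qed.

(** The right derivative at [n] of [Qs N G 2]. *)
Definition Q1 (N : Z) (G : Z -> C) (n : Z) : C :=
  - / 2 * sum_mod N (fun i => dft N G (n + 1 + i)%Z * RtoC (1 - 2 * IZR (i + 1) / IZR N)).

Lemma sum_dft (N : Z) (G : Z -> C) (a : Z) : (0 < N)%Z -> periodic N G ->
  sum_mod N (fun i => dft N G (a + i)%Z) = sqN N * G 0%Z.
Proof.
  intros HN HG. rewrite sum_mod_shift; auto; [|now apply dft_periodic].
  rewrite <- (dft_inv N G 0 HN HG), Cmult_assoc, Cinv_r, Cmult_1_l by now apply sqN_neq_0.
  apply sum_mod_ext; auto. intros k _. replace (0 * k)%Z with 0%Z by lia. rewrite ee_0 by auto. ring.
Qed.

Lemma is_Cder_sum_mod (N : Z) (f df : Z -> R -> C) (x : R) :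
  (forall i, is_Cder (f i) x (df i x)) ->
  is_Cder (fun t => sum_mod N (fun i => f i t)) x (sum_mod N (fun i => df i x)).
Proof.
  intros H. unfold sum_mod. induction (Nat.pred (Z.to_nat N)) as [|n IH].
  - rewrite Csum_O. apply (is_Cder_ext (f 0%Z)); [|apply H]. intros t. now rewrite Csum_O.
  - rewrite Csum_Sn.
    apply (is_Cder_ext (fun t => sum_n (fun k => f (Z.of_nat k) t) n + f (Z.of_nat (S n)) t)).
    + intros t. now rewrite Csum_Sn.
    + apply is_Cder_plus; auto.
Qed.

(** The polynomial that agrees with [Qs N G 2] on [[n, n + 1]]. It can be differentiated at both
    ends, where the second primitive itself has corners. *)
Definition qpol (N : Z) (G : Z -> C) (n : Z) (x : R) : C :=
  - (IZR N / 2) * sum_mod N (fun i => dft N G (n + 1 + i)%Z * RtoC (bpoly N n i x)).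

Definition qpol' (N : Z) (G : Z -> C) (n : Z) (x : R) : C :=
  - (IZR N / 2) * sum_mod N (fun i => dft N G (n + 1 + i)%Z *
     RtoC (2 * (x - IZR (n + 1 + i)) / IZR N ^ 2 + / IZR N)).

Lemma is_Cder_qpol (N : Z) (G : Z -> C) (n : Z) (x : R) : (0 < N)%Z ->
  is_Cder (qpol N G n) x (qpol' N G n x).
Proof.
  intros HN. assert (0 < IZR N)%R by (apply IZR_lt; lia).
  apply (is_Cder_scal (- (IZR N / 2)) (fun t => sum_mod N (fun i => dft N G (n + 1 + i)%Z * RtoC (bpoly N n i t)))).
  apply (is_Cder_sum_mod N (fun i t => dft N G (n + 1 + i)%Z * RtoC (bpoly N n i t))
    (fun i t => dft N G (n + 1 + i)%Z * RtoC (2 * (t - IZR (n + 1 + i)) / IZR N ^ 2 + / IZR N))).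
  intros i. apply (is_Cder_scal _ (fun t => RtoC (bpoly N n i t))).
  apply (is_Cder_RtoC (bpoly N n i)). unfold bpoly. auto_derive; [trivial|]. field. lra.
Qed.

(** Between integers the comb carries no mass, so the second derivative is minus its mean
    [G 0 / sqrt N]. *)
Lemma is_Cder_qpol' (N : Z) (G : Z -> C) (n : Z) (x : R) : (0 < N)%Z -> periodic N G ->
  is_Cder (qpol' N G n) x (- (G 0%Z / sqN N)).
Proof.
  intros HN HG. assert (0 < IZR N)%R by (apply IZR_lt; lia).
  replace (- (G 0%Z / sqN N)) with (- (IZR N / 2) * sum_mod N (fun i => dft N G (n + 1 + i)%Z * RtoC (2 / IZR N ^ 2))).
  - apply (is_Cder_scal (- (IZR N / 2)) (fun t => sum_mod N (fun i => dft N G (n + 1 + i)%Z *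
       RtoC (2 * (t - IZR (n + 1 + i)) / IZR N ^ 2 + / IZR N)))).
    apply (is_Cder_sum_mod N (fun i t => dft N G (n + 1 + i)%Z * RtoC (2 * (t - IZR (n + 1 + i)) / IZR N ^ 2 + / IZR N))
      (fun i t => dft N G (n + 1 + i)%Z * RtoC (2 / IZR N ^ 2))).
    intros i. apply (is_Cder_scal _ (fun t => RtoC (2 * (t - IZR (n + 1 + i)) / IZR N ^ 2 + / IZR N))).
    apply (is_Cder_RtoC (fun t => 2 * (t - IZR (n + 1 + i)) / IZR N ^ 2 + / IZR N)%R). auto_derive; [trivial|]. field. lra.
  - rewrite (sum_mod_ext N _ (fun i => RtoC (2 / IZR N ^ 2) * dft N G (n + 1 + i)%Z)); auto.
    2:{ intros; ring. }
    rewrite sum_mod_scal, sum_dft by auto. rewrite RtoC_div, RtoC_pow by nra.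
    rewrite <- (sqN_sqr N) by auto. pose proof (sqN_neq_0 N HN). field. auto.
Qed.

Lemma qpol'_left (N : Z) (G : Z -> C) (n : Z) : (0 < N)%Z -> qpol' N G n (IZR n) = Q1 N G n.
Proof.
  intros HN. assert (0 < IZR N)%R by (apply IZR_lt; lia). unfold qpol', Q1.
  rewrite <- !sum_mod_scal. apply sum_mod_ext; auto. intros i _.
  replace (2 * (IZR n - IZR (n + 1 + i)) / IZR N ^ 2 + / IZR N)%R with (/ IZR N * (1 - 2 * IZR (i + 1) / IZR N))%R.
  - rewrite (RtoC_mult (/ IZR N)), RtoC_inv by lra. field.
    apply IZR_C_neq_0. lia.
  - rewrite !plus_IZR. field. lra.
Qed.

(** The jump of the slope at [n + 1] is the mass there. Passing to the next window of residues
    exchanges the weight [1] at its first point for [-1] at a congruent last point; with the factor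
    [- 1/2] this is one copy of [dft N G (n + 1)]. *)
Lemma qpol'_right (N : Z) (G : Z -> C) (n : Z) : (0 < N)%Z -> periodic N G ->
  qpol' N G n (IZR n + 1)%R = Q1 N G (n + 1) - dft N G (n + 1).
Proof.
  intros HN HG. assert (HR : (0 < IZR N)%R) by (apply IZR_lt; lia).
  pose proof (IZR_C_neq_0 N ltac:(lia)) as HC.
  set (F := fun j : Z => dft N G (n + 1 + j)%Z * RtoC (1 - 2 * IZR j / IZR N)).
  assert (E1 : qpol' N G n (IZR n + 1)%R = - / 2 * sum_mod N F).
  { unfold qpol'. rewrite <- !sum_mod_scal. apply sum_mod_ext; auto. intros i _. unfold F.
    replace (2 * (IZR n + 1 - IZR (n + 1 + i)) / IZR N ^ 2 + / IZR N)%R with (/ IZR N * (1 - 2 * IZR i / IZR N))%R.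
    - rewrite (RtoC_mult (/ IZR N)), RtoC_inv by lra. field. exact HC.
    - rewrite !plus_IZR. field. lra. }
  assert (E2 : Q1 N G (n + 1) = - / 2 * (sum_mod N F + F N - F 0%Z)).
  { unfold Q1. f_equal. pose proof (sum_mod_shift1 N F 0 HN) as H.
    rewrite (sum_mod_ext N (fun k => F (0 + k)%Z) F), (Z.add_0_l N) in H by auto. rewrite <- H.
    apply sum_mod_ext; auto. intros k _. unfold F. replace (0 + 1 + k)%Z with (k + 1)%Z by lia.
    f_equal. f_equal. lia. }
  rewrite E1, E2. unfold F. rewrite dft_periodic by auto. rewrite Z.add_0_r.
  replace (1 - 2 * IZR N / IZR N)%R with (-1)%R by (field; lra).
  replace (1 - 2 * 0 / IZR N)%R with 1%R by (field; lra). field.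
Qed.

Lemma Qs2_qpol_left (N : Z) (G : Z -> C) (n : Z) : (0 < N)%Z -> periodic N G ->
  qpol N G n (IZR n) = Qs N G 2 (IZR n).
Proof. intros HN HG. symmetry. apply Qs2_eq; auto. lra. Qed.

Lemma Qs2_qpol_right (N : Z) (G : Z -> C) (n : Z) : (0 < N)%Z -> periodic N G ->
  qpol N G n (IZR n + 1)%R = Qs N G 2 (IZR n + 1)%R.
Proof. intros HN HG. symmetry. apply Qs2_eq; auto. lra. Qed.

(** The function [q p1 - q' p0 - mean * Psi] is a primitive of [q p2], because [q'' = - mean]. Its
    values at the two ends give the boundary terms, and the jump of [q'] gives the summand at
    [n + 1]. *)
Lemma EM2_step (N : Z) (G : Z -> C) (n : Z) (Psi p0 p1 p2 : R -> C) : (0 < N)%Z -> periodic N G ->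
  (forall x, (IZR n <= x <= IZR n + 1)%R ->
     is_Cder Psi x (p0 x) /\ is_Cder p0 x (p1 x) /\ is_Cder p1 x (p2 x) /\ Ccont p2 x) ->
  is_CRInt (fun x => Qs N G 2 x * p2 x) (IZR n) (IZR n + 1)
    (dft N G (n + 1) * p0 (IZR n + 1)%R - G 0%Z / sqN N * (Psi (IZR n + 1)%R - Psi (IZR n))
     + (Qs N G 2 (IZR n + 1)%R * p1 (IZR n + 1)%R - Q1 N G (n + 1) * p0 (IZR n + 1)%R)
     - (Qs N G 2 (IZR n) * p1 (IZR n) - Q1 N G n * p0 (IZR n))).
Proof.
  intros HN HG Hp.
  set (P := fun x => qpol N G n x * p1 x - qpol' N G n x * p0 x - G 0%Z / sqN N * Psi x).
  assert (HI : is_CRInt (fun x => qpol N G n x * p2 x) (IZR n) (IZR n + 1) (P (IZR n + 1)%R - P (IZR n))).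
  { apply is_CRInt_derive; [lra| |].
    - intros x Hx. destruct (Hp x Hx) as [H0 [H1 [H2 H3]]].
      replace (qpol N G n x * p2 x) with
        ((qpol' N G n x * p1 x + qpol N G n x * p2 x) - (- (G 0%Z / sqN N) * p0 x + qpol' N G n x * p1 x)
          - G 0%Z / sqN N * p0 x) by ring.
      apply (is_Cder_minus (fun x => qpol N G n x * p1 x - qpol' N G n x * p0 x) (fun x => G 0%Z / sqN N * Psi x)).
      + apply (is_Cder_minus (fun x => qpol N G n x * p1 x) (fun x => qpol' N G n x * p0 x)).
        * apply (is_Cder_mult (qpol N G n) p1); auto. now apply is_Cder_qpol.
        * apply (is_Cder_mult (qpol' N G n) p0); auto. now apply is_Cder_qpol'.
      + now apply is_Cder_scal.
    - intros x Hx. destruct (Hp x Hx) as [_ [_ [_ H3]]].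
      apply Ccont_mult; auto. exact (is_Cder_cont _ _ _ (is_Cder_qpol N G n x HN)). }
  match goal with |- is_CRInt _ _ _ ?v => replace v with (P (IZR n + 1)%R - P (IZR n)) end.
  - apply is_CRInt_ext with (3 := HI); [lra|]. intros x Hx. f_equal. symmetry. apply Qs2_eq; auto. lra.
  - unfold P. rewrite Qs2_qpol_left, Qs2_qpol_right, qpol'_left, qpol'_right by auto. ring.
Qed.

Lemma IZR_add_nat (A : Z) (T : nat) : IZR (A + Z.of_nat T) = (IZR A + INR T)%R.
Proof. now rewrite plus_IZR, INR_IZR_INZ. Qed.

Lemma EM2 (N : Z) (G : Z -> C) (A : Z) (Psi p0 p1 p2 : R -> C) (T : nat) : (0 < N)%Z -> periodic N G ->
  (forall x, (IZR A <= x)%R ->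
     is_Cder Psi x (p0 x) /\ is_Cder p0 x (p1 x) /\ is_Cder p1 x (p2 x) /\ Ccont p2 x) ->
  is_CRInt (fun x => Qs N G 2 x * p2 x) (IZR A) (IZR A + INR T)
    (psum (fun k => dft N G (A + Z.of_nat (S k)) * p0 (IZR A + INR (S k))%R) T
     - G 0%Z / sqN N * (Psi (IZR A + INR T)%R - Psi (IZR A))
     + (Qs N G 2 (IZR A + INR T)%R * p1 (IZR A + INR T)%R - Q1 N G (A + Z.of_nat T) * p0 (IZR A + INR T)%R)
     - (Qs N G 2 (IZR A) * p1 (IZR A) - Q1 N G A * p0 (IZR A))).
Proof.
  intros HN HG Hp. induction T.
  - simpl INR. rewrite Rplus_0_r. simpl Z.of_nat. rewrite Z.add_0_r. simpl psum.
    match goal with |- is_CRInt _ _ _ ?v => replace v with (RtoC 0) by ring end. apply is_CRInt_point.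
  - pose proof (EM2_step N G (A + Z.of_nat T) Psi p0 p1 p2 HN HG) as HS.
    rewrite IZR_add_nat in HS.
    assert (E : (IZR A + INR T + 1 = IZR A + INR (S T))%R) by (rewrite S_INR; ring).
    rewrite E in HS. replace (A + Z.of_nat T + 1)%Z with (A + Z.of_nat (S T))%Z in HS by lia.
    assert (HS' := HS ltac:(intros x Hx; apply Hp; pose proof (pos_INR T); lra)).
    pose proof (is_CRInt_chasles _ _ _ _ _ _ IHT HS') as H.
    match goal with |- is_CRInt _ _ _ ?v => match type of H with is_CRInt _ _ _ ?w => replace v with w; [exact H|] end end.
    cbn [psum]. ring.
Qed.

Lemma Ccont_bounded (f : R -> C) (a b : R) : (a <= b)%R ->
  (forall x, (a <= x <= b)%R -> Ccont f x) ->
  exists B : R, (0 <= B)%R /\ forall x, (a <= x <= b)%R -> (Cmod (f x) <= B)%R.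
Proof.
  intros Hab Hf.
  destruct (continuity_ab_maj (fun x => Cmod (f x)) a b Hab) as [m [Hm Hm2]].
  - intros c Hc. apply continuity_pt_filterlim.
    apply (proj2 (filterlim_locally (fun x => Cmod (f x)) _)). intros eps.
    apply filter_imp with (2 := proj2 (Clim_eps (locally c) f (f c)) (Hf c Hc) eps (cond_pos eps)).
    intros x Hx. change (Rabs (Cmod (f x) - Cmod (f c)) < eps)%R.
    pose proof (Cmod_triangle_minus (f x) (f c)). pose proof (Cmod_triangle_minus (f c) (f x)) as H2.
    rewrite (Cmod_sub_sym (f c)) in H2. apply Rabs_def1; lra.
  - exists (Cmod (f m)). split; [apply Cmod_ge_0|auto].
Qed.

Lemma is_Cder_tq (N : Z) (G : Z -> C) (i k : nat) (x : R) : (0 < N)%Z ->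
  is_Cder (tq N G (S i) k) x (tq N G i k x).
Proof.
  intros HN. pose proof (mu_neq_0 N k HN) as Hmu.
  assert (H1 : is_Cder (fun x : R => Cexp (- (Ci * mu N k * x))) x (- (Ci * mu N k) * Cexp (- (Ci * mu N k * x)))).
  { apply (is_Cder_Cexp (fun x : R => - (Ci * mu N k * x))).
    apply (is_Cder_ext (fun x : R => x * - (Ci * mu N k))); [intros; ring|]. apply is_Cder_lin. }
  assert (H2 : is_Cder (fun x : R => Cexp (Ci * mu N k * x)) x ((Ci * mu N k) * Cexp (Ci * mu N k * x))).
  { apply (is_Cder_Cexp (fun x : R => (Ci * mu N k * x))).
    apply (is_Cder_ext (fun x : R => x * (Ci * mu N k))); [intros; ring|]. apply is_Cder_lin. }
  assert (Hl : lam N k * - (Ci * mu N k) = 1).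
  { unfold lam. replace (Ci / mu N k * - (Ci * mu N k)) with (- (Ci * Ci)) by (field; exact Hmu).
    apply C_ext; simpl; ring. }
  unfold tq.
  replace (lam N k ^ i * (G (Z.of_nat (S k)) * Cexp (- (Ci * mu N k * x))) +
           (- lam N k) ^ i * (G (- Z.of_nat (S k))%Z * Cexp (Ci * mu N k * x))) with
   (lam N k ^ S i * (G (Z.of_nat (S k)) * (- (Ci * mu N k) * Cexp (- (Ci * mu N k * x)))) +
    (- lam N k) ^ S i * (G (- Z.of_nat (S k))%Z * ((Ci * mu N k) * Cexp (Ci * mu N k * x)))).
  - apply (is_Cder_plus (fun x : R => lam N k ^ S i * (G (Z.of_nat (S k)) * Cexp (- (Ci * mu N k * x))))
      (fun x : R => (- lam N k) ^ S i * (G (- Z.of_nat (S k))%Z * Cexp (Ci * mu N k * x)))).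
    + apply (is_Cder_scal _ (fun x : R => G (Z.of_nat (S k)) * Cexp (- (Ci * mu N k * x)))).
      apply (is_Cder_scal _ (fun x : R => Cexp (- (Ci * mu N k * x)))). exact H1.
    + apply (is_Cder_scal _ (fun x : R => G (- Z.of_nat (S k))%Z * Cexp (Ci * mu N k * x))).
      apply (is_Cder_scal _ (fun x : R => Cexp (Ci * mu N k * x))). exact H2.
  - simpl Cpow.
    match goal with |- ?a * ?b * (?g * (?m * ?e)) + - ?a * ?c * (?h * (?n * ?e2)) = _ =>
      transitivity ((a * m) * (b * (g * e)) + (a * m) * (c * (h * e2))); [ring|] end.
    rewrite Hl. ring.
Qed.

Lemma Ccont_tq (N : Z) (G : Z -> C) (i k : nat) (x : R) : (0 < N)%Z -> Ccont (tq N G i k) x.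
Proof.
  intros HN.
  apply (Ccont_plus (fun x : R => lam N k ^ i * (G (Z.of_nat (S k)) * Cexp (- (Ci * mu N k * x))))
      (fun x : R => (- lam N k) ^ i * (G (- Z.of_nat (S k))%Z * Cexp (Ci * mu N k * x))));
  (apply Ccont_mult; [apply Ccont_const|]; apply Ccont_mult; [apply Ccont_const|]).
  - apply (Ccont_Cexp (fun x : R => - (Ci * mu N k * x))).
    apply (is_Cder_cont _ x (- (Ci * mu N k))).
    apply (is_Cder_ext (fun x : R => x * - (Ci * mu N k))); [intros; ring|]. apply is_Cder_lin.
  - apply (Ccont_Cexp (fun x : R => (Ci * mu N k * x))).
    apply (is_Cder_cont _ x (Ci * mu N k)).
    apply (is_Cder_ext (fun x : R => x * (Ci * mu N k))); [intros; ring|]. apply is_Cder_lin.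
Qed.

(** Integration by parts is done on each Fourier mode, where it is elementary. Both series converge
    absolutely since [K >= 2], so the result can be summed without differentiating [Qs] itself. *)
Lemma Qs_parts (N : Z) (G : Z -> C) (K : nat) (chi chi' : R -> C) (a b : R) (I : C) :
  (0 < N)%Z -> periodic N G -> (2 <= K)%nat -> (a <= b)%R ->
  (forall x, (a <= x <= b)%R -> is_Cder chi x (chi' x) /\ Ccont chi' x) ->
  is_CRInt (fun x => Qs N G K x * chi x) a b I ->
  is_CRInt (fun x => Qs N G (S K) x * chi' x) a b (Qs N G (S K) b * chi b - Qs N G (S K) a * chi a - I).
Proof.
  intros HN HG HK Hab Hchi HI.
  destruct (periodic_bound N G HN HG) as [B [HB0 HB]].
  destruct (Ccont_bounded chi a b Hab) as [b1 [Hb1 Hb1']].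
  { intros x Hx. exact (is_Cder_cont _ _ _ (proj1 (Hchi x Hx))). }
  destruct (Ccont_bounded chi' a b Hab) as [b2 [Hb2 Hb2']].
  { intros x Hx. apply Hchi, Hx. }
  set (c := fun i k => (2 * B * (IZR N / (2 * PI)) ^ i * / INR (S k) ^ 2)%R).
  assert (Hc : forall i k x, (2 <= i)%nat -> (Cmod (tq N G i k x) <= c i k)%R) by (intros; now apply tq_bound).
  destruct (is_CRInt_CSeries (fun k x => tq N G K k x * chi x + tq N G (S K) k x * chi' x)
    (fun x => CSeries (fun k => tq N G K k x) * chi x + CSeries (fun k => tq N G (S K) k x) * chi' x)
    (fun k => tq N G (S K) k b * chi b - tq N G (S K) k a * chi a)
    (fun k => (c K k * b1 + c (S K) k * b2)%R) a b Hab) as [H1 H2].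
  - apply (ex_series_ext (fun k => plus (scal b1 (c K k)) (scal b2 (c (S K) k)))).
    + intros k. change (b1 * c K k + b2 * c (S K) k = c K k * b1 + c (S K) k * b2)%R. ring.
    + apply (ex_series_plus (V := R_NormedModule));
        apply (ex_series_scal (V := R_NormedModule)); apply ex_series_tq_bound.
  - intros k x Hx. apply Rle_trans with (1 := Cmod_triangle _ _). rewrite !Cmod_mult.
    apply Rplus_le_compat; apply Rmult_le_compat; auto using Cmod_ge_0.
  - intros k. apply (is_CRInt_derive (fun x => tq N G (S K) k x * chi x)); auto.
    + intros x Hx. destruct (Hchi x Hx) as [D1 D2].
      apply (is_Cder_mult (tq N G (S K) k) chi); [now apply is_Cder_tq|exact D1].
    + intros x Hx. destruct (Hchi x Hx) as [D1 D2].
      apply Ccont_plus; apply Ccont_mult; auto using Ccont_tq. exact (is_Cder_cont _ _ _ D1).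
  - intros x Hx. symmetry. apply CSeries_unique.
    apply (is_Cseries_ext (fun k => chi x * tq N G K k x + chi' x * tq N G (S K) k x)); [intros; ring|].
    rewrite (Cmult_comm _ (chi x)), (Cmult_comm _ (chi' x)).
    apply is_Cseries_plus; apply is_Cseries_scal, tq_series; auto.
  - assert (E : CSeries (fun k => tq N G (S K) k b * chi b - tq N G (S K) k a * chi a) =
      chi b * CSeries (fun k => tq N G (S K) k b) + - chi a * CSeries (fun k => tq N G (S K) k a)).
    { apply CSeries_unique.
      apply (is_Cseries_ext (fun k => chi b * tq N G (S K) k b + - chi a * tq N G (S K) k a)); [intros; ring|].
      apply is_Cseries_plus; apply is_Cseries_scal, tq_series; auto. }
    rewrite E in H1. pose proof (is_CRInt_scal (/ sqN N) _ _ _ _ H1) as H3.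
    pose proof (is_CRInt_minus _ _ _ _ _ _ H3 HI) as H4.
    match goal with |- is_CRInt _ _ _ ?v => match type of H4 with is_CRInt _ _ _ ?w => replace v with w end end.
    + apply is_CRInt_ext with (3 := H4); auto. intros x _. unfold Qs. ring.
    + unfold Qs. ring.
Qed.

(** The boundary terms of the Euler-Maclaurin formula of order [K], at the integer [n]. *)
Definition Qv (N : Z) (G : Z -> C) (i : nat) (n : Z) : C :=
  match i with 1%nat => Q1 N G n | _ => Qs N G i (IZR n) end.

Fixpoint BB (N : Z) (G : Z -> C) (p : nat -> R -> C) (K : nat) (n : Z) : C :=
  match K with
  | O => 0
  | S K' => BB N G p K' n + (-1) ^ K * p K' (IZR n) * Qv N G K n
  end.

(** Each step raises the order by one integration by parts, which contributes one more boundary term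
    with alternating sign. The induction starts at order 2, where the jumps of the first primitive
    have already been turned into the sum. *)
Lemma EM (N : Z) (G : Z -> C) (A : Z) (Psi : R -> C) (p : nat -> R -> C) (T K : nat) :
  (0 < N)%Z -> periodic N G -> (2 <= K)%nat ->
  (forall x, (IZR A <= x)%R -> is_Cder Psi x (p 0%nat x) /\ forall i, is_Cder (p i) x (p (S i) x)) ->
  is_CRInt (fun x => Qs N G K x * p K x) (IZR A) (IZR A + INR T)
    ((-1) ^ K * (psum (fun k => dft N G (A + Z.of_nat (S k)) * p 0%nat (IZR A + INR (S k))%R) T
     - G 0%Z / sqN N * (Psi (IZR A + INR T)%R - Psi (IZR A))
     + (BB N G p K (A + Z.of_nat T) - BB N G p K A))).
Proof.
  intros HN HG HK Hp. induction HK as [|K HK IH].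
  - pose proof (EM2 N G A Psi (p 0%nat) (p 1%nat) (p 2%nat) T HN HG) as H.
    match type of H with _ -> is_CRInt _ _ _ ?w => match goal with |- is_CRInt _ _ _ ?v => replace v with w end end.
    + apply H. intros x Hx. destruct (Hp x Hx) as [H0 H1].
      split; [exact H0|split; [apply H1|split; [apply H1|]]]. exact (is_Cder_cont _ _ _ (H1 2%nat)).
    + simpl BB. unfold Qv. rewrite !IZR_add_nat. simpl Cpow. ring.
  - pose proof (pos_INR T).
    pose proof (Qs_parts N G K (p K) (p (S K)) (IZR A) (IZR A + INR T) _ HN HG HK ltac:(lra)
      ltac:(intros x Hx; split; [apply (Hp x (proj1 Hx))|exact (is_Cder_cont _ _ _ (proj2 (Hp x (proj1 Hx)) (S K)))]) IH) as H1.
    match goal with |- is_CRInt _ _ _ ?v => match type of H1 with is_CRInt _ _ _ ?w => replace v with w; [exact H1|] end end.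
    simpl BB. unfold Qv. destruct K as [|K]; [lia|]. rewrite !IZR_add_nat.
    assert (E : forall n, (-1) ^ n * (-1) ^ n = 1).
    { induction n; simpl; [ring|]. replace (-1 * (-1) ^ n * (-1 * (-1) ^ n)) with ((-1) ^ n * (-1) ^ n) by ring. exact IHn. }
    specialize (E (S K)). change ((-1) ^ S (S K)) with (-1 * (-1) ^ S K).
    set (e := (-1) ^ S K) in *.
    match goal with |- ?a * ?b - ?c * ?d - _ = _ =>
      transitivity (e * e * (a * b - c * d) - e * (psum (fun k => dft N G (A + Z.of_nat (S k)) * p 0%nat (IZR A + INR (S k))%R) T
     - G 0%Z / sqN N * (Psi (IZR A + INR T)%R - Psi (IZR A))
     + (BB N G p (S K) (A + Z.of_nat T) - BB N G p (S K) A))) end.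
    + rewrite E. ring.
    + ring.
Qed.

(** * Analytic functions *)

Lemma pow_n_Cpow (x : C) k : pow_n (K := C_AbsRing) x k = x ^ k.
Proof. induction k; [reflexivity|]. simpl. rewrite IHk. reflexivity. Qed.

Lemma is_pseries_C (a : nat -> C) (x l : C) :
  is_pseries (K := C_AbsRing) (V := C_NormedModule) a x l <-> is_Cseries (fun k => x ^ k * a k) l.
Proof.
  unfold is_pseries.
  assert (E : forall k, scal (pow_n (K := C_AbsRing) x k) (a k) = x ^ k * a k).
  { intros k. rewrite pow_n_Cpow. reflexivity. }
  split; apply (is_series_ext (V := C_NormedModule)); intros k; [apply E|symmetry; apply E].
Qed.

Lemma analytic_at_intro (F : C -> C) (z0 : C) (a : nat -> C) (rho : R) : (0 < rho)%R ->
  (forall z, (Cmod (z - z0) < rho)%R -> is_Cseries (fun k => (z - z0) ^ k * a k) (F z)) -> analytic_at F z0.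
Proof. intros Hr H. exists a, rho. split; [exact Hr|]. intros z Hz. apply is_pseries_C, H, Hz. Qed.

Lemma analytic_at_elim (F : C -> C) (z0 : C) : analytic_at F z0 ->
  exists (a : nat -> C) (rho : R), (0 < rho)%R /\
  (forall z, (Cmod (z - z0) < rho)%R -> is_Cseries (fun k => (z - z0) ^ k * a k) (F z)).
Proof.
  intros [a [rho [Hr H]]]. exists a, rho. split; [exact Hr|]. intros z Hz. apply is_pseries_C, H, Hz.
Qed.

Lemma analytic_plus (F G : C -> C) (z0 : C) :
  analytic_at F z0 -> analytic_at G z0 -> analytic_at (fun z => F z + G z) z0.
Proof.
  intros HF HG. destruct (analytic_at_elim _ _ HF) as [a [r [Hr H]]].
  destruct (analytic_at_elim _ _ HG) as [b [r' [Hr' H']]].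
  apply (analytic_at_intro _ _ (fun k => a k + b k) (Rmin r r')); [now apply Rmin_pos|].
  intros z Hz. apply (is_Cseries_ext (fun k => (z - z0) ^ k * a k + (z - z0) ^ k * b k)); [intros; ring|].
  apply is_Cseries_plus; [apply H|apply H']; apply Rlt_le_trans with (1 := Hz); [apply Rmin_l|apply Rmin_r].
Qed.

Lemma analytic_scal (c : C) (F : C -> C) (z0 : C) : analytic_at F z0 -> analytic_at (fun z => c * F z) z0.
Proof.
  intros HF. destruct (analytic_at_elim _ _ HF) as [a [r [Hr H]]].
  apply (analytic_at_intro _ _ (fun k => c * a k) r); auto.
  intros z Hz. apply (is_Cseries_ext (fun k => c * ((z - z0) ^ k * a k))); [intros; ring|].
  apply is_Cseries_scal, H, Hz.
Qed.

Lemma is_Cseries_first (a : nat -> C) (l : C) :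
  is_Cseries (fun k => a (S k)) (l - a 0%nat) -> is_Cseries a l.
Proof.
  intros H. apply (is_Cseries_decr_n a 0). rewrite Csum_O. exact H.
Qed.

Lemma analytic_mul_id (F : C -> C) (z0 : C) : analytic_at F z0 -> analytic_at (fun z => z * F z) z0.
Proof.
  intros HF.
  assert (H1 : analytic_at (fun z => (z - z0) * F z) z0).
  { destruct (analytic_at_elim _ _ HF) as [a [r [Hr H]]].
    apply (analytic_at_intro _ _ (fun k => match k with O => RtoC 0 | S k' => a k' end) r); auto.
    intros z Hz. apply is_Cseries_first. simpl.
    replace ((z - z0) * F z - 1 * 0) with ((z - z0) * F z) by ring.
    apply (is_Cseries_ext (fun k => (z - z0) * ((z - z0) ^ k * a k))); [intros; simpl; ring|].
    apply is_Cseries_scal, H, Hz. }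
  pose proof (analytic_plus _ _ _ H1 (analytic_scal z0 F z0 HF)) as H.
  replace (fun z => z * F z) with (fun z => (z - z0) * F z + z0 * F z); [exact H|].
  apply functional_extensionality. intros z. ring.
Qed.

Lemma analytic_const (c : C) (z0 : C) : analytic_at (fun _ => c) z0.
Proof.
  apply (analytic_at_intro _ _ (fun k => match k with O => c | S _ => RtoC 0 end) 1); [lra|].
  intros z _. apply is_Cseries_first. simpl. replace (c - 1 * c) with (RtoC 0) by ring.
  apply (is_Cseries_ext (fun _ => RtoC 0)); [intros; ring|apply is_Cseries_0].
Qed.

Lemma one_minus_neq_0 (q : C) : (Cmod q < 1)%R -> 1 - q <> 0.
Proof.
  intros Hq E. assert (E' : q = 1) by (replace q with (1 - (1 - q)) by ring; rewrite E; ring).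
    rewrite E', Cmod_1 in Hq. lra.
Qed.

Lemma is_Cseries_geom (q : C) : (Cmod q < 1)%R -> is_Cseries (fun k => q ^ k) (/ (1 - q)).
Proof.
  intros Hq. pose proof (one_minus_neq_0 q Hq) as Hn.
  assert (HS : forall n, sum_n (fun k => q ^ k) n = (1 - q ^ S n) * / (1 - q)).
  { induction n.
    - rewrite Csum_O. simpl. match goal with |- @eq _ ?a ?b => change (@eq C a b) end. field. exact Hn.
    - rewrite Csum_Sn, IHn. simpl. match goal with |- @eq _ ?a ?b => change (@eq C a b) end. field. exact Hn. }
  apply (filterlim_ext (fun n => (1 - q ^ S n) * / (1 - q))); [intros n; symmetry; apply HS|].
  enough (H : Clim (fun n => (1 - q ^ S n) * / (1 - q)) eventually ((1 - 0) * / (1 - q))).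
  { replace ((1 - 0) * / (1 - q)) with (/ (1 - q)) in H by ring. exact H. }
  apply (Clim_mult eventually (fun n => 1 - q ^ S n) (fun _ => / (1 - q))); [|apply filterlim_const].
  apply (Clim_minus eventually (fun _ => RtoC 1) (fun n => q ^ S n)); [apply filterlim_const|].
  apply (Clim_squeeze0 eventually _ (fun n => Cmod q ^ S n)%R).
  - exists 0%nat. intros n _. rewrite Cmod_pow. lra.
  - assert (H := is_lim_seq_geom (Cmod q)). rewrite Rabs_pos_eq in H by apply Cmod_ge_0.
    apply (proj1 (is_lim_seq_incr_1 _ _)) in H; [exact H|exact Hq].
Qed.

Lemma analytic_inv (z1 z0 : C) : z0 <> z1 -> analytic_at (fun z => / (z - z1)) z0.
Proof.
  intros Hne. pose proof (Cminus_eq_contra _ _ Hne) as Hd.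
  pose proof (proj1 (Cmod_gt_0 _) Hd) as Hd0.
  apply (analytic_at_intro _ _ (fun k => / (z0 - z1) * (- / (z0 - z1)) ^ k) (Cmod (z0 - z1))); auto.
  intros z Hz. set (q := (z - z0) * (- / (z0 - z1))).
  assert (Hq : (Cmod q < 1)%R).
  { unfold q. rewrite Cmod_mult, Cmod_opp, Cmod_inv by auto.
    apply Rmult_lt_reg_r with (Cmod (z0 - z1)); auto. rewrite Rmult_assoc, Rinv_l by lra. lra. }
  replace (/ (z - z1)) with (/ (z0 - z1) * / (1 - q)).
  - apply (is_Cseries_ext (fun k => / (z0 - z1) * q ^ k)).
    + intros k. unfold q. rewrite Cpow_mult_l. ring.
    + apply is_Cseries_scal, is_Cseries_geom, Hq.
  - assert (E : z - z1 = (z0 - z1) * (1 - q)) by (unfold q; field; exact Hd).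
    rewrite E. pose proof (one_minus_neq_0 q Hq). field. auto.
Qed.

(** The falling factorial [al (al - 1) ... (al - i + 1)]. *)
Fixpoint ff (al : C) (i : nat) : C :=
  match i with O => 1 | S i' => ff al i' * (al - INR i') end.

Lemma analytic_ff (F : C -> C) (z0 : C) (i : nat) : analytic_at F z0 -> analytic_at (fun z => ff (- z) i * F z) z0.
Proof.
  revert F. induction i; intros F HF.
  - replace (fun z => ff (- z) 0 * F z) with F; auto. apply functional_extensionality. intros z. simpl. ring.
  - replace (fun z => ff (- z) (S i) * F z) with (fun z => ff (- z) i * ((-1) * (z * F z) + (- INR i) * F z)).
    + apply IHi, analytic_plus; [apply analytic_scal, analytic_mul_id, HF|apply analytic_scal, HF].
    + apply functional_extensionality. intros z. simpl. ring.
Qed.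

(** * Complex powers of positive reals *)

Definition xp (al : C) (x : R) : C := Cexp (al * ln x).

Lemma Cmod_xp (al : C) (x : R) : Cmod (xp al x) = exp (Re al * ln x).
Proof. unfold xp. rewrite Cmod_Cexp. f_equal. destruct al; simpl. ring. Qed.

Lemma xp_1 (al : C) : xp al 1 = 1.
Proof. unfold xp. rewrite ln_1, Cmult_0_r. apply Cexp_0. Qed.

Lemma is_Cder_xp (al : C) (x : R) : (0 < x)%R -> is_Cder (xp al) x (al * xp (al - 1) x).
Proof.
  intros Hx.
  replace (al * xp (al - 1) x) with (al * RtoC (/ x) * xp al x).
  - apply (is_Cder_Cexp (fun x => al * RtoC (ln x))). apply (is_Cder_scal al (fun x => RtoC (ln x))).
    apply (is_Cder_RtoC ln). apply is_derive_Reals, derivable_pt_lim_ln, Hx.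
  - unfold xp. replace ((al - 1) * ln x) with (al * ln x + RtoC (- ln x)) by (rewrite RtoC_opp; ring).
    rewrite Cexp_plus, Cexp_R, exp_Ropp, exp_ln by auto. ring.
Qed.

(** The [i]-th derivative of [x^(-s)]. *)
Definition pw (s : C) (i : nat) (x : R) : C := ff (- s) i * xp (- s - INR i) x.

Lemma is_Cder_pw (s : C) (i : nat) (x : R) : (0 < x)%R -> is_Cder (pw s i) x (pw s (S i) x).
Proof.
  intros Hx. unfold pw. cbn [ff].
  replace (ff (- s) i * (- s - INR i) * xp (- s - INR (S i)) x) with
    (ff (- s) i * ((- s - INR i) * xp (- s - INR i - 1) x)).
  - apply (is_Cder_scal _ (xp (- s - INR i))). now apply is_Cder_xp.
  - rewrite S_INR, RtoC_plus. replace (- s - (INR i + 1)) with (- s - INR i - 1) by ring. ring.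
Qed.

Lemma Ccont_xp (al : C) (x : R) : (0 < x)%R -> Ccont (xp al) x.
Proof. intros Hx. exact (is_Cder_cont _ _ _ (is_Cder_xp al x Hx)). Qed.

Lemma Qs_int (N : Z) (G : Z -> C) (K : nat) (chi : R -> C) (a b : R) :
  (0 < N)%Z -> periodic N G -> (2 <= K)%nat -> (a <= b)%R ->
  (forall x, (a <= x <= b)%R -> Ccont chi x) ->
  exists I : C, is_CRInt (fun x => Qs N G K x * chi x) a b I.
Proof.
  intros HN HG HK Hab Hchi.
  destruct (periodic_bound N G HN HG) as [B [HB0 HB]].
  destruct (Ccont_bounded chi a b Hab Hchi) as [b1 [Hb1 Hb1']].
  set (I := fun k => RInt (V := C_R_CompleteNormedModule) (fun x => tq N G K k x * chi x) a b).
  destruct (is_CRInt_CSeries (fun k x => tq N G K k x * chi x)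
    (fun x => CSeries (fun k => tq N G K k x) * chi x) I
    (fun k => (2 * B * (IZR N / (2 * PI)) ^ K * / INR (S k) ^ 2) * b1)%R a b Hab) as [H1 H2].
  - apply (ex_series_scal_r b1), ex_series_tq_bound.
  - intros k x Hx. rewrite Cmod_mult. apply Rmult_le_compat; auto using Cmod_ge_0. now apply tq_bound.
  - intros k. apply (RInt_correct (V := C_R_CompleteNormedModule) (fun x => tq N G K k x * chi x)).
    apply ex_CRInt_cont; auto. intros x Hx. apply Ccont_mult; auto using Ccont_tq.
  - intros x Hx. symmetry. apply CSeries_unique.
    apply (is_Cseries_ext (fun k => chi x * tq N G K k x)); [intros; ring|].
    rewrite Cmult_comm. apply is_Cseries_scal, tq_series; auto.
  - eexists. pose proof (is_CRInt_scal (/ sqN N) _ _ _ _ H1) as H3.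
    apply is_CRInt_ext with (3 := H3); auto. intros x _. unfold Qs. ring.
Qed.

Definition jterm (N : Z) (G : Z -> C) (K : nat) (w : R -> C) (n : nat) : C :=
  RInt (V := C_R_CompleteNormedModule) (fun x => Qs N G K x * w x) (1 + INR n) (1 + INR (S n)).

Lemma jterm_correct (N : Z) (G : Z -> C) (K : nat) (w : R -> C) (n : nat) :
  (0 < N)%Z -> periodic N G -> (2 <= K)%nat -> (forall x, (0 < x)%R -> Ccont w x) ->
  is_CRInt (fun x => Qs N G K x * w x) (1 + INR n) (1 + INR (S n)) (jterm N G K w n).
Proof.
  intros HN HG HK Hw. pose proof (pos_INR n). pose proof (S_INR n).
  apply (RInt_correct (V := C_R_CompleteNormedModule) (fun x => Qs N G K x * w x)).
  destruct (Qs_int N G K w (1 + INR n) (1 + INR (S n)) HN HG HK ltac:(lra)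
    ltac:(intros x Hx; apply Hw; lra)) as [I HI]. now exists I.
Qed.

Lemma jterm_psum (N : Z) (G : Z -> C) (K : nat) (w : R -> C) (T : nat) :
  (0 < N)%Z -> periodic N G -> (2 <= K)%nat -> (forall x, (0 < x)%R -> Ccont w x) ->
  is_CRInt (fun x => Qs N G K x * w x) 1 (1 + INR T) (psum (jterm N G K w) T).
Proof.
  intros HN HG HK Hw. induction T.
  - simpl. rewrite Rplus_0_r. apply is_CRInt_point.
  - cbn [psum]. apply (is_CRInt_chasles _ _ (1 + INR T)); auto. now apply jterm_correct.
Qed.

(** The integral over [x >= 1] of the periodic primitive against [x^(- s - K)], cut at the integers
    into a series. Convergence and dependence on [s] then become questions about series of integrals
    over compact intervals. *)
Definition Jint (N : Z) (G : Z -> C) (K : nat) (s : C) : C :=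
  CSeries (jterm N G K (xp (- s - INR K))).

Lemma ln_ge_0 (x : R) : (1 <= x)%R -> (0 <= ln x)%R.
Proof.
  intros [H|H]; [left; rewrite <- ln_1; apply ln_increasing; lra|rewrite <- H, ln_1; lra].
Qed.

Lemma ln_le' (x y : R) : (0 < x <= y)%R -> (ln x <= ln y)%R.
Proof. intros [H0 [H|H]]; [left; now apply ln_increasing|rewrite H; lra]. Qed.

Lemma exp_ln_inv_sqr (x : R) : (0 < x)%R -> exp (- 2 * ln x) = (/ x ^ 2)%R.
Proof.
  intros Hx. replace (- 2 * ln x)%R with (- ln x + - ln x)%R by ring.
  rewrite exp_plus, exp_Ropp, exp_ln by auto. field. lra.
Qed.

Lemma Cmod_xp_le (al : C) (x y : R) : (Re al <= -2)%R -> (1 <= y <= x)%R -> (Cmod (xp al x) <= / y ^ 2)%R.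
Proof.
  intros Ha Hx. rewrite Cmod_xp, <- exp_ln_inv_sqr by lra. apply exp_le.
  pose proof (ln_ge_0 y ltac:(lra)). pose proof (ln_le' y x ltac:(lra)). nra.
Qed.

Lemma jterm_bound (N : Z) (G : Z -> C) (K : nat) (s : C) (B : R) (n : nat) :
  (0 < N)%Z -> periodic N G -> (2 <= K)%nat -> (2 <= Re s + INR K)%R ->
  (forall x, (Cmod (Qs N G K x) <= B)%R) ->
  (Cmod (jterm N G K (xp (- s - INR K)) n) <= B * / INR (S n) ^ 2)%R.
Proof.
  intros HN HG HK Hs HB. pose proof (pos_INR n). pose proof (S_INR n) as HS.
  replace (B * / INR (S n) ^ 2)%R with ((1 + INR (S n) - (1 + INR n)) * (B * / INR (S n) ^ 2))%R by (rewrite HS; ring).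
  apply is_CRInt_norm_const with (3 := jterm_correct N G K _ n HN HG HK (fun x Hx => Ccont_xp _ x Hx)); [lra|].
  intros x Hx. rewrite Cmod_mult. apply Rmult_le_compat; auto using Cmod_ge_0.
  apply Cmod_xp_le; [|lra]. simpl. unfold Re in Hs. lra.
Qed.

Lemma Jint_series (N : Z) (G : Z -> C) (K : nat) (s : C) :
  (0 < N)%Z -> periodic N G -> (2 <= K)%nat -> (2 <= Re s + INR K)%R ->
  is_Cseries (jterm N G K (xp (- s - INR K))) (Jint N G K s).
Proof.
  intros HN HG HK Hs. destruct (Qs_bound N G K HN HG HK) as [B [HB0 HB]].
  apply (is_CSeries_le _ (fun n => B * / INR (S n) ^ 2)%R).
  - intros n. now apply jterm_bound.
  - apply ex_series_tq_bound.
Qed.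

Lemma psum_lim (a : nat -> C) (l : C) : is_Cseries a l -> Clim (psum a) eventually l.
Proof.
  intros H. apply (proj1 (Clim_eps eventually _ _)). intros eps He.
  destruct (proj2 (Clim_eps eventually _ _) H eps He) as [M HM].
  exists (S M). intros n Hn. destruct n; [lia|]. rewrite psum_sum_n. apply HM. lia.
Qed.

(** * Continuation of the Dirichlet series *)

(** The Euler-Maclaurin formula of order [K] on the half-line from 1, applied to [x^(-s)]. *)
Definition FK (N : Z) (G : Z -> C) (K : nat) (s : C) : C :=
  dft N G 1 + G 0%Z / sqN N * / (s - 1) + BB N G (pw s) K 1 + (-1) ^ K * ff (- s) K * Jint N G K s.

Lemma Cpow_m1_sqr n : (-1) ^ n * (-1) ^ n = 1.
Proof.
  induction n; simpl; [ring|].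
  replace (-1 * (-1) ^ n * (-1 * (-1) ^ n)) with ((-1) ^ n * (-1) ^ n) by ring. exact IHn.
Qed.

Definition Psi (s : C) (x : R) : C := xp (1 - s) x * / (1 - s).

Definition XT (N : Z) (G : Z -> C) (s : C) (T : nat) : C :=
  psum (fun k => dft N G (1 + Z.of_nat (S k)) * pw s 0 (1 + INR (S k))) T
    - G 0%Z / sqN N * (Psi s (1 + INR T) - Psi s 1).

Lemma one_minus_s_neq_0 (s : C) : s <> 1 -> 1 - s <> 0.
Proof. intros H. apply Cminus_eq_contra. auto. Qed.

Lemma EM_pw (N : Z) (G : Z -> C) (K : nat) (s : C) (T : nat) :
  (0 < N)%Z -> periodic N G -> (2 <= K)%nat -> s <> 1 ->
  XT N G s T + BB N G (pw s) K (1 + Z.of_nat T) =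
  BB N G (pw s) K 1 + (-1) ^ K * ff (- s) K * psum (jterm N G K (xp (- s - INR K))) T.
Proof.
  intros HN HG HK Hs.
  pose proof (EM N G 1 (Psi s) (pw s) T K HN HG HK) as H.
  assert (HD : forall x, (1 <= x)%R -> is_Cder (Psi s) x (pw s 0 x) /\ forall i, is_Cder (pw s i) x (pw s (S i) x)).
  { intros x Hx. split; [|intros i; apply is_Cder_pw; lra].
    apply (is_Cder_ext (fun x => / (1 - s) * xp (1 - s) x)); [intros; unfold Psi; ring|].
    replace (pw s 0 x) with (/ (1 - s) * ((1 - s) * xp (1 - s - 1) x)).
    - apply (is_Cder_scal _ (xp (1 - s))). apply is_Cder_xp. lra.
    - unfold pw. simpl. replace (1 - s - 1) with (- s - 0) by ring.
      field. now apply one_minus_s_neq_0. }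
  specialize (H HD).
  pose proof (is_CRInt_scal (ff (- s) K) _ _ _ _
    (jterm_psum N G K (xp (- s - INR K)) T HN HG HK (fun x Hx => Ccont_xp _ x Hx))) as H2.
  assert (H3 : is_CRInt (fun x => Qs N G K x * pw s K x) 1 (1 + INR T) (ff (- s) K * psum (jterm N G K (xp (- s - INR K))) T)).
  { pose proof (pos_INR T). apply is_CRInt_ext with (3 := H2); [lra|]. intros x _. unfold pw. ring. }
  pose proof (is_CRInt_unique _ _ _ _ _ H H3) as E.
  rewrite <- Cmult_assoc, <- E, Cmult_assoc, Cpow_m1_sqr. unfold XT. ring.
Qed.

Lemma EM_pw_lim (N : Z) (G : Z -> C) (K : nat) (s : C) :
  (0 < N)%Z -> periodic N G -> (2 <= K)%nat -> s <> 1 -> (2 <= Re s + INR K)%R ->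
  Clim (fun T => dft N G 1 + G 0%Z / sqN N * / (s - 1) + (XT N G s T + BB N G (pw s) K (1 + Z.of_nat T)))
    eventually (FK N G K s).
Proof.
  intros HN HG HK Hs HR. unfold FK.
  apply (filterlim_ext (fun T => dft N G 1 + G 0%Z / sqN N * / (s - 1) + BB N G (pw s) K 1 +
    (-1) ^ K * ff (- s) K * psum (jterm N G K (xp (- s - INR K))) T)).
  { intros T. rewrite EM_pw by auto. ring. }
  apply (Clim_plus eventually (fun _ => _)); [apply filterlim_const|].
  apply (Clim_mult eventually (fun _ => _)); [apply filterlim_const|].
  apply psum_lim. now apply Jint_series.
Qed.

Lemma xp_lim (al : C) : (Re al < 0)%R -> Clim (fun T : nat => xp al (1 + INR T)) eventually (RtoC 0).
Proof.
  intros Ha. apply (Clim_squeeze0 eventually _ (fun T => exp (Re al * ln (1 + INR T)))).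
  - exists 0%nat. intros T _. rewrite Cmod_xp. lra.
  - change (is_lim_seq (fun T => exp (Re al * ln (1 + INR T))) 0%R).
    apply (is_lim_seq_ext (fun T => exp (Re al * ln (INR (S T))))).
    { intros T. rewrite S_INR. f_equal. f_equal. f_equal. ring. }
    apply (filterlim_comp _ _ _ (fun T => Re al * ln (INR (S T)))%R exp eventually (Rbar_locally m_infty)).
    + assert (H : is_lim_seq (fun T => Re al * ln (INR (S T)))%R (Rbar_mult (Re al) p_infty)).
      { apply is_lim_seq_scal_l. apply (is_lim_seq_incr_1 (fun T => ln (INR T))).
        apply (filterlim_comp _ _ _ INR ln eventually (Rbar_locally p_infty)); [exact is_lim_seq_INR|].
        exact is_lim_ln_p. }
      replace (Rbar_mult (Re al) p_infty) with m_infty in H; [exact H|].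
      symmetry. apply is_Rbar_mult_unique, is_Rbar_mult_sym, is_Rbar_mult_p_infty_neg. exact Ha.
    + exact is_lim_exp_m.
Qed.

Lemma Clim_0_bounded {T} (F : (T -> Prop) -> Prop) {FF : Filter F} (f g : T -> C) (B : R) :
  Clim f F (RtoC 0) -> (forall x, (Cmod (g x) <= B)%R) -> Clim (fun x => f x * g x) F (RtoC 0).
Proof.
  intros Hf Hg. apply (proj1 (Clim_eps F _ _)). intros eps He.
  assert (He2 : (0 < eps / (Rabs B + 1))%R).
  { apply Rdiv_lt_0_compat; auto. pose proof (Rabs_pos B). lra. }
  apply filter_imp with (2 := proj2 (Clim_eps F _ _) Hf _ He2). intros x Hx.
  replace (f x * g x - 0) with (f x * g x) by ring. replace (f x - 0) with (f x) in Hx by ring.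
  rewrite Cmod_mult. pose proof (Cmod_ge_0 (f x)). pose proof (Cmod_ge_0 (g x)).
  pose proof (Rle_abs B). specialize (Hg x). pose proof (Rabs_pos B).
  apply Rle_lt_trans with (Cmod (f x) * (Rabs B + 1))%R; [apply Rmult_le_compat_l; lra|].
  apply Rlt_le_trans with (eps / (Rabs B + 1) * (Rabs B + 1))%R; [apply Rmult_lt_compat_r; lra|].
  right. field. lra.
Qed.

Lemma Q1_periodic (N : Z) (G : Z -> C) : (0 < N)%Z -> periodic N (Q1 N G).
Proof.
  intros HN n. unfold Q1. f_equal. apply sum_mod_ext; auto. intros k _.
  replace (n + N + 1 + k)%Z with (n + 1 + k + N)%Z by lia. now rewrite dft_periodic.
Qed.

Lemma Qv_bound (N : Z) (G : Z -> C) (i : nat) : (0 < N)%Z -> periodic N G -> (1 <= i)%nat ->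
  exists B : R, forall n, (Cmod (Qv N G i n) <= B)%R.
Proof.
  intros HN HG Hi. destruct i as [|[|i]]; [lia| |].
  - destruct (periodic_bound N (Q1 N G) HN (Q1_periodic N G HN)) as [B [_ HB]]. now exists B.
  - destruct (Qs_bound N G (S (S i)) HN HG ltac:(lia)) as [B [_ HB]]. exists B. intros n. apply HB.
Qed.

Lemma BB_term_lim (N : Z) (G : Z -> C) (K : nat) (s : C) : (0 < N)%Z -> periodic N G ->
  (0 < Re s + INR K)%R ->
  Clim (fun T => (-1) ^ S K * pw s K (IZR (1 + Z.of_nat T)) * Qv N G (S K) (1 + Z.of_nat T)) eventually (RtoC 0).
Proof.
  intros HN HG HR. destruct (Qv_bound N G (S K) HN HG ltac:(lia)) as [B HB].
  apply (Clim_0_bounded eventually (fun T => (-1) ^ S K * pw s K (IZR (1 + Z.of_nat T))) _ B); auto.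
  apply (filterlim_ext (fun T => ((-1) ^ S K * ff (- s) K) * xp (- s - INR K) (1 + INR T))).
  { intros T. rewrite IZR_add_nat. unfold pw. ring. }
  replace (RtoC 0) with (((-1) ^ S K * ff (- s) K) * 0) by ring.
  apply (Clim_mult eventually (fun _ => _)); [apply filterlim_const|]. apply xp_lim. simpl. unfold Re in HR. lra.
Qed.

(** For finite [T] the expressions of orders [K] and [K + 1] differ by one boundary term at [1 + T],
    which tends to 0 when [Re s + K > 0]; both orders are limits of these expressions. *)
Lemma FK_succ (N : Z) (G : Z -> C) (K : nat) (s : C) :
  (0 < N)%Z -> periodic N G -> (2 <= K)%nat -> s <> 1 -> (2 <= Re s + INR K)%R ->
  FK N G (S K) s = FK N G K s.
Proof.
  intros HN HG HK Hs HR.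
  apply (Clim_unique eventually (fun T => dft N G 1 + G 0%Z / sqN N * / (s - 1) + (XT N G s T + BB N G (pw s) (S K) (1 + Z.of_nat T)))).
  - apply EM_pw_lim; auto. rewrite S_INR. lra.
  - pose proof (Clim_plus eventually _ _ _ _ (EM_pw_lim N G K s HN HG HK Hs HR) (BB_term_lim N G K s HN HG ltac:(lra))) as H.
    rewrite Cplus_0_r in H. apply filterlim_ext with (2 := H). intros T. cbn [BB]. ring.
Qed.

Lemma FK_eq (N : Z) (G : Z -> C) (K K' : nat) (s : C) :
  (0 < N)%Z -> periodic N G -> (2 <= K)%nat -> (2 <= K')%nat -> s <> 1 ->
  (2 <= Re s + INR K)%R -> (2 <= Re s + INR K')%R -> FK N G K s = FK N G K' s.
Proof.
  intros HN HG HK HK' Hs HR HR'.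
  assert (H : forall a b, (a <= b)%nat -> (2 <= a)%nat -> (2 <= Re s + INR a)%R -> FK N G b s = FK N G a s).
  { intros a b Hab Ha HRa. induction Hab as [|b Hab IH]; [reflexivity|].
    rewrite <- IH. apply FK_succ; auto; [lia|]. apply le_INR in Hab. lra. }
  destruct (le_dec K K'); [symmetry|]; apply H; auto; lia.
Qed.

(** For [Re s > 1] the primitive of [x^(-s)] and all boundary terms at the far end tend to 0, so the
    limit that defines [FK] is that of the partial sums of the Dirichlet series. *)
Lemma FK_dirichlet (N : Z) (G : Z -> C) (K : nat) (s : C) :
  (0 < N)%Z -> periodic N G -> (2 <= K)%nat -> (1 < Re s)%R ->
  is_Cseries (fun n : nat => dft N G (Z.of_nat (S n)) * Cexp (- s * ln (INR (S n)))) (FK N G K s).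
Proof.
  intros HN HG HK HR.
  assert (Hs : s <> 1) by (intros ->; simpl in HR; lra).
  pose proof (pos_INR K) as HK0. pose proof (le_INR _ _ HK) as HK2. simpl in HK2.
  assert (HB : forall k, Clim (fun T => BB N G (pw s) k (1 + Z.of_nat T)) eventually (RtoC 0)).
  { induction k.
    { apply (filterlim_ext (fun _ => RtoC 0)); [reflexivity|]. exact (Clim_const eventually 0). }
    pose proof (pos_INR k).
    pose proof (Clim_plus eventually _ _ _ _ IHk (BB_term_lim N G k s HN HG ltac:(lra))) as HS.
    rewrite Cplus_0_r in HS. exact HS. }
  assert (HP : Clim (fun T => Psi s (1 + INR T)) eventually (RtoC 0)).
  { unfold Psi. replace (RtoC 0) with (0 * / (1 - s)) by ring.
    apply (Clim_mult eventually _ (fun _ => _)); [|apply filterlim_const]. apply xp_lim. simpl. unfold Re in HR. lra. }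
  pose proof (EM_pw_lim N G K s HN HG HK Hs ltac:(lra)) as H1.
  pose proof (Clim_minus eventually _ _ _ _ H1 (HB K)) as H2.
  pose proof (Clim_plus eventually _ _ _ _ H2 (Clim_mult eventually _ _ _ _ (Clim_const eventually (G 0%Z / sqN N)) HP)) as H3.
  replace (FK N G K s - 0 + G 0%Z / sqN N * 0) with (FK N G K s) in H3 by ring.
  unfold is_series. apply filterlim_ext with (2 := H3). intros T.
  assert (E : Psi s 1 = / (1 - s)) by (unfold Psi; rewrite xp_1; ring).
  assert (E2 : / (s - 1) = - / (1 - s)).
  { pose proof (one_minus_s_neq_0 s Hs). field. split; auto. apply Cminus_eq_contra, Hs. }
  assert (HS : forall T, sum_n (fun n : nat => dft N G (Z.of_nat (S n)) * Cexp (- s * ln (INR (S n)))) T =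
    dft N G 1 + psum (fun k => dft N G (1 + Z.of_nat (S k)) * pw s 0 (1 + INR (S k))) T).
  { clear T. induction T.
    - rewrite Csum_O. simpl. rewrite ln_1, Cmult_0_r, Cexp_0. cring.
    - rewrite Csum_Sn, IHT. cbn [psum].
      replace (pw s 0 (1 + INR (S T))) with (Cexp (- s * ln (INR (S (S T))))).
      + replace (1 + Z.of_nat (S T))%Z with (Z.of_nat (S (S T))) by lia. cring.
      + unfold pw, xp. rewrite (S_INR (S T)). simpl ff. rewrite (Rplus_comm 1).
        replace (- s - INR 0) with (- s) by (simpl; ring). ring. }
  etransitivity; [|symmetry; apply HS]. unfold XT. rewrite E, E2. cring.
Qed.

(** Expand [x^(-h) = sum (- h ln x)^j / j!] with [h = s - s0] and [|h| < 1]. On the [n]-th interval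
    the sum of the majorants is at most a constant times [exp (ln (n + 2)) / (n + 1)^3]: the
    logarithms cost one power, which is why the exponent must be at least 3 here and only 2 for
    convergence. *)
Lemma analytic_Jint (N : Z) (G : Z -> C) (K : nat) (s0 : C) :
  (0 < N)%Z -> periodic N G -> (2 <= K)%nat -> (3 <= Re s0 + INR K)%R -> analytic_at (Jint N G K) s0.
Proof.
  intros HN HG HK HR. destruct (Qs_bound N G K HN HG HK) as [B [HB0 HB]].
  set (w := fun j x => xp (- s0 - INR K) x * RtoC ((- ln x) ^ j / INR (fact j))).
  assert (Hw : forall j x, (0 < x)%R -> Ccont (w j) x).
  { intros j x Hx. apply Ccont_mult; [now apply Ccont_xp|].
    apply (Ccont_RtoC (fun x => (- ln x) ^ j / INR (fact j))%R).
    apply (ex_derive_continuous (fun x => (- ln x) ^ j / INR (fact j))%R). auto_derive. exact Hx. }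
  set (c := fun n j => jterm N G K (w j) n).
  set (L := fun n : nat => ln (1 + INR (S n))).
  assert (HL0 : forall n, (0 <= L n)%R).
  { intros n. apply ln_ge_0. pose proof (pos_INR (S n)). lra. }
  set (D := fun n j => (B * (/ INR (S n) ^ 2 * / INR (S n)) * (L n ^ j / INR (fact j)))%R).
  assert (Hwb : forall n j x, (1 + INR n <= x <= 1 + INR (S n))%R ->
     (Cmod (Qs N G K x * w j x) <= D n j)%R).
  { intros n j x Hx. pose proof (pos_INR n). unfold w, D. rewrite !Cmod_mult, Cmod_R.
    pose proof (INR_fact_lt_0 j) as Hf. pose proof (Rinv_0_lt_compat _ Hf).
    assert (Hl : (0 <= ln x <= L n)%R).
    { split; [apply ln_ge_0; lra|]. apply ln_le'. lra. }
    assert (H1 : (Cmod (xp (- s0 - INR K) x) <= / INR (S n) ^ 2 * / INR (S n))%R).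
    { rewrite Cmod_xp. apply Rle_trans with (exp (-3 * ln (INR (S n)))).
      - apply exp_le. rewrite S_INR.
        assert (Hre : (Re (- s0 - INR K) <= -3)%R) by (simpl; unfold Re in HR; lra).
        pose proof (ln_ge_0 (INR n + 1) ltac:(lra)). pose proof (ln_le' (INR n + 1) x ltac:(lra)). nra.
      - replace (-3 * ln (INR (S n)))%R with (- 2 * ln (INR (S n)) + - ln (INR (S n)))%R by ring.
        pose proof (lt_0_INR (S n) ltac:(lia)).
        rewrite exp_plus, exp_ln_inv_sqr, exp_Ropp, exp_ln by auto. lra. }
    rewrite Rmult_assoc.
    apply Rmult_le_compat; auto using Cmod_ge_0.
    - apply Rmult_le_pos; [apply Cmod_ge_0|apply Rabs_pos].
    - apply Rmult_le_compat; auto using Cmod_ge_0, Rabs_pos.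
      unfold Rdiv. rewrite Rabs_mult, <- RPow_abs, Rabs_Ropp, (Rabs_pos_eq (ln x)), (Rabs_pos_eq (/ _)) by lra.
      apply Rmult_le_compat_r; [lra|]. apply pow_incr. lra. }
  assert (Hcb : forall n j, (Cmod (c n j) <= D n j)%R).
  { intros n j. pose proof (S_INR n) as HS.
    replace (D n j) with ((1 + INR (S n) - (1 + INR n)) * D n j)%R by (rewrite HS; ring).
    apply is_CRInt_norm_const with (3 := jterm_correct N G K (w j) n HN HG HK (Hw j)); [lra|]. apply Hwb. }
  assert (HDs : forall n, is_series (D n) (B * (/ INR (S n) ^ 2 * / INR (S n)) * exp (L n))%R).
  { intros n. apply (is_series_scal (V := R_NormedModule)). apply is_series_exp. }
  assert (HDD : ex_series (fun n => Series (D n))).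
  { apply (ex_series_le (V := R_CompleteNormedModule) _ (fun n => (B * 2) * / INR (S n) ^ 2)%R); [|apply ex_series_tq_bound].
    intros n. rewrite (is_series_unique _ _ (HDs n)).
    change (norm (B * (/ INR (S n) ^ 2 * / INR (S n)) * exp (L n))%R) with (Rabs (B * (/ INR (S n) ^ 2 * / INR (S n)) * exp (L n))).
    unfold L. rewrite exp_ln by (pose proof (pos_INR (S n)); lra).
    pose proof (lt_0_INR (S n) ltac:(lia)) as Hn. pose proof (Rinv_0_lt_compat _ Hn) as Hi.
    assert (H1 : (0 < / INR (S n) ^ 2)%R) by (apply Rinv_0_lt_compat; nra).
    rewrite Rabs_pos_eq.
    2:{ apply Rmult_le_pos; [|lra]. apply Rmult_le_pos; auto. nra. }
    assert (H2 : (/ INR (S n) * (1 + INR (S n)) <= 2)%R).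
    { apply Rmult_le_reg_l with (INR (S n)); auto. rewrite <- Rmult_assoc, Rinv_r by lra.
      rewrite S_INR in *. pose proof (pos_INR n). lra. }
    replace (B * (/ INR (S n) ^ 2 * / INR (S n)) * (1 + INR (S n)))%R with
      ((B * / INR (S n) ^ 2) * (/ INR (S n) * (1 + INR (S n))))%R by ring.
    replace (B * 2 * / INR (S n) ^ 2)%R with ((B * / INR (S n) ^ 2) * 2)%R by ring.
    apply Rmult_le_compat_l; auto. apply Rmult_le_pos; lra. }
  apply (analytic_at_intro _ _ (fun j => CSeries (fun n => c n j)) 1); [lra|].
  intros s Hs. set (h := s - s0) in *.
  assert (Hhj : forall j, (Cmod h ^ j <= 1)%R).
  { intros j. rewrite <- (pow1 j). apply pow_incr. split; [apply Cmod_ge_0|lra]. }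
  assert (Hj : forall n, jterm N G K (xp (- s - INR K)) n = CSeries (fun j => h ^ j * c n j)).
  { intros n. pose proof (S_INR n) as HSn. pose proof (pos_INR n).
    destruct (is_CRInt_CSeries (fun j x => h ^ j * (Qs N G K x * w j x)) (fun x => Qs N G K x * xp (- s - INR K) x)
       (fun j => h ^ j * c n j) (D n) (1 + INR n) (1 + INR (S n))) as [H1 _].
    - lra.
    - eexists; apply HDs.
    - intros j x Hx. rewrite Cmod_mult, Cmod_pow. rewrite <- (Rmult_1_l (D n j)).
      apply Rmult_le_compat; auto using Cmod_ge_0. apply pow_le, Cmod_ge_0.
    - intros j. apply is_CRInt_scal. exact (jterm_correct N G K (w j) n HN HG HK (Hw j)).
    - intros x Hx. symmetry. apply CSeries_unique.
      replace (Qs N G K x * xp (- s - INR K) x) with (Qs N G K x * xp (- s0 - INR K) x * Cexp (- h * ln x)).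
      + apply (is_Cseries_ext (fun j => Qs N G K x * xp (- s0 - INR K) x * ((- h * ln x) ^ j / INR (fact j)))).
        * intros j. unfold w. rewrite RtoC_div by apply INR_fact_neq_0. rewrite RtoC_pow, RtoC_opp.
          replace (- h * ln x) with (h * - ln x) by ring. rewrite Cpow_mult_l. unfold Cdiv. ring.
        * apply is_Cseries_scal, is_Cseries_exp.
      + unfold xp. rewrite <- Cmult_assoc, <- Cexp_plus. f_equal. f_equal. unfold h. ring.
    - pose proof (jterm_correct N G K (xp (- s - INR K)) n HN HG HK (fun x Hx => Ccont_xp _ x Hx)) as H2.
      exact (is_CRInt_unique _ _ _ _ _ H2 H1). }
  assert (HF : is_Cseries (fun j => CSeries (fun n => h ^ j * c n j)) (CSeries (fun n => CSeries (fun j => h ^ j * c n j)))).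
  { apply (CSeries_fubini (fun n j => h ^ j * c n j) D); auto.
    - intros n j. rewrite Cmod_mult, Cmod_pow. rewrite <- (Rmult_1_l (D n j)).
      apply Rmult_le_compat; auto using Cmod_ge_0. apply pow_le, Cmod_ge_0.
    - intros n. eexists; apply HDs. }
  replace (Jint N G K s) with (CSeries (fun n => CSeries (fun j => h ^ j * c n j))).
  - apply is_Cseries_ext with (2 := HF). intros j. apply CSeries_unique, is_Cseries_scal.
    apply (is_CSeries_le _ (fun n => Series (D n))); auto.
    intros n. apply Rle_trans with (1 := Hcb n j).
    assert (Hp : forall j, (0 <= D n j)%R) by (intros j'; apply Rle_trans with (2 := Hcb n j'), Cmod_ge_0).
    apply Rle_trans with (sum_n (D n) j); [|apply sum_n_le_Series; auto; eexists; apply HDs].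
    destruct j; [rewrite Rsum_O; lra|]. rewrite Rsum_Sn.
    assert (0 <= sum_n (D n) j)%R.
    { apply Rle_trans with (sum_n (D n) 0%nat); [rewrite Rsum_O; auto|]. apply sum_n_nonneg_incr; auto with arith. }
    lra.
  - apply CSeries_ext. intros n. symmetry. apply Hj.
Qed.

Lemma analytic_ext (F F' : C -> C) (z0 : C) (r : R) : (0 < r)%R ->
  (forall z, (Cmod (z - z0) < r)%R -> F z = F' z) -> analytic_at F z0 -> analytic_at F' z0.
Proof.
  intros Hr HE HF. destruct (analytic_at_elim _ _ HF) as [a [r' [Hr' H]]].
  apply (analytic_at_intro _ _ a (Rmin r r')); [now apply Rmin_pos|].
  intros z Hz. rewrite <- HE by (apply Rlt_le_trans with (1 := Hz), Rmin_l).
  apply H. apply Rlt_le_trans with (1 := Hz), Rmin_r.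
Qed.

Lemma analytic_FK (N : Z) (G : Z -> C) (K : nat) (s0 : C) :
  (0 < N)%Z -> periodic N G -> (2 <= K)%nat -> s0 <> 1 -> (3 <= Re s0 + INR K)%R -> analytic_at (FK N G K) s0.
Proof.
  intros HN HG HK Hs HR. unfold FK.
  apply (analytic_plus (fun s => dft N G 1 + G 0%Z / sqN N * / (s - 1) + BB N G (pw s) K 1)
    (fun s => (-1) ^ K * ff (- s) K * Jint N G K s)).
  - apply (analytic_plus (fun s => dft N G 1 + G 0%Z / sqN N * / (s - 1)) (fun s => BB N G (pw s) K 1)).
    + apply (analytic_plus (fun s => dft N G 1) (fun s => G 0%Z / sqN N * / (s - 1))); [apply analytic_const|].
      apply analytic_scal, analytic_inv, Hs.
    + clear HK HR. induction K; cbn [BB]; [exact (analytic_const 0 s0)|].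
      apply (analytic_plus (fun s => BB N G (pw s) K 1)); auto.
      apply (analytic_ext (fun s => ((-1) ^ S K * Qv N G (S K) 1) * (ff (- s) K * 1)) _ s0 1); [lra| |].
      * intros z _. unfold pw. rewrite xp_1. ring.
      * apply analytic_scal, (analytic_ff (fun _ => RtoC 1)), analytic_const.
  - apply (analytic_ext (fun s => (-1) ^ K * (ff (- s) K * Jint N G K s)) _ s0 1); [lra|intros; ring|].
    apply analytic_scal, analytic_ff. now apply analytic_Jint.
Qed.

(** An order large enough at [s]; the two successors keep it at least 2 when [Re s] is large. *)
Definition Ks (s : C) : nat := S (S (Z.to_nat (up (2 - Re s)))).

Lemma Ks_spec (s : C) : (2 <= Re s + INR (Ks s))%R.
Proof.
  unfold Ks. destruct (archimed (2 - Re s)) as [H _].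
  destruct (Z_le_gt_dec 0 (up (2 - Re s))) as [Hz|Hz].
  - rewrite !S_INR, INR_IZR_INZ, Z2Nat.id by exact Hz. lra.
  - assert (IZR (up (2 - Re s)) <= -1)%R by (apply IZR_le; lia).
    pose proof (pos_INR (S (S (Z.to_nat (up (2 - Re s)))))). lra.
Qed.

Definition Lc (N : Z) (G : Z -> C) (s : C) : C := FK N G (Ks s) s.

Lemma Lc_eq (N : Z) (G : Z -> C) (K : nat) (s : C) :
  (0 < N)%Z -> periodic N G -> (2 <= K)%nat -> s <> 1 -> (2 <= Re s + INR K)%R -> Lc N G s = FK N G K s.
Proof.
  intros HN HG HK Hs HR. apply FK_eq; auto; [unfold Ks; lia|apply Ks_spec].
Qed.

Lemma Lc_continuation (N : Z) (G : Z -> C) : (0 < N)%Z -> periodic N G ->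
  is_L_continuation (dft N G) (Lc N G).
Proof.
  intros HN HG. split.
  (* Two extra orders allow one fixed [K] on a disc of radius at most 1 around [s], where the values
     do not depend on the order; the disc also stays away from 1. *)
  - intros s Hs. set (K := S (S (Ks s))).
    assert (HK : (4 <= Re s + INR K)%R) by (unfold K; rewrite !S_INR; pose proof (Ks_spec s); lra).
    assert (Hd : (0 < Cmod (s - 1))%R) by (apply Cmod_gt_0, Cminus_eq_contra, Hs).
    apply (analytic_ext (FK N G K) _ s (Rmin 1 (Cmod (s - 1)))); [apply Rmin_pos; lra| |].
    + intros z Hz. symmetry. apply Lc_eq; auto; [unfold K, Ks; lia| |].
      * intros ->. assert (H := Rlt_le_trans _ _ _ Hz (Rmin_r _ _)). rewrite Cmod_sub_sym in H. lra.
      * assert (H := Rlt_le_trans _ _ _ Hz (Rmin_l _ _)).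
        pose proof (Cmod_Re_le (z - s)) as H2. replace (Re (z - s)) with (Re z - Re s)%R in H2 by reflexivity.
        assert (H3 : (Rabs (Re z - Re s) < 1)%R) by lra. apply Rabs_def2 in H3. lra.
    + apply analytic_FK; auto; [unfold K, Ks; lia|lra].
  - intros s Hs. apply FK_dirichlet; auto. unfold Ks; lia.
Qed.

(** * Values at the non-positive integers *)

(** The [i]-th derivative of [x^k], in a form that makes sense at [x = 0], where [pw] relies on a
    logarithm. The truncated exponent for [i > k] is harmless because [ff] vanishes. *)
Definition pk (k i : nat) (x : R) : C := ff (INR k) i * RtoC (x ^ (k - i)).

Lemma ff_zero (k i : nat) : (k < i)%nat -> ff (INR k) i = 0.
Proof.
  intros H. induction H as [|i H IH]; simpl; [|rewrite IH; ring].
  replace (INR k - INR k) with (RtoC 0) by ring. ring.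
Qed.

Lemma is_Cder_pk (k i : nat) (x : R) : is_Cder (pk k i) x (pk k (S i) x).
Proof.
  destruct (le_lt_dec i k) as [H|H].
  - unfold pk. cbn [ff]. rewrite <- Cmult_assoc.
    apply (is_Cder_scal _ (fun x => RtoC (x ^ (k - i)))).
    rewrite <- RtoC_minus, <- RtoC_mult, <- minus_INR by auto.
    apply (is_Cder_RtoC (fun x => x ^ (k - i))%R). auto_derive; [trivial|].
    replace (k - S i)%nat with (pred (k - i)) by lia. ring.
  - apply (is_Cder_ext (fun _ => RtoC 0)); [intros t; unfold pk; rewrite ff_zero by auto; ring|].
    unfold pk. rewrite ff_zero by lia. rewrite Cmult_0_l. apply is_Cder_const.
Qed.

Lemma BB_ext (N : Z) (G : Z -> C) (p p' : nat -> R -> C) (K : nat) (n : Z) :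
  (forall i, p i (IZR n) = p' i (IZR n)) -> BB N G p K n = BB N G p' K n.
Proof. intros H. induction K; cbn [BB]; [reflexivity|]. now rewrite IHK, H. Qed.

Lemma ff_fact (k : nat) : ff (INR k) k = INR (fact k).
Proof.
  assert (H : forall i, (i <= k)%nat -> ff (INR k) i * INR (fact (k - i)) = INR (fact k)).
  { induction i; intros Hi.
    - simpl. rewrite Nat.sub_0_r. ring.
    - rewrite <- IHi by lia. cbn [ff]. rewrite <- RtoC_minus, <- minus_INR by lia.
      replace (k - i)%nat with (S (k - S i)) by lia. rewrite fact_simpl, mult_INR, RtoC_mult. ring. }
  specialize (H k ltac:(lia)). rewrite Nat.sub_diag in H. simpl fact in H. rewrite <- H. simpl. ring.
Qed.

Lemma BB_pk_0 (N : Z) (G : Z -> C) (k : nat) :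
  BB N G (pk k) (S (S k)) 0 = (-1) ^ S k * INR (fact k) * Qv N G (S k) 0.
Proof.
  assert (H : forall i, (i <= k)%nat -> BB N G (pk k) i 0 = 0).
  { induction i; intros Hi; cbn [BB]; [reflexivity|]. rewrite IHi by lia.
    unfold pk. rewrite pow_i by lia. ring. }
  cbn [BB]. rewrite H by auto. unfold pk at 2. rewrite ff_zero by lia.
  unfold pk. rewrite Nat.sub_diag, ff_fact. simpl pow. ring.
Qed.

(** At [s = - k] and order [k + 2] the remainder integral is killed by [ff]. Applying the summation
    formula to [x^k] on [[0, 1]], again without remainder, trades the boundary terms at 1 for those
    at 0, where only the [k]-th derivative [k!] survives. This generalizes the expression of zeta
    values by Bernoulli numbers. *)
Lemma Lc_value (N : Z) (G : Z -> C) (k : nat) : (0 < N)%Z -> periodic N G ->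
  Lc N G (- INR k) = (-1) ^ S k * INR (fact k) * Qv N G (S k) 0.
Proof.
  intros HN HG. pose proof (pos_INR k) as Hk0.
  assert (Hs : - INR k <> 1).
  { rewrite <- RtoC_opp. intros E. apply RtoC_inj in E. lra. }
  rewrite (Lc_eq N G (S (S k))); auto; [|lia|rewrite !S_INR; simpl; lra].
  unfold FK. replace (- - INR k) with (RtoC (INR k)) by ring. rewrite (ff_zero k (S (S k))) by lia.
  pose proof (EM N G 0 (fun x => / (INR k + 1) * RtoC (x ^ S k)) (pk k) 1 (S (S k)) HN HG ltac:(lia)) as H.
  assert (Hk1 : RtoC (INR k) + 1 <> 0).
  { rewrite <- RtoC_plus. intros E. apply RtoC_inj in E. lra. }
  assert (HD : forall x, (0 <= x)%R -> is_Cder (fun x => / (INR k + 1) * RtoC (x ^ S k)) x (pk k 0 x) /\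
     forall i, is_Cder (pk k i) x (pk k (S i) x)).
  { intros x _. split; [|intros; apply is_Cder_pk].
    unfold pk. cbn [ff]. rewrite Nat.sub_0_r.
    replace (1 * RtoC (x ^ k)) with (/ (INR k + 1) * RtoC (INR (S k) * x ^ k)).
    - apply (is_Cder_scal _ (fun x => RtoC (x ^ S k))). apply (is_Cder_RtoC (fun x => x ^ S k)%R).
      apply is_derive_Reals. exact (derivable_pt_lim_pow x (S k)).
    - rewrite RtoC_mult, S_INR, RtoC_plus. field. exact Hk1. }
  specialize (H HD).
  assert (H0 : is_CRInt (fun x => Qs N G (S (S k)) x * pk k (S (S k)) x) 0 (0 + INR 1) (RtoC 0)).
  { pose proof (is_CRInt_scal 0 _ _ _ _ H) as H2. rewrite Cmult_0_l in H2.
    apply is_CRInt_ext with (3 := H2); [simpl; lra|]. intros x _. unfold pk. rewrite ff_zero by lia. ring. }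
  pose proof (is_CRInt_unique _ _ _ _ _ H H0) as E.
  apply (f_equal (fun z => (-1) ^ S (S k) * z)) in E.
  rewrite Cmult_assoc, Cpow_m1_sqr, Cmult_0_r, Cmult_1_l in E. cbn [psum] in E.
  rewrite BB_pk_0 in E.
  replace (BB N G (pw (- INR k)) (S (S k)) 1) with (BB N G (pk k) (S (S k)) 1).
  2:{ apply BB_ext. intros i. unfold pw, pk. rewrite xp_1, pow1.
      replace (- - INR k) with (RtoC (INR k)) by ring. reflexivity. }
  replace (/ (- INR k - 1)) with (- / (INR k + 1)).
  2:{ field. split; auto. intros E2. apply Hs. replace (- INR k) with ((- INR k - 1) + 1) by ring. rewrite E2. ring. }
  simpl Z.of_nat in E. simpl Z.add in E.
  replace (pk k 0 (0 + INR 1)) with (RtoC 1) in E.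
  2:{ unfold pk. simpl INR. rewrite Rplus_0_l, pow1. simpl. ring. }
  simpl INR in E. rewrite Rplus_0_l, pow1, pow_i in E by lia.
  match goal with |- ?l = ?r => transitivity ((l - r) + r); [ring|] end.
  match type of E with ?l = _ => match goal with |- ?x + _ = _ => replace x with l end end.
  - rewrite E. ring.
  - ring.
Qed.

(** * Uniqueness of analytic continuation *)

Lemma is_Cseries_term_bound (a : nat -> C) (l : C) : is_Cseries a l ->
  exists M : R, (0 <= M)%R /\ forall n, (Cmod (a n) <= M)%R.
Proof.
  intros H.
  destruct (proj2 (Clim_eps eventually _ _) H 1%R ltac:(lra)) as [K HK].
  assert (Hf : forall n, exists M : R, (0 <= M)%R /\ forall k, (k <= n)%nat -> (Cmod (a k) <= M)%R).
  { induction n as [|n [M [HM0 HM]]].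
    - exists (Cmod (a 0%nat)). split; [apply Cmod_ge_0|]. intros k Hk. replace k with 0%nat by lia. lra.
    - exists (Rmax M (Cmod (a (S n)))). split; [apply Rle_trans with (1 := HM0), Rmax_l|].
      intros k Hk. destruct (Nat.eq_dec k (S n)) as [->|Hne]; [apply Rmax_r|].
      apply Rle_trans with (2 := Rmax_l _ _), HM. lia. }
  destruct (Hf (S K)) as [M [HM0 HM]]. exists (Rmax M 2). split; [apply Rle_trans with (1 := HM0), Rmax_l|].
  intros n. destruct (le_lt_dec n (S K)) as [Hn|Hn]; [apply Rle_trans with (2 := Rmax_l _ _); auto|].
  apply Rle_trans with (2 := Rmax_r _ _). destruct n as [|n]; [lia|].
  pose proof (HK n ltac:(lia)) as H1. pose proof (HK (S n) ltac:(lia)) as H2.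
  assert (E : a (S n) = (sum_n a (S n) - l) + (l - sum_n a n)) by (rewrite Csum_Sn; ring).
  rewrite E. apply Rle_trans with (1 := Cmod_triangle _ _). rewrite (Cmod_sub_sym l).
  change (Cmod (sum_n a n - l) < 1)%R in H1. change (Cmod (sum_n a (S n) - l) < 1)%R in H2. lra.
Qed.

(** Convergence at the single point [r] bounds [a_n r^n], so on half that radius everything after
    the first term is dominated by a geometric series of ratio [1/2]. *)
Lemma power_series_at_center (a : nat -> C) (r : R) : (0 < r)%R ->
  (exists l, is_Cseries (fun j => (RtoC r) ^ j * a j) l) ->
  exists K : R, (0 <= K)%R /\ forall h l : C, (Cmod h <= r / 2)%R -> is_Cseries (fun j => h ^ j * a j) l ->
    (Cmod (l - a 0%nat) <= K * Cmod h)%R.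
Proof.
  intros Hr [l0 Hl0]. destruct (is_Cseries_term_bound _ _ Hl0) as [M [HM0 HM]].
  exists (2 * M / r)%R. split; [apply Rdiv_le_0_compat; lra|].
  intros h l Hh Hl.
  pose proof (is_Cseries_incr_n _ 0 _ Hl) as H1. rewrite Csum_O in H1. simpl in H1.
  replace (l - 1 * a 0%nat) with (l - a 0%nat) in H1 by ring.
  rewrite <- (CSeries_unique _ _ H1).
  assert (Hb : forall k, (Cmod (h * h ^ k * a (S k)) <= (M / r * Cmod h) * (/ 2) ^ k)%R).
  { intros k. specialize (HM (S k)). rewrite Cmod_mult, Cmod_pow, Cmod_R, Rabs_pos_eq in HM by lra.
    rewrite !Cmod_mult, Cmod_pow. simpl in HM.
    assert (Hp : (0 < r ^ k)%R) by (apply pow_lt; lra).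
    assert (Ha : (Cmod (a (S k)) <= M / (r * r ^ k))%R).
    { apply Rmult_le_reg_l with (r * r ^ k)%R; [nra|].
      replace (r * r ^ k * (M / (r * r ^ k)))%R with M by (field; lra). exact HM. }
    assert (Hq : (Cmod h ^ k <= (r / 2) ^ k)%R) by (apply pow_incr; split; [apply Cmod_ge_0|auto]).
    apply Rle_trans with (Cmod h * (r / 2) ^ k * (M / (r * r ^ k)))%R.
    - apply Rmult_le_compat; auto using Cmod_ge_0.
      + apply Rmult_le_pos; [apply Cmod_ge_0|apply pow_le, Cmod_ge_0].
      + apply Rmult_le_compat_l; [apply Cmod_ge_0|auto].
    - right. unfold Rdiv at 1. rewrite Rpow_mult_distr. field. lra. }
  assert (Hg : is_series (fun k => (M / r * Cmod h) * (/ 2) ^ k)%R (M / r * Cmod h * 2)%R).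
  { assert (Hq : (Rabs (/ 2) < 1)%R) by (rewrite Rabs_pos_eq; lra).
    pose proof (is_series_geom (/ 2) Hq) as Hg. replace (/ (1 - / 2))%R with 2%R in Hg by field.
    exact (is_series_scal (V := R_NormedModule) (M / r * Cmod h)%R _ _ Hg). }
  apply Rle_trans with (1 := CSeries_le _ _ Hb (ex_intro _ _ Hg)).
  rewrite (is_series_unique _ _ Hg). right. field. lra.
Qed.

(** Zeros accumulating at the centre force the constant coefficient to vanish by continuity.
    Dividing the series by [h] keeps its nonzero zeros and shifts the coefficients, hence the
    induction on [k] for all series at once. *)
Lemma power_series_zeros (k : nat) : forall (a : nat -> C) (rho : R), (0 < rho)%R ->
  (forall h : C, (Cmod h < rho)%R -> exists l, is_Cseries (fun j => h ^ j * a j) l) ->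
  (forall eps : R, (0 < eps)%R -> exists h : C, h <> 0 /\ (Cmod h < eps)%R /\ is_Cseries (fun j => h ^ j * a j) (RtoC 0)) ->
  a k = 0.
Proof.
  assert (H0 : forall (a : nat -> C) (rho : R), (0 < rho)%R ->
    (forall h : C, (Cmod h < rho)%R -> exists l, is_Cseries (fun j => h ^ j * a j) l) ->
    (forall eps : R, (0 < eps)%R -> exists h : C, h <> 0 /\ (Cmod h < eps)%R /\ is_Cseries (fun j => h ^ j * a j) (RtoC 0)) ->
    a 0%nat = 0).
  { intros a rho Hr Hc Hz.
    destruct (power_series_at_center a (rho / 2) ltac:(lra)) as [K [HK0 HK]].
    { apply Hc. rewrite Cmod_R, Rabs_pos_eq; lra. }
    apply Cmod_eq_0. apply Rle_antisym; [|apply Cmod_ge_0].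
    apply Rnot_lt_le. intros Hp.
    destruct (Hz (Rmin (rho / 4) (Cmod (a 0%nat) / (K + 1)))) as [h [Hh [Hh2 Hs]]].
    { apply Rmin_pos; [lra|]. apply Rdiv_lt_0_compat; lra. }
    assert (H1 : (Cmod h < rho / 4)%R) by (apply Rlt_le_trans with (1 := Hh2), Rmin_l).
    assert (H2 : (Cmod h < Cmod (a 0%nat) / (K + 1))%R) by (apply Rlt_le_trans with (1 := Hh2), Rmin_r).
    specialize (HK h 0 ltac:(lra) Hs). replace (0 - a 0%nat) with (- a 0%nat) in HK by ring. rewrite Cmod_opp in HK.
    apply (Rmult_lt_compat_r (K + 1)) in H2; [|lra].
    replace (Cmod (a 0%nat) / (K + 1) * (K + 1))%R with (Cmod (a 0%nat)) in H2 by (field; lra).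
    pose proof (Cmod_ge_0 h). nra. }
  assert (Hsh : forall (a : nat -> C) (h l : C), h <> 0 -> a 0%nat = 0 -> is_Cseries (fun j => h ^ j * a j) l ->
     is_Cseries (fun j => h ^ j * a (S j)) (l / h)).
  { intros a h l Hh Ha Hs. pose proof (is_Cseries_incr_n _ 0 _ Hs) as H1. rewrite Csum_O, Ha in H1.
    replace (l - h ^ 0 * 0) with l in H1 by ring.
    replace (l / h) with (/ h * l) by (unfold Cdiv; ring).
    apply (is_Cseries_ext (fun j => / h * (h ^ (1 + j) * a (1 + j)%nat))); [|apply is_Cseries_scal, H1].
    intros j. simpl. field. exact Hh. }
  induction k as [|k IH]; intros a rho Hr Hc Hz; [now apply (H0 a rho)|].
  pose proof (H0 a rho Hr Hc Hz) as Ha.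
  apply (IH (fun j => a (S j)) rho); auto.
  - intros h Hh. destruct (Ceq_dec h 0) as [->|Hne].
    + exists (a 1%nat). apply is_Cseries_first. simpl. replace (a 1%nat - 1 * a 1%nat) with (RtoC 0) by ring.
      apply (is_Cseries_ext (fun _ => RtoC 0)); [intros; ring|apply is_Cseries_0].
    + destruct (Hc h Hh) as [l Hl]. exists (l / h). now apply Hsh.
  - intros eps He. destruct (Hz eps He) as [h [Hh [Hh2 Hs]]]. exists h. repeat split; auto.
    replace (RtoC 0) with (0 / h) by (field; auto). now apply Hsh.
Qed.

Lemma analytic_zeros (F : C -> C) (z0 : C) : analytic_at F z0 ->
  (forall eps : R, (0 < eps)%R -> exists z : C, z <> z0 /\ (Cmod (z - z0) < eps)%R /\ F z = 0) ->
  exists rho : R, (0 < rho)%R /\ forall z, (Cmod (z - z0) < rho)%R -> F z = 0.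
Proof.
  intros HF Hz. destruct (analytic_at_elim _ _ HF) as [a [rho [Hr H]]].
  exists rho. split; auto. intros z Hzr.
  assert (Ha : forall k, a k = 0).
  { intros k. apply (power_series_zeros k a rho Hr).
    - intros h Hh. exists (F (z0 + h)). replace h with (z0 + h - z0) at 1 by ring.
      specialize (H (z0 + h)). replace (z0 + h - z0) with h in * by ring. auto.
    - intros eps He. destruct (Hz (Rmin eps rho)) as [y [Hy1 [Hy2 Hy3]]]; [now apply Rmin_pos|].
      exists (y - z0). split; [now apply Cminus_eq_contra|]. split; [apply Rlt_le_trans with (1 := Hy2), Rmin_l|].
      rewrite <- Hy3. apply H. apply Rlt_le_trans with (1 := Hy2), Rmin_r. }
  apply (is_Cseries_unique _ _ _ (H z Hzr)).
  apply (is_Cseries_ext (fun _ => RtoC 0)); [intros; rewrite Ha; ring|apply is_Cseries_0].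
Qed.

(** Let [m] be the supremum of the parameters up to which [D] vanishes. Zeros accumulate at [m] from
    below, so [D] vanishes on a disc around that point; if [m] were below 1 the segment of zeros
    could be prolonged. *)
Lemma identity_segment (D : C -> C) (p v : C) (t0 : R) : v <> 0 ->
  (forall t, (0 <= t <= 1)%R -> analytic_at D (p + t * v)) ->
  (0 < t0 <= 1)%R -> (forall t, (0 <= t <= t0)%R -> D (p + t * v) = 0) -> D (p + v) = 0.
Proof.
  intros Hv HA Ht0 H0.
  pose proof (proj1 (Cmod_gt_0 _) Hv) as Hv0.
  set (E := fun t : R => (0 <= t <= 1)%R /\ forall u, (0 <= u <= t)%R -> D (p + u * v) = 0).
  destruct (completeness E) as [m [Hm1 Hm2]].
  { exists 1%R. intros t [Ht _]. lra. }
  { exists t0. split; [lra|auto]. }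
  assert (Hmt : (t0 <= m)%R) by (apply Hm1; split; [lra|auto]).
  assert (Hm : (m <= 1)%R) by (apply Hm2; intros t [Ht _]; lra).
  assert (Hlt : forall u, (0 <= u < m)%R -> D (p + u * v) = 0).
  { intros u Hu. destruct (classic (exists t, E t /\ (u <= t)%R)) as [[t [[Ht Ht2] Hut]]|Hn]; [apply Ht2; lra|].
    exfalso. assert (is_upper_bound E u); [|specialize (Hm2 u H); lra].
    intros t Ht. destruct (Rle_dec t u); auto. exfalso. apply Hn. exists t. split; auto. lra. }
  destruct (analytic_zeros D (p + m * v) (HA m ltac:(lra))) as [rho [Hr HD]].
  { intros eps He. set (d := Rmin (m / 2) (eps / (2 * Cmod v))).
    assert (Hd : (0 < d)%R) by (apply Rmin_pos; [lra|]; apply Rdiv_lt_0_compat; lra).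
    assert (Hdm : (d <= m / 2)%R) by apply Rmin_l.
    assert (Hde : (d <= eps / (2 * Cmod v))%R) by apply Rmin_r.
    exists (p + (m - d)%R * v).
    assert (Ed : p + (m - d)%R * v - (p + m * v) = - (d * v)) by (rewrite RtoC_minus; ring).
    split; [|split].
    - intros Eq. rewrite Eq in Ed. replace (p + m * v - (p + m * v)) with (RtoC 0) in Ed by ring.
      apply (f_equal Cmod) in Ed. rewrite Cmod_0, Cmod_opp, Cmod_mult, Cmod_R, Rabs_pos_eq in Ed by lra. nra.
    - rewrite Ed, Cmod_opp, Cmod_mult, Cmod_R, Rabs_pos_eq by lra.
      apply Rle_lt_trans with (eps / (2 * Cmod v) * Cmod v)%R; [apply Rmult_le_compat_r; lra|].
      replace (eps / (2 * Cmod v) * Cmod v)%R with (eps / 2)%R by (field; lra). lra.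
    - apply Hlt. lra. }
  assert (Hnear : forall u, (Rabs (u - m) < rho / Cmod v)%R -> D (p + u * v) = 0).
  { intros u Hu. apply HD. replace (p + u * v - (p + m * v)) with ((u - m)%R * v) by (rewrite RtoC_minus; ring).
    rewrite Cmod_mult, Cmod_R. apply (Rmult_lt_compat_r (Cmod v)) in Hu; auto.
    replace (rho / Cmod v * Cmod v)%R with rho in Hu by (field; lra). exact Hu. }
  assert (Hrv : (0 < rho / Cmod v)%R) by (apply Rdiv_lt_0_compat; lra).
  destruct (Rle_dec 1 m) as [H1|H1].
  - replace (p + v) with (p + 1%R * v) by ring. apply Hnear. replace (1 - m)%R with 0%R by lra. rewrite Rabs_R0. exact Hrv.
  - exfalso. set (e := Rmin (1 - m) (rho / (2 * Cmod v))).
    assert (He : (0 < e)%R) by (apply Rmin_pos; [lra|]; apply Rdiv_lt_0_compat; lra).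
    assert (He1 : (e <= 1 - m)%R) by apply Rmin_l.
    assert (He2 : (e <= rho / (2 * Cmod v))%R) by apply Rmin_r.
    assert (HE : E (m + e)%R).
    { split; [lra|]. intros u Hu. destruct (Rlt_dec u m) as [H2|H2]; [apply Hlt; lra|].
      apply Hnear. rewrite Rabs_pos_eq by lra.
      apply Rle_lt_trans with (rho / (2 * Cmod v))%R; [lra|].
      replace (rho / (2 * Cmod v))%R with (rho / Cmod v / 2)%R by (field; lra). lra. }
    specialize (Hm1 _ HE). lra.
Qed.

(** The segment from [2 + i] to [- k] meets the real axis only at its end, so it avoids the possible
    pole at 1. Up to parameter [1 / (2 (k + 2))] its real part is at least [3/2], where both
    continuations are the Dirichlet series. *)
Lemma continuation_unique (g : Z -> C) (F1 F2 : C -> C) (k : nat) :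
  is_L_continuation g F1 -> is_L_continuation g F2 -> F1 (- INR k) = F2 (- INR k).
Proof.
  intros [A1 S1] [A2 S2].
  set (D := fun s => F1 s + (-1) * F2 s). pose proof (pos_INR k) as Hk.
  assert (HD : D ((2 + Ci) + (- INR k - (2 + Ci))) = 0).
  { apply (identity_segment D (2 + Ci) (- INR k - (2 + Ci)) (/ (2 * (INR k + 2)))).
    - intros E. apply (f_equal Re) in E. simpl in E. lra.
    - intros t Ht. assert (Hne : 2 + Ci + t * (- INR k - (2 + Ci)) <> 1).
      { intros E. pose proof (f_equal Re E) as ER. pose proof (f_equal Im E) as EI. simpl in ER, EI.
        assert (t = 1%R) by lra. subst t. lra. }
      apply (analytic_plus F1 (fun s => (-1) * F2 s)); [apply A1, Hne|apply analytic_scal, A2, Hne].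
    - split; [apply Rinv_0_lt_compat; lra|]. rewrite <- Rinv_1. apply Rinv_le_contravar; lra.
    - intros t Ht.
      assert (HR : (1 < Re (2 + Ci + t * (- INR k - (2 + Ci))))%R).
      { simpl. assert (t * (INR k + 2) <= / 2)%R.
        { apply Rle_trans with (/ (2 * (INR k + 2)) * (INR k + 2))%R; [apply Rmult_le_compat_r; lra|]. right. field. lra. }
        lra. }
      unfold D. rewrite (is_Cseries_unique _ _ _ (S1 _ HR) (S2 _ HR)). ring. }
  replace (2 + Ci + (- INR k - (2 + Ci))) with (- INR k : C) in HD by ring.
  unfold D in HD. replace (F1 (- INR k)) with ((F1 (- INR k) + (-1) * F2 (- INR k)) + F2 (- INR k)) by ring.
  rewrite HD. ring.
Qed.

(** [Lfun] is some continuation selected by [epsilon]; [Lc] shows that one exists, and uniqueness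
    transfers its values. *)
Lemma Lfun_dft (N : Z) (G : Z -> C) (k : nat) : (0 < N)%Z -> periodic N G ->
  Lfun (dft N G) (- INR k) = (-1) ^ S k * INR (fact k) * Qv N G (S k) 0.
Proof.
  intros HN HG. rewrite <- Lc_value by auto.
  apply (continuation_unique (dft N G)); [|now apply Lc_continuation].
  unfold Lfun. apply epsilon_spec. exists (Lc N G). now apply Lc_continuation.
Qed.

(** * Improper integrals of series *)

Lemma exp_int_le (d K R0 : R) : (0 < d)%R -> (0 <= K)%R -> (0 <= R0)%R ->
  exists l, is_RInt (fun r => K * exp (- d * r))%R 0 R0 l /\ (l <= K / d)%R.
Proof.
  intros Hd HK HR. exists (K / d - K / d * exp (- d * R0))%R. split.
  - replace (K / d - K / d * exp (- d * R0))%R with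
      (minus (- (K / d) * exp (- d * R0)) (- (K / d) * exp (- d * 0)))%R.
    + apply (is_RInt_derive (V := R_CompleteNormedModule) (fun r => - (K / d) * exp (- d * r))%R).
      * intros r _. auto_derive; [trivial|]. field. lra.
      * intros r _. apply (ex_derive_continuous (fun r => K * exp (- d * r))%R). auto_derive. trivial.
    + change (- (K / d) * exp (- d * R0) - - (K / d) * exp (- d * 0) = K / d - K / d * exp (- d * R0))%R.
      rewrite Rmult_0_r, exp_0. ring.
  - assert (0 <= K / d)%R by (apply Rdiv_le_0_compat; lra).
    pose proof (exp_pos (- d * R0)). nra.
Qed.

(** With the majorant [b n * K * exp (- d r)], the series is uniform on compact intervals, and the
    truncated integrals are bounded by [b n * K / d] independently of the length, so Tannery's
    theorem gives the limit at infinity. *)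
Lemma RInt_CSeries_improper (f : nat -> R -> C) (F : R -> C) (I : nat -> R -> C) (l : nat -> C) (b : nat -> R) (K d : R) :
  (0 < d)%R -> (0 <= K)%R -> (forall n, 0 <= b n)%R -> ex_series b ->
  (forall n r, (0 <= r)%R -> is_CRInt (f n) 0 r (I n r)) ->
  (forall n, Clim (I n) (Rbar_locally p_infty) (l n)) ->
  (forall n r, (0 <= r)%R -> (Cmod (f n r) <= b n * (K * exp (- d * r)))%R) ->
  (forall r, (0 <= r)%R -> F r = CSeries (fun n => f n r)) ->
  (forall R0, (0 <= R0)%R -> is_CRInt F 0 R0 (CSeries (fun n => I n R0))) /\
  Clim (fun R0 => CSeries (fun n => I n R0)) (Rbar_locally p_infty) (CSeries l) /\
  is_Cseries l (CSeries l).
Proof.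
  intros Hd HK Hb0 Hb HI Hl Hf HF.
  assert (HIb : forall n r, (0 <= r)%R -> (Cmod (I n r) <= b n * (K / d))%R).
  { intros n r Hr. destruct (exp_int_le d K r Hd HK Hr) as [J [HJ HJle]].
    apply Rle_trans with (b n * J)%R; [|apply Rmult_le_compat_l; auto].
    apply (is_CRInt_norm (f n) (fun r => b n * (K * exp (- d * r)))%R 0 r); auto.
    - intros x Hx. apply Hf. lra.
    - apply (is_RInt_scal (V := R_NormedModule) _ _ _ (b n) _ HJ). }
  assert (Hbs : ex_series (fun n => b n * (K / d))%R) by (apply (ex_series_scal_r (K / d)), Hb).
  split; [|split].
  - intros R0 HR0. apply (is_CRInt_CSeries f F (fun n => I n R0) (fun n => b n * K)%R 0 R0); auto.
    + apply (ex_series_scal_r K), Hb.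
    + intros n x Hx. apply Rle_trans with (1 := Hf n x (proj1 Hx)).
      apply Rmult_le_compat_l; auto. rewrite <- (Rmult_1_r K) at 2. apply Rmult_le_compat_l; auto.
      rewrite <- exp_0. apply exp_le. nra.
    + intros x Hx. apply HF. lra.
  - apply (CSeries_tannery (Rbar_locally p_infty) (fun R0 n => I n R0) l (fun n => b n * (K / d))%R Hbs); auto.
    exists 0%R. intros R0 HR0 n. apply HIb. lra.
  - apply (is_CSeries_le l (fun n => b n * (K / d))%R); auto. intros n.
    apply (Clim_bound (Rbar_locally p_infty) (I n)); auto. exists 0%R. intros R0 HR0. apply HIb. lra.
Qed.

Lemma INR_lim : filterlim INR eventually (Rbar_locally p_infty).
Proof. exact is_lim_seq_INR. Qed.

(** * Summation against a rapidly decreasing function on the half-line *)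

Lemma psum_is_Cseries (a : nat -> C) (l : C) : Clim (psum a) eventually l -> is_Cseries a l.
Proof.
  intros H. apply (proj1 (Clim_eps eventually _ _)). intros eps He.
  destruct (proj2 (Clim_eps eventually _ _) H eps He) as [M HM].
  exists M. intros n Hn. specialize (HM (S n) ltac:(lia)). rewrite psum_sum_n in HM. exact HM.
Qed.

(** The share of the frequencies [mu] and [- mu] in the integral of the second primitive against
    [p2], when [Iinf] is the half-line Fourier integral of [p2]; the factor [1 / sqrt N] is left
    outside. *)
Definition tterm (N : Z) (G : Z -> C) (Iinf : R -> C) (k : nat) : C :=
  lam N k ^ 2 * (G (Z.of_nat (S k)) * Iinf (mu N k) + G (- Z.of_nat (S k))%Z * Iinf (- mu N k)%R).

(** The summation formula of order 2 on [[0, T]], with the periodic primitive expanded into its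
    modes. The primitives are bounded, so the decay of [p0] and [p1] removes the boundary terms at
    [T]. *)
Lemma half_line_sum (N : Z) (G : Z -> C) (Ps p0 p1 p2 : R -> C) (Pinf : C) (Iinf : R -> C) (K : R) :
  (0 < N)%Z -> periodic N G -> (0 <= K)%R ->
  (forall x, (0 <= x)%R -> is_Cder Ps x (p0 x) /\ is_Cder p0 x (p1 x) /\ is_Cder p1 x (p2 x) /\ Ccont p2 x) ->
  (forall x, (0 <= x)%R -> (Cmod (p2 x) <= K * exp (- 1 * x))%R) ->
  Clim p0 (Rbar_locally p_infty) (RtoC 0) -> Clim p1 (Rbar_locally p_infty) (RtoC 0) ->
  Clim Ps (Rbar_locally p_infty) Pinf ->
  (forall m : R, exists I : R -> C,
     (forall X, (0 <= X)%R -> is_CRInt (fun x => p2 x * Cexp (- (Ci * m * x))) 0 X (I X)) /\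
     Clim I (Rbar_locally p_infty) (Iinf m)) ->
  is_Cseries (tterm N G Iinf) (CSeries (tterm N G Iinf)) /\
  is_Cseries (fun n => dft N G (Z.of_nat (S n)) * p0 (INR (S n)))
    (G 0%Z / sqN N * (Pinf - Ps 0%R) + Qs N G 2 0 * p1 0%R - Q1 N G 0 * p0 0%R
      + / sqN N * CSeries (tterm N G Iinf)).
Proof.
  intros HN HG HK HD Hp2 H0 H1 HP HI.
  destruct (periodic_bound N G HN HG) as [B [HB0 HB]].
  (* The hypothesis supplies truncated integrals separately for each frequency; a choice assembles
     them into one function of the frequency. *)
  assert (HIc : exists J : R -> R -> C, forall m : R,
     (forall X, (0 <= X)%R -> is_CRInt (fun x => p2 x * Cexp (- (Ci * m * x))) 0 X (J m X)) /\
     Clim (J m) (Rbar_locally p_infty) (Iinf m)).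
  { exists (fun m : R => epsilon (inhabits (fun _ : R => RtoC 0)) (fun I : R -> C =>
     (forall X, (0 <= X)%R -> is_CRInt (fun x => p2 x * Cexp (- (Ci * m * x))) 0 X (I X)) /\
     Clim I (Rbar_locally p_infty) (Iinf m))).
    intros m. apply epsilon_spec, HI. }
  destruct HIc as [J HJ].
  set (I := fun k X => lam N k ^ 2 * (G (Z.of_nat (S k)) * J (mu N k) X + G (- Z.of_nat (S k))%Z * J (- mu N k)%R X)).
  set (b := fun k => (2 * B * (IZR N / (2 * PI)) ^ 2 * / INR (S k) ^ 2)%R).
  assert (Htq : forall k x, tq N G 2 k x * p2 x = lam N k ^ 2 * (G (Z.of_nat (S k)) * (p2 x * Cexp (- (Ci * mu N k * x)))
       + G (- Z.of_nat (S k))%Z * (p2 x * Cexp (- (Ci * RtoC (- mu N k) * x))))).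
  { intros k x. unfold tq. replace (- (Ci * RtoC (- mu N k) * x)) with (Ci * mu N k * x) by (rewrite RtoC_opp; ring).
    simpl Cpow. ring. }
  destruct (RInt_CSeries_improper (fun k x => tq N G 2 k x * p2 x) (fun x => CSeries (fun k => tq N G 2 k x) * p2 x)
    I (tterm N G Iinf) b K 1) as [A1 [A2 A3]].
  - lra.
  - exact HK.
  - intros k. apply Rle_trans with (2 := tq_bound N G B 2 k 0 HN ltac:(lia) HB0 HB), Cmod_ge_0.
  - apply ex_series_tq_bound.
  - intros k r Hr. apply (is_CRInt_ext (fun x => lam N k ^ 2 * (G (Z.of_nat (S k)) * (p2 x * Cexp (- (Ci * mu N k * x)))
       + G (- Z.of_nat (S k))%Z * (p2 x * Cexp (- (Ci * RtoC (- mu N k) * x)))))); auto.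
    apply is_CRInt_scal. apply is_CRInt_plus; apply is_CRInt_scal.
    + exact (proj1 (HJ (mu N k)) r Hr).
    + exact (proj1 (HJ (- mu N k)%R) r Hr).
  - intros k. unfold I, tterm. apply (Clim_mult _ (fun _ => _)); [apply filterlim_const|].
    apply Clim_plus; [exact _| |]; (apply (Clim_mult _ (fun _ => _)); [apply filterlim_const|apply HJ]).
  - intros k r Hr. rewrite Cmod_mult. apply Rmult_le_compat; auto using Cmod_ge_0. apply tq_bound; auto.
  - intros r Hr. symmetry. apply CSeries_unique.
    apply (is_Cseries_ext (fun k => p2 r * tq N G 2 k r)); [intros; ring|].
    rewrite Cmult_comm. apply is_Cseries_scal, tq_series; auto.
  - split; [exact A3|].
    assert (HQ : forall T : nat, psum (fun k => dft N G (Z.of_nat (S k)) * p0 (INR (S k))) T =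
      G 0%Z / sqN N * (Ps (INR T) - Ps 0%R) + (Qs N G 2 0 * p1 0%R - Q1 N G 0 * p0 0%R)
       + / sqN N * CSeries (fun k => I k (INR T))
       - (p1 (INR T) * Qs N G 2 (INR T) - p0 (INR T) * Q1 N G (Z.of_nat T))).
    { intros T. pose proof (EM2 N G 0 Ps p0 p1 p2 T HN HG HD) as H2.
      rewrite Rplus_0_l, (Z.add_0_l (Z.of_nat T)) in H2.
      pose proof (is_CRInt_scal (/ sqN N) _ _ _ _ (A1 (INR T) (pos_INR T))) as H3.
      assert (H4 : is_CRInt (fun x => Qs N G 2 x * p2 x) 0 (INR T) (/ sqN N * CSeries (fun k => I k (INR T)))).
      { apply is_CRInt_ext with (3 := H3); [apply pos_INR|]. intros x _. unfold Qs. ring. }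
      rewrite <- (is_CRInt_unique _ _ _ _ _ H2 H4).
      assert (EP : psum (fun k => dft N G (Z.of_nat (S k)) * p0 (INR (S k))) T =
        psum (fun k => dft N G (0 + Z.of_nat (S k)) * p0 (0 + INR (S k))%R) T).
      { f_equal. apply functional_extensionality. intros k. now rewrite Rplus_0_l, Z.add_0_l. }
      rewrite EP. ring. }
    apply psum_is_Cseries.
    apply (filterlim_ext _ _ (fun T => eq_sym (HQ T))).
    destruct (Qs_bound N G 2 HN HG ltac:(lia)) as [B2 [_ HB2]].
    destruct (periodic_bound N (Q1 N G) HN (Q1_periodic N G HN)) as [B1 [_ HB1]].
    assert (HS : forall g l, Clim g (Rbar_locally p_infty) l -> Clim (fun T => g (INR T)) eventually l).
    { intros g l Hg. exact (filterlim_comp _ _ _ INR g _ _ _ INR_lim Hg). }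
    pose proof (Clim_0_bounded eventually (fun T => p1 (INR T)) (fun T => Qs N G 2 (INR T)) B2 (HS _ _ H1) (fun T => HB2 _)) as L1.
    pose proof (Clim_0_bounded eventually (fun T => p0 (INR T)) (fun T => Q1 N G (Z.of_nat T)) B1 (HS _ _ H0) (fun T => HB1 _)) as L2.
    pose proof (Clim_mult eventually _ _ _ _ (Clim_const eventually (G 0%Z / sqN N))
      (Clim_minus eventually _ _ _ _ (HS _ _ HP) (Clim_const eventually (Ps 0%R)))) as L3.
    pose proof (Clim_mult eventually _ _ _ _ (Clim_const eventually (/ sqN N)) (HS _ _ A2)) as L4.
    pose proof (Clim_minus eventually _ _ _ _ (Clim_plus eventually _ _ _ _
      (Clim_plus eventually _ _ _ _ L3 (Clim_const eventually (Qs N G 2 0 * p1 0%R - Q1 N G 0 * p0 0%R))) L4)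
      (Clim_minus eventually _ _ _ _ L1 L2)) as L5.
    match type of L5 with filterlim _ _ (locally ?v) => match goal with |- filterlim _ _ (locally ?w) => replace w with v by ring; exact L5 end end.
Qed.

(** * Gaussian integrals *)

(** Because [gint] depends on the square only, [exp (- A u^2)] gets a primitive without a square
    root of [A]. This is [gint_ode] at [A u^2]. *)
Lemma is_Cder_erf (A : C) (u : R -> C) (x : R) (du : C) : is_Cder u x du ->
  is_Cder (fun t => u t * gint (A * (u t * u t))) x (du * Cexp (- (A * (u x * u x)))).
Proof.
  intros Hu. rewrite <- gint_ode.
  pose proof (is_Cder_scal A _ _ _ (is_Cder_mult u u x du du Hu Hu)) as H1.
  pose proof (is_Cder_comp gint (fun t => A * (u t * u t)) x _ _ (qd_gint _) H1) as H2.
  pose proof (is_Cder_mult u _ x du _ Hu H2) as H3.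
  match type of H3 with is_derive _ _ ?v => match goal with |- is_derive _ _ ?w => replace w with v by ring end end.
  exact H3.
Qed.

Lemma Rlim_scal0 {T} (F : (T -> Prop) -> Prop) {FF : Filter F} (c : R) (g : T -> R) :
  filterlim g F (locally 0%R) -> filterlim (fun x => c * g x)%R F (locally 0%R).
Proof.
  intros H.
  assert (H5 : filterlim (fun x => c * g x)%R F (locally (c * 0)%R)).
  { exact (filterlim_comp _ _ _ _ (fun x => c * x)%R F _ _ H (filterlim_scal_r (V := R_NormedModule) c 0%R)). }
  rewrite Rmult_0_r in H5. exact H5.
Qed.

(** [Re (v^2) > 0] together with [Re v > 0] places [v] in the sector [|Im v| < Re v], where
    [gint_limit_bound] gives an error of size [exp (- Re (v^2))]. *)
Lemma erf_lim {T} (F : (T -> Prop) -> Prop) {FF : Filter F} (v : T -> C) :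
  F (fun t => 0 < Re (v t))%R -> filterlim (fun t => Re (v t * v t)) F (Rbar_locally p_infty) ->
  Clim (fun t => v t * gint (v t * v t)) F (RtoC (sqrt PI / 2)).
Proof.
  intros H1 H2.
  assert (H : Clim (fun t => v t * gint (v t * v t) - RtoC (sqrt PI / 2)) F (RtoC 0)).
  { apply (Clim_squeeze0 F _ (fun t => sqrt PI / 2 * exp (- Re (v t * v t)))%R).
    - assert (H3 : F (fun t => 0 < Re (v t * v t))%R) by (apply H2; exists 0%R; auto).
      apply filter_imp with (2 := filter_and _ _ H1 H3). intros t [Ha Hb].
      apply gint_limit_bound; auto. replace (Re (v t * v t)) with ((Re (v t) - Im (v t)) * (Re (v t) + Im (v t)))%R in Hb
        by (simpl; unfold Re, Im; ring).
      apply Rabs_def1; nra.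
    - assert (H4 : filterlim (fun t => exp (- Re (v t * v t))) F (locally 0%R)).
      { apply (filterlim_comp _ _ _ (fun t => - Re (v t * v t))%R exp F (Rbar_locally m_infty)).
        - apply (filterlim_comp _ _ _ _ Ropp F (Rbar_locally p_infty)); [exact H2|].
          exact (filterlim_Rbar_opp p_infty).
        - exact is_lim_exp_m. }
      exact (Rlim_scal0 F _ _ H4). }
  pose proof (Clim_plus F _ _ _ _ H (Clim_const F (RtoC (sqrt PI / 2)))) as H3. rewrite Cplus_0_l in H3.
  apply filterlim_ext with (2 := H3). intros t. ring.
Qed.

Lemma pow_le_fact_exp (x : R) (k : nat) : (0 <= x)%R -> (x ^ k <= INR (fact k) * exp x)%R.
Proof.
  intros Hx. pose proof (exp_ge_taylor x k Hx) as H.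
  assert (H2 : (x ^ k / INR (fact k) <= sum_f_R0 (fun j => x ^ j / INR (fact j)) k)%R).
  { destruct k; [simpl; lra|]. rewrite tech5.
    assert (0 <= sum_f_R0 (fun j => x ^ j / INR (fact j)) k)%R; [|lra].
    apply cond_pos_sum. intros n. apply Rdiv_le_0_compat; [now apply pow_le|apply INR_fact_lt_0]. }
  pose proof (INR_fact_lt_0 k) as Hf.
  apply Rmult_le_reg_l with (/ INR (fact k))%R; [now apply Rinv_0_lt_compat|].
  rewrite <- Rmult_assoc, Rinv_l by lra. unfold Rdiv in H2. lra.
Qed.

Lemma gauss_decay (a x : R) (k : nat) : (0 < a)%R -> (0 <= x)%R ->
  (x ^ k * exp (- a * (x * x)) <= INR (fact k) * exp (/ a) * exp (- 1 * x))%R.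
Proof.
  intros Ha Hx. pose proof (pow_le_fact_exp x k Hx) as H1.
  apply Rle_trans with (INR (fact k) * exp x * exp (- a * (x * x)))%R.
  { apply Rmult_le_compat_r; [left; apply exp_pos|auto]. }
  rewrite !Rmult_assoc. apply Rmult_le_compat_l; [apply pos_INR|].
  rewrite <- !exp_plus. apply exp_le.
  (* Completing the square gives [2 x - a x^2 <= 1 / a]: one [exp x] absorbs the power and the other
     leaves the decay [exp (- x)]. *)
  assert (0 <= a * ((x - / a) * (x - / a)))%R by (apply Rmult_le_pos; [lra|apply Rle_0_sqr]).
  replace (a * ((x - / a) * (x - / a)))%R with (a * (x * x) - 2 * x + / a)%R in H by (field; lra). lra.
Qed.

Definition gau (A : C) (x : R) : C := Cexp (- (A * RtoC (x * x))).

Lemma Cmod_gau (A : C) (x : R) : Cmod (gau A x) = exp (- Re A * (x * x)).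
Proof. unfold gau. rewrite Cmod_Cexp. f_equal. destruct A; simpl. ring. Qed.

Lemma is_Cder_gau (A : C) (x : R) : is_Cder (gau A) x (- (2 * A * x) * gau A x).
Proof.
  apply (is_Cder_Cexp (fun x => - (A * RtoC (x * x)))).
  replace (- (2 * A * x)) with (- A * RtoC (2 * x)) by (rewrite RtoC_mult; ring).
  apply (is_Cder_ext (fun t : R => - A * RtoC (t * t))); [intros; ring|].
  apply (is_Cder_scal (- A) (fun t : R => RtoC (t * t))). apply (is_Cder_RtoC (fun t => t * t)%R). auto_derive; [trivial|ring].
Qed.

Lemma gau_pow_decay (A : C) (k : nat) (x : R) : (0 < Re A)%R -> (0 <= x)%R ->
  (Cmod (RtoC x ^ k * gau A x) <= INR (fact k) * exp (/ Re A) * exp (- 1 * x))%R.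
Proof.
  intros HA Hx. rewrite Cmod_mult, Cmod_pow, Cmod_R, Cmod_gau, Rabs_pos_eq by auto.
  now apply gauss_decay.
Qed.

Lemma exp_lim0 : filterlim (fun x => exp (- 1 * x)) (Rbar_locally p_infty) (locally 0%R).
Proof.
  apply (filterlim_comp _ _ _ (fun x => - 1 * x)%R exp (Rbar_locally p_infty) (Rbar_locally m_infty)); [|exact is_lim_exp_m].
  apply (filterlim_ext Ropp); [intros x; ring|exact (filterlim_Rbar_opp p_infty)].
Qed.

Lemma gau_pow_lim (A : C) (k : nat) : (0 < Re A)%R ->
  Clim (fun x : R => RtoC x ^ k * gau A x) (Rbar_locally p_infty) (RtoC 0).
Proof.
  intros HA. apply (Clim_squeeze0 _ _ (fun x => (INR (fact k) * exp (/ Re A)) * exp (- 1 * x))%R).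
  - exists 0%R. intros x Hx. apply gau_pow_decay; auto; lra.
  - exact (Rlim_scal0 _ _ _ exp_lim0).
Qed.

Lemma is_Cder_char (m x : R) : is_Cder (fun x => Cexp (- (Ci * m * x))) x (- (Ci * m) * Cexp (- (Ci * m * x))).
Proof.
  apply (is_Cder_Cexp (fun x => - (Ci * m * x))).
  apply (is_Cder_ext (fun x : R => x * - (Ci * m))); [intros; ring|]. apply is_Cder_lin.
Qed.

Lemma Cexp_char_bound (m x : R) : (Cmod (Cexp (- (Ci * m * x))) <= 1)%R.
Proof.
  replace (- (Ci * m * x)) with (Ci * RtoC (- (m * x))) by (rewrite RtoC_opp, RtoC_mult; ring).
  rewrite Cmod_Cexp_Ci. lra.
Qed.

Lemma char_0 (m : R) : Cexp (- (Ci * m * RtoC 0)) = 1.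
Proof. rewrite <- Cexp_0. f_equal. ring. Qed.

(** Two integrations by parts carry the derivatives of [p2 = p0''] over to the exponential; the
    bounded exponential times the decaying [p0], [p1] leaves nothing at infinity. *)
Lemma parts2 (p0 p1 p2 : R -> C) (J : R -> C) (Jinf : C) (m : R) :
  (forall x, (0 <= x)%R -> is_Cder p0 x (p1 x) /\ is_Cder p1 x (p2 x) /\ Ccont p2 x) ->
  Clim p0 (Rbar_locally p_infty) (RtoC 0) -> Clim p1 (Rbar_locally p_infty) (RtoC 0) ->
  (forall X, (0 <= X)%R -> is_CRInt (fun x => p0 x * Cexp (- (Ci * m * x))) 0 X (J X)) ->
  Clim J (Rbar_locally p_infty) Jinf ->
  exists I : R -> C,
     (forall X, (0 <= X)%R -> is_CRInt (fun x => p2 x * Cexp (- (Ci * m * x))) 0 X (I X)) /\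
     Clim I (Rbar_locally p_infty) (- p1 0%R - Ci * m * p0 0%R - m * m * Jinf).
Proof.
  intros HD L0 L1 HJ LJ.
  set (E := fun x : R => Cexp (- (Ci * m * x))).
  set (P := fun x : R => p1 x * E x + Ci * m * (p0 x * E x)).
  exists (fun X => P X - P 0%R - m * m * J X). split.
  - intros X HX.
    assert (H1 : is_CRInt (fun x => p2 x * E x + m * m * (p0 x * E x)) 0 X (P X - P 0%R)).
    { apply is_CRInt_derive; auto.
      - intros x Hx. destruct (HD x (proj1 Hx)) as [D0 [D1 _]].
        replace (p2 x * E x + m * m * (p0 x * E x)) with
          ((p2 x * E x + p1 x * (- (Ci * m) * E x)) + Ci * m * (p1 x * E x + p0 x * (- (Ci * m) * E x))).
        + apply (is_Cder_plus (fun x => p1 x * E x) (fun x => Ci * m * (p0 x * E x))).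
          * apply (is_Cder_mult p1 E); [exact D1|apply is_Cder_char].
          * apply (is_Cder_scal _ (fun x => p0 x * E x)). apply (is_Cder_mult p0 E); [exact D0|apply is_Cder_char].
        + match goal with |- ?l = ?r => transitivity (p2 x * E x - (Ci * Ci) * (m * m * (p0 x * E x))); [ring|] end.
          replace (Ci * Ci) with (- (1 : C)) by (apply C_ext; simpl; ring). ring.
      - intros x Hx. destruct (HD x (proj1 Hx)) as [D0 [D1 D2]].
        pose proof (is_Cder_cont _ _ _ (is_Cder_char m x)) as CE.
        apply Ccont_plus; [now apply Ccont_mult|]. apply Ccont_mult; [apply Ccont_const|].
        apply Ccont_mult; [exact (is_Cder_cont _ _ _ D0)|exact CE]. }
    pose proof (is_CRInt_minus _ _ _ _ _ _ H1 (is_CRInt_scal (m * m) _ _ _ _ (HJ X HX))) as H2.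
    apply is_CRInt_ext with (3 := H2); auto. intros x _. unfold E. ring.
  - assert (LP : Clim P (Rbar_locally p_infty) (0 + Ci * m * 0)).
    { apply Clim_plus; [exact _| |].
      - apply (Clim_0_bounded _ p1 E 1 L1). intros x. apply Cexp_char_bound.
      - apply (Clim_mult _ (fun _ => _)); [apply filterlim_const|].
        apply (Clim_0_bounded _ p0 E 1 L0). intros x. apply Cexp_char_bound. }
    pose proof (Clim_minus _ _ _ _ _ (Clim_minus _ _ _ _ _ LP (Clim_const _ (P 0%R)))
      (Clim_mult _ _ _ _ _ (Clim_const (Rbar_locally p_infty) (m * m)) LJ)) as H.
    match type of H with filterlim _ _ (locally ?v) => match goal with |- filterlim _ _ (locally ?w) => replace w with v; [exact H|] end end.
    unfold P, E. rewrite char_0. ring.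
Qed.

Section Gaussian.
Context (c : C) (Hc : (0 < Re c)%R) (Hcc : (0 < Re (c * c))%R).

(** What completing the square leaves over in [c^2 x^2 + i m x]. *)
Definition kap (m : R) : C := RtoC (m * m) / (4 * (c * c)).
(** [Wf m] is the integral of [exp (- c^2 x^2 - i m x)] over [x > 0]. *)
Definition Wf (m : R) : C :=
  Cexp (- kap m) * (RtoC (sqrt PI / 2) / c - Ci * m / (2 * (c * c)) * gint (- kap m)).

Let c_neq_0 : c <> 0.
Proof. intros E. rewrite E in Hc. simpl in Hc. lra. Qed.

(** On the horizontal line through [z], the real part of [(c (x + z))^2] is a real quadratic
    polynomial in [x] with leading coefficient [Re (c^2) > 0], and [Re c > 0] fixes the
    half-plane. *)
Lemma erf_path_lim (z : C) :
  Clim (fun x : R => (x + z) * gint (c * c * ((x + z) * (x + z)))) (Rbar_locally p_infty) (RtoC (sqrt PI / 2) / c).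
Proof.
  pose proof c_neq_0 as Hn.
  assert (H : Clim (fun x : R => (c * (x + z)) * gint ((c * (x + z)) * (c * (x + z)))) (Rbar_locally p_infty) (RtoC (sqrt PI / 2))).
  { apply erf_lim; [exact _| |].
    - exists ((1 + Rabs (Re (c * z))) / Re c)%R. intros x Hx.
      replace (Re (c * (x + z))) with (Re c * x + Re (c * z))%R by (simpl; unfold Re; ring).
      apply (Rmult_lt_compat_r (Re c)) in Hx; auto.
      replace ((1 + Rabs (Re (c * z))) / Re c * Re c)%R with (1 + Rabs (Re (c * z)))%R in Hx by (field; lra).
      pose proof (Rle_abs (- Re (c * z))). rewrite Rabs_Ropp in H. lra.
    - set (b := Re (2 * (c * c) * z)). set (e := Re ((c * z) * (c * z))).
      apply (filterlim_ext (fun x => (Re (c * c) * x + b) * x + e)%R).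
      { intros x. unfold b, e. simpl. unfold Re, Im. simpl. ring. }
      intros P [M HM].
      exists (Rmax 1 ((1 + Rabs b + Rabs M + Rabs e) / Re (c * c))). intros x Hx.
      apply HM.
      assert (H1 : (1 < x)%R) by (apply Rle_lt_trans with (2 := Hx), Rmax_l).
      assert (H2 : ((1 + Rabs b + Rabs M + Rabs e) / Re (c * c) < x)%R) by (apply Rle_lt_trans with (2 := Hx), Rmax_r).
      apply (Rmult_lt_compat_r (Re (c * c))) in H2; auto.
      replace ((1 + Rabs b + Rabs M + Rabs e) / Re (c * c) * Re (c * c))%R with (1 + Rabs b + Rabs M + Rabs e)%R in H2 by (field; lra).
      pose proof (Rle_abs (- b)) as B1. rewrite Rabs_Ropp in B1. pose proof (Rle_abs M).
      pose proof (Rle_abs (- e)) as B2. rewrite Rabs_Ropp in B2. pose proof (Rabs_pos M). pose proof (Rabs_pos e).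
      assert ((Re (c * c) * x + b) * x >= 1 + Rabs M + Rabs e)%R by nra. lra. }
  pose proof (Clim_mult _ _ _ _ _ H (Clim_const (Rbar_locally p_infty) (/ c))) as H1.
  apply filterlim_ext with (2 := H1). intros x.
  replace ((c * (x + z)) * (c * (x + z))) with (c * c * ((x + z) * (x + z))) by ring. field. exact Hn.
Qed.

Lemma gauss_fourier (m : R) :
  exists J : R -> C,
   (forall X, (0 <= X)%R -> is_CRInt (fun x => gau (c * c) x * Cexp (- (Ci * m * x))) 0 X (J X)) /\
   Clim J (Rbar_locally p_infty) (Wf m).
Proof.
  pose proof c_neq_0 as Hn.
  (* The shift that completes the square: [c^2 x^2 + i m x = c^2 (x + z)^2 + kap m]. *)
  set (z := Ci * m / (2 * (c * c))).
  set (V := fun x : R => (x + z) * gint (c * c * ((x + z) * (x + z)))).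
  assert (Hz : c * c * (z * z) = - kap m).
  { unfold z, kap. rewrite RtoC_mult.
    match goal with |- ?l = _ => transitivity ((Ci * Ci) * (m * m / (4 * (c * c)))); [field; exact Hn|] end.
    replace (Ci * Ci) with (- (1 : C)) by (apply C_ext; simpl; ring). ring. }
  exists (fun X => Cexp (- kap m) * (V X - V 0%R)). split.
  - intros X HX.
    assert (HD : forall x, is_Cder V x (1 * Cexp (- (c * c * ((x + z) * (x + z)))))).
    { intros x. apply (is_Cder_erf (c * c) (fun x : R => x + z)).
      replace (RtoC 1) with (1 + 0) by ring.
      apply (is_Cder_plus (fun x : R => RtoC x) (fun _ => z)); [apply is_Cder_id|apply is_Cder_const]. }
    pose proof (is_CRInt_derive V _ 0 X HX (fun x _ => HD x)) as H1.
    assert (H2 : forall x, (0 <= x <= X)%R -> Ccont (fun x : R => 1 * Cexp (- (c * c * ((x + z) * (x + z))))) x).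
    { intros x _. apply Ccont_mult; [apply Ccont_const|]. apply (Ccont_Cexp (fun x : R => - (c * c * ((x + z) * (x + z))))).
      assert (Hx : Ccont (fun x : R => x + z) x).
      { apply Ccont_plus; [|apply Ccont_const]. exact (is_Cder_cont _ _ _ (is_Cder_id x)). }
      apply (Clim_opp (locally x) (fun x : R => c * c * ((x + z) * (x + z)))).
      apply Ccont_mult; [apply Ccont_const|]. now apply Ccont_mult. }
    pose proof (is_CRInt_scal (Cexp (- kap m)) _ _ _ _ (H1 H2)) as H3.
    apply is_CRInt_ext with (3 := H3); auto. intros x _. rewrite Cmult_1_l, <- Cexp_plus. unfold gau.
    rewrite <- Cexp_plus. f_equal. rewrite <- Hz, RtoC_mult. unfold z. field. exact Hn.
  - unfold Wf. apply (Clim_mult _ (fun _ => _)); [apply filterlim_const|].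
    replace (Ci * m / (2 * (c * c)) * gint (- kap m)) with (V 0%R).
    + apply Clim_minus; [exact _|apply erf_path_lim|apply filterlim_const].
    + unfold V. rewrite Cplus_0_l, Hz. reflexivity.
Qed.

Lemma gau_0 : gau (c * c) 0 = 1.
Proof. unfold gau. rewrite <- Cexp_0. f_equal. rewrite Rmult_0_l. ring. Qed.

Lemma Ccont_gau (x : R) : Ccont (gau (c * c)) x.
Proof. exact (is_Cder_cont _ _ _ (is_Cder_gau (c * c) x)). Qed.

(** The integrals of [p'' x * exp (- i m x)] over [x > 0], for [p x = exp (- c^2 x^2)] and
    for [p x = x * exp (- c^2 x^2)]. *)
Definition Iinf0 (m : R) : C := - (Ci * m) - m * m * Wf m.
Definition Iinf1 (m : R) : C := - (1) - m * m * ((1 - Ci * m * Wf m) / (2 * (c * c))).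

(** Here [p0 0 = 1] and [p1 0 = 0], so the boundary at 0 contributes the first-order value [Q1]; the
    mean is multiplied by the full half-line Gaussian integral. *)
Lemma gauss_sum0 (N : Z) (G : Z -> C) : (0 < N)%Z -> periodic N G ->
  is_Cseries (tterm N G Iinf0) (CSeries (tterm N G Iinf0)) /\
  is_Cseries (fun n => dft N G (Z.of_nat (S n)) * gau (c * c) (INR (S n)))
    (G 0%Z / sqN N * (RtoC (sqrt PI / 2) / c) - Q1 N G 0 + / sqN N * CSeries (tterm N G Iinf0)).
Proof.
  intros HN HG. set (A := c * c).
  set (p1 := fun x : R => - (2 * A * x) * gau A x).
  set (p2 := fun x : R => (4 * A * A * x ^ 2 - 2 * A) * gau A x).
  assert (D1 : forall x, is_Cder p1 x (p2 x)).
  { intros x. unfold p1, p2.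
    replace ((4 * A * A * x ^ 2 - 2 * A) * gau A x) with
      ((- (2 * A)) * 1 * gau A x + (- (2 * A)) * x * (- (2 * A * x) * gau A x)) by (simpl Cpow; ring).
    apply (is_Cder_ext (fun x : R => (- (2 * A)) * x * gau A x)); [intros; ring|].
    apply (is_Cder_mult (fun x : R => (- (2 * A)) * x) (gau A)); [|apply is_Cder_gau].
    apply (is_Cder_scal _ (fun x : R => RtoC x)), is_Cder_id. }
  assert (C2 : forall x, Ccont p2 x).
  { intros x. apply Ccont_mult; [|apply Ccont_gau].
    apply (is_Cder_cont _ x (4 * A * A * (INR 2 * 1 * x ^ 1) - 0)).
    apply (is_Cder_minus (fun x : R => 4 * A * A * x ^ 2) (fun _ => 2 * A)); [|apply is_Cder_const].
    apply (is_Cder_scal _ (fun x : R => x ^ 2)). apply (is_Cder_pow (fun x : R => RtoC x)), is_Cder_id. }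
  assert (L0 : Clim (gau A) (Rbar_locally p_infty) (RtoC 0)).
  { apply filterlim_ext with (2 := gau_pow_lim A 0 Hcc). intros x. simpl. ring. }
  assert (L1 : Clim p1 (Rbar_locally p_infty) (RtoC 0)).
  { pose proof (Clim_mult _ _ _ _ _ (Clim_const (Rbar_locally p_infty) (- (2 * A))) (gau_pow_lim A 1 Hcc)) as H.
    rewrite Cmult_0_r in H. apply filterlim_ext with (2 := H). intros x. unfold p1. simpl. ring. }
  set (K := (Cmod (4 * A * A) * (INR (fact 2) * exp (/ Re A)) + Cmod (2 * A) * (INR (fact 0) * exp (/ Re A)))%R).
  assert (Hb : forall x, (0 <= x)%R -> (Cmod (p2 x) <= K * exp (- 1 * x))%R).
  { intros x Hx. unfold p2.
    replace ((4 * A * A * x ^ 2 - 2 * A) * gau A x) with (4 * A * A * (x ^ 2 * gau A x) + - (2 * A * (x ^ 0 * gau A x))) by (simpl; ring).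
    apply Rle_trans with (1 := Cmod_triangle _ _). rewrite Cmod_opp, (Cmod_mult (4 * A * A)), (Cmod_mult (2 * A)).
    unfold K. rewrite Rmult_plus_distr_r, !(Rmult_assoc (Cmod _)).
    apply Rplus_le_compat; (apply Rmult_le_compat_l; [apply Cmod_ge_0|now apply gau_pow_decay]). }
  destruct (half_line_sum N G (fun x => x * gint (A * (x * x))) (gau A) p1 p2 (RtoC (sqrt PI / 2) / c) Iinf0 K) as [H1 H2]; auto.
  - unfold K. pose proof (exp_pos (/ Re A)).
    apply Rplus_le_le_0_compat; (apply Rmult_le_pos; [apply Cmod_ge_0|]; apply Rmult_le_pos; [apply pos_INR|lra]).
  - intros x Hx. split; [|split; [apply is_Cder_gau|split; auto]].
    replace (gau A x) with (1 * Cexp (- (A * (x * x)))).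
    + apply (is_Cder_erf A (fun x : R => RtoC x)). apply is_Cder_id.
    + unfold gau. rewrite RtoC_mult. ring.
  - pose proof (erf_path_lim 0) as H. apply filterlim_ext with (2 := H). intros x. unfold A. now rewrite Cplus_0_r.
  - intros m. destruct (gauss_fourier m) as [J [J1 J2]].
    destruct (parts2 (gau A) p1 p2 J (Wf m) m) as [I [I1 I2]]; auto.
    { intros x Hx. split; [apply is_Cder_gau|split; auto]. }
    exists I. split; auto. unfold Iinf0.
    replace (- p1 0%R - Ci * m * gau A 0 - m * m * Wf m) with (- (Ci * m) - m * m * Wf m) in I2; [exact I2|].
    unfold p1, A. rewrite gau_0. ring.
  - split; auto.
    match type of H2 with is_series _ ?v => match goal with |- is_series _ ?w => replace w with v; [exact H2|] end end.
    unfold p1, A. rewrite gau_0. ring.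
Qed.

(** With the extra factor [x] one has [p0 0 = 0] and [p1 0 = 1], so the boundary at 0 contributes
    the second-order value instead. *)
Lemma gauss_sum1 (N : Z) (G : Z -> C) : (0 < N)%Z -> periodic N G ->
  is_Cseries (tterm N G Iinf1) (CSeries (tterm N G Iinf1)) /\
  is_Cseries (fun n => dft N G (Z.of_nat (S n)) * (RtoC (INR (S n)) * gau (c * c) (INR (S n))))
    (G 0%Z / sqN N * / (2 * (c * c)) + Qs N G 2 0 + / sqN N * CSeries (tterm N G Iinf1)).
Proof.
  intros HN HG. pose proof c_neq_0 as Hn. set (A := c * c).
  assert (HA : A <> 0) by now apply Cmult_neq_0.
  set (p0 := fun x : R => RtoC x * gau A x).
  set (p1 := fun x : R => (1 - 2 * A * x ^ 2) * gau A x).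
  set (p2 := fun x : R => (4 * A * A * x ^ 3 - 6 * A * x) * gau A x).
  assert (Hpow : forall (k : nat) (x : R), is_Cder (fun x : R => RtoC x ^ k) x (INR k * 1 * RtoC x ^ pred k)).
  { intros k x. apply (is_Cder_pow (fun x : R => RtoC x)), is_Cder_id. }
  assert (D0 : forall x, is_Cder p0 x (p1 x)).
  { intros x. unfold p0, p1.
    replace ((1 - 2 * A * x ^ 2) * gau A x) with (1 * gau A x + x * (- (2 * A * x) * gau A x)) by (simpl Cpow; ring).
    apply (is_Cder_mult (fun x : R => RtoC x) (gau A)); [apply is_Cder_id|apply is_Cder_gau]. }
  assert (D1 : forall x, is_Cder p1 x (p2 x)).
  { intros x. unfold p1, p2.
    replace ((4 * A * A * x ^ 3 - 6 * A * x) * gau A x) with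
      ((0 - 2 * A * (INR 2 * 1 * x ^ 1)) * gau A x + (1 - 2 * A * x ^ 2) * (- (2 * A * x) * gau A x)).
    - apply (is_Cder_mult (fun x : R => 1 - 2 * A * x ^ 2) (gau A)); [|apply is_Cder_gau].
      apply (is_Cder_minus (fun _ => RtoC 1) (fun x : R => 2 * A * x ^ 2)); [apply is_Cder_const|].
      apply (is_Cder_scal _ (fun x : R => x ^ 2)), (Hpow 2%nat).
    - simpl INR. replace (RtoC (1 + 1)) with (RtoC 2) by (f_equal; ring). simpl Cpow. ring. }
  assert (C2 : forall x, Ccont p2 x).
  { intros x. apply Ccont_mult; [|apply Ccont_gau].
    apply (is_Cder_cont _ x (4 * A * A * (INR 3 * 1 * x ^ 2) - 6 * A * 1)).
    apply (is_Cder_minus (fun x : R => 4 * A * A * x ^ 3) (fun x : R => 6 * A * x)).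
    - apply (is_Cder_scal _ (fun x : R => x ^ 3)), (Hpow 3%nat).
    - apply (is_Cder_scal _ (fun x : R => RtoC x)), is_Cder_id. }
  assert (L0 : Clim p0 (Rbar_locally p_infty) (RtoC 0)).
  { apply filterlim_ext with (2 := gau_pow_lim A 1 Hcc). intros x. unfold p0. simpl. ring. }
  assert (L00 : Clim (gau A) (Rbar_locally p_infty) (RtoC 0)).
  { apply filterlim_ext with (2 := gau_pow_lim A 0 Hcc). intros x. simpl. ring. }
  assert (L1 : Clim p1 (Rbar_locally p_infty) (RtoC 0)).
  { pose proof (Clim_minus _ _ _ _ _ L00 (Clim_mult _ _ _ _ _ (Clim_const (Rbar_locally p_infty) (2 * A)) (gau_pow_lim A 2 Hcc))) as H.
    replace (0 - 2 * A * 0) with (RtoC 0) in H by ring. apply filterlim_ext with (2 := H). intros x. unfold p1. ring. }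
  set (K := (Cmod (4 * A * A) * (INR (fact 3) * exp (/ Re A)) + Cmod (6 * A) * (INR (fact 1) * exp (/ Re A)))%R).
  assert (Hb : forall x, (0 <= x)%R -> (Cmod (p2 x) <= K * exp (- 1 * x))%R).
  { intros x Hx. unfold p2.
    replace ((4 * A * A * x ^ 3 - 6 * A * x) * gau A x) with (4 * A * A * (x ^ 3 * gau A x) + - (6 * A * (x ^ 1 * gau A x))) by (simpl; ring).
    apply Rle_trans with (1 := Cmod_triangle _ _). rewrite Cmod_opp, (Cmod_mult (4 * A * A)), (Cmod_mult (6 * A)).
    unfold K. rewrite Rmult_plus_distr_r, !(Rmult_assoc (Cmod _)).
    apply Rplus_le_compat; (apply Rmult_le_compat_l; [apply Cmod_ge_0|now apply gau_pow_decay]). }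
  assert (DP : forall x, is_Cder (fun x => - / (2 * A) * gau A x) x (p0 x)).
  { intros x. replace (p0 x) with (- / (2 * A) * (- (2 * A * x) * gau A x)) by (unfold p0; field; exact HA).
    apply (is_Cder_scal _ (gau A)), is_Cder_gau. }
  destruct (half_line_sum N G (fun x => - / (2 * A) * gau A x) p0 p1 p2 (- / (2 * A) * 0) Iinf1 K) as [H1 H2]; auto.
  - unfold K. pose proof (exp_pos (/ Re A)).
    apply Rplus_le_le_0_compat; (apply Rmult_le_pos; [apply Cmod_ge_0|]; apply Rmult_le_pos; [apply pos_INR|lra]).
  - apply (Clim_mult _ (fun _ => _)); [apply filterlim_const|exact L00].
  - intros m. destruct (gauss_fourier m) as [J [J1 J2]].
    set (E := fun x : R => Cexp (- (Ci * m * x))).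
    (* [x exp (- A x^2)] is the derivative of [- exp (- A x^2) / (2 A)], so one integration by parts
       reduces its Fourier integral to that of the Gaussian. *)
    set (P := fun x : R => - / (2 * A) * (gau A x * E x)).
    destruct (parts2 p0 p1 p2 (fun X => P X - P 0%R - Ci * m / (2 * A) * J X)
      (- / (2 * A) * 0 - P 0%R - Ci * m / (2 * A) * Wf m) m) as [I [I1 I2]]; auto.
    + intros X HX.
      assert (H3 : is_CRInt (fun x => p0 x * E x + Ci * m / (2 * A) * (gau A x * E x)) 0 X (P X - P 0%R)).
      { apply is_CRInt_derive; auto.
        - intros x Hx.
          replace (p0 x * E x + Ci * m / (2 * A) * (gau A x * E x)) with
            (- / (2 * A) * (- (2 * A * x) * gau A x * E x + gau A x * (- (Ci * m) * E x))) by (unfold p0; field; exact HA).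
          apply (is_Cder_scal _ (fun x => gau A x * E x)).
          apply (is_Cder_mult (gau A) E); [apply is_Cder_gau|apply is_Cder_char].
        - intros x Hx. pose proof (is_Cder_cont _ _ _ (is_Cder_char m x)) as CE.
          apply Ccont_plus.
          + apply Ccont_mult; [exact (is_Cder_cont _ _ _ (D0 x))|exact CE].
          + apply Ccont_mult; [apply Ccont_const|]. apply Ccont_mult; [apply Ccont_gau|exact CE]. }
      pose proof (is_CRInt_minus _ _ _ _ _ _ H3 (is_CRInt_scal (Ci * m / (2 * A)) _ _ _ _ (J1 X HX))) as H4.
      apply is_CRInt_ext with (3 := H4); auto. intros x _. unfold E, p0, A. ring.
    + apply Clim_minus; [exact _| |apply (Clim_mult _ (fun _ => _)); [apply filterlim_const|exact J2]].
      apply Clim_minus; [exact _| |apply filterlim_const].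
      unfold P. apply (Clim_mult _ (fun _ => _)); [apply filterlim_const|].
      apply (Clim_0_bounded _ (gau A) E 1 L00). intros x. apply Cexp_char_bound.
    + exists I. split; auto. unfold Iinf1.
      match type of I2 with filterlim _ _ (locally ?v) => match goal with |- filterlim _ _ (locally ?w) => replace w with v; [exact I2|] end end.
      unfold P, E, p1, p0. rewrite char_0. unfold A. rewrite gau_0. simpl Cpow. field. exact Hn.
  - split; auto.
    match type of H2 with is_series _ ?v => match goal with |- is_series _ ?w => replace w with v; [exact H2|] end end.
    unfold p1, p0, A. rewrite gau_0. simpl Cpow. field. split; [now apply sqN_neq_0|exact Hn].
Qed.

End Gaussian.

(** * The principal square root *)

(** The principal root by the half-angle formulas rather than through the argument: the real part is
    visibly nonnegative and estimates reduce to real algebra. On the cut the root lies on the upper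
    side. *)
Definition csqrt (z : C) : C :=
  (sqrt ((Cmod z + Re z) / 2), if Rle_dec 0 (Im z) then sqrt ((Cmod z - Re z) / 2) else (- sqrt ((Cmod z - Re z) / 2))%R).

Lemma csqrt_arg_pos (z : C) : (0 <= (Cmod z + Re z) / 2)%R /\ (0 <= (Cmod z - Re z) / 2)%R.
Proof.
  pose proof (Cmod_Re_le z). pose proof (Rle_abs (Re z)). pose proof (Rle_abs (- Re z)) as H1.
  rewrite Rabs_Ropp in H1. lra.
Qed.

Lemma csqrt_Re_ge0 (z : C) : (0 <= Re (csqrt z))%R.
Proof. apply sqrt_pos. Qed.

Lemma csqrt_sqr (z : C) : csqrt z * csqrt z = z.
Proof.
  destruct (csqrt_arg_pos z) as [H1 H2].
  pose proof (sqrt_sqrt _ H1) as E1. pose proof (sqrt_sqrt _ H2) as E2.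
  assert (E3 : (sqrt ((Cmod z + Re z) / 2) * sqrt ((Cmod z - Re z) / 2) = Rabs (Im z) / 2)%R).
  { rewrite <- sqrt_mult_alt by auto.
    replace ((Cmod z + Re z) / 2 * ((Cmod z - Re z) / 2))%R with (Rsqr (Im z / 2)).
    - rewrite sqrt_Rsqr_abs. unfold Rdiv. rewrite Rabs_mult, (Rabs_pos_eq (/ 2)) by lra. reflexivity.
    - pose proof (Cmod2_alt z) as E. unfold Rsqr. simpl in E. lra. }
  apply C_ext; unfold csqrt; destruct (Rle_dec 0 (Im z)) as [Hi|Hi]; simpl.
  - rewrite E1, E2. unfold Re. field.
  - replace (- sqrt ((Cmod z - Re z) / 2) * - sqrt ((Cmod z - Re z) / 2))%R with
      (sqrt ((Cmod z - Re z) / 2) * sqrt ((Cmod z - Re z) / 2))%R by ring. rewrite E1, E2. field.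
  - rewrite (Rmult_comm (sqrt ((Cmod z - Re z) / 2))), E3, Rabs_pos_eq by auto. field.
  - rewrite <- Ropp_mult_distr_r, <- Ropp_mult_distr_l, (Rmult_comm (sqrt ((Cmod z - Re z) / 2))), E3.
    rewrite Rabs_left by lra. field.
Qed.

Lemma csqrt_Im_pos (z : C) : (0 <= Im z)%R -> (0 <= Im (csqrt z))%R.
Proof. intros H. unfold csqrt. simpl. destruct (Rle_dec 0 (Im z)); [apply sqrt_pos|lra]. Qed.

Lemma csqrt_Im_neg (z : C) : (Im z < 0)%R -> (Im (csqrt z) <= 0)%R.
Proof.
  intros H. unfold csqrt. simpl. destruct (Rle_dec 0 (Im z)); [lra|].
  pose proof (sqrt_pos ((Cmod z - Re z) / 2)). lra.
Qed.

Lemma Cmod_csqrt (z : C) : Cmod (csqrt z) = sqrt (Cmod z).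
Proof.
  rewrite <- (csqrt_sqr z) at 2. rewrite Cmod_mult. symmetry. apply sqrt_square, Cmod_ge_0.
Qed.

Lemma csqrt_unique (z s : C) : s * s = z -> (0 < Re s)%R -> csqrt z = s.
Proof.
  intros Hs Hr. pose proof (csqrt_Re_ge0 z) as H0.
  assert (E : (csqrt z - s) * (csqrt z + s) = 0).
  { replace ((csqrt z - s) * (csqrt z + s)) with (csqrt z * csqrt z - s * s) by ring. rewrite csqrt_sqr, Hs. ring. }
  destruct (Ceq_dec (csqrt z) s) as [Eq|Ne]; [exact Eq|exfalso].
  apply (Cmult_neq_0 (csqrt z - s) (csqrt z + s)); auto; [now apply Cminus_eq_contra|].
  intros E2. apply (f_equal Re) in E2. change (Re (csqrt z) + Re s = 0)%R in E2. lra.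
Qed.

Lemma Re_pos_neq_0 (s : C) : (0 < Re s)%R -> s <> 0.
Proof. intros H E. rewrite E in H. simpl in H. lra. Qed.

(** The remainder is exactly [- h^2 / (2 s (s + s')^2)], where [s'] is the root at [z + h]. Both
    roots have nonnegative real part, so [|s + s'| >= Re s], even if the increment crosses the
    cut. *)
Lemma qd_csqrt (z : C) : (0 < Re (csqrt z))%R -> qd csqrt z (/ (2 * csqrt z)).
Proof.
  intros Hp. set (s := csqrt z) in *. pose proof (Re_pos_neq_0 s Hp) as Hn.
  pose proof (proj1 (Cmod_gt_0 s) Hn) as Hs0.
  exists (/ (2 * Cmod s * (Re s * Re s)))%R, 1%R. split; [|split; [lra|]].
  { left. apply Rinv_0_lt_compat. repeat apply Rmult_lt_0_compat; auto; lra. }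
  intros h _. set (s' := csqrt (z + h)).
  assert (Hre : (Re s <= Re (s + s'))%R).
  { pose proof (csqrt_Re_ge0 (z + h)). change (Re s <= Re s + Re s')%R. unfold s'. lra. }
  assert (Hsum : s + s' <> 0) by (apply Re_pos_neq_0; lra).
  assert (Hmod : (Re s <= Cmod (s + s'))%R).
  { apply Rle_trans with (1 := Hre), Rle_trans with (2 := Cmod_Re_le _), Rle_abs. }
  assert (Eh : h = (s' - s) * (s + s')).
  { replace ((s' - s) * (s + s')) with (s' * s' - s * s) by ring. unfold s', s. rewrite !csqrt_sqr. ring. }
  assert (E : s' - s - h * / (2 * s) = - (h * h) * / (2 * s * ((s + s') * (s + s')))).
  { rewrite Eh. field. split; auto. }
  fold s. rewrite E, Cmod_mult, Cmod_opp, Cmod_mult, Cmod_inv, !Cmod_mult, Cmod_R, (Rabs_pos_eq 2) by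
    (try lra; repeat apply Cmult_neq_0; auto; intros E2; apply RtoC_inj in E2; lra).
  rewrite (Rmult_comm (/ _)). apply Rmult_le_compat_l; [apply Rmult_le_pos; apply Cmod_ge_0|].
  apply Rinv_le_contravar; [repeat apply Rmult_lt_0_compat; auto; lra|].
  apply Rmult_le_compat_l; [lra|]. apply Rmult_le_compat; lra.
Qed.

(** * Binomial series *)

(** The Taylor coefficients of [(1 - y)^(- al)]. *)
Fixpoint bco (al : R) (k : nat) : R :=
  match k with O => 1%R | S k' => (bco al k' * ((al + INR k') / INR (S k')))%R end.

(** A crude growth is enough. It is responsible for the disc [|y| <= 1/6], on which the terms are
    dominated by powers of [1/2], and for the restriction of the exponents to at most 3. *)
Lemma bco_bound (al : R) (k : nat) : (0 <= al <= 3)%R -> (0 <= bco al k <= 3 ^ k)%R.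
Proof.
  intros Ha. induction k as [|k [IH1 IH2]]; [simpl; lra|].
  cbn [bco]. pose proof (pos_INR k). rewrite S_INR.
  assert (H1 : (0 <= (al + INR k) / (INR k + 1) <= 3)%R).
  { split; [apply Rdiv_le_0_compat; lra|].
    apply Rmult_le_reg_r with (INR k + 1)%R; [lra|].
    replace ((al + INR k) / (INR k + 1) * (INR k + 1))%R with (al + INR k)%R by (field; lra). lra. }
  split; [apply Rmult_le_pos; lra|]. simpl. rewrite (Rmult_comm 3). apply Rmult_le_compat; lra.
Qed.

Lemma Rsum_n_ext_loc (a b : nat -> R) n : (forall k, (k <= n)%nat -> a k = b k) -> sum_n a n = sum_n b n.
Proof. exact (sum_n_ext_loc (G := R_AbelianMonoid) a b n). Qed.

Lemma Rsum_n_plus (a b : nat -> R) n : sum_n (fun k => a k + b k)%R n = (sum_n a n + sum_n b n)%R.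
Proof. exact (sum_n_plus (G := R_AbelianMonoid) a b n). Qed.

Lemma Rsum_n_shift1 (F : nat -> R) n : sum_n F (S n) = (F 0%nat + sum_n (fun k => F (S k)) n)%R.
Proof.
  induction n.
  - rewrite Rsum_Sn, !Rsum_O. reflexivity.
  - rewrite (Rsum_Sn F), IHn, (Rsum_Sn (fun k => F (S k))). rring.
Qed.

Lemma bco_succ (al : R) (k : nat) : (INR (S k) * bco al (S k) = (al + INR k) * bco al k)%R.
Proof. cbn [bco]. field. apply not_0_INR. lia. Qed.

(** Multiply by [k + 1], split it as [i + (k + 1 - i)] under the sum, and apply the recurrence
    [bco_succ] to the corresponding factor; this proves the multiplicativity of the binomial series
    without powers of [1 - y]. *)
Lemma bco_vandermonde (al be : R) (k : nat) :
  sum_n (fun i => bco al i * bco be (k - i))%R k = bco (al + be) k.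
Proof.
  induction k as [|k IH].
  - rewrite Rsum_O. simpl. rring.
  - apply (Rmult_eq_reg_l (INR (S k))); [|apply not_0_INR; lia].
    rewrite bco_succ, <- IH, <- !Rsum_n_scal.
    set (f := fun i : nat => (INR i * bco al i * bco be (S k - i))%R).
    set (g := fun i : nat => (bco al i * (INR (S k - i) * bco be (S k - i)))%R).
    transitivity (sum_n (fun i => f i + g i)%R (S k)).
    { apply Rsum_n_ext_loc. intros i Hi. unfold f, g. rewrite minus_INR by auto. rring. }
    rewrite Rsum_n_plus, (Rsum_n_shift1 f), (Rsum_Sn g).
    replace (f 0%nat) with 0%R by (unfold f; simpl; ring).
    replace (g (S k)) with 0%R by (unfold g; rewrite Nat.sub_diag; simpl; ring).
    rewrite Rplus_0_l, Rplus_0_r, <- Rsum_n_plus. apply Rsum_n_ext_loc. intros i Hi. unfold f, g.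
    replace (S k - S i)%nat with (k - i)%nat by lia. replace (S k - i)%nat with (S (k - i)) by lia.
    rewrite bco_succ, bco_succ, minus_INR by auto. rring.
Qed.

Definition bbin (al : R) (y : C) : C := CSeries (fun k => RtoC (bco al k) * y ^ k).

Lemma bbin_term (al : R) (y : C) (k : nat) : (0 <= al <= 3)%R ->
  (Cmod (RtoC (bco al k) * y ^ k) <= (3 * Cmod y) ^ k)%R.
Proof.
  intros Ha. pose proof (bco_bound al k Ha).
  rewrite Cmod_mult, Cmod_R, Cmod_pow, Rabs_pos_eq, Rpow_mult_distr by lra.
  apply Rmult_le_compat_r; [apply pow_le, Cmod_ge_0|lra].
Qed.

Lemma ex_geom (y : C) : (Cmod y <= 1 / 6)%R -> is_series (fun k => (3 * Cmod y) ^ k)%R (/ (1 - 3 * Cmod y))%R.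
Proof. intros Hy. apply is_series_geom. rewrite Rabs_pos_eq; pose proof (Cmod_ge_0 y); lra. Qed.

Lemma bbin_series (al : R) (y : C) : (0 <= al <= 3)%R -> (Cmod y <= 1 / 6)%R ->
  is_Cseries (fun k => RtoC (bco al k) * y ^ k) (bbin al y).
Proof.
  intros Ha Hy. apply (is_CSeries_le _ (fun k => (3 * Cmod y) ^ k)%R).
  - intros k. now apply bbin_term.
  - eexists. now apply ex_geom.
Qed.

Lemma bbin_mult (al be : R) (y : C) : (0 <= al)%R -> (0 <= be)%R -> (al + be <= 3)%R -> (Cmod y <= 1 / 6)%R ->
  bbin al y * bbin be y = bbin (al + be) y.
Proof.
  intros Ha Hb Hab Hy.
  assert (Hex : forall ga, (0 <= ga <= 3)%R -> ex_series (fun k => Cmod (RtoC (bco ga k) * y ^ k))).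
  { intros ga Hga. apply (ex_series_le (V := R_CompleteNormedModule) _ (fun k => (3 * Cmod y) ^ k)%R).
    - intros k. change (Rabs (Cmod (RtoC (bco ga k) * y ^ k)) <= (3 * Cmod y) ^ k)%R.
      rewrite Rabs_pos_eq by apply Cmod_ge_0. now apply bbin_term.
    - eexists. now apply ex_geom. }
  pose proof (is_Cseries_cauchy _ _ _ _ (Hex al ltac:(lra)) (Hex be ltac:(lra))
    (bbin_series al y ltac:(lra) Hy) (bbin_series be y ltac:(lra) Hy)) as H.
  apply (is_Cseries_unique _ _ _ H).
  apply (is_Cseries_ext (fun k => RtoC (bco (al + be) k) * y ^ k)); [|apply bbin_series; auto; lra].
  intros k. rewrite <- bco_vandermonde.
  assert (E : forall n, (n <= k)%nat -> RtoC (sum_n (fun i => bco al i * bco be (k - i))%R n) * y ^ k =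
    sum_n (fun i => RtoC (bco al i) * y ^ i * (RtoC (bco be (k - i)) * y ^ (k - i))) n).
  { induction n; intros Hn.
    - rewrite Rsum_O, Csum_O. rewrite Nat.sub_0_r, RtoC_mult. simpl Cpow. cring.
    - rewrite Rsum_Sn, Csum_Sn, <- IHn by lia. rewrite RtoC_plus, RtoC_mult.
      replace (y ^ k) with (y ^ S n * y ^ (k - S n)) by (rewrite <- Cpow_add_r; f_equal; lia). cring. }
  now apply E.
Qed.

Lemma bbin_1 (y : C) : (Cmod y <= 1 / 6)%R -> bbin 1 y = / (1 - y).
Proof.
  intros Hy. apply CSeries_unique. apply (is_Cseries_ext (fun k => y ^ k)).
  - intros k. assert (E : bco 1 k = 1%R).
    { induction k; [reflexivity|]. cbn [bco]. rewrite IHk, S_INR. pose proof (pos_INR k). field. lra. }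
    rewrite E. ring.
  - apply is_Cseries_geom. lra.
Qed.

(** Reduces half-integer exponents to integer powers of the inverse square root, the only branch
    that has to be followed. *)
Lemma bbin_half_pow (n : nat) (y : C) : (INR n <= 6)%R -> (Cmod y <= 1 / 6)%R ->
  bbin (1 / 2) y ^ n = bbin (INR n / 2) y.
Proof.
  intros Hn Hy. induction n.
  - simpl. symmetry. apply CSeries_unique. apply (is_Cseries_ext (fun k => match k with O => RtoC 1 | S _ => RtoC 0 end)).
    + intros k. destruct k; [simpl; ring|].
      assert (E : bco (0 / 2) (S k) = 0%R).
      { induction k; [simpl; field|]. cbn [bco] in *. rewrite IHk. ring. }
      rewrite E. ring.
    + apply is_Cseries_first. replace (1 - 1) with (RtoC 0) by ring. apply is_Cseries_0.
  - rewrite S_INR in *. pose proof (pos_INR n). cbn [Cpow]. rewrite IHn by lra.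
    rewrite bbin_mult by lra. f_equal. field.
Qed.

Lemma bbin_near_1 (al : R) (y : C) : (0 <= al <= 3)%R -> (Cmod y <= 1 / 6)%R -> (Cmod (bbin al y - 1) <= 6 * Cmod y)%R.
Proof.
  intros Ha Hy.
  pose proof (CSeries_tail_le (fun k => RtoC (bco al k) * y ^ k) (fun k => (3 * Cmod y) ^ k)%R 0
    (fun k => bbin_term al y k Ha) (ex_intro _ _ (ex_geom y Hy))) as H.
  rewrite Csum_O, Rsum_O, (is_series_unique _ _ (ex_geom y Hy)) in H. simpl in H.
  replace (1 * 1) with (RtoC 1) in H by ring. fold (bbin al y) in H.
  apply Rle_trans with (1 := H). pose proof (Cmod_ge_0 y).
  apply Rmult_le_reg_r with (1 - 3 * Cmod y)%R; [lra|].
  replace ((/ (1 - 3 * Cmod y) - 1) * (1 - 3 * Cmod y))%R with (3 * Cmod y)%R by (field; lra). nra.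
Qed.

(** The branch of [csqrt] near [a] is given by the binomial series, as long as [a] stays away
    from the negative real axis. *)
Lemma csqrt_local (a y : C) (eta : R) : (0 < eta <= 1)%R -> a <> 0 ->
  (eta * Cmod (csqrt a) <= Re (csqrt a))%R -> (Cmod y <= eta / 12)%R ->
  csqrt a <> 0 /\ / csqrt (a * (1 - y)) = / csqrt a * bbin (1 / 2) y.
Proof.
  intros He Ha Hre Hy. assert (Hy6 : (Cmod y <= 1 / 6)%R) by lra.
  set (p := csqrt a) in *. set (b := bbin (1 / 2) y).
  assert (Hp : p <> 0).
  { intros E. apply Ha. rewrite <- (csqrt_sqr a). fold p. rewrite E. ring. }
  pose proof (proj1 (Cmod_gt_0 p) Hp) as Hp0.
  pose proof (bbin_near_1 (1 / 2) y ltac:(lra) Hy6) as Hb. fold b in Hb.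
  assert (H1y : 1 - y <> 0) by (apply one_minus_neq_0; lra).
  assert (Hbb : b * b = / (1 - y)).
  { unfold b. rewrite bbin_mult by lra. replace (1 / 2 + 1 / 2)%R with 1%R by field. now apply bbin_1. }
  assert (Hb0 : b <> 0).
  { intros E. rewrite E, Cmult_0_l in Hbb. apply (f_equal (fun x => x * (1 - y))) in Hbb.
    rewrite Cinv_l, Cmult_0_l in Hbb by auto. apply C1_nz. auto. }
  split; auto.
  assert (E : csqrt (a * (1 - y)) = p * / b).
  { apply csqrt_unique.
    - rewrite <- (csqrt_sqr a). fold p. replace (1 - y) with (/ (b * b)).
      + field. auto.
      + rewrite Hbb. field. exact H1y.
    (* [Re (p / b)] has the sign of [Re (p conj b)]. As [|b - 1| <= 6 |y| <= eta / 2], the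
       perturbation cannot leave the half-plane from the sector [Re p >= eta |p|]; this explains the
       radius [eta / 12]. *)
    - assert (Hconj : (0 < Re (p * Cconj b))%R).
      { replace (p * Cconj b) with (p + p * Cconj (b - 1)) by (apply C_ext; simpl; ring).
        change (0 < Re p + Re (p * Cconj (b - 1)))%R.
        pose proof (Cmod_Re_le (p * Cconj (b - 1))) as H. rewrite Cmod_mult, Cmod_conj in H.
        pose proof (Rle_abs (- Re (p * Cconj (b - 1)))) as H2. rewrite Rabs_Ropp in H2.
        assert (Cmod p * Cmod (b - 1) <= Cmod p * (eta / 2))%R by (apply Rmult_le_compat_l; lra). nra. }
      assert (Eb : / b = Cconj b * RtoC (/ (Cmod b ^ 2))).
      { assert (Hmb : (0 < Cmod b)%R) by (apply Cmod_gt_0; auto).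
        rewrite RtoC_inv by nra. rewrite RtoC_pow.
        assert (E2 : RtoC (Cmod b) ^ 2 = b * Cconj b) by (rewrite <- RtoC_pow; apply Cmod2_conj).
        rewrite E2. field. split; auto. intros E3. apply Hb0.
        apply Cmod_eq_0. rewrite <- Cmod_conj, E3. apply Cmod_0. }
      rewrite Eb, Cmult_assoc.
      replace (Re (p * Cconj b * RtoC (/ Cmod b ^ 2))) with (Re (p * Cconj b) * / Cmod b ^ 2)%R
        by (simpl; unfold Re; ring).
      apply Rmult_lt_0_compat; auto. apply Rinv_0_lt_compat.
      assert (Hmb : (0 < Cmod b)%R) by (apply Cmod_gt_0; auto). nra. }
  rewrite E. field. auto.
Qed.

(** * Series of inverse powers of square roots *)

Definition Phis (n : nat) (Cf w : nat -> C) (xi : C) : C := CSeries (fun k => Cf k * (/ csqrt (1 - w k * xi)) ^ n).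

(** At [xi0] the [k]-th radicand is [a_k (1 - y_k)] with [y_k] proportional to [xi - xi0]. The
    bounds [|a_k| >= s0] and [|w_k| <= W] and the sector [eta] are uniform in [k], so one radius
    makes every [|y_k| <= eta / 12]; Fubini then collects the binomial expansions by powers of
    [xi - xi0]. *)
Lemma Phis_local (n : nat) (Cf w : nat -> C) (C0 W eta s0 : R) (xi0 : C) :
  (INR n <= 6)%R -> (forall k, (Cmod (Cf k) <= C0 * / INR (S k) ^ 2)%R) -> (0 <= W)%R -> (forall k, (Cmod (w k) <= W)%R) ->
  (0 < eta <= 1)%R -> (0 < s0)%R ->
  (forall k, (s0 <= Cmod (1 - w k * xi0))%R /\
     (eta * Cmod (csqrt (1 - w k * xi0)) <= Re (csqrt (1 - w k * xi0)))%R) ->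
  exists rho : R, (0 < rho)%R /\ forall xi, (Cmod (xi - xi0) < rho)%R ->
    is_Cseries (fun j => (xi - xi0) ^ j * CSeries (fun k =>
       Cf k * (/ csqrt (1 - w k * xi0)) ^ n * (RtoC (bco (INR n / 2) j) * (w k / (1 - w k * xi0)) ^ j))) (Phis n Cf w xi).
Proof.
  intros Hn HC HW Hw He Hs0 Ha.
  assert (HC0 : (0 <= C0)%R).
  { pose proof (HC 0%nat) as H. simpl in H. rewrite !Rmult_1_l, Rinv_1, Rmult_1_r in H. pose proof (Cmod_ge_0 (Cf 0%nat)). lra. }
  exists (eta / 12 * s0 / (W + 1))%R. split; [apply Rdiv_lt_0_compat; nra|].
  intros xi Hxi. set (h := xi - xi0) in *.
  set (a := fun k => 1 - w k * xi0).
  assert (Ha0 : forall k, a k <> 0).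
  { intros k. apply Cmod_gt_0. unfold a. pose proof (proj1 (Ha k)). lra. }
  set (y := fun k => w k / a k * h).
  assert (Hy : forall k, (Cmod (y k) <= eta / 12)%R).
  { intros k. unfold y. rewrite Cmod_mult, Cmod_div by auto.
    pose proof (proj1 (Ha k)) as Hak. fold (a k) in Hak. pose proof (Hw k) as Hwk. pose proof (Cmod_ge_0 (w k)).
    pose proof (Cmod_ge_0 h).
    apply Rle_trans with (W / s0 * (eta / 12 * s0 / (W + 1)))%R.
    - apply Rmult_le_compat; [apply Rdiv_le_0_compat; lra|lra| |lra].
      unfold Rdiv. apply Rmult_le_compat; [lra|left; apply Rinv_0_lt_compat; lra|auto|].
      apply Rinv_le_contravar; lra.
    - replace (W / s0 * (eta / 12 * s0 / (W + 1)))%R with (eta / 12 * (W / (W + 1)))%R by (field; lra).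
      assert (W / (W + 1) <= 1)%R.
      { apply Rmult_le_reg_r with (W + 1)%R; [lra|]. replace (W / (W + 1) * (W + 1))%R with W by (field; lra). lra. }
      assert (0 <= W / (W + 1))%R by (apply Rdiv_le_0_compat; lra). nra. }
  assert (Hn0 : (0 <= INR n / 2 <= 3)%R) by (pose proof (pos_INR n); lra).
  set (t := fun k j => Cf k * (/ csqrt (a k)) ^ n * (RtoC (bco (INR n / 2) j) * (y k) ^ j)).
  set (S0 := (/ sqrt s0)%R).
  assert (HS0 : (0 < S0)%R) by (apply Rinv_0_lt_compat, sqrt_lt_R0; auto).
  assert (Hinv : forall k, (Cmod ((/ csqrt (a k)) ^ n) <= S0 ^ n)%R).
  { intros k. rewrite Cmod_pow. apply pow_incr. split; [apply Cmod_ge_0|].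
    rewrite Cmod_inv by (destruct (csqrt_local (a k) (y k) eta He (Ha0 k) (proj2 (Ha k)) (Hy k)); auto).
    rewrite Cmod_csqrt. apply Rinv_le_contravar; [apply sqrt_lt_R0; auto|]. apply sqrt_le_1_alt, Ha. }
  set (D := fun k j => (C0 * S0 ^ n * / INR (S k) ^ 2 * (/ 2) ^ j)%R).
  assert (Ht : forall k j, (Cmod (t k j) <= D k j)%R).
  { intros k j. unfold t, D. rewrite Cmod_mult, (Cmod_mult (Cf k)).
    pose proof (pow_lt S0 n HS0).
    apply Rmult_le_compat; try apply Cmod_ge_0.
    - apply Rmult_le_pos; apply Cmod_ge_0.
    - apply Rle_trans with (C0 * / INR (S k) ^ 2 * S0 ^ n)%R; [|lra].
      apply Rmult_le_compat; auto using Cmod_ge_0.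
    - apply Rle_trans with (1 := bbin_term _ _ j Hn0). apply pow_incr.
      pose proof (Cmod_ge_0 (y k)). pose proof (Hy k). lra. }
  assert (Hg : is_series (fun j => (/ 2) ^ j)%R (/ (1 - / 2))%R).
  { apply is_series_geom. rewrite Rabs_pos_eq; lra. }
  assert (HDs : forall k, is_series (D k) (C0 * S0 ^ n * / INR (S k) ^ 2 * / (1 - / 2))%R).
  { intros k. exact (is_series_scal (V := R_NormedModule) _ _ _ Hg). }
  assert (HDD : ex_series (fun k => Series (D k))).
  { apply (ex_series_ext (fun k => (C0 * S0 ^ n * 2) * / INR (S k) ^ 2)%R); [|apply ex_series_tq_bound].
    intros k. rewrite (is_series_unique _ _ (HDs k)).
    match goal with |- ?u = ?v => change (@eq R u v) end. field. apply not_0_INR. lia. }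
  assert (Hterm : forall k, CSeries (t k) = Cf k * (/ csqrt (1 - w k * xi)) ^ n).
  { intros k. apply CSeries_unique. unfold t.
    replace (Cf k * (/ csqrt (1 - w k * xi)) ^ n) with (Cf k * (/ csqrt (a k)) ^ n * bbin (INR n / 2) (y k)).
    - apply is_Cseries_scal, bbin_series; auto. pose proof (Hy k). lra.
    - destruct (csqrt_local (a k) (y k) eta He (Ha0 k) (proj2 (Ha k)) (Hy k)) as [_ E].
      replace (1 - w k * xi) with (a k * (1 - y k)).
      + rewrite E, Cpow_mult_l, bbin_half_pow by (auto; pose proof (Hy k); lra). ring.
      + unfold y, a, h. field. apply Ha0. }
  pose proof (CSeries_fubini t D Ht (fun k => ex_intro _ _ (HDs k)) HDD) as HF.
  unfold Phis. rewrite <- (CSeries_ext _ _ Hterm).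
  apply is_Cseries_ext with (2 := HF). intros j.
  (* For [h] nonzero the power [h^j] is divided out of a series already known to converge; at
     [h = 0] only [j = 0] contributes. *)
  destruct (Ceq_dec h 0) as [Hh|Hh].
  - destruct j as [|j].
    + rewrite (CSeries_ext _ (fun k => Cf k * (/ csqrt (a k)) ^ n * (RtoC (bco (INR n / 2) 0) * (w k / a k) ^ 0))).
      * simpl Cpow at 1. unfold a. ring.
      * intros k. unfold t. simpl. reflexivity.
    + rewrite (CSeries_ext _ (fun _ => RtoC 0)).
      * rewrite (CSeries_unique _ _ is_Cseries_0), Hh. simpl. ring.
      * intros k. unfold t, y. rewrite Hh. simpl. ring.
  - assert (Hhj : h ^ j <> 0).
    { clear - Hh. induction j; [apply C1_nz|]. simpl. now apply Cmult_neq_0. }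
    assert (E : CSeries (fun k => / h ^ j * t k j) = / h ^ j * CSeries (fun k => t k j)).
    { apply CSeries_unique, is_Cseries_scal. apply (is_CSeries_le _ (fun k => Series (D k))); auto.
      intros k. apply Rle_trans with (1 := Ht k j). rewrite (is_series_unique _ _ (HDs k)). unfold D.
      pose proof (pow_lt S0 n HS0). pose proof (lt_0_INR (S k) ltac:(lia)) as Hk.
      apply Rmult_le_compat_l.
      - apply Rmult_le_pos; [apply Rmult_le_pos; lra|left; apply Rinv_0_lt_compat; nra].
      - replace (/ (1 - / 2))%R with 2%R by field. apply Rle_trans with (1 ^ j)%R; [apply pow_incr; lra|rewrite pow1; lra]. }
    transitivity (h ^ j * CSeries (fun k => / h ^ j * t k j)); [rewrite E; field; exact Hhj|].
    f_equal. apply CSeries_ext. intros k. unfold t, y, a. rewrite Cpow_mult_l. field.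
    destruct (csqrt_local (a k) (y k) eta He (Ha0 k) (proj2 (Ha k)) (Hy k)) as [E3 _].
    repeat match goal with |- _ /\ _ => split end; first [exact Hhj|exact E3|exact (Ha0 k)].
Qed.

Ltac cfield := match goal with |- @eq _ ?a ?b => change (@eq C a b) end; field.

(** * The Borel transform *)

(** By [Lfun_dft], the Borel transform of [Theta_tilde nu (dft N G) N] is the sum over [k] of
    [Cf N G nu k * (1 - ww N k * xi)^(- (nu + 3 / 2))]. *)
Definition ww (N : Z) (k : nat) : C := 4 * lam N k ^ 2 * (PI * Ci / IZR N).
Definition Dk (N : Z) (G : Z -> C) (nu k : nat) : C :=
  (-1) ^ S nu * (2 / sqN N) * (lam N k ^ S nu * G (Z.of_nat (S k))).
Definition Cf (N : Z) (G : Z -> C) (nu k : nat) : C := Dk N G nu k * RtoC (INR nu + 1 / 2) * ww N k.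

(** [ww N k = - i om N k], so the [k]-th singular point [1 / ww] of the Borel transform is
    [i PI (k + 1)^2 / N], on the positive imaginary axis. *)
Definition om (N : Z) (k : nat) : R := (4 * PI / (IZR N * mu N k ^ 2))%R.

Lemma om_pos (N : Z) (k : nat) : (0 < N)%Z -> (0 < om N k)%R.
Proof.
  intros HN. pose proof (mu_pos N k HN). assert (0 < IZR N)%R by (apply IZR_lt; lia). pose proof PI_RGT_0.
  apply Rdiv_lt_0_compat; [lra|]. apply Rmult_lt_0_compat; [lra|]. nra.
Qed.

Lemma ww_om (N : Z) (k : nat) : (0 < N)%Z -> ww N k = - (Ci * om N k).
Proof.
  intros HN. pose proof (mu_pos N k HN) as Hmu. assert (HR : (0 < IZR N)%R) by (apply IZR_lt; lia).
  assert (E : lam N k ^ 2 = RtoC (- / mu N k ^ 2)).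
  { unfold lam. rewrite RtoC_opp, RtoC_inv, RtoC_pow by nra. simpl Cpow.
    transitivity ((Ci * Ci) * / (mu N k * (mu N k * 1))).
    - field. now apply mu_neq_0.
    - replace (Ci * Ci) with (- (1 : C)) by (apply C_ext; simpl; ring). ring. }
  unfold ww. rewrite E. unfold om. unfold Cdiv. rewrite <- RtoC_inv by lra.
  apply C_ext; simpl; field; lra.
Qed.

Lemma om_eq (N : Z) (k : nat) : (0 < N)%Z -> om N k = (IZR N / PI * / INR (S k) ^ 2)%R.
Proof.
  intros HN. assert (HR : (0 < IZR N)%R) by (apply IZR_lt; lia). pose proof PI_RGT_0.
  pose proof (lt_0_INR (S k) ltac:(lia)). unfold om, mu. field. repeat split; lra.
Qed.

Lemma Cmod_ww (N : Z) (k : nat) : (0 < N)%Z -> Cmod (ww N k) = om N k.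
Proof.
  intros HN. rewrite ww_om, Cmod_opp, Cmod_mult, Cmod_Ci, Cmod_R, Rabs_pos_eq by (auto; left; now apply om_pos). ring.
Qed.

Lemma inv_sqr_le_1 (k : nat) : (0 < / INR (S k) ^ 2 <= 1)%R.
Proof.
  assert (1 <= INR (S k))%R by (rewrite S_INR; pose proof (pos_INR k); lra).
  split; [apply Rinv_0_lt_compat; nra|]. rewrite <- Rinv_1. apply Rinv_le_contravar; nra.
Qed.

Lemma Cmod_ww_le (N : Z) (k : nat) : (0 < N)%Z -> (Cmod (ww N k) <= IZR N / PI)%R.
Proof.
  intros HN. rewrite Cmod_ww, om_eq by auto. pose proof (inv_sqr_le_1 k).
  assert (0 < IZR N / PI)%R by (apply Rdiv_lt_0_compat; [apply IZR_lt; lia|apply PI_RGT_0]). nra.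
Qed.

Lemma Cf_bound (N : Z) (G : Z -> C) (nu : nat) : (0 < N)%Z -> periodic N G ->
  exists C0 : R, (0 <= C0)%R /\ forall k, (Cmod (Cf N G nu k) <= C0 * / INR (S k) ^ 2)%R.
Proof.
  intros HN HG. destruct (periodic_bound N G HN HG) as [B [HB0 HB]].
  set (L := (IZR N / (2 * PI))%R).
  assert (HL : (0 < L)%R).
  { apply Rdiv_lt_0_compat; [apply IZR_lt; lia|]. pose proof PI_RGT_0; lra. }
  set (c1 := Cmod ((-1) ^ S nu * (2 / sqN N))). set (c2 := (INR nu + 1 / 2)%R).
  assert (Hc2 : (0 < c2)%R) by (unfold c2; pose proof (pos_INR nu); lra).
  assert (Hc1 : (0 <= c1)%R) by apply Cmod_ge_0.
  assert (HNP : (0 < IZR N / PI)%R) by (apply Rdiv_lt_0_compat; [apply IZR_lt; lia|apply PI_RGT_0]).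
  pose proof (pow_lt L (S nu) HL) as HLp.
  exists (c1 * (L ^ S nu * B) * c2 * (IZR N / PI))%R. split.
  { apply Rmult_le_pos; [apply Rmult_le_pos; [apply Rmult_le_pos; [auto|apply Rmult_le_pos]|]|]; lra. }
  intros k. unfold Cf, Dk. rewrite !(Cmod_mult _ (ww N k)), Cmod_ww, om_eq by auto.
  rewrite (Cmod_mult _ (RtoC _)), (Cmod_mult ((-1) ^ S nu * (2 / sqN N))), (Cmod_mult (lam N k ^ S nu)), Cmod_pow, Cmod_R.
  fold c1. fold c2. rewrite (Rabs_pos_eq c2) by lra.
  assert (Hlam : (Cmod (lam N k) ^ S nu <= L ^ S nu)%R).
  { apply pow_incr. split; [apply Cmod_ge_0|]. rewrite Cmod_lam by auto. fold L.
    assert (H1 : (1 <= INR (S k))%R) by (rewrite S_INR; pose proof (pos_INR k); lra).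
    assert (/ INR (S k) <= 1)%R by (rewrite <- Rinv_1; apply Rinv_le_contravar; lra). nra. }
  rewrite <- !Rmult_assoc. apply Rmult_le_compat_r; [left; apply inv_sqr_le_1|].
  apply Rmult_le_compat_r; [lra|]. apply Rmult_le_compat_r; [lra|].
  rewrite !Rmult_assoc. apply Rmult_le_compat_l; auto.
  apply Rmult_le_compat; auto using Cmod_ge_0. apply pow_le, Cmod_ge_0.
Qed.

Lemma Cpow_opp_sgn (z : C) (i : nat) : (- z) ^ i = (-1) ^ i * z ^ i.
Proof. replace (- z) with ((-1) * z) by ring. apply Cpow_mult_l. Qed.

Lemma Cpow_m1_even (p : nat) : (-1) ^ (2 * p) = 1.
Proof. replace (2 * p)%nat with (p + p)%nat by lia. rewrite Cpow_add_r. apply Cpow_m1_sqr. Qed.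

(** With [p = j + 1], the factorial of the [L]-value, the [p!] of the formal series and the
    [(p - 1)!] of the Borel transform combine into a coefficient of [(1 - y)^(- nu - 3/2)], by
    comparing the ratios of successive [j]. *)
Lemma fact_ratio (nu j : nat) : (nu <= 1)%nat ->
  (INR (fact (2 * S j + nu)) / INR (fact (S j)) / INR (fact j) = 4 ^ S j * (INR nu + 1 / 2) * bco (INR nu + 3 / 2) j)%R.
Proof.
  intros Hnu. induction j as [|j IH].
  - destruct nu as [|[|nu]]; [simpl; field|simpl; field|lia].
  - replace (2 * S (S j) + nu)%nat with (S (S (2 * S j + nu))) by lia.
    rewrite (fact_simpl (S (2 * S j + nu))), (fact_simpl (2 * S j + nu)), (fact_simpl (S j)), !mult_INR.
    cbn [bco]. rewrite (fact_simpl j) at 2. rewrite mult_INR.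
    transitivity (INR (fact (2 * S j + nu)) / INR (fact (S j)) / INR (fact j) *
      (INR (S (S (2 * S j + nu))) * INR (S (2 * S j + nu)) / (INR (S (S j)) * INR (S j))))%R.
    { field. repeat split; try apply INR_fact_neq_0; apply not_0_INR; lia. }
    rewrite IH. rewrite !S_INR, plus_INR, mult_INR, !S_INR. pose proof (pos_INR j).
    destruct nu as [|[|nu]]; [simpl INR|simpl INR|lia]; simpl pow; field; lra.
Qed.

(** The parity opposite to that of [n^nu], for which the modes [m] and [- m] of the primitives of
    order [2p + nu + 1] add up at 0 instead of cancelling. *)
Definition par (G : Z -> C) (nu : nat) : Prop := forall n : Z, G (- n)%Z = (-1) ^ S nu * G n.

Lemma tq_0_par (N : Z) (G : Z -> C) (nu p k : nat) : par G nu ->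
  tq N G (2 * p + nu + 1) k 0 = 2 * (lam N k ^ (2 * p + nu + 1) * G (Z.of_nat (S k))).
Proof.
  intros HP. unfold tq. rewrite Cpow_opp_sgn, HP.
  replace (- (Ci * mu N k * 0)) with (RtoC 0) by ring. replace (Ci * mu N k * 0) with (RtoC 0) by ring. rewrite Cexp_0.
  replace ((-1) ^ (2 * p + nu + 1)) with ((-1) ^ S nu).
  2:{ replace (2 * p + nu + 1)%nat with (2 * p + S nu)%nat by lia. rewrite Cpow_add_r, Cpow_m1_even. ring. }
  transitivity (lam N k ^ (2 * p + nu + 1) * G (Z.of_nat (S k)) +
    ((-1) ^ S nu * (-1) ^ S nu) * (lam N k ^ (2 * p + nu + 1) * G (Z.of_nat (S k)))); [ring|].
  rewrite Cpow_m1_sqr. ring.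
Qed.

Lemma Theta_tilde_Q (N : Z) (G : Z -> C) (nu p : nat) : (0 < N)%Z -> periodic N G ->
  Theta_tilde nu (dft N G) N p = / INR (fact p) * ((-1) ^ S nu * INR (fact (2 * p + nu)) * Qv N G (S (2 * p + nu)) 0)
    * (PI * Ci / IZR N) ^ p.
Proof.
  intros HN HG. unfold Theta_tilde. f_equal. f_equal.
  replace (RtoC (- (2 * INR p) - INR nu)) with (- INR (2 * p + nu) : C).
  - rewrite Lfun_dft by auto. f_equal. f_equal.
    replace (S (2 * p + nu)) with (2 * p + S nu)%nat by lia. rewrite Cpow_add_r, Cpow_m1_even. ring.
  - rewrite <- RtoC_opp. f_equal. rewrite plus_INR, mult_INR. simpl. ring.
Qed.

Lemma Theta_tilde_0 (N : Z) (G : Z -> C) (nu : nat) : (0 < N)%Z -> periodic N G -> (nu <= 1)%nat ->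
  Theta_tilde nu (dft N G) N 0 = (-1) ^ S nu * Qv N G (S nu) 0.
Proof.
  intros HN HG Hnu. rewrite Theta_tilde_Q by auto.
  replace (2 * 0 + nu)%nat with nu by lia.
  assert (E : fact nu = 1%nat) by (destruct nu as [|[|nu]]; [reflexivity|reflexivity|lia]).
  rewrite E. simpl fact. simpl INR. simpl (_ ^ 0). field.
Qed.

Lemma Theta_tilde_succ (N : Z) (G : Z -> C) (nu j : nat) : (0 < N)%Z -> periodic N G -> (nu <= 1)%nat -> par G nu ->
  Theta_tilde nu (dft N G) N (S j) / INR (fact j) =
  CSeries (fun k => Cf N G nu k * (RtoC (bco (INR nu + 3 / 2) j) * ww N k ^ j)).
Proof.
  intros HN HG Hnu HP. rewrite Theta_tilde_Q by auto.
  unfold Qv. destruct (2 * S j + nu)%nat as [|i] eqn:Ei; [lia|]. rewrite <- Ei.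
  replace (S (2 * S j + nu)) with (2 * S j + nu + 1)%nat by lia.
  set (I := (2 * S j + nu + 1)%nat).
  pose proof (tq_series N G I 0 HN HG ltac:(unfold I; lia)) as Hs. unfold Qs.
  set (K := / INR (fact (S j)) * ((-1) ^ S nu * INR (fact (2 * S j + nu)) * / sqN N) * (PI * Ci / IZR N) ^ S j / INR (fact j)).
  pose proof (is_Cseries_scal K _ _ Hs) as H2.
  match goal with |- ?l = _ => replace l with (K * CSeries (fun k => tq N G I k 0)) by (unfold K, Cdiv; simpl IZR; ring) end.
  symmetry. apply CSeries_unique. apply is_Cseries_ext with (2 := H2). intros k.
  unfold I. rewrite tq_0_par by auto.
  assert (EF : RtoC (INR (fact (2 * S j + nu))) * / INR (fact (S j)) * / INR (fact j) =
     RtoC (4 ^ S j) * RtoC (INR nu + 1 / 2) * RtoC (bco (INR nu + 3 / 2) j)).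
  { rewrite <- !RtoC_mult, <- (fact_ratio nu j Hnu). unfold Rdiv. rewrite !RtoC_mult, !RtoC_inv by apply INR_fact_neq_0. reflexivity. }
  unfold K, Cf, Dk.
  transitivity ((RtoC (INR (fact (2 * S j + nu))) * / INR (fact (S j)) * / INR (fact j)) *
    ((-1) ^ S nu * (2 / sqN N) * (lam N k ^ (2 * S j + nu + 1) * G (Z.of_nat (S k))) * (PI * Ci / IZR N) ^ S j)).
  { unfold Cdiv. ring. }
  rewrite EF.
  assert (EW : ww N k * ww N k ^ j = RtoC (4 ^ S j) * lam N k ^ (2 * S j) * (PI * Ci / IZR N) ^ S j).
  { change (ww N k * ww N k ^ j) with (ww N k ^ S j). unfold ww. rewrite !Cpow_mult_l, RtoC_pow, <- Cpow_mult_r. reflexivity. }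
  replace (2 * S j + nu + 1)%nat with (2 * S j + S nu)%nat by lia. rewrite (Cpow_add_r (lam N k)).
  transitivity (RtoC (INR nu + 1 / 2) * RtoC (bco (INR nu + 3 / 2) j) * ((-1) ^ S nu * (2 / sqN N) * (lam N k ^ S nu * G (Z.of_nat (S k))))
    * (RtoC (4 ^ S j) * lam N k ^ (2 * S j) * (PI * Ci / IZR N) ^ S j)).
  { ring. }
  rewrite <- EW. ring.
Qed.

(** * Geometry of the ray *)

(** The point [1 - t exp (- i sg ep)] when [s], [c] are the sine and cosine of [ep]: the values of
    [1 - ww xi] on the ray, with [t = om r]. *)
Definition zray (s c sg t : R) : C := ((1 - t * c)%R, (sg * (t * s))%R).

Section Ray.
Context (s c sg : R) (Hs : (0 < s)%R) (Hc : (0 < c)%R) (Hsc : (s * s + c * c = 1)%R) (Hsg : sg = 1%R \/ sg = (-1)%R).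

Let sg_sqr : (sg * sg = 1)%R.
Proof. destruct Hsg as [->| ->]; ring. Qed.

Let c_lt_1 : (c < 1)%R.
Proof. nra. Qed.

Lemma zray_Cmod2 (t : R) : (Cmod (zray s c sg t) ^ 2 = 1 - 2 * t * c + t * t)%R.
Proof.
  rewrite Cmod2_alt. simpl. unfold Re, Im. simpl.
  replace ((1 - t * c) * ((1 - t * c) * 1) + sg * (t * s) * (sg * (t * s) * 1))%R with
    (1 - 2 * t * c + t * t * (c * c + (sg * sg) * (s * s)))%R by ring.
  rewrite sg_sqr. replace (c * c + 1 * (s * s))%R with 1%R by lra. ring.
Qed.

(** The squared modulus is [(t - c)^2 + s^2]. *)
Lemma zray_Cmod_ge (t : R) : (s <= Cmod (zray s c sg t))%R.
Proof.
  pose proof (zray_Cmod2 t) as H. pose proof (Cmod_ge_0 (zray s c sg t)).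
  assert (H2 : (s * s <= 1 - 2 * t * c + t * t)%R) by (pose proof (Rle_0_sqr (t - c)) as H2; unfold Rsqr in H2; nra).
  apply Rnot_lt_le. intros Hlt. nra.
Qed.

(** With [c = cos ep] this is [sin (ep / 2)]. The ray keeps arguments within [PI - ep] of 0, so the
    square roots have arguments within [PI / 2 - ep / 2] and real part at least [sin (ep / 2)] times
    their modulus. *)
Definition eta : R := sqrt ((1 - c) / 2).

Lemma eta_pos : (0 < eta <= 1)%R.
Proof.
  split; [apply sqrt_lt_R0; lra|]. unfold eta. rewrite <- sqrt_1 at 2. apply sqrt_le_1_alt. lra.
Qed.

(** By the half-angle formula the claim is [Re z >= - c |z|]. When [Re z < 0] one compares squares:
    the difference is [(1 - c^2) (2 t c - 1)], positive because [t c > 1]. *)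
Lemma zray_sector (t : R) : (0 <= t)%R ->
  (eta * Cmod (csqrt (zray s c sg t)) <= Re (csqrt (zray s c sg t)))%R.
Proof.
  intros Ht. pose proof (zray_Cmod2 t) as HM. set (m := Cmod (zray s c sg t)) in *.
  assert (Hm : (0 <= m)%R) by apply Cmod_ge_0.
  rewrite Cmod_csqrt. fold m. unfold eta. rewrite <- sqrt_mult_alt by lra.
  change (Re (csqrt (zray s c sg t))) with (sqrt ((m + Re (zray s c sg t)) / 2)).
  apply sqrt_le_1_alt. change (Re (zray s c sg t)) with (1 - t * c)%R.
  enough (- (c * m) <= 1 - t * c)%R by lra.
  destruct (Rle_dec 0 (1 - t * c)) as [H|H]; [nra|].
  assert (Hsq : ((t * c - 1) * (t * c - 1) <= (c * m) * (c * m))%R).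
  { replace ((c * m) * (c * m))%R with (c * c * (1 - 2 * t * c + t * t))%R by (rewrite <- HM; ring).
    assert (0 <= (1 - c * c) * (2 * (t * c) - 1))%R by (apply Rmult_le_pos; nra). nra. }
  assert (0 <= c * m)%R by (apply Rmult_le_pos; lra).
  apply Rnot_lt_le. intros Hlt. nra.
Qed.

Lemma zray_Re_pos (t : R) : (0 <= t)%R -> (0 < Re (csqrt (zray s c sg t)))%R.
Proof.
  intros Ht. apply Rlt_le_trans with (2 := zray_sector t Ht). apply Rmult_lt_0_compat; [apply eta_pos|].
  rewrite Cmod_csqrt. apply sqrt_lt_R0. pose proof (zray_Cmod_ge t). lra.
Qed.

Lemma zray_Im_sgn (t : R) : (0 < t)%R -> (0 <= sg * Im (csqrt (zray s c sg t)))%R.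
Proof.
  intros Ht. assert (0 < t * s)%R by nra. destruct Hsg as [E|E]; rewrite E.
  - rewrite Rmult_1_l. apply csqrt_Im_pos. simpl. lra.
  - assert (Im (csqrt (zray s c (-1) t)) <= 0)%R; [|lra]. apply csqrt_Im_neg. simpl. lra.
Qed.

End Ray.

Lemma Cexp_Ci (x : R) : Cexp (Ci * x) = (cos x, sin x).
Proof.
  unfold Cexp. simpl. replace (0 * x - 1 * 0)%R with 0%R by ring. replace (0 * 0 + 1 * x)%R with x by ring.
  rewrite exp_0. apply C_ext; simpl; ring.
Qed.

Lemma direction_eq (sg eps : R) : sg = 1%R \/ sg = (-1)%R ->
  Cexp (Ci * (PI / 2 - sg * eps)%R) = ((sg * sin eps)%R, cos eps).
Proof.
  intros H. rewrite Cexp_Ci. rewrite cos_shift, sin_shift.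
  destruct H as [-> | ->]; [rewrite !Rmult_1_l; reflexivity|].
  replace (-1 * eps)%R with (- eps)%R by ring. rewrite cos_neg, sin_neg. f_equal. ring.
Qed.

Lemma one_minus_ww_ray (N : Z) (k : nat) (sg eps r : R) : (0 < N)%Z -> sg = 1%R \/ sg = (-1)%R ->
  1 - ww N k * ray (PI / 2 - sg * eps) r = zray (sin eps) (cos eps) sg (om N k * r).
Proof.
  intros HN Hsg. rewrite ww_om by auto. unfold ray. rewrite direction_eq by auto.
  apply C_ext; simpl; ring.
Qed.

(** * The Laplace integral of one term *)

Section Laplace.
Context (j q : C) (N : Z) (HN : (0 < N)%Z) (Hj : (0 < Im j)%R) (Hq : q * q = j / Ci) (Hq0 : (0 < Re q)%R).
Context (sg ep : R) (Hsg : sg = 1%R \/ sg = (-1)%R) (Hep : (0 < ep < PI / 2)%R).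
Context (Hdir : (0 < Re (Cexp (Ci * (PI / 2 - sg * ep)%R) / j))%R).

(** Normalized so that [exp (- cq^2 n^2) = exp (i PI n^2 j / N)], with [cq] in the right
    half-plane. *)
Definition cq : C := q * RtoC (sqrt (PI / IZR N)).
Definition e1 : C := Cexp (Ci * (PI / 2 - sg * ep)%R).
Definition dl : R := Re (e1 / j).

Lemma j_neq_0 : j <> 0.
Proof. intros E. rewrite E in Hj. simpl in Hj. lra. Qed.

Let HNR : (0 < IZR N)%R.
Proof. apply IZR_lt. lia. Qed.

Lemma cq_sqr : cq * cq = RtoC (PI / IZR N) * (j / Ci).
Proof.
  unfold cq. rewrite <- Hq.
  transitivity (q * q * (RtoC (sqrt (PI / IZR N)) * RtoC (sqrt (PI / IZR N)))); [ring|].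
  rewrite <- RtoC_mult, sqrt_sqrt; [ring|]. pose proof PI_RGT_0. left. apply Rdiv_lt_0_compat; lra.
Qed.

Lemma cq_Re : (0 < Re cq)%R.
Proof.
  unfold cq. pose proof PI_RGT_0.
  replace (Re (q * RtoC (sqrt (PI / IZR N)))) with (Re q * sqrt (PI / IZR N))%R by (simpl; unfold Re; ring).
  apply Rmult_lt_0_compat; auto. apply sqrt_lt_R0. apply Rdiv_lt_0_compat; lra.
Qed.

Lemma cq_sqr_Re : (0 < Re (cq * cq))%R.
Proof.
  rewrite cq_sqr. pose proof PI_RGT_0.
  replace (Re (RtoC (PI / IZR N) * (j / Ci))) with (PI / IZR N * Im j)%R.
  - apply Rmult_lt_0_compat; auto. apply Rdiv_lt_0_compat; lra.
  - assert (E : j / Ci = - (Ci * j)).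
    { transitivity (- (Ci * Ci) * (j / Ci)); [|field; apply Ci_nz].
      replace (Ci * Ci) with (- (1 : C)) by (apply C_ext; simpl; ring). ring. }
    rewrite E. simpl. unfold Im. ring.
Qed.

Lemma cq_neq_0 : cq <> 0.
Proof. apply Re_pos_neq_0, cq_Re. Qed.

Definition kp (k : nat) : C := kap cq (mu N k).

(** The link between the two expansions: [kp] is [xi / j] at the singular point [xi = 1 / ww], so
    the constant left by completing the square is the Laplace exponent at the singularity. *)
Lemma kp_ww (k : nat) : kp k * (ww N k * j) = 1.
Proof.
  unfold kp, kap. rewrite cq_sqr, ww_om by auto. unfold om.
  pose proof (mu_neq_0 N k HN) as Hm. pose proof (mu_pos N k HN) as Hm0. pose proof PI_RGT_0. pose proof j_neq_0.
  assert (HPI : RtoC PI <> 0) by (intros E; apply RtoC_inj in E; lra).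
  pose proof (IZR_C_neq_0 N ltac:(lia)).
  assert (HNm : (IZR N * mu N k ^ 2 <> 0)%R).
  { apply Rmult_integral_contrapositive_currified; [lra|]. apply pow_nonzero. lra. }
  rewrite (RtoC_div PI) by lra. rewrite (RtoC_div (4 * PI)) by exact HNm. rewrite !RtoC_mult, RtoC_pow.
  transitivity (- (Ci * Ci)).
  - field. repeat split; auto. apply Ci_nz.
  - apply C_ext; simpl; ring.
Qed.

Definition uk (k : nat) (r : R) : C := csqrt (1 - ww N k * ray (PI / 2 - sg * ep) r).
Definition Xr (r : R) : C := Cexp (- ray (PI / 2 - sg * ep) r / j).

Lemma sin_cos_ep : (0 < sin ep)%R /\ (0 < cos ep)%R /\ (sin ep * sin ep + cos ep * cos ep = 1)%R.
Proof.
  split; [apply sin_gt_0; lra|split; [apply cos_gt_0; lra|]].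
  pose proof (sin2_cos2 ep) as H. unfold Rsqr in H. exact H.
Qed.

Lemma uk_zray (k : nat) (r : R) : uk k r = csqrt (zray (sin ep) (cos ep) sg (om N k * r)).
Proof. unfold uk. now rewrite one_minus_ww_ray. Qed.

Lemma uk_Re (k : nat) (r : R) : (0 <= r)%R -> (0 < Re (uk k r))%R.
Proof.
  intros Hr. rewrite uk_zray. destruct sin_cos_ep as [H1 [H2 H3]].
  apply zray_Re_pos; auto. apply Rmult_le_pos; [left; now apply om_pos|exact Hr].
Qed.

Lemma uk_sqr (k : nat) (r : R) : uk k r * uk k r = 1 - ww N k * (r * e1).
Proof. unfold uk. rewrite csqrt_sqr. reflexivity. Qed.

Lemma uk_inv_bound (k : nat) (r : R) : (0 <= r)%R -> (Cmod (/ uk k r) <= / sqrt (sin ep))%R.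
Proof.
  intros Hr. destruct sin_cos_ep as [H1 [H2 H3]].
  rewrite Cmod_inv by (apply Re_pos_neq_0; now apply uk_Re). rewrite uk_zray, Cmod_csqrt.
  apply Rinv_le_contravar; [now apply sqrt_lt_R0|]. apply sqrt_le_1_alt. now apply zray_Cmod_ge.
Qed.

Lemma is_Cder_ray (r : R) : is_Cder (fun r => ray (PI / 2 - sg * ep) r) r e1.
Proof. apply (is_Cder_lin e1). Qed.

Lemma is_Cder_uk (k : nat) (r : R) : (0 <= r)%R -> is_Cder (uk k) r (- (ww N k * e1) * / (2 * uk k r)).
Proof.
  intros Hr. apply (is_Cder_comp csqrt (fun r => 1 - ww N k * ray (PI / 2 - sg * ep) r)).
  - apply qd_csqrt, uk_Re, Hr.
  - replace (- (ww N k * e1)) with (0 - ww N k * e1) by ring.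
    apply (is_Cder_minus (fun _ => RtoC 1) (fun r => ww N k * ray (PI / 2 - sg * ep) r)); [apply is_Cder_const|].
    apply (is_Cder_scal _ (fun r => ray (PI / 2 - sg * ep) r)), is_Cder_ray.
Qed.

Lemma is_Cder_Xr (r : R) : is_Cder Xr r (- e1 / j * Xr r).
Proof.
  apply (is_Cder_Cexp (fun r => - ray (PI / 2 - sg * ep) r / j)).
  apply (is_Cder_ext (fun r => - / j * ray (PI / 2 - sg * ep) r)); [intros t; unfold Cdiv; ring|].
  replace (- e1 / j) with (- / j * e1) by (unfold Cdiv; ring).
  apply (is_Cder_scal _ (fun r => ray (PI / 2 - sg * ep) r)), is_Cder_ray.
Qed.

Lemma Cmod_Xr (r : R) : Cmod (Xr r) = exp (- dl * r).
Proof.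
  unfold Xr. rewrite Cmod_Cexp. f_equal. unfold ray. fold e1.
  replace (- (r * e1) / j) with (- r * (e1 / j)) by (unfold Cdiv; ring).
  unfold dl. destruct (e1 / j) as [x y]. simpl. ring.
Qed.

(** [Dk N G nu k * Lf nu k] is a primitive of the [k]-th term of the Laplace integrand. *)
Definition Vk (k : nat) (r : R) : C := uk k r * gint (- kp k * (uk k r * uk k r)).
Definition L0 (k : nat) (r : R) : C := Xr r * / uk k r - 2 * kp k * Cexp (- kp k) * Vk k r.
Definition Lf (nu k : nat) (r : R) : C :=
  match nu with O => L0 k r | _ => Xr r * (/ uk k r) ^ 3 + 2 * kp k * L0 k r end.

Lemma is_Cder_inv (f : R -> C) (x : R) (df : C) : f x <> 0 -> is_Cder f x df ->
  is_Cder (fun t => / f t) x (- df * / (f x * f x)).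
Proof.
  intros H Hf. replace (- df * / (f x * f x)) with (df * - / (f x * f x)) by ring.
  apply (is_Cder_comp (fun z => / z) f); auto.
  set (z := f x) in *. pose proof (proj1 (Cmod_gt_0 z) H) as Hz.
  exists (2 / (Cmod z * (Cmod z * Cmod z)))%R, (Cmod z / 2)%R. split; [|split; [lra|]].
  - apply Rdiv_le_0_compat; [lra|]. repeat apply Rmult_lt_0_compat; auto.
  - intros h Hh.
    assert (Hzh : (Cmod z / 2 <= Cmod (z + h))%R).
    { pose proof (Cmod_triangle_minus z (- h)) as T. rewrite Cmod_opp in T.
      replace (z - - h) with (z + h) in T by ring. lra. }
    assert (Hn : z + h <> 0) by (apply Cmod_gt_0; lra).
    replace (/ (z + h) - / z - h * - / (z * z)) with (h * h * / (z * z * (z + h))) by (field; auto).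
    rewrite Cmod_mult, Cmod_inv, !Cmod_mult by (repeat apply Cmult_neq_0; auto).
    rewrite (Rmult_comm (2 / _)). apply Rmult_le_compat_l; [apply Rmult_le_pos; apply Cmod_ge_0|].
    replace (2 / (Cmod z * (Cmod z * Cmod z)))%R with (/ (Cmod z * Cmod z * (Cmod z / 2)))%R by (field; lra).
    apply Rinv_le_contravar; [repeat apply Rmult_lt_0_compat; lra|].
    apply Rmult_le_compat_l; [nra|auto].
Qed.

Lemma Vk_exp (k : nat) (r : R) : Cexp (- kp k) * Cexp (- (- kp k * (uk k r * uk k r))) = Xr r.
Proof.
  rewrite <- Cexp_plus. unfold Xr. f_equal. rewrite uk_sqr. unfold ray. fold e1.
  transitivity (- (kp k * ww N k) * (r * e1)); [ring|].
  assert (E : kp k * ww N k = / j).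
  { pose proof (kp_ww k) as H. pose proof j_neq_0 as H0. transitivity (kp k * (ww N k * j) * / j); [field; auto|].
    rewrite H. ring. }
  rewrite E. unfold Cdiv. ring.
Qed.

(** Differentiating [Xr / uk] yields the desired [uk^(-3)] term and an unwanted [uk^(-1)] term.
    Since [exp (- kp) exp (kp uk^2) = Xr], the derivative of the error function [Vk] is also
    [Xr / uk] up to a constant and cancels the latter. *)
Lemma is_Cder_L0 (k : nat) (r : R) : (0 <= r)%R ->
  is_Cder (L0 k) r (1 / 2 * ww N k * (Xr r * (/ uk k r) ^ 3 * e1)).
Proof.
  intros Hr. pose proof (Re_pos_neq_0 _ (uk_Re k r Hr)) as Hu. pose proof j_neq_0 as Hjn.
  pose proof (is_Cder_uk k r Hr) as Du.
  pose proof (is_Cder_mult Xr (fun r => / uk k r) r _ _ (is_Cder_Xr r) (is_Cder_inv (uk k) r _ Hu Du)) as D1.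
  pose proof (is_Cder_scal (2 * kp k * Cexp (- kp k)) _ _ _ (is_Cder_erf (- kp k) (uk k) r _ Du)) as D2.
  pose proof (is_Cder_minus _ _ _ _ _ D1 D2) as D.
  refine (eq_ind _ (fun v => is_Cder (L0 k) r v) D _ _).
  transitivity (- e1 / j * Xr r * / uk k r + Xr r * (- (- (ww N k * e1) * / (2 * uk k r)) * / (uk k r * uk k r)) -
    2 * kp k * (- (ww N k * e1) * / (2 * uk k r)) * (Cexp (- kp k) * Cexp (- (- kp k * (uk k r * uk k r))))).
  { cring. }
  rewrite Vk_exp. simpl Cpow.
  assert (E : / j = kp k * ww N k).
  { transitivity (kp k * (ww N k * j) * / j); [rewrite kp_ww; ring|field; auto]. }
  unfold Cdiv. rewrite E. cfield. exact Hu.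
Qed.

(** For [nu = 1] the same reduction is made once more: [Xr / uk^3] gives the [uk^(-5)] term, and the
    leftover [uk^(-3)] term is removed by [2 kp L0]. *)
Lemma is_Cder_Lf (nu k : nat) (r : R) : (nu <= 1)%nat -> (0 <= r)%R ->
  is_Cder (Lf nu k) r (RtoC (INR nu + 1 / 2) * ww N k * (Xr r * (/ uk k r) ^ (2 * nu + 3) * e1)).
Proof.
  intros Hnu Hr. destruct nu as [|[|nu]]; [| |lia].
  - replace (RtoC (INR 0 + 1 / 2)) with (1 / 2 : C).
    + apply (is_Cder_L0 k r Hr).
    + simpl INR. rewrite Rplus_0_l, RtoC_div by lra. reflexivity.
  - pose proof (Re_pos_neq_0 _ (uk_Re k r Hr)) as Hu. pose proof j_neq_0 as Hjn.
    pose proof (is_Cder_uk k r Hr) as Du.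
    pose proof (is_Cder_pow (fun r => / uk k r) r _ 3 (is_Cder_inv (uk k) r _ Hu Du)) as D3.
    pose proof (is_Cder_plus _ _ _ _ _ (is_Cder_mult Xr (fun r => (/ uk k r) ^ 3) r _ _ (is_Cder_Xr r) D3)
      (is_Cder_scal (2 * kp k) _ _ _ (is_Cder_L0 k r Hr))) as D.
    refine (eq_ind _ (fun v => is_Cder (Lf 1 k) r v) D _ _).
    assert (E : / j = kp k * ww N k).
    { transitivity (kp k * (ww N k * j) * / j); [rewrite kp_ww; ring|field; auto]. }
    simpl Nat.mul. simpl Nat.add. simpl pred. simpl INR.
    replace (1 + 1 + 1)%R with 3%R by ring. replace (1 + 1 / 2)%R with (3 / 2)%R by field.
    rewrite (RtoC_div 3 2) by lra. simpl Cpow. unfold Cdiv. rewrite E. cfield. exact Hu.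
Qed.

(** One square root of [- kp]. Up to here only squares occurred; the limit at infinity depends on
    the root. *)
Definition alk (k : nat) : C := - (Ci * mu N k) / (2 * cq).

Lemma alk_sqr (k : nat) : alk k * alk k = - kp k.
Proof.
  pose proof cq_neq_0 as Hc. unfold alk, kp, kap. rewrite RtoC_mult.
  transitivity ((Ci * Ci) * (mu N k * mu N k / (4 * (cq * cq)))); [field; exact Hc|].
  replace (Ci * Ci) with (- (1 : C)) by (apply C_ext; simpl; ring). ring.
Qed.

(** The two square roots of a number of positive real part have real parts of opposite signs. *)
Lemma quadrant (a b x y m : R) : (0 < m)%R -> (0 < a)%R -> (0 <= sg * b)%R -> (Rabs y < x)%R ->
  let v := RtoC sg * (- (Ci * m) / (2 * (x, y)) * (a, b)) in
  (0 < Re (v * v))%R -> (0 < Re v)%R.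
Proof.
  intros Hm Ha Hb Hxy v Hv. apply Rabs_def2 in Hxy.
  assert (Hd : (0 < x * x + y * y)%R) by nra.
  set (K := (m / (2 * (x * x + y * y)))%R).
  assert (HK : (0 < K)%R) by (apply Rdiv_lt_0_compat; lra).
  assert (Ev : v = ((sg * (K * (b * x - a * y)))%R, (- (sg * (K * (a * x + b * y))))%R)).
  { unfold v. assert (E : - (Ci * m) / (2 * (x, y)) * (a, b) = RtoC K * ((b * x - a * y)%R, (- (a * x + b * y))%R)).
    - assert (Hxy0 : (x, y) <> RtoC 0) by (intros E; apply (f_equal Re) in E; simpl in E; lra).
      assert (E : (a, b) * (- (Ci * m)) = (2 * (x, y)) * (RtoC K * ((b * x - a * y)%R, (- (a * x + b * y))%R))).
      { apply C_ext; unfold K; simpl; field; lra. }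
      transitivity ((a, b) * (- (Ci * m)) / (2 * (x, y))); [unfold Cdiv; ring|]. rewrite E. field. exact Hxy0.
    - rewrite E. apply C_ext; simpl; ring. }
  rewrite Ev in *. simpl in Hv |- *.
  set (P := (b * x - a * y)%R) in *. set (Q := (a * x + b * y)%R) in *.
  assert (Hs2 : (sg * sg = 1)%R) by (destruct Hsg as [->| ->]; ring).
  assert (HPQ : (Q * Q < P * P)%R).
  { apply Rnot_le_lt. intros Hle.
    replace (sg * (K * P) * (sg * (K * P)) - - (sg * (K * Q)) * - (sg * (K * Q)))%R with
      ((sg * sg) * (K * K) * (P * P - Q * Q))%R in Hv by ring.
    rewrite Hs2 in Hv. assert (0 < K * K)%R by nra. nra. }
  replace (sg * (K * P))%R with (K * (sg * P))%R by ring. apply Rmult_lt_0_compat; auto.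
  apply Rnot_le_lt. intros Hle. unfold P, Q in *. destruct Hsg as [E|E]; rewrite E in *.
  - rewrite Rmult_1_l in *. assert (0 <= b * (x + y))%R by nra. assert (a * (y - x) < 0)%R by nra.
    assert (0 <= a * y - b * x)%R by lra.
    assert (a * y - b * x <= a * x + b * y)%R by lra. nra.
  - assert (Hb' : (b <= 0)%R) by lra. assert (0 <= (- b) * (x - y))%R by nra. assert (0 < a * (x + y))%R by nra.
    assert (0 <= b * x - a * y)%R by lra. assert (b * x - a * y <= a * x + b * y)%R by lra. nra.
Qed.

(** Put [v = sg alk uk]. Then [v^2 = - kp uk^2] has real part [dl r - Re kp], which tends to
    infinity. On the ray [sg Im uk >= 0], and [quadrant] deduces that it is this sign of the root
    that has positive real part, so [v gint (v^2)] tends to [sqrt PI / 2]. Passing the singularities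
    on the other side changes [sg]. *)
Lemma Vk_lim (k : nat) : Clim (Vk k) (Rbar_locally p_infty) (RtoC sg / alk k * RtoC (sqrt PI / 2)).
Proof.
  pose proof cq_neq_0 as Hc. pose proof (mu_pos N k HN) as Hm.
  assert (Hal : alk k <> 0).
  { intros E. pose proof (alk_sqr k) as H. rewrite E in H. pose proof (kp_ww k) as H2.
    replace (kp k) with (- (0 * 0)) in H2 by (rewrite H; ring).
    apply C1_nz. rewrite <- H2. ring. }
  assert (Hs2 : RtoC sg * RtoC sg = 1) by (rewrite <- RtoC_mult; f_equal; destruct Hsg as [->| ->]; ring).
  assert (Hs0 : RtoC sg <> 0) by (intros E; rewrite E, Cmult_0_l in Hs2; apply C1_nz; auto).
  set (v := fun r : R => RtoC sg * (alk k * uk k r)).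
  assert (Evv : forall r, v r * v r = - kp k * (uk k r * uk k r)).
  { intros r. unfold v. transitivity ((RtoC sg * RtoC sg) * (alk k * alk k) * (uk k r * uk k r)); [ring|].
    rewrite Hs2, alk_sqr. ring. }
  assert (Hj' : kp k * ww N k = / j).
  { pose proof j_neq_0. transitivity (kp k * (ww N k * j) * / j); [field; auto|]. rewrite kp_ww. ring. }
  assert (ERe : forall r, Re (v r * v r) = (dl * r - Re (kp k))%R).
  { intros r. rewrite Evv, uk_sqr.
    replace (- kp k * (1 - ww N k * (r * e1))) with (RtoC r * (e1 * (kp k * ww N k)) - kp k) by ring.
    rewrite Hj'. change (e1 * / j) with (e1 / j). unfold dl. destruct (e1 / j) as [x y]. simpl. unfold Re. simpl. ring. }
  assert (Hinf : filterlim (fun r => Re (v r * v r)) (Rbar_locally p_infty) (Rbar_locally p_infty)).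
  { intros P [M HM]. exists ((Rabs M + Rabs (Re (kp k))) / dl)%R. intros r Hr. apply HM. rewrite ERe.
    assert (Hdl : (0 < dl)%R) by exact Hdir.
    apply (Rmult_lt_compat_r dl) in Hr; auto.
    replace ((Rabs M + Rabs (Re (kp k))) / dl * dl)%R with (Rabs M + Rabs (Re (kp k)))%R in Hr by (field; lra).
    pose proof (Rle_abs M). pose proof (Rle_abs (Re (kp k))). lra. }
  assert (Hpos : Rbar_locally p_infty (fun r => 0 < Re (v r))%R).
  { assert (H2 : Rbar_locally p_infty (fun r => 0 < Re (v r * v r))%R) by (apply Hinf; exists 0%R; auto).
    assert (H3 : Rbar_locally p_infty (fun r => 0 < r)%R) by (exists 0%R; auto).
    apply filter_imp with (2 := filter_and _ _ H2 H3). intros r [Hr2 Hr].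
    pose proof (uk_Re k r ltac:(lra)) as Ha.
    assert (Hb : (0 <= sg * Im (uk k r))%R).
    { rewrite uk_zray. destruct sin_cos_ep as [S1 [S2 S3]]. apply zray_Im_sgn; auto.
      apply Rmult_lt_0_compat; auto. now apply om_pos. }
    assert (Hxy : (Rabs (Im cq) < Re cq)%R).
    { pose proof cq_Re as H. pose proof cq_sqr_Re as H4.
      replace (Re (cq * cq)) with ((Re cq - Im cq) * (Re cq + Im cq))%R in H4 by (simpl; unfold Re, Im; ring).
      apply Rabs_def1; nra. }
    pose proof (quadrant (Re (uk k r)) (Im (uk k r)) (Re cq) (Im cq) (mu N k) Hm Ha Hb Hxy) as HQ.
    cbv zeta in HQ. unfold v, alk in *.
    replace (Re cq, Im cq) with cq in HQ by (destruct cq; reflexivity).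
    replace (Re (uk k r), Im (uk k r)) with (uk k r) in HQ by (destruct (uk k r); reflexivity).
    apply HQ. exact Hr2. }
  pose proof (erf_lim (Rbar_locally p_infty) v Hpos Hinf) as HL.
  pose proof (Clim_mult _ _ _ _ _ (Clim_const (Rbar_locally p_infty) (RtoC sg / alk k)) HL) as HL2.
  apply filterlim_ext with (2 := HL2). intros r. rewrite Evv. unfold Vk, v.
  transitivity ((RtoC sg * RtoC sg) * (uk k r * gint (- kp k * (uk k r * uk k r)))); [field; exact Hal|].
  rewrite Hs2. ring.
Qed.

Definition Linf (nu k : nat) : C :=
  let l := - (2 * kp k * Cexp (- kp k)) * (RtoC sg / alk k * RtoC (sqrt PI / 2)) in
  match nu with O => l | _ => 2 * kp k * l end.

Lemma Xr_lim : Clim Xr (Rbar_locally p_infty) (RtoC 0).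
Proof.
  apply (Clim_squeeze0 _ _ (fun r => exp (- dl * r))).
  - exists 0%R. intros r _. rewrite Cmod_Xr. lra.
  - apply (filterlim_comp _ _ _ (fun r => - dl * r)%R exp (Rbar_locally p_infty) (Rbar_locally m_infty)); [|exact is_lim_exp_m].
    intros P [M HM]. exists (Rabs M / dl)%R. intros r Hr. apply HM.
    assert (Hdl : (0 < dl)%R) by exact Hdir.
    apply (Rmult_lt_compat_r dl) in Hr; auto. replace (Rabs M / dl * dl)%R with (Rabs M) in Hr by (field; lra).
    pose proof (Rle_abs (- M)) as H. rewrite Rabs_Ropp in H. lra.
Qed.

Lemma Xr_uk_lim (n k : nat) : Clim (fun r => Xr r * (/ uk k r) ^ n) (Rbar_locally p_infty) (RtoC 0).
Proof.
  apply (Clim_squeeze0 _ _ (fun r => (/ sqrt (sin ep)) ^ n * Cmod (Xr r))%R).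
  - exists 0%R. intros r Hr. rewrite Cmod_mult, Cmod_pow, Rmult_comm.
    apply Rmult_le_compat_r; [apply Cmod_ge_0|]. apply pow_incr. split; [apply Cmod_ge_0|]. apply uk_inv_bound. lra.
  - apply Rlim_scal0; [exact _|].
    apply (proj2 (filterlim_locally _ _)). intros e.
    apply filter_imp with (2 := proj2 (Clim_eps _ _ _) Xr_lim e (cond_pos e)). intros r Hr.
    change (Rabs (Cmod (Xr r) - 0) < e)%R. rewrite Rminus_0_r, Rabs_pos_eq by apply Cmod_ge_0.
    replace (Xr r) with (Xr r - 0) by ring. exact Hr.
Qed.

Lemma Lf_lim (nu k : nat) : Clim (Lf nu k) (Rbar_locally p_infty) (Linf nu k).
Proof.
  assert (H0 : Clim (L0 k) (Rbar_locally p_infty) (Linf 0 k)).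
  { pose proof (Clim_minus _ _ _ _ _ (Xr_uk_lim 1 k) (Clim_mult _ _ _ _ _
      (Clim_const (Rbar_locally p_infty) (2 * kp k * Cexp (- kp k))) (Vk_lim k))) as H.
    match type of H with filterlim _ _ (locally ?v) => replace v with (Linf 0 k) in H by (unfold Linf; ring) end.
    apply filterlim_ext with (2 := H). intros r. unfold L0. simpl. ring. }
  destruct nu as [|nu]; [exact H0|].
  pose proof (Clim_plus _ _ _ _ _ (Xr_uk_lim 3 k) (Clim_mult _ _ _ _ _
      (Clim_const (Rbar_locally p_infty) (2 * kp k)) H0)) as H.
  rewrite Cplus_0_l in H. exact H.
Qed.

Lemma uk_0 (k : nat) : uk k 0 = 1.
Proof.
  unfold uk. apply csqrt_unique; [|simpl; lra]. unfold ray. ring.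
Qed.

Lemma L0_at_0 (k : nat) : L0 k 0 = 1 - 2 * kp k * Cexp (- kp k) * gint (- kp k).
Proof.
  unfold L0, Vk. rewrite uk_0. replace (Xr 0) with (RtoC 1).
  - replace (- kp k * (1 * 1)) with (- kp k) by ring. field.
  - unfold Xr, ray. rewrite <- Cexp_0. f_equal. unfold Cdiv. ring.
Qed.

Lemma Lf_at_0 (nu k : nat) : Lf nu k 0 = match nu with O => L0 k 0 | _ => 1 + 2 * kp k * L0 k 0 end.
Proof.
  destruct nu as [|nu]; [reflexivity|]. cbn [Lf]. rewrite uk_0. replace (Xr 0) with (RtoC 1).
  - simpl Cpow. field.
  - unfold Xr, ray. rewrite <- Cexp_0. f_equal. unfold Cdiv. ring.
Qed.

Lemma Lap_int (nu k : nat) (X : R) : (nu <= 1)%nat -> (0 <= X)%R ->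
  is_CRInt (fun r => RtoC (INR nu + 1 / 2) * ww N k * (Xr r * (/ uk k r) ^ (2 * nu + 3) * e1)) 0 X (Lf nu k X - Lf nu k 0).
Proof.
  intros Hnu HX. apply is_CRInt_derive; auto.
  - intros r Hr. apply is_Cder_Lf; auto. lra.
  - intros r Hr. apply Ccont_mult; [apply Ccont_const|]. apply Ccont_mult; [|apply Ccont_const].
    apply Ccont_mult; [exact (is_Cder_cont _ _ _ (is_Cder_Xr r))|].
    pose proof (Re_pos_neq_0 _ (uk_Re k r ltac:(lra))) as Hu.
    exact (is_Cder_cont _ _ _ (is_Cder_pow (fun r => / uk k r) r _ (2 * nu + 3) (is_Cder_inv (uk k) r _ Hu (is_Cder_uk k r ltac:(lra))))).
Qed.

Lemma is_CRInt_gen_lim (F : R -> C) (J : R -> C) (l : C) :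
  (forall X, (0 <= X)%R -> is_CRInt F 0 X (J X)) -> Clim J (Rbar_locally p_infty) l ->
  is_RInt_gen (V := C_R_NormedModule) F (at_point 0%R) (Rbar_locally p_infty) l.
Proof.
  intros HJ Hl P HP. destruct (Hl P HP) as [M HM].
  apply (Filter_prod _ _ _ (fun a => a = 0%R) (fun b => (Rmax 0 M < b)%R)).
  - reflexivity.
  - exists (Rmax 0 M). auto.
  - intros a b -> Hb. exists (J b). split.
    + apply HJ. pose proof (Rmax_l 0 M). simpl. lra.
    + apply HM. pose proof (Rmax_r 0 M). lra.
Qed.

(** The Borel transform continues along the ray because the radicands stay away from 0 and in a
    sector, uniformly in the frequency. The Laplace integral is computed mode by mode from the
    primitives [Lf]; a uniform bound on [1 / uk] and the decay rate [dl] justify the interchange. *)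
Lemma borel_laplace (G : Z -> C) (nu : nat) : periodic N G -> (nu <= 1)%nat -> par G nu ->
  (exists k : Z, (PI / 2 - sg * ep) - PI / 2 < Carg j + 2 * IZR k * PI < (PI / 2 - sg * ep) + PI / 2)%R ->
  is_Cseries (fun k => Dk N G nu k * (Linf nu k - Lf nu k 0)) (CSeries (fun k => Dk N G nu k * (Linf nu k - Lf nu k 0))) /\
  is_Borel_Laplace (PI / 2 - sg * ep) (Theta_tilde nu (dft N G) N) j
    (Theta_tilde nu (dft N G) N 0 + CSeries (fun k => Dk N G nu k * (Linf nu k - Lf nu k 0))).
Proof.
  intros HG Hnu HP Harg.
  destruct (Cf_bound N G nu HN HG) as [C0 [HC0 HC]].
  destruct sin_cos_ep as [S1 [S2 S3]].
  set (n := (2 * nu + 3)%nat).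
  assert (Hn : (INR n <= 6)%R) by (replace 6%R with (INR 6) by (simpl; ring); apply le_INR; unfold n; lia).
  assert (HW : (0 <= IZR N / PI)%R) by (left; apply Rdiv_lt_0_compat; [lra|apply PI_RGT_0]).
  set (Phi := Phis n (Cf N G nu) (ww N)).
  assert (HA : forall r, (0 <= r)%R -> analytic_at Phi (ray (PI / 2 - sg * ep) r)).
  { intros r Hr.
    destruct (Phis_local n (Cf N G nu) (ww N) C0 (IZR N / PI) (eta (cos ep)) (sin ep) (ray (PI / 2 - sg * ep) r)) as [rho [Hrho H]]; auto.
    - intros k. now apply Cmod_ww_le.
    - now apply (eta_pos (sin ep) (cos ep)).
    - intros k. rewrite one_minus_ww_ray by auto. split; [now apply zray_Cmod_ge|].
      apply zray_sector; auto. apply Rmult_le_pos; [left; now apply om_pos|exact Hr].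
    - eapply analytic_at_intro; [exact Hrho|]. exact H. }
  assert (Hcs1 : csqrt 1 = 1) by (apply csqrt_unique; [ring|simpl; lra]).
  destruct (RInt_CSeries_improper
    (fun k r => Xr r * (Cf N G nu k * (/ uk k r) ^ n) * e1)
    (fun r => Cexp (- ray (PI / 2 - sg * ep) r / j) * Phi (ray (PI / 2 - sg * ep) r) * Cexp (Ci * (PI / 2 - sg * ep)%R))
    (fun k X => Dk N G nu k * (Lf nu k X - Lf nu k 0)) (fun k => Dk N G nu k * (Linf nu k - Lf nu k 0))
    (fun k => C0 * / INR (S k) ^ 2)%R ((/ sqrt (sin ep)) ^ n) dl) as [I1 [I2 I3]].
  - exact Hdir.
  - apply pow_le. left. apply Rinv_0_lt_compat. now apply sqrt_lt_R0.
  - intros k. apply Rmult_le_pos; auto. left. apply inv_sqr_le_1.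
  - apply ex_series_tq_bound.
  - intros k X HX. pose proof (is_CRInt_scal (Dk N G nu k) _ _ _ _ (Lap_int nu k X Hnu HX)) as H.
    apply is_CRInt_ext with (3 := H); auto. intros r _. unfold Cf, n. ring.
  - intros k. apply (Clim_mult _ (fun _ => _)); [apply filterlim_const|].
    apply Clim_minus; [exact _|apply Lf_lim|apply filterlim_const].
  - intros k r Hr. rewrite !Cmod_mult, Cmod_pow, Cmod_Xr.
    assert (E : Cmod e1 = 1%R) by apply Cmod_Cexp_Ci. rewrite E, Rmult_1_r, Rmult_comm, Rmult_assoc.
    apply Rmult_le_compat; auto using Cmod_ge_0.
    + apply Rmult_le_pos; [apply pow_le, Cmod_ge_0|left; apply exp_pos].
    + apply Rmult_le_compat_r; [left; apply exp_pos|]. apply pow_incr. split; [apply Cmod_ge_0|now apply uk_inv_bound].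
  - intros r Hr. symmetry. apply CSeries_unique. fold e1. fold (Xr r).
    apply (is_Cseries_ext (fun k => (Xr r * e1) * (Cf N G nu k * (/ uk k r) ^ n))); [intros; ring|].
    replace (Xr r * Phi (ray (PI / 2 - sg * ep) r) * e1) with (Xr r * e1 * Phi (ray (PI / 2 - sg * ep) r)) by ring.
    apply is_Cseries_scal. unfold Phi, Phis.
    apply (is_CSeries_le _ (fun k => C0 * / INR (S k) ^ 2 * (/ sqrt (sin ep)) ^ n)%R).
    + intros k. rewrite Cmod_mult, Cmod_pow. apply Rmult_le_compat; auto using Cmod_ge_0; [apply pow_le, Cmod_ge_0|].
      apply pow_incr. split; [apply Cmod_ge_0|]. now apply uk_inv_bound.
    + apply (ex_series_scal_r ((/ sqrt (sin ep)) ^ n)), ex_series_tq_bound.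
  - split; [exact I3|].
    split; [apply j_neq_0|]. split; [exact Harg|].
    (* At the origin every radicand is 1, so [eta = s0 = 1] are admissible and the expansion has the
       coefficients of [Theta_tilde_succ]. *)
    destruct (Phis_local n (Cf N G nu) (ww N) C0 (IZR N / PI) 1 1 0) as [rho [Hrho H]]; auto; try lra.
    { intros k. now apply Cmod_ww_le. }
    { intros k. replace (1 - ww N k * 0) with (RtoC 1) by ring. rewrite Hcs1, Cmod_1. simpl. lra. }
    exists Phi, rho, (CSeries (fun k => Dk N G nu k * (Linf nu k - Lf nu k 0))).
    split; [exact Hrho|]. split; [|split; [exact HA|split; [|reflexivity]]].
    + intros xi Hxi. apply is_pseries_C. replace (xi : C) with (xi - 0) in Hxi by ring.
      apply is_Cseries_ext with (2 := H xi Hxi). intros i.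
      replace (xi - 0) with xi by ring. f_equal. rewrite Theta_tilde_succ by auto.
      apply CSeries_ext. intros k. replace (1 - ww N k * 0) with (RtoC 1) by ring. rewrite Hcs1.
      replace (/ 1) with (RtoC 1) by field. rewrite Cpow_1_l.
      replace (INR n / 2)%R with (INR nu + 3 / 2)%R.
      * unfold Cdiv. replace (/ 1) with (RtoC 1) by field. rewrite !Cmult_1_r. reflexivity.
      * unfold n. rewrite plus_INR, mult_INR. simpl. field.
    + apply (is_CRInt_gen_lim _ _ _ I1 I2).
Qed.

End Laplace.

(** * The quadratic twists *)

(** [tw N] is an additive character modulo [2 N]; [tw N (2 * n) = ee N n]. *)
Definition tw (N m : Z) : C := Cexp (Ci * PI * IZR m / IZR N).

Lemma tw_plus (N a b : Z) : (0 < N)%Z -> tw N (a + b) = tw N a * tw N b.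
Proof.
  intros HN. unfold tw. rewrite <- Cexp_plus. f_equal. rewrite plus_IZR, RtoC_plus. field.
  apply IZR_C_neq_0; lia.
Qed.

Lemma tw_double (N n : Z) : tw N (2 * n) = ee N n.
Proof. unfold tw, ee. f_equal. rewrite mult_IZR, RtoC_mult. unfold Cdiv. ring. Qed.

Lemma tw_2N (N a : Z) : (0 < N)%Z -> tw N (2 * N * a) = 1.
Proof. intros HN. rewrite <- Z.mul_assoc, tw_double. now apply ee_mult_N. Qed.

Lemma tw_0 (N : Z) : (0 < N)%Z -> tw N 0 = 1.
Proof. intros HN. rewrite <- (tw_2N N 0 HN). f_equal. lia. Qed.

Lemma tw_scale (c M m : Z) : (0 < c)%Z -> (0 < M)%Z -> tw (c * M) (c * m) = tw M m.
Proof.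
  intros Hc HM. unfold tw. f_equal. rewrite !mult_IZR, !RtoC_mult. field.
  split; apply IZR_C_neq_0; lia.
Qed.

(** Evenness enters here: [(n + N)^2 - n^2 = 2 N (n + N / 2)] is a multiple of [2 N]. *)
Lemma tw_shift_sqr (N k n : Z) : (0 < N)%Z -> Z.Even N -> tw N (k * (n + N) ^ 2) = tw N (k * n ^ 2).
Proof.
  intros HN [N' HE].
  replace (k * (n + N) ^ 2)%Z with (k * n ^ 2 + 2 * N * (k * (n + N')))%Z by (rewrite HE; ring).
  rewrite tw_plus, tw_2N by auto. ring.
Qed.

Lemma Cexp_nat_mul (n : nat) (z : C) : Cexp (INR n * z) = Cexp z ^ n.
Proof.
  induction n as [|n IH].
  - simpl. rewrite Cmult_0_l. apply Cexp_0.
  - rewrite S_INR, RtoC_plus. simpl Cpow. rewrite <- IH, <- Cexp_plus. f_equal. ring.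
Qed.

Lemma Cpowz_Cexp (z : C) (k : Z) : Cpowz (Cexp z) k = Cexp (IZR k * z).
Proof.
  destruct k as [|p|p]; simpl Cpowz.
  - rewrite Cmult_0_l. now rewrite Cexp_0.
  - rewrite <- Cexp_nat_mul, INR_IZR_INZ, positive_nat_Z. reflexivity.
  - rewrite <- Cexp_nat_mul, <- Cexp_opp, INR_IZR_INZ, positive_nat_Z. f_equal.
    change (Z.neg p) with (- Z.pos p)%Z. rewrite opp_IZR, RtoC_opp. ring.
Qed.

Lemma Cpowz_Lambda (N n k : Z) : Cpowz (Lambda N n) k = tw N (k * n ^ 2).
Proof.
  unfold Lambda, tw. rewrite Cpowz_Cexp. f_equal.
  replace (k * n ^ 2)%Z with (k * (n * n))%Z by ring. rewrite !mult_IZR, !RtoC_mult. simpl Cpow. unfold Cdiv. ring.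
Qed.

Lemma sum_n_rev (F : nat -> C) n : sum_n (fun k => F (n - k)%nat) n = sum_n F n.
Proof.
  revert F. induction n as [|n IH]; intros F; [rewrite !Csum_O; reflexivity|].
  pose proof (sum_n_shift1 (fun k => F (S n - k)%nat) n) as H. cbv beta in H.
  rewrite (Csum_Sn F), <- (IH F), Csum_Sn.
  replace (S n - S n)%nat with 0%nat in * by lia. rewrite Nat.sub_0_r in H.
  rewrite (sum_n_ext (G := C_AbelianMonoid) _ (fun k => F (n - k)%nat)) in H by reflexivity.
  rewrite H. cring.
Qed.

Lemma sum_mod_rev (N : Z) (F : Z -> C) : (0 < N)%Z ->
  sum_mod N (fun k => F (N - 1 - k)%Z) = sum_mod N F.
Proof.
  intros HN. unfold sum_mod. rewrite <- (sum_n_rev (fun k => F (Z.of_nat k))).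
  apply (sum_n_ext_loc (G := C_AbelianMonoid)). intros k Hk. f_equal. lia.
Qed.

Lemma dft_par (N : Z) (G : Z -> C) (e : C) : (0 < N)%Z -> periodic N G ->
  (forall n : Z, G (- n)%Z = e * G n) -> forall n : Z, dft N G (- n)%Z = e * dft N G n.
Proof.
  intros HN HG HP n. unfold dft. rewrite (Cmult_assoc e), (Cmult_comm e), <- Cmult_assoc. f_equal.
  rewrite <- sum_mod_scal, <- sum_mod_rev by auto.
  assert (HF : periodic N (fun m => e * (G m * ee N (- (m * n))))).
  { intros m. rewrite HG. replace (- ((m + N) * n))%Z with (- (m * n) + N * (- n))%Z by ring.
    rewrite ee_plus, ee_mult_N by auto. ring. }
  rewrite <- (sum_mod_shift N _ 1 HN HF). apply sum_mod_ext; auto. intros k _.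
  replace (N - 1 - k)%Z with (- (1 + k) + N)%Z by ring. rewrite HG, HP.
  replace (- ((- (1 + k) + N) * - n))%Z with (- ((1 + k) * n) + N * n)%Z by ring.
  rewrite ee_plus, ee_mult_N by auto. ring.
Qed.

(** After exchanging the sums, each [l] meets exactly one residue [r] modulo [M]; summing over the
    window that starts at [l] makes it the first term. *)
Lemma sum_mod_classes (M N : Z) (F u : Z -> C) : (0 < M)%Z -> (0 < N)%Z -> periodic M F ->
  sum_mod M (fun r => F r * sum_mod N (fun l => if Z.eqb (l mod M) (r mod M) then u l else 0)) =
  sum_mod N (fun l => F l * u l).
Proof.
  intros HM HN HF.
  rewrite (sum_mod_ext M _ (fun r => sum_mod N (fun l => F r * (if Z.eqb (l mod M) (r mod M) then u l else 0))))
    by (auto; intros; now rewrite sum_mod_scal).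
  rewrite sum_mod_swap. apply sum_mod_ext; auto. intros l _.
  rewrite <- (sum_mod_shift M _ l); auto.
  - rewrite sum_mod_first; auto.
    + now rewrite Z.add_0_r, Z.eqb_refl.
    + intros k Hk. destruct (Z.eqb_spec (l mod M) ((l + k) mod M)) as [E|E]; [|ring].
      exfalso. assert (Hd : ((l + k - l) mod M = 0)%Z).
      { rewrite Zminus_mod, <- E, Z.sub_diag. apply Z.mod_0_l. lia. }
      replace (l + k - l)%Z with k in Hd by ring. rewrite Z.mod_small in Hd; lia.
  - intros r. rewrite HF. now replace ((r + M) mod M)%Z with (r mod M)%Z by (rewrite <- (Z.mul_1_l M) at 2; now rewrite Z_mod_plus_full).
Qed.

Definition twist (N : Z) (a : Z) (f : Z -> C) (n : Z) : C := tw N (a * n ^ 2) * f n.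

Section Transform.
Context (M a b c d : Z) (f : Z -> C).
Context (HM : (0 < M)%Z) (HE : Z.Even M) (Hf : periodic M f) (Hdet : (a * d - b * c = 1)%Z) (Hc : (0 < c)%Z).

Let N : Z := (c * M)%Z.

Let HN : (0 < N)%Z.
Proof. unfold N. lia. Qed.

Let HNE : Z.Even N.
Proof. destruct HE as [M' E]. exists (c * M')%Z. unfold N. rewrite E. ring. Qed.

Let periodic_mult (k n : Z) : f (n + k * M)%Z = f n.
Proof.
  assert (H : forall p : nat, forall n, f (n + Z.of_nat p * M)%Z = f n).
  { induction p as [|p IH]; intros m; [f_equal; lia|].
    replace (m + Z.of_nat (S p) * M)%Z with (m + Z.of_nat p * M + M)%Z by lia. now rewrite Hf. }
  destruct (Z_le_gt_dec 0 k) as [Hk|Hk].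
  - rewrite <- (Z2Nat.id k Hk). apply H.
  - rewrite <- (H (Z.to_nat (- k)) (n + k * M)%Z). f_equal. rewrite Z2Nat.id by lia. ring.
Qed.

Lemma periodic_twist : periodic N (twist N a f).
Proof.
  intros n. unfold twist. rewrite tw_shift_sqr by auto. f_equal. apply periodic_mult.
Qed.

(** Collapses the sum over [r] modulo [M] and the class sums [gsum] into one sum modulo [c M], the
    rest of the summand being [M]-periodic in [r]. *)
Lemma htrans_eq (n : Z) :
  htrans M f a b c d n = / sqN N * tw M (b * d * n ^ 2) *
    sum_mod N (fun l => f (l + d * n)%Z * tw M (2 * (b * n * l)) * tw N (a * l ^ 2)).
Proof.
  unfold htrans. rewrite Cpowz_Lambda. change (RtoC (sqrt (IZR (c * M)))) with (sqN N). f_equal.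
  rewrite <- (sum_mod_classes M N (fun r => f (r + d * n)%Z * tw M (2 * (b * n * r)))); auto.
  - apply sum_mod_ext; auto. intros r _. unfold gsum. fold N.
    rewrite (sum_mod_ext N (fun l => if (l mod M =? r mod M)%Z then Cpowz (Lambda N l) a else 0)
      (fun l => if (l mod M =? r mod M)%Z then tw N (a * l ^ 2) else 0)).
    + rewrite tw_double. unfold ee. rewrite !mult_IZR, !RtoC_mult.
      replace (2 * PI * Ci * (IZR b * IZR n * IZR r) / IZR M) with (2 * PI * Ci * IZR b * IZR n * IZR r / IZR M)
        by (unfold Cdiv; ring). ring.
    + exact HN.
    + intros l _. now rewrite Cpowz_Lambda.
  - intros r. replace (2 * (b * n * (r + M)))%Z with (2 * (b * n * r) + 2 * M * (b * n))%Z by ring.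
    rewrite tw_plus, tw_2N by auto. replace (r + M + d * n)%Z with (r + d * n + M)%Z by ring. rewrite Hf. ring.
Qed.

Lemma htrans_periodic : periodic M (htrans M f a b c d).
Proof.
  intros n. rewrite !htrans_eq, tw_shift_sqr by auto. f_equal. apply sum_mod_ext; auto. intros l _.
  replace (2 * (b * (n + M) * l))%Z with (2 * (b * n * l) + 2 * M * (b * l))%Z by ring.
  rewrite tw_plus, tw_2N by auto. replace (l + d * (n + M))%Z with (l + d * n + d * M)%Z by ring.
  rewrite periodic_mult. ring.
Qed.

(** The exponents match because [l = m - d n] turns
    [- d n^2 + b c d n^2 + a l^2 + 2 b c n l] into [a m^2 - 2 m n] when [a d - b c = 1]. *)
Lemma htrans_dft (n : Z) : tw N (- d * n ^ 2) * htrans M f a b c d n = dft N (twist N a f) n.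
Proof.
  rewrite htrans_eq. unfold dft.
  transitivity (/ sqN N * (tw N (- d * n ^ 2) * tw M (b * d * n ^ 2) *
    sum_mod N (fun l => f (l + d * n)%Z * tw M (2 * (b * n * l)) * tw N (a * l ^ 2)))); [ring|].
  f_equal. rewrite <- sum_mod_scal.
  rewrite <- (sum_mod_shift N (fun m => twist N a f m * ee N (- (m * n))) (d * n)); auto.
  - apply sum_mod_ext; auto. intros l _. unfold twist.
    rewrite <- (tw_scale c M (b * d * n ^ 2)), <- (tw_scale c M (2 * (b * n * l))), <- tw_double by auto. fold N.
    rewrite (Z.add_comm l).
    transitivity (f (d * n + l)%Z * (tw N (- d * n ^ 2) * tw N (c * (b * d * n ^ 2)) * tw N (c * (2 * (b * n * l))) * tw N (a * l ^ 2)));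
      [ring|].
    transitivity (f (d * n + l)%Z * (tw N (a * (d * n + l) ^ 2) * tw N (2 * - ((d * n + l) * n)))); [|ring].
    rewrite <- !tw_plus by auto. f_equal. f_equal.
    replace (c * (b * d * n ^ 2))%Z with ((b * c) * d * n ^ 2)%Z by ring.
    replace (c * (2 * (b * n * l)))%Z with (2 * (b * c) * n * l)%Z by ring.
    replace (b * c)%Z with (a * d - 1)%Z by lia. ring.
  - intros m. rewrite periodic_twist. replace (- ((m + N) * n))%Z with (- (m * n) + N * (- n))%Z by ring.
    rewrite ee_plus, ee_mult_N by auto. ring.
Qed.

Lemma htrans_of_dft (n : Z) : htrans M f a b c d n = tw N (d * n ^ 2) * dft N (twist N a f) n.
Proof.
  rewrite <- htrans_dft, Cmult_assoc, <- tw_plus by auto.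
  replace (d * n ^ 2 + - d * n ^ 2)%Z with 0%Z by ring. rewrite tw_0 by auto. ring.
Qed.

Lemma twist_par (e : C) : (forall n : Z, f (- n)%Z = e * f n) -> forall n : Z, twist N a f (- n)%Z = e * twist N a f n.
Proof. intros H n. unfold twist. rewrite H. replace ((- n) ^ 2)%Z with (n ^ 2)%Z by ring. ring. Qed.

Lemma htrans_par (e : C) : (forall n : Z, f (- n)%Z = e * f n) ->
  forall n : Z, htrans M f a b c d (- n)%Z = e * htrans M f a b c d n.
Proof.
  intros H n. rewrite !htrans_of_dft.
  rewrite (dft_par N _ e HN periodic_twist (twist_par e H)). replace ((- n) ^ 2)%Z with (n ^ 2)%Z by ring. ring.
Qed.

End Transform.

(** * Powers and arguments *)

Lemma Cpower_plus (z : C) (al be : R) : Cpower z (al + be) = Cpower z al * Cpower z be.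
Proof.
  unfold Cpower. rewrite Rpower_plus, RtoC_mult, Rmult_plus_distr_r, RtoC_plus, Cmult_plus_distr_l, Cexp_plus. ring.
Qed.

Lemma Cpower_0 (z : C) : (0 < Cmod z)%R -> Cpower z 0 = 1.
Proof.
  intros H. unfold Cpower. rewrite Rpower_O by auto. rewrite Rmult_0_l, Cmult_0_r, Cexp_0. ring.
Qed.

Lemma Carg_polar (z : C) : z <> 0 -> z = Cmod z * Cexp (Ci * Carg z).
Proof.
  intros Hz. apply Cmod_gt_0 in Hz.
  pose proof (Cmod_Re_le z) as H1. apply Rabs_le_between in H1.
  set (m := Cmod z) in *. set (x := (Re z / m)%R).
  assert (Hx : (-1 <= x <= 1)%R).
  { unfold x. split; [apply Rmult_le_reg_r with m|apply Rmult_le_reg_r with m]; auto; field_simplify; lra. }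
  assert (Hs : (m * sqrt (1 - x * x) = Rabs (Im z))%R).
  { rewrite <- (sqrt_Rsqr m) at 1 by lra. rewrite <- sqrt_mult_alt by apply Rle_0_sqr.
    rewrite <- sqrt_Rsqr_abs. f_equal. unfold Rsqr.
    assert (E : (m ^ 2 = Re z ^ 2 + Im z ^ 2)%R) by apply Cmod2_alt.
    unfold x. replace (m * m * (1 - Re z / m * (Re z / m)))%R with (m ^ 2 - Re z * Re z)%R by (field; lra). rewrite E. ring. }
  assert (Hc : (m * x = Re z)%R) by (unfold x; field; lra).
  rewrite Cexp_Ci. unfold Carg. fold m. fold x.
  destruct (Rle_dec 0 (Im z)) as [H|H].
  - rewrite cos_acos, sin_acos by auto. unfold Rsqr. rewrite Rabs_pos_eq in Hs by auto.
    apply C_ext; simpl; [rewrite <- Hc|rewrite <- Hs]; ring.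
  - rewrite cos_neg, sin_neg, cos_acos, sin_acos by auto. unfold Rsqr. rewrite Rabs_left in Hs by lra.
    apply C_ext; simpl; [rewrite <- Hc; ring|]. replace (Im z) with (- (m * sqrt (1 - x * x)))%R by lra. ring.
Qed.

Lemma Cpower_1 (z : C) : z <> 0 -> Cpower z 1 = z.
Proof.
  intros Hz. unfold Cpower. rewrite Rpower_1 by now apply Cmod_gt_0.
  rewrite Rmult_1_l. symmetry. now apply Carg_polar.
Qed.

Lemma Carg_right_half (z : C) : (0 < Re z)%R -> (- (PI / 2) < Carg z < PI / 2)%R.
Proof.
  intros Hz. assert (Hm : (0 < Cmod z)%R) by (apply Cmod_gt_0, Re_pos_neq_0, Hz).
  pose proof (Cmod_Re_le z) as H1. apply Rabs_le_between in H1.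
  set (x := (Re z / Cmod z)%R).
  assert (Hx0 : (0 < x)%R) by now apply Rdiv_lt_0_compat.
  assert (Hx1 : (x <= 1)%R) by (apply Rmult_le_reg_r with (Cmod z); auto; unfold x; field_simplify; lra).
  assert (H : (0 <= acos x < PI / 2)%R).
  { pose proof (acos_bound x). split; [lra|]. apply Rnot_le_lt. intros Hle.
    pose proof (cos_le_0 (acos x) Hle ltac:(lra)) as Hc. rewrite cos_acos in Hc; lra. }
  unfold Carg. fold x. pose proof PI_RGT_0. destruct (Rle_dec 0 (Im z)); lra.
Qed.

Lemma Cpower_half_Re (z : C) : (0 < Re z)%R -> (0 < Re (Cpower z (1 / 2)))%R.
Proof.
  intros Hz. pose proof (Carg_right_half z Hz) as H. pose proof PI_RGT_0.
  unfold Cpower. rewrite Cexp_Ci. simpl. unfold Re, Im. simpl.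
  replace (Rpower (Cmod z) (1 / 2) * cos (1 / 2 * Carg z) - 0 * sin (1 / 2 * Carg z))%R
    with (Rpower (Cmod z) (1 / 2) * cos (1 / 2 * Carg z))%R by ring.
  apply Rmult_lt_0_compat; [apply exp_pos|]. apply cos_gt_0; lra.
Qed.

(** The real part is [sin (sg ep + arg j) / |j|], and the angle lies strictly between 0 and [PI]. *)
Lemma Re_direction (j : C) (sg ep : R) : (0 < Im j)%R -> sg = 1%R \/ sg = (-1)%R ->
  (ep < Carg j < PI - ep)%R -> (0 < ep)%R -> (0 < Re (Cexp (Ci * (PI / 2 - sg * ep)%R) / j))%R.
Proof.
  intros Hj Hsg Harg Hep.
  assert (Hj0 : j <> 0) by (intros E; rewrite E in Hj; simpl in Hj; lra).
  pose proof (proj1 (Cmod_gt_0 j) Hj0) as Hm.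
  assert (E : Cexp (Ci * (PI / 2 - sg * ep)%R) / j = (/ Cmod j)%R * Cexp (Ci * (PI / 2 - (sg * ep + Carg j))%R)).
  { rewrite (Carg_polar j Hj0) at 1. rewrite RtoC_inv by lra.
    assert (Hm0 : RtoC (Cmod j) <> 0) by (intros E; apply RtoC_inj in E; lra).
    transitivity (/ Cmod j * (Cexp (Ci * (PI / 2 - sg * ep)%R) * / Cexp (Ci * Carg j))).
    { field. split; [apply Cexp_neq_0|exact Hm0]. }
    rewrite <- Cexp_opp.
    replace (PI / 2 - (sg * ep + Carg j))%R with (PI / 2 - sg * ep + - Carg j)%R by ring.
    rewrite RtoC_plus, RtoC_opp, Cmult_plus_distr_l, Cexp_plus.
    replace (Ci * - Carg j) with (- (Ci * Carg j)) by ring. ring. }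
  rewrite E, Cexp_Ci, cos_shift. simpl. unfold Re, Im. simpl.
  replace (/ Cmod j * sin (sg * ep + Carg j) - 0 * sin (PI / 2 - (sg * ep + Carg j)))%R
    with (/ Cmod j * sin (sg * ep + Carg j))%R by ring.
  apply Rmult_lt_0_compat; [now apply Rinv_0_lt_compat|].
  apply sin_gt_0; destruct Hsg as [->| ->]; lra.
Qed.

(** * Termwise identities *)

Lemma Qs2_odd (N : Z) (G : Z -> C) : (0 < N)%Z -> odd_fun G -> Qs N G 2 0 = 0.
Proof.
  intros HN HG. unfold Qs. rewrite (CSeries_unique _ (RtoC 0)); [ring|].
  apply (is_Cseries_ext (fun _ => RtoC 0)); [|apply is_Cseries_0]. intros k. unfold tq. rewrite HG.
  replace (- (Ci * mu N k * 0)) with (RtoC 0) by ring. replace (Ci * mu N k * 0) with (RtoC 0) by ring. simpl Cpow. ring.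
Qed.

(** The reflection [i -> N - i] changes the sign of the weights [1 - 2 i / N] and fixes the values,
    so only the two ends remain. This half of the value at 0 is what the constant term of a
    two-sided theta series requires. *)
Lemma Q1_even (N : Z) (G : Z -> C) : (0 < N)%Z -> periodic N G -> even_fun G -> Q1 N G 0 = dft N G 0 / 2.
Proof.
  intros HN HG HP.
  assert (HH : forall n, dft N G (- n)%Z = dft N G n).
  { intros n. rewrite (dft_par N G 1 HN HG); [ring|]. intros m. rewrite HP. ring. }
  pose proof (IZR_C_neq_0 N ltac:(lia)) as HN0.
  set (F := fun i : Z => dft N G i * (1 - 2 * IZR i / IZR N)).
  assert (E1 : sum_mod N (fun i => dft N G (0 + 1 + i)%Z * RtoC (1 - 2 * IZR (i + 1) / IZR N)) = sum_mod N (fun i => F (0 + 1 + i)%Z)).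
  { apply sum_mod_ext; auto. intros k _. unfold F. replace (0 + 1 + k)%Z with (k + 1)%Z by ring.
    rewrite RtoC_minus, RtoC_div, RtoC_mult by (apply eq_IZR_contrapositive; lia). reflexivity. }
  pose proof (sum_mod_shift1 N F 0 HN) as H1.
  assert (E2 : sum_mod N (fun i => F (0 + 1 + i)%Z) = - sum_mod N (fun i => F (0 + i)%Z)).
  { rewrite <- sum_mod_rev by auto. transitivity (-1 * sum_mod N (fun i => F (0 + i)%Z)); [|ring].
    rewrite <- sum_mod_scal. apply sum_mod_ext; auto. intros k _. unfold F.
    replace (0 + 1 + (N - 1 - k))%Z with (- k + N)%Z by ring. rewrite dft_periodic, HH by auto.
    rewrite plus_IZR, opp_IZR, RtoC_plus, RtoC_opp. simpl (0 + k)%Z. field. exact HN0. }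
  assert (E3 : F (0 + N)%Z - F 0%Z = -2 * dft N G 0).
  { unfold F. rewrite dft_periodic by auto. simpl (0 + N)%Z. field. exact HN0. }
  unfold Q1. rewrite E1.
  set (S := sum_mod N (fun i => F (0 + 1 + i)%Z)) in *. set (S' := sum_mod N (fun i => F (0 + i)%Z)) in *.
  assert (E4 : S = - dft N G 0).
  { assert (ES : S' = - S) by (rewrite E2; ring). rewrite ES in H1.
    transitivity ((S + S) / 2); [field|]. rewrite H1 at 1.
    transitivity ((F (0 + N)%Z - F 0%Z) / 2); [field|]. rewrite E3. field. }
  rewrite E4. field.
Qed.

Section Terms.
Context (j q : C) (N : Z) (HN : (0 < N)%Z) (Hj : (0 < Im j)%R) (Hq : q * q = j / Ci) (Hq0 : (0 < Re q)%R).

Let c : C := cq q N.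
Let E (k : nat) : C := Cexp (- kp q N k).

Let qn0 : q <> 0.
Proof. now apply Re_pos_neq_0. Qed.

Let cn0 : c <> 0.
Proof. exact (cq_neq_0 q N HN Hq0). Qed.

Let sn0 : sqN N <> 0.
Proof. now apply sqN_neq_0. Qed.

Let Ci2 : Ci * Ci = - (1 : C).
Proof. apply C_ext; simpl; ring. Qed.

(** Together with [mu_cq], eliminates [PI] in favour of [c], [q] and [sqrt N], so that the termwise
    identities become rational identities modulo [i^2 = -1]. *)
Lemma sqrt_PI_cq : RtoC (sqrt PI) = c * sqN N / q.
Proof.
  unfold c, cq, sqN. pose proof PI_RGT_0. assert (0 < IZR N)%R by (apply IZR_lt; lia).
  transitivity (RtoC (sqrt (PI / IZR N) * sqrt (IZR N))).
  - f_equal. rewrite <- sqrt_mult_alt by (left; apply Rdiv_lt_0_compat; lra). f_equal. field. lra.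
  - rewrite RtoC_mult. field. exact qn0.
Qed.

Lemma mu_cq (k : nat) : RtoC (mu N k) = 2 * INR (S k) * (c * c) / (q * q).
Proof.
  unfold c, cq, mu. pose proof PI_RGT_0. assert (HR : (0 < IZR N)%R) by (apply IZR_lt; lia).
  transitivity (2 * INR (S k) * (RtoC (sqrt (PI / IZR N)) * RtoC (sqrt (PI / IZR N)))); [|field; exact qn0].
  rewrite <- (RtoC_mult (sqrt _)), sqrt_sqrt by (left; apply Rdiv_lt_0_compat; lra).
  rewrite <- !RtoC_mult. f_equal. field. lra.
Qed.

Let mn0 (k : nat) : RtoC (mu N k) <> 0.
Proof. now apply mu_neq_0. Qed.

Let sqrt_PI_half : RtoC (sqrt PI / 2) = c * sqN N / q / 2.
Proof. rewrite RtoC_div by lra. now rewrite sqrt_PI_cq. Qed.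

Let Wf_p (k : nat) : Wf c (mu N k) = E k * (c * sqN N / q / 2 / c - Ci * mu N k / (2 * (c * c)) * gint (- kp q N k)).
Proof. unfold Wf, E, kp. fold c. rewrite sqrt_PI_half. reflexivity. Qed.

Let Wf_m (k : nat) : Wf c (- mu N k)%R = E k * (c * sqN N / q / 2 / c + Ci * mu N k / (2 * (c * c)) * gint (- kp q N k)).
Proof.
  unfold Wf, E, kp. fold c. rewrite sqrt_PI_half.
  assert (Hk : kap c (- mu N k)%R = kap c (mu N k)) by (unfold kap; do 2 f_equal; ring).
  rewrite Hk, RtoC_opp. field. split; [exact cn0|exact qn0].
Qed.

(** The [gint] parts of [Wf] at opposite frequencies cancel, as do the linear terms; what remains is
    twice the complete Gaussian half-integral. *)
Lemma tterm0_even (G : Z -> C) (k : nat) : even_fun G ->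
  tterm N G (Iinf0 c) k = sqN N / q * (G (Z.of_nat (S k)) * E k).
Proof.
  intros HP. unfold tterm, Iinf0. rewrite HP, Wf_m, Wf_p, RtoC_opp. unfold lam. simpl Cpow.
  field [Ci2]. repeat split; auto.
Qed.

(** Oddness of [G] and the extra factor [m] in front of [Wf] compensate each other, so again only
    the sum of [Wf] at opposite frequencies occurs and no [gint] is left. *)
Lemma tterm1_odd (G : Z -> C) (k : nat) : odd_fun G ->
  tterm N G (Iinf1 c) k = - (Ci * sqN N / (q * q * q)) * (INR (S k) * (G (Z.of_nat (S k)) * E k)).
Proof.
  intros HP. unfold tterm, Iinf1. rewrite HP, Wf_m, Wf_p, RtoC_opp. unfold lam. simpl Cpow.
  transitivity (- (Ci * sqN N / q / (2 * (c * c))) * (mu N k * (G (Z.of_nat (S k)) * E k))).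
  - field [Ci2]. repeat split; auto.
  - rewrite mu_cq. field. auto.
Qed.

Context (sg ep : R).

Let kp_eq (k : nat) : kp q N k = mu N k * mu N k / (4 * (c * c)).
Proof. unfold kp, kap. fold c. rewrite RtoC_mult. reflexivity. Qed.

(** Now the [gint] parts add up: the left side is exactly [- Dk] times the primitive [Lf] at 0. The
    limit [Linf] has no [gint], and [Dk Linf] is [- sg / q] times the Gaussian, which the last
    summand restores. *)
Lemma tterm0_odd (G : Z -> C) (k : nat) : odd_fun G ->
  / sqN N * tterm N G (Iinf0 c) k =
  Dk N G 0 k * (Linf q N sg 0 k - Lf j q N sg ep 0 k 0) + sg / q * (G (Z.of_nat (S k)) * E k).
Proof.
  intros HP. rewrite Lf_at_0, L0_at_0. unfold tterm, Iinf0. rewrite HP, Wf_m, Wf_p, RtoC_opp.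
  unfold Dk, Linf, alk. fold c. fold (E k). rewrite sqrt_PI_half. set (g := gint _). rewrite kp_eq. unfold lam. simpl Cpow.
  field [Ci2]. repeat split; auto. apply Ci_nz.
Qed.

(** As for [nu = 0]: the left side is [- Dk] times [Lf] at 0, and [Dk Linf] is the Gaussian term.
    Its natural factor is the frequency [mu], converted into the integer [k + 1] by [mu_cq]. *)
Lemma tterm1_even (G : Z -> C) (k : nat) : even_fun G ->
  / sqN N * tterm N G (Iinf1 c) k =
  Dk N G 1 k * (Linf q N sg 1 k - Lf j q N sg ep 1 k 0) -
  sg * Ci / (q * q * q) * (INR (S k) * (G (Z.of_nat (S k)) * E k)).
Proof.
  intros HP. rewrite Lf_at_0, L0_at_0. unfold tterm, Iinf1. rewrite HP, Wf_m, Wf_p, RtoC_opp.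
  unfold Dk, Linf, alk. fold c. fold (E k). rewrite sqrt_PI_half. set (g := gint _).
  transitivity (Dk N G 1 k * (Linf q N sg 1 k - Lf j q N sg ep 1 k 0) - sg * Ci / (2 * c * c * q) * (mu N k * (G (Z.of_nat (S k)) * E k))).
  - rewrite Lf_at_0, L0_at_0. unfold Dk, Linf, alk. fold c. fold (E k). rewrite sqrt_PI_half. fold g. rewrite kp_eq. unfold lam. simpl Cpow.
    field [Ci2]. repeat split; auto. apply Ci_nz.
  - rewrite Lf_at_0, L0_at_0. unfold Dk, Linf, alk. fold c. fold (E k). rewrite sqrt_PI_half. fold g. f_equal. rewrite mu_cq. field. auto.
Qed.

End Terms.

(** * The two theta series *)

Lemma Ci_sqr : Ci * Ci = - (1 : C).
Proof. apply C_ext; simpl; ring. Qed.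

Lemma Im_cocycle_pos (c d : Z) (tau : C) : (0 < c)%Z -> (0 < Im tau)%R -> (0 < Im (IZR c * tau + IZR d))%R.
Proof.
  intros Hc Ht. assert (0 < IZR c)%R by (apply IZR_lt; lia).
  replace (Im (IZR c * tau + IZR d)) with (IZR c * Im tau)%R by (simpl; unfold Im; ring). now apply Rmult_lt_0_compat.
Qed.

Section Theta.
Context (M a b c d : Z) (f : Z -> C).
Context (HM : (0 < M)%Z) (HE : Z.Even M) (Hf : periodic M f) (Hdet : (a * d - b * c = 1)%Z) (Hc : (0 < c)%Z).
Context (tau q : C) (Ht : (0 < Im tau)%R).

Let j : C := IZR c * tau + IZR d.

Context (Hq : q * q = j / Ci) (Hq0 : (0 < Re q)%R).

Let N : Z := (c * M)%Z.
Let G : Z -> C := twist N a f.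

Let HN : (0 < N)%Z.
Proof. unfold N. lia. Qed.

Let jn0 : j <> 0.
Proof. exact (j_neq_0 j (Im_cocycle_pos c d tau Hc Ht)). Qed.

Let cn0 : RtoC (IZR c) <> 0.
Proof. apply IZR_C_neq_0. lia. Qed.

Let Mn0 : RtoC (IZR M) <> 0.
Proof. apply IZR_C_neq_0. lia. Qed.

Let PIn0 : RtoC PI <> 0.
Proof. intros E. apply RtoC_inj in E. pose proof PI_RGT_0. lra. Qed.

Let tw_nat (e : Z) (n : nat) : tw N (e * Z.of_nat (S n) ^ 2) = Cexp (Ci * PI * (IZR e * (INR (S n) * INR (S n))) / (IZR c * IZR M)).
Proof.
  unfold tw, N. f_equal. replace (e * Z.of_nat (S n) ^ 2)%Z with (e * (Z.of_nat (S n) * Z.of_nat (S n)))%Z by ring.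
  rewrite !mult_IZR, <- !INR_IZR_INZ, !RtoC_mult. reflexivity.
Qed.

Let cq_j : cq q N * cq q N = PI / (IZR c * IZR M) * (j / Ci).
Proof.
  rewrite (cq_sqr j q N HN Hq). unfold N. rewrite mult_IZR, RtoC_div, RtoC_mult; [reflexivity|].
  apply Rmult_integral_contrapositive_currified; apply eq_IZR_contrapositive; lia.
Qed.

(** The factor [Lambda_N^d] between [h] and the Fourier transform shifts the exponent [c tau] to
    [c tau + d = j] over the common level [N]. *)
Lemma Theta_htrans (nu : nat) :
  Theta tau nu (htrans M f a b c d) M =
  CSeries (fun n => dft N G (Z.of_nat (S n)) * (INR (S n) ^ nu * gau (cq q N * cq q N) (INR (S n)))).
Proof.
  unfold Theta. apply CSeries_ext. intros n. rewrite htrans_of_dft by auto. fold N. fold G.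
  rewrite tw_nat. unfold gau. rewrite cq_j, RtoC_mult.
  transitivity (dft N G (Z.of_nat (S n)) * (INR (S n) ^ nu * (Cexp (Ci * PI * (IZR d * (INR (S n) * INR (S n))) / (IZR c * IZR M)) *
    Cexp (Ci * PI * INR (S n) ^ 2 * tau / IZR M)))); [ring|].
  rewrite <- Cexp_plus. do 3 f_equal. unfold j. field [Ci_sqr]. repeat split; auto; apply Ci_nz.
Qed.

(** Splitting [gamma tau] into [a / c] and [- 1 / (c j)], the first part is the twist that turns [f]
    into [G], the second gives [exp (- kp)]. *)
Lemma Theta_gtau (nu : nat) :
  Theta ((IZR a * tau + IZR b) / (IZR c * tau + IZR d)) nu f M =
  CSeries (fun n => INR (S n) ^ nu * (G (Z.of_nat (S n)) * Cexp (- kp q N n))).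
Proof.
  unfold Theta. apply CSeries_ext. intros n. unfold G, twist. rewrite tw_nat.
  transitivity (INR (S n) ^ nu * (f (Z.of_nat (S n)) * (Cexp (Ci * PI * (IZR a * (INR (S n) * INR (S n))) / (IZR c * IZR M)) * Cexp (- kp q N n)))); [|ring].
  rewrite <- Cexp_plus, <- Cmult_assoc. do 3 f_equal.
  unfold kp, kap. rewrite cq_j, RtoC_mult.
  assert (Emu : RtoC (mu N n) = 2 * PI * INR (S n) / (IZR c * IZR M)).
  { unfold mu, N. rewrite mult_IZR, RtoC_div, !RtoC_mult; [reflexivity|].
    apply Rmult_integral_contrapositive_currified; apply eq_IZR_contrapositive; lia. }
  rewrite Emu.
  assert (Eb : RtoC (IZR a * IZR d) = RtoC (1 + IZR b * IZR c)).
  { f_equal. rewrite <- !mult_IZR, <- plus_IZR. f_equal. lia. }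
  rewrite RtoC_plus, !RtoC_mult in Eb.
  fold j.
  (* The determinant condition in the form [c (a tau + b) = a j - 1]. *)
  assert (Ej : (IZR a * tau + IZR b) / j = (IZR a - / j) / IZR c).
  { assert (H : (IZR a * tau + IZR b) * IZR c = IZR a * j - 1) by (unfold j; ring [Eb]).
    transitivity ((IZR a * tau + IZR b) * IZR c / (j * IZR c)); [field; auto|]. rewrite H. field. auto. }
  rewrite Ej. field. repeat split; auto; apply Ci_nz.
Qed.

End Theta.

(** * The four transformation formulas *)

Theorem theorem6 (M : Z) (f : Z -> C) (a b c d : Z)
  (HMpos : (0 < M)%Z) (HMeven : Z.Even M)
  (Hper : periodic M f) (Hpar : even_fun f \/ odd_fun f)
  (Hdet : (a * d - b * c = 1)%Z) (Hc : (0 < c)%Z) :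
  let h : Z -> C := htrans M f a b c d in
  let Lh : Z -> C := fun n : Z => Cpowz (Lambda (c * M) n) (- d) * h n in
  periodic M h /\
  (even_fun f -> even_fun h) /\
  (odd_fun f -> odd_fun h) /\
  forall tau : C, (0 < Im tau)%R ->
  let j : C := IZR c * tau + IZR d in
  let gtau : C := (IZR a * tau + IZR b) / (IZR c * tau + IZR d) in
  (even_fun f ->
     theta gtau f M = Cpower (j / Ci) (1 / 2) * theta tau h M) /\
  (odd_fun f ->
     Theta gtau 1 f M = Ci * Cpower (j / Ci) (3 / 2) * Theta tau 1 h M) /\
  (even_fun f ->
     forall (sgn eps : R), sgn = 1%R \/ sgn = (-1)%R ->
     (0 < eps < PI / 2)%R -> (eps < Carg j < PI - eps)%R ->
     exists S : C,
       is_Borel_Laplace (PI / 2 - sgn * eps) (Theta_tilde 1 Lh (c * M)) j S /\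
       Theta tau 1 h M + sgn * (Ci * Cpower (j / Ci) (- (3 / 2)) * Theta gtau 1 f M)
       = sqrt (IZR (c * M)) / (2 * PI) * f 0%Z * (Ci / j) + S) /\
  (odd_fun f ->
     forall (sgn eps : R), sgn = 1%R \/ sgn = (-1)%R ->
     (0 < eps < PI / 2)%R -> (eps < Carg j < PI - eps)%R ->
     exists S : C,
       is_Borel_Laplace (PI / 2 - sgn * eps) (Theta_tilde 0 Lh (c * M)) j S /\
       Theta tau 0 h M - sgn * (Cpower (j / Ci) (- (1 / 2)) * Theta gtau 0 f M)
       = S).
Proof.
  intros h Lh. set (N := (c * M)%Z). set (G := twist N a f).
  assert (HN : (0 < N)%Z) by (unfold N; lia).
  assert (HG : periodic N G) by now apply periodic_twist.
  assert (even_scal : forall g : Z -> C, even_fun g <-> forall n, g (- n)%Z = 1 * g n).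
  { intros g. split; intros H n; rewrite H; ring. }
  assert (odd_scal : forall g : Z -> C, odd_fun g <-> forall n, g (- n)%Z = -1 * g n).
  { intros g. split; intros H n; rewrite H; ring. }
  assert (Gev : even_fun f -> even_fun G) by (rewrite !even_scal; apply twist_par).
  assert (God : odd_fun f -> odd_fun G) by (rewrite !odd_scal; apply twist_par).
  split; [now apply htrans_periodic|].
  split; [rewrite !even_scal; now apply htrans_par|].
  split; [rewrite !odd_scal; now apply htrans_par|].
  intros tau Ht j gtau.
  assert (Hj : (0 < Im j)%R) by now apply Im_cocycle_pos.
  assert (Hj0 : j <> 0) by exact (j_neq_0 j Hj).
  set (z := j / Ci).
  assert (Hz : (0 < Re z)%R).
  { unfold z. replace (j / Ci) with (- (Ci * j)) by (field [Ci_sqr]; apply Ci_nz).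
    simpl. unfold Im in *. simpl in *. lra. }
  assert (Hz0 : z <> 0) by now apply Re_pos_neq_0.
  set (q := Cpower z (1 / 2)).
  assert (Hq0 : (0 < Re q)%R) by now apply Cpower_half_Re.
  assert (Hq : q * q = j / Ci).
  { unfold q. rewrite <- Cpower_plus. replace (1 / 2 + 1 / 2)%R with 1%R by field. now apply Cpower_1. }
  assert (qn0 : q <> 0) by now apply Re_pos_neq_0.
  assert (Hinv : forall al : R, Cpower z al <> 0 -> Cpower z (- al) = / Cpower z al).
  { intros al H. transitivity (/ Cpower z al * (Cpower z al * Cpower z (- al))); [field; auto|].
    rewrite <- Cpower_plus, Rplus_opp_r, Cpower_0 by now apply Cmod_gt_0. ring. }
  assert (Hq3 : Cpower z (3 / 2) = q * q * q).
  { unfold q. rewrite <- !Cpower_plus. f_equal. field. }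
  assert (Hq3n : Cpower z (- (3 / 2)) = / (q * q * q)).
  { rewrite Hinv; rewrite Hq3; [reflexivity|]. apply Cmult_neq_0; [apply Cmult_neq_0|]; exact qn0. }
  assert (Hq1n : Cpower z (- (1 / 2)) = / q) by now apply Hinv.
  assert (sn0 : sqN N <> 0) by now apply sqN_neq_0.
  assert (cn0 : cq q N <> 0) by exact (cq_neq_0 q N HN Hq0).
  assert (G0 : G 0%Z = f 0%Z).
  { unfold G, twist. replace (a * 0 ^ 2)%Z with 0%Z by ring. rewrite tw_0 by auto. ring. }
  assert (ELh : Lh = dft N G).
  { apply functional_extensionality. intros n. unfold Lh. rewrite Cpowz_Lambda. now apply htrans_dft. }
  pose proof (cq_Re q N HN Hq0) as Hc1. pose proof (cq_sqr_Re j q N HN Hj Hq) as Hc2.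
  destruct (gauss_sum0 (cq q N) Hc1 Hc2 N G HN HG) as [T0 S0].
  destruct (gauss_sum1 (cq q N) Hc1 Hc2 N G HN HG) as [T1 S1].
  set (E := fun n => G (Z.of_nat (S n)) * Cexp (- kp q N n)).
  assert (Th0 : Theta tau 0 h M = G 0%Z / sqN N * (RtoC (sqrt PI / 2) / cq q N) - Q1 N G 0 + / sqN N * CSeries (tterm N G (Iinf0 (cq q N)))).
  { unfold h. rewrite (Theta_htrans M a b c d f HMpos HMeven Hper Hdet Hc tau q Hq). apply CSeries_unique.
    apply is_Cseries_ext with (2 := S0). intros n. simpl (_ ^ 0). rewrite Cmult_1_l. reflexivity. }
  assert (Th1 : Theta tau 1 h M = G 0%Z / sqN N * / (2 * (cq q N * cq q N)) + Qs N G 2 0 + / sqN N * CSeries (tterm N G (Iinf1 (cq q N)))).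
  { unfold h. rewrite (Theta_htrans M a b c d f HMpos HMeven Hper Hdet Hc tau q Hq). apply CSeries_unique.
    apply is_Cseries_ext with (2 := S1). intros n. rewrite Cpow_1_r. reflexivity. }
  assert (Tg0 : forall l, is_Cseries E l -> Theta gtau 0 f M = l).
  { intros l Hl. unfold gtau. rewrite (Theta_gtau M a b c d f HMpos Hdet Hc tau q Ht Hq). apply CSeries_unique.
    apply is_Cseries_ext with (2 := Hl). intros n. simpl (_ ^ 0). rewrite Cmult_1_l. reflexivity. }
  assert (Tg1 : forall l, is_Cseries (fun n => INR (S n) * E n) l -> Theta gtau 1 f M = l).
  { intros l Hl. unfold gtau. rewrite (Theta_gtau M a b c d f HMpos Hdet Hc tau q Ht Hq). apply CSeries_unique.
    apply is_Cseries_ext with (2 := Hl). intros n. rewrite Cpow_1_r. reflexivity. }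
  assert (Hdirs : forall sgn eps : R, sgn = 1%R \/ sgn = (-1)%R -> (0 < eps < PI / 2)%R -> (eps < Carg j < PI - eps)%R ->
    (exists k : Z, PI / 2 - sgn * eps - PI / 2 < Carg j + 2 * IZR k * PI < PI / 2 - sgn * eps + PI / 2)%R).
  { intros sgn eps Hs He Ha. exists 0%Z. destruct Hs as [->| ->]; lra. }
  split; [|split; [|split]].
  - intros Hf. specialize (Gev Hf).
    pose proof (is_Cseries_scal (q / sqN N) _ _ T0) as HT.
    (* The convergence of the series at [gamma tau] is inherited from that of [tterm], of which it
       is a multiple. *)
    assert (HE : is_Cseries E (q / sqN N * CSeries (tterm N G (Iinf0 (cq q N))))).
    { apply is_Cseries_ext with (2 := HT). intros k. rewrite tterm0_even by auto. unfold E. field. auto. }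
    assert (Hh0 : h 0%Z = dft N G 0).
    { rewrite <- ELh. unfold Lh. rewrite Cpowz_Lambda. replace (- d * 0 ^ 2)%Z with 0%Z by ring. rewrite tw_0 by auto. ring. }
    (* In [h 0 + 2 Theta] the boundary term [- Q1 = - h 0 / 2] cancels [h 0], while the mean term
       [G 0 / (2 q)] becomes the constant [f 0] after multiplication by [q]. *)
    unfold theta. rewrite (Tg0 _ HE), Th0, Hh0, Q1_even, G0 by auto.
    rewrite RtoC_div, (sqrt_PI_cq q N HN Hq0) by lra. fold q. field. auto.
  - intros Hf. specialize (God Hf).
    pose proof (is_Cseries_scal (Ci * (q * q * q) / sqN N) _ _ T1) as HT.
    assert (HE : is_Cseries (fun n => INR (S n) * E n) (Ci * (q * q * q) / sqN N * CSeries (tterm N G (Iinf1 (cq q N))))).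
    { apply is_Cseries_ext with (2 := HT). intros k. rewrite tterm1_odd by auto. unfold E. field [Ci_sqr]. auto. }
    assert (G00 : G 0%Z = 0).
    { pose proof (God 0%Z) as H. simpl Z.opp in H. transitivity ((G 0%Z + G 0%Z) / 2); [field|]. rewrite H at 1. field. }
    rewrite (Tg1 _ HE), Th1, Hq3, G00, Qs2_odd by auto. field. auto.
  - intros Hf sgn eps Hs He Ha. specialize (Gev Hf).
    assert (Hs2 : RtoC sgn * RtoC sgn = 1) by (rewrite <- RtoC_mult; f_equal; destruct Hs as [->| ->]; ring).
    destruct (borel_laplace j q N HN Hj Hq Hq0 sgn eps Hs He (Re_direction j sgn eps Hj Hs Ha (proj1 He)) G 1 HG ltac:(lia))
      as [B1 B2]; auto.
    { intros n. rewrite Gev. ring. }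
    set (B := CSeries _) in B1, B2. set (A := CSeries _) in T1, Th1.
    exists (Theta_tilde 1 (dft N G) N 0 + B). split; [rewrite ELh; exact B2|].
    pose proof (is_Cseries_plus _ _ _ _ (is_Cseries_scal (- (sgn * Ci * (q * q * q)) * - / sqN N) _ _ T1)
      (is_Cseries_scal (- (sgn * Ci * (q * q * q))) _ _ B1)) as HT.
    (* [tterm1_even] solved for the Gaussian, using [sg^2 = 1] and [i^2 = -1]. *)
    assert (HE : is_Cseries (fun n => INR (S n) * E n)
      (- (sgn * Ci * (q * q * q)) * - / sqN N * A + - (sgn * Ci * (q * q * q)) * B)).
    { apply is_Cseries_ext with (2 := HT). intros k.
      transitivity (sgn * Ci * (q * q * q) * (/ sqN N * tterm N G (Iinf1 (cq q N)) k -
        Dk N G 1 k * (Linf q N sgn 1 k - Lf j q N sgn eps 1 k 0))); [cring|].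
      rewrite (tterm1_even j q N HN Hq0 sgn eps G k Gev). fold (E k).
      transitivity (- (RtoC sgn * RtoC sgn) * (Ci * Ci) * (INR (S k) * E k)); [field; auto|].
      rewrite Hs2, Ci_sqr. ring. }
    rewrite (Tg1 _ HE), Th1, Hq3n, G0, Theta_tilde_0 by auto.
    rewrite (cq_sqr j q N HN Hq). fold N (sqN N). cbn [Qv].
    assert (HPI : RtoC PI <> 0) by (intros EPI; apply RtoC_inj in EPI; pose proof PI_RGT_0; lra).
    (* With [cq^2 = (PI / N) (j / i)] the mean term becomes the [f 0] term of the formula; the
       boundary value [Qs N G 2 0] is the constant coefficient of the formal series. *)
    assert (EN : RtoC (PI / IZR N) = PI / (sqN N * sqN N)).
    { rewrite sqN_sqr by auto. apply RtoC_div, eq_IZR_contrapositive. lia. }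
    rewrite EN.
    transitivity (sqN N / (2 * PI) * f 0%Z * (Ci / j) + Qs N G 2 0 + / sqN N * A +
      (RtoC sgn * RtoC sgn) * (Ci * Ci) * (/ sqN N * A - B)).
    + field. repeat split; auto. apply Ci_nz.
    + rewrite Hs2, Ci_sqr. ring.
  - intros Hf sgn eps Hs He Ha. specialize (God Hf).
    assert (Hs2 : RtoC sgn * RtoC sgn = 1) by (rewrite <- RtoC_mult; f_equal; destruct Hs as [->| ->]; ring).
    destruct (borel_laplace j q N HN Hj Hq Hq0 sgn eps Hs He (Re_direction j sgn eps Hj Hs Ha (proj1 He)) G 0 HG ltac:(lia))
      as [B1 B2]; auto.
    { intros n. rewrite God. ring. }
    set (B := CSeries _) in B1, B2. set (A := CSeries _) in T0, Th0.
    exists (Theta_tilde 0 (dft N G) N 0 + B). split; [rewrite ELh; exact B2|].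
    pose proof (is_Cseries_plus _ _ _ _ (is_Cseries_scal (sgn * q / sqN N) _ _ T0)
      (is_Cseries_scal (- (sgn * q)) _ _ B1)) as HT.
    assert (HE : is_Cseries E (sgn * q / sqN N * A + - (sgn * q) * B)).
    { apply is_Cseries_ext with (2 := HT). intros k.
      transitivity (sgn * q * (/ sqN N * tterm N G (Iinf0 (cq q N)) k -
        Dk N G 0 k * (Linf q N sgn 0 k - Lf j q N sgn eps 0 k 0))); [cfield; auto|].
      rewrite (tterm0_odd j q N HN Hq0 sgn eps G k God). fold (E k).
      transitivity ((RtoC sgn * RtoC sgn) * E k); [field; auto|].
      rewrite Hs2. ring. }
    (* Oddness removes the mean term, so the boundary value [- Q1] alone remains and is the constant
       coefficient of the formal series. *)
    assert (G00 : G 0%Z = 0).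
    { pose proof (God 0%Z) as H. simpl Z.opp in H. transitivity ((G 0%Z + G 0%Z) / 2); [field|]. rewrite H at 1. field. }
    rewrite (Tg0 _ HE), Th0, Hq1n, G00, Theta_tilde_0 by auto. cbn [Qv].
    transitivity (- Q1 N G 0 + / sqN N * A - (RtoC sgn * RtoC sgn) * (/ sqN N * A - B)); [field; auto|].
    rewrite Hs2. ring.
Qed.
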